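(* Let $\lambda\in\mathbb R$, $\lambda\neq0$, let $f(x,y,z)\in\{y,\;y-z,\;y-x^2\}$, and consider the piecewise quadratic system in $\mathbb R^3$ $$\begin{pmatrix}\dot x\\ \dot y\\ \dot z\end{pmatrix}=\begin{pmatrix}-y\\ x\\ \lambda(x^2+y^2-z)\end{pmatrix}+\varepsilon\begin{pmatrix}P_1(x,y,z)\\ P_2(x,y,z)\\ P_3(x,y,z)\end{pmatrix},$$ where, for $\ell=1,2,3$, $$P_\ell(x,y,z)=\begin{cases}\displaystyle\sum_{0\le i+j+k\le2}p_{ijk}^{\ell,+}x^iy^jz^k, & f(x,y,z)>0,\\ \displaystyle\sum_{0\le i+j+k\le2}p_{ijk}^{\ell,-}x^iy^jz^k, & f(x,y,z)<0.\end{cases}$$ Then there exist real coefficients $p_{ijk}^{\ell,\pm}$ such that for every $\varepsilon\neq0$ sufficiently small the system admits at least $\ell_h$ limit cycles converging, as $\varepsilon\to0$, to some of the crossing periodic orbits of the unperturbed system ($\varepsilon=0$) contained in the paraboloid $\mathcal S=\{(x,y,z)\in\mathbb R^3:z=x^2+y^2\}$, where (1) $\ell_h=4$ if $f(x,y,z)=y$; (2) $\ell_h=6$ if $f(x,y,z)=y-z$; (3) $\ell_h=8$ if $f(x,y,z)=y-x^2$.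
   Context: The switching manifold is $\Sigma=f^{-1}(0)$. For $\varepsilon=0$ the paraboloid $\mathcal S$ is invariant and foliated by periodic orbits with the same period; those which meet $\Sigma$ transversally, crossing from one side to the other, are called crossing periodic orbits. A limit cycle is an isolated periodic orbit. *)

(* Defs.v *)
From Stdlib Require Import Reals.
From Coquelicot Require Import Coquelicot.
Open Scope R_scope.

(* The norm of this normed module is the Euclidean norm of R^3. *)
Definition R3 : NormedModule R_AbsRing :=
  prod_NormedModule R_AbsRing
    (prod_NormedModule R_AbsRing R_NormedModule R_NormedModule) R_NormedModule.

Definition vector_field : Type := R3 -> R3.

Definition null_set (N : R -> Prop) : Prop :=
  forall eta : R, 0 < eta ->
  exists u v : nat -> R,
    (forall n, u n <= v n) /\
    (forall t, N t -> exists n, u n < t < v n) /\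
    (forall n, sum_n (fun k => v k - u k) n <= eta).

(* Absolute continuity on every compact interval; the intervals [u k, v k],
   k = 0..n, do not overlap and are listed from left to right. *)
Definition absolutely_continuous (g : R -> R3) : Prop :=
  forall a b eta : R, a < b -> 0 < eta ->
  exists delta : R, 0 < delta /\
  forall (n : nat) (u v : nat -> R),
    (forall k, (k <= n)%nat -> a <= u k /\ u k <= v k /\ v k <= b) ->
    (forall k, (k < n)%nat -> v k <= u (S k)) ->
    sum_n (fun k => v k - u k) n < delta ->
    sum_n (fun k => norm (minus (g (v k)) (g (u k)))) n < eta.

(* Filippov's convention for the system equal to Xp where f > 0 and to Xm where
   f < 0: on {f = 0} every convex combination of the two fields is an admissible
   velocity. *)
Definition filippov_velocity (f : R3 -> R) (Xp Xm : vector_field) (p v : R3) : Prop :=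
  (0 < f p -> v = Xp p) /\
  (f p < 0 -> v = Xm p) /\
  (f p = 0 -> exists s : R, 0 <= s <= 1 /\
                v = plus (scal s (Xp p)) (scal (1 - s) (Xm p))).

Definition filippov_solution (f : R3 -> R) (Xp Xm : vector_field) (g : R -> R3) : Prop :=
  absolutely_continuous g /\
  null_set (fun t => ~ exists v : R3,
                is_derive g t v /\ filippov_velocity f Xp Xm (g t) v).

Definition periodic_orbit (f : R3 -> R) (Xp Xm : vector_field) (G : R3 -> Prop) : Prop :=
  exists (g : R -> R3) (T : R),
    filippov_solution f Xp Xm g /\
    0 < T /\
    (forall t, g (t + T) = g t) /\
    (exists t, g t <> g 0) /\
    (forall p, G p <-> exists t, g t = p).

Definition lie_derivative (X : vector_field) (f : R3 -> R) (p : R3) : R :=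
  Derive (fun t => f (plus p (scal t (X p)))) 0.

(* Both fields are transversal to {f = 0} at p and point to the same side. *)
Definition crossing_point (f : R3 -> R) (Xp Xm : vector_field) (p : R3) : Prop :=
  f p = 0 /\ 0 < lie_derivative Xp f p * lie_derivative Xm f p.

Definition crossing_periodic_orbit (f : R3 -> R) (Xp Xm : vector_field)
    (G : R3 -> Prop) : Prop :=
  periodic_orbit f Xp Xm G /\
  (exists p, G p /\ f p = 0) /\
  (forall p, G p -> f p = 0 -> crossing_point f Xp Xm p).

Definition near_set (G : R3 -> Prop) (r : R) (p : R3) : Prop :=
  exists q, G q /\ norm (minus p q) < r.

Definition limit_cycle (f : R3 -> R) (Xp Xm : vector_field) (G : R3 -> Prop) : Prop :=
  periodic_orbit f Xp Xm G /\
  exists r : R, 0 < r /\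
  forall G' : R3 -> Prop,
    periodic_orbit f Xp Xm G' ->
    (forall p, G' p -> near_set G r p) ->
    forall p, G' p <-> G p.

(* Convergence in the Hausdorff distance as eps -> 0. *)
Definition converges_to (C : R -> R3 -> Prop) (G : R3 -> Prop) : Prop :=
  forall eta : R, 0 < eta ->
  exists delta : R, 0 < delta /\
  forall eps : R, 0 < Rabs eps < delta ->
    (forall p, C eps p -> near_set G eta p) /\
    (forall q, G q -> near_set (C eps) eta q).

Definition quadratic (c : nat -> nat -> nat -> R) (x y z : R) : R :=
  sum_n (fun i => sum_n (fun j => sum_n (fun k =>
    c i j k * x ^ i * y ^ j * z ^ k) (2 - i - j)) (2 - i)) 2.

(* p l i j k is the coefficient of x^i y^j z^k in the l-th component, l = 1, 2, 3;
   the values of p at other indices are irrelevant. *)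
Definition perturbed_field (lam eps : R) (p : nat -> nat -> nat -> nat -> R) : vector_field :=
  fun '(x, y, z) =>
    (- y + eps * quadratic (p 1%nat) x y z,
     x + eps * quadratic (p 2%nat) x y z,
     lam * (x ^ 2 + y ^ 2 - z) + eps * quadratic (p 3%nat) x y z).

(* Main.v *)
Require Import Defs.
From Stdlib Require Import Reals.
From Coquelicot Require Import Coquelicot.
From Stdlib Require Import ZArith Lra Lia Psatz ClassicalEpsilon Cantor List.
Open Scope R_scope.

(** The averaging method at first order, carried out for a discontinuous field.

    Put rho = x^2 + y^2 and s = z - rho, so that the paraboloid is s = 0. The
    system becomes x' = - y + eps G1, y' = x + eps G2, s' = - lam s + eps G3: for
    eps = 0 the plane rotates, rho is constant and s is multiplied by
    mu = exp (- 2 pi lam) <> 1 in a turn. Near the paraboloid each of the three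
    switching surfaces is a graph y = sw_y rho + sw_k s over the two invariants
    ([switching]). An orbit near a circle of the paraboloid consists of two legs,
    one on each side of the surface ([leg_exit]), and the first return to the
    surface is a map of (rho, s) of the form

      rho |-> rho + 2 eps (gain rho + O(eps)),   s |-> mu s + O(eps),

    where [gain] is the sum of the integrals of x G1 + y G2 along the two
    unperturbed arcs ([melnikov]). The remainders are also Lipschitz with small
    constants ([return_estimates]). Instead of differentiating with respect to
    initial values, this is obtained from a calculus of second differences
    ([quad], [ctrl]) in which two trajectories are compared with each other and
    with their unperturbed versions.

    A simple zero of [gain] then gives a fixed point of the return map
    ([fixed_exists], the intermediate value theorem applied twice) and nothing
    else that is periodic stays close to it ([fixed_unique]: a signed distance to
    the fixed point increases along every other orbit). To turn the fixed point
    into a limit cycle, an arbitrary Filippov solution near the paraboloid has to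
    be shown to follow the legs. Such a solution is only absolutely continuous and
    has a velocity almost everywhere; [ac_nonincreasing] and the estimates built
    on it ([drift], [gronwall]) recover what is true of smooth curves. Both fields
    cross the surface in the same direction ([enters]), so that the solution
    coincides with the smooth trajectory on each side ([follow]) and, when it is
    periodic, with the cycle itself ([periodic_solution_is_loop]). The outcome is
    [cycle_near]: a simple zero rs of [gain] produces limit cycles within O(eps) of
    the circle rho = rs.

    It remains to choose quadratic perturbations whose gain has 4, 6 or 8 simple
    zeros. Nine coefficients suffice; with X = sqrt (r - Y^2) and Y = sw_y r the
    gain is a combination of X, X r, X r^2, X^3, r X Y, r, r^2, and of r and r^2
    multiplied by atan (Y / X) ([reduced_gain]). In a parameter a of the circles
    near the vertex and up to a nonvanishing factor, suitable combinations of these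
    functions are a^n plus terms of higher order, with exponents n = 0, ..., 4 for
    the plane y = 0, n = 0, 1, 2, 3, 4, 6, 8 for y = z and
    n = 0, 1, 2, 3, 4, 6, 8, 10, 12 for y = x^2. Rescaling a = del u with del small
    turns the gain into any prescribed polynomial in u with these exponents, up to
    an error of order del in the C^1 sense ([realizes]). The polynomials chosen
    have the simple zeros 1, ..., 4, 1, ..., 6 and 1, ..., 8. *)

(** * Elementary inequalities *)

Ltac pos := solve [lra | assumption | apply Rabs_pos | left; apply exp_pos | apply Rmult_le_pos; pos].
Ltac mono := solve [lra | apply Rmult_le_compat_r; [pos | mono] | apply Rmult_le_compat_l; [pos | mono]].
Ltac tri := eapply Rle_trans; [apply Rabs_triang |].
Ltac Rmin_le := first [apply Rle_refl | apply Rmin_l | eapply Rle_trans; [apply Rmin_r | Rmin_le]].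
Ltac below H := eapply Rle_trans; [exact H | Rmin_le].

Lemma Rabs_add_le a b x y : Rabs a <= x -> Rabs b <= y -> Rabs (a + b) <= x + y.
Proof. intros Ha Hb. eapply Rle_trans; [apply Rabs_triang | lra]. Qed.

Lemma Rabs_tri3 a b x y z : Rabs a <= x -> Rabs b <= y -> z = a + b -> Rabs z <= x + y.
Proof. intros Ha Hb ->. now apply Rabs_add_le. Qed.

Lemma Rabs_prod a b x y : Rabs a <= x -> Rabs b <= y -> Rabs (a * b) <= x * y.
Proof. intros Ha Hb. rewrite Rabs_mult. apply Rmult_le_compat; auto using Rabs_pos. Qed.

Lemma between_range lo hi u t v : lo <= u <= hi -> lo <= t <= hi -> Rmin u t <= v <= Rmax u t -> lo <= v <= hi.
Proof. unfold Rmin, Rmax. destruct (Rle_dec u t); lra. Qed.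

Lemma sign_cases s : s * s = 1 -> s = 1 \/ s = -1.
Proof. intros Hs. assert (E : (s - 1) * (s + 1) = 0) by lra. apply Rmult_integral in E. lra. Qed.

Lemma sign_abs s a : s * s = 1 -> Rabs (s * a) = Rabs a.
Proof.
intros Hs. rewrite Rabs_mult. destruct (sign_cases s Hs) as [-> | ->].
- rewrite Rabs_R1. ring.
- rewrite (Rabs_left (-1)) by lra. ring.
Qed.

Lemma small_enough q b : 0 <= q -> 0 < b -> exists e, 0 < e /\ forall t, t <= e -> q * t <= b.
Proof.
intros Hq Hb. exists (b / (q + 1)). split; [apply Rdiv_lt_0_compat; lra |].
intros t Ht. apply Rle_trans with (q * (b / (q + 1))); [mono |].
apply Rmult_le_reg_r with (q + 1); [lra |].
replace (q * (b / (q + 1)) * (q + 1)) with (q * b) by (field; lra). nra.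
Qed.

(** * Absolute continuity and null sets *)

(** The supremum of the points reached from a cannot stop before b, since P passes
    across a neighbourhood of it. Being free of any continuity of P, this form suits
    properties that are only checked pointwise. *)
Lemma real_induction (P : R -> Prop) (a b : R) :
  a <= b -> P a ->
  (forall c, a <= c <= b -> exists d, 0 < d /\
     forall s t, a <= s <= c -> c <= t <= b -> c - d < s -> t < c + d -> P s -> P t) ->
  P b.
Proof.
intros Hab Pa step.
set (E := fun x => a <= x <= b /\ P x).
destruct (completeness E) as [c [Hub Hlub]].
- exists b. intros x [Hx _]. lra.
- exists a. split; [lra | exact Pa].
- assert (Hac : a <= c) by (apply Hub; split; [lra | exact Pa]).
  assert (Hcb : c <= b) by (apply Hlub; intros x [Hx _]; lra).
  destruct (step c (conj Hac Hcb)) as [d [Hd Hstep]].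
  assert (Hs : exists s, E s /\ c - d < s).
  { destruct (Classical_Prop.classic (exists s, E s /\ c - d < s)) as [H | H]; [exact H |].
    exfalso. assert (c <= c - d); [| lra].
    apply Hlub. intros x Ex. apply Rnot_lt_le. intros Hx. apply H. now exists x. }
  destruct Hs as [s [[Hsab Ps] Hs]].
  assert (Hsc : s <= c) by (apply Hub; now split).
  set (t := Rmin b (c + d / 2)).
  assert (Ht : c <= t <= b /\ t < c + d).
  { unfold t. split; [split |]; [apply Rmin_glb; lra | apply Rmin_l |].
    apply Rle_lt_trans with (c + d / 2); [apply Rmin_r | lra]. }
  assert (Pt : P t) by (apply (Hstep s t); tauto || lra).
  assert (Htc : t <= c) by (apply Hub; split; [lra | exact Pt]).
  revert Ht Pt Htc. unfold t, Rmin. destruct (Rle_dec b (c + d / 2)); intros; [exact Pt | lra].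
Qed.

(** The increment is taken between points on both sides of t, which is what the step of
    a real induction at t offers. *)
Lemma is_derive_straddle (phi : R -> R) (t l eta : R) :
  is_derive phi t l -> 0 < eta ->
  exists d, 0 < d /\ forall s r, t - d < s <= t -> t <= r < t + d ->
    phi r - phi s <= (l + eta) * (r - s).
Proof.
intros [_ Hd] Heta.
specialize (Hd t (fun P H => H) (mkposreal eta Heta)). simpl in Hd.
destruct Hd as [d Hd]. exists d. split; [apply cond_pos |].
intros s r Hs Hr.
assert (Hs' := Hd s). assert (Hr' := Hd r).
unfold ball, norm, minus, plus, opp, scal in Hs', Hr'; simpl in Hs', Hr'.
unfold AbsRing_ball, abs, minus, plus, opp in Hs', Hr'; simpl in Hs', Hr'.
unfold mult in Hs', Hr'; simpl in Hs', Hr'.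
assert (Bs : Rabs (s + - t) < d) by (apply Rabs_def1; lra).
assert (Br : Rabs (r + - t) < d) by (apply Rabs_def1; lra).
specialize (Hs' Bs). specialize (Hr' Br).
rewrite (Rabs_left1 (s + - t)) in Hs' by lra.
rewrite (Rabs_pos_eq (r + - t)) in Hr' by lra.
assert (B1 := Rle_abs (phi r + - phi t + - ((r + - t) * l))).
assert (B2 := Rle_abs (- (phi s + - phi t + - ((s + - t) * l)))).
rewrite Rabs_Ropp in B2. lra.
Qed.

Definition ac_on (phi : R -> R) (a b : R) : Prop :=
  forall eta, 0 < eta -> exists delta, 0 < delta /\
  forall (n : nat) (u v : nat -> R),
    (forall k, (k <= n)%nat -> a <= u k /\ u k <= v k /\ v k <= b) ->
    (forall k, (k < n)%nat -> v k <= u (S k)) ->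
    sum_n (fun k => v k - u k) n < delta ->
    sum_n (fun k => Rabs (phi (v k) - phi (u k))) n < eta.

Lemma sum_n_S (f : nat -> R) n : sum_n f (S n) = sum_n f n + f (S n).
Proof. now rewrite sum_Sn. Qed.

Lemma sum_n_0 (f : nat -> R) : sum_n f 0 = f 0%nat.
Proof. now rewrite sum_O. Qed.

Lemma sum_n_le_le (f g : nat -> R) n :
  (forall k, (k <= n)%nat -> f k <= g k) -> sum_n f n <= sum_n g n.
Proof.
induction n as [| n IH]; intros H.
- rewrite !sum_n_0. apply H; lia.
- rewrite !sum_n_S. apply Rplus_le_compat; [apply IH; intros; apply H; lia | apply H; lia].
Qed.

Lemma sum_n_lt_lower (f : nat -> R) n k :
  (forall i, 0 <= f i) -> (k <= n)%nat -> f k <= sum_n f n.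
Proof.
intros Hf. induction n as [| n IH]; intros Hk.
- replace k with 0%nat by lia. rewrite sum_n_0. lra.
- rewrite sum_n_S. destruct (Nat.eq_dec k (S n)) as [-> | Hne].
  + assert (0 <= sum_n f n); [| lra].
    clear -Hf. induction n as [| n IH]; [rewrite sum_n_0; apply Hf |].
    rewrite sum_n_S. specialize (Hf (S n)). lra.
  + assert (f k <= sum_n f n) by (apply IH; lia). specialize (Hf (S n)). lra.
Qed.

Lemma sum_n_mono (f : nat -> R) m n :
  (forall i, 0 <= f i) -> (m <= n)%nat -> sum_n f m <= sum_n f n.
Proof.
intros Hf Hmn. induction Hmn as [| n _ IH]; [lra |].
rewrite sum_n_S. specialize (Hf (S n)). lra.
Qed.

Lemma sum_n_sub (f g : nat -> R) n :
  sum_n (fun k => f k - g k) n = sum_n f n - sum_n g n.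
Proof.
induction n as [| n IH]; [now rewrite !sum_n_0 |]. rewrite !sum_n_S, IH.
match goal with |- @eq _ ?x ?y => change (@eq R x y) end. ring.
Qed.

(** The part of the interval from u to v that lies to the left of x. The length of a
    cover consumed up to x is a sum of such terms whether or not its intervals overlap.
    *)
Definition swept (u v x : R) : R := Rmax u (Rmin v x) - u.

Lemma swept_ge0 u v x : 0 <= swept u v x.
Proof. unfold swept. assert (H := Rmax_l u (Rmin v x)). lra. Qed.

Lemma swept_le u v x : u <= v -> swept u v x <= v - u.
Proof.
intros H. unfold swept. assert (Rmax u (Rmin v x) <= v); [| lra].
apply Rmax_lub; [exact H | apply Rmin_l].
Qed.

Lemma swept_mono u v x y : x <= y -> swept u v x <= swept u v y.
Proof.
intros H. unfold swept. apply Rplus_le_compat_r. apply Rle_max_compat_l.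
apply Rle_min_compat_l. exact H.
Qed.

Lemma swept_in u v x : u < x < v -> swept u v x = x - u.
Proof.
intros H. unfold swept. rewrite Rmin_right by lra. rewrite Rmax_right by lra. ring.
Qed.

(** Real induction on the end point. Outside the null set the derivative is nonpositive
    and a short step costs at most eta times its length. At a point of the null set the
    induction jumps over one interval of the cover and records the jump; the recorded
    intervals do not overlap, and their total length is at most the length of the cover
    consumed so far, hence less than delta. Absolute continuity bounds what they
    contribute. *)
Lemma ac_nonincreasing (phi : R -> R) (a b : R) (N : R -> Prop) :
  a <= b -> ac_on phi a b -> null_set N ->
  (forall t, a <= t <= b -> ~ N t -> exists l, is_derive phi t l /\ l <= 0) ->
  phi b <= phi a.
Proof.
intros Hab Hac HN Hder.
assert (key : forall eta, 0 < eta -> phi b - phi a <= eta * (b - a) + eta).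
2:{ apply Rnot_lt_le. intros Hlt.
    set (e := (phi b - phi a) / (2 * (b - a + 1))).
    assert (He : 0 < e) by (apply Rdiv_lt_0_compat; lra).
    specialize (key e He).
    assert (e * (2 * (b - a + 1)) = phi b - phi a) by (unfold e; field; lra). nra. }
intros eta Heta.
destruct (Hac eta Heta) as [delta [Hdelta Hsmall]].
destruct (HN (delta / 2) ltac:(lra)) as [u [v [Huv [Hcov Htot]]]].
(* Psi M x is the length of the first M intervals of the cover consumed at x *)
set (Psi := fun M x => sum_n (fun k => swept (u k) (v k) x) M).
set (P := fun x => exists (n : nat) (p q : nat -> R) (M : nat),
  (forall k, (k <= n)%nat -> a <= p k /\ p k <= q k /\ q k <= x) /\
  (forall k, (k < n)%nat -> q k <= p (S k)) /\
  phi x - phi a <= eta * (x - a) + sum_n (fun k => Rabs (phi (q k) - phi (p k))) n /\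
  sum_n (fun k => q k - p k) n <= Psi M x).
assert (Pb : P b).
{ apply (real_induction P a b Hab).
  - exists 0%nat, (fun _ => a), (fun _ => a), 0%nat. repeat split; try lra; try lia.
    + rewrite sum_n_0, Rminus_diag, Rabs_R0. lra.
    + rewrite sum_n_0. unfold Psi. rewrite sum_n_0.
      assert (H := swept_ge0 (u 0%nat) (v 0%nat) a). lra.
  - intros c Hc. destruct (Classical_Prop.classic (N c)) as [Nc | Nc].
    + destruct (Hcov c Nc) as [k0 Hk0].
      exists (Rmin (c - u k0) (v k0 - c)). split; [apply Rmin_glb_lt; lra |].
      intros s t Hs Ht Hsd Htd [n [p [q [M [H1 [H2 [H3 H4]]]]]]].
      assert (B1 := Rmin_l (c - u k0) (v k0 - c)).
      assert (B2 := Rmin_r (c - u k0) (v k0 - c)).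
      set (M' := Nat.max M k0).
      exists (S n), (fun k => if Nat.leb k n then p k else s),
        (fun k => if Nat.leb k n then q k else t), M'.
      repeat split.
      * destruct (Nat.leb_spec k n) as [Hk | Hk]; [apply H1; exact Hk | lra].
      * destruct (Nat.leb_spec k n) as [Hk | Hk]; [apply H1; exact Hk | lra].
      * destruct (Nat.leb_spec k n) as [Hk | Hk]; [| lra].
        destruct (H1 k Hk) as [_ [_ Hq]]. lra.
      * intros k Hk. rewrite (proj2 (Nat.leb_le k n)) by lia.
        destruct (Nat.leb_spec (S k) n) as [Hk' | Hk']; [apply H2; lia |].
        apply H1; lia.
      * rewrite sum_n_S. rewrite (proj2 (Nat.leb_gt (S n) n)) by lia.
        rewrite (sum_n_ext_loc _ (fun k => Rabs (phi (q k) - phi (p k)))).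
        2:{ intros k Hk. rewrite (proj2 (Nat.leb_le k n)) by lia. reflexivity. }
        assert (B := Rle_abs (phi t - phi s)). nra.
      * rewrite sum_n_S. rewrite (proj2 (Nat.leb_gt (S n) n)) by lia.
        rewrite (sum_n_ext_loc _ (fun k => q k - p k)).
        2:{ intros k Hk. rewrite (proj2 (Nat.leb_le k n)) by lia. reflexivity. }
        assert (E1 : Psi M s <= Psi M' s).
        { apply sum_n_mono; [intros; apply swept_ge0 | apply Nat.le_max_l]. }
        assert (E2 : t - s <= Psi M' t - Psi M' s).
        { unfold Psi. rewrite <- sum_n_sub.
          replace (t - s) with (swept (u k0) (v k0) t - swept (u k0) (v k0) s).
          - apply (sum_n_lt_lower (fun k => swept (u k) (v k) t - swept (u k) (v k) s)).
            + intros i. assert (B := swept_mono (u i) (v i) s t ltac:(lra)). lra.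
            + apply Nat.le_max_r.
          - rewrite !swept_in by lra. ring. }
        lra.
    + destruct (Hder c Hc Nc) as [l [Hl Hl0]].
      destruct (is_derive_straddle phi c l eta Hl Heta) as [d [Hd Hst]].
      exists d. split; [exact Hd |].
      intros s t Hs Ht Hsd Htd [n [p [q [M [H1 [H2 [H3 H4]]]]]]].
      exists n, p, q, M. repeat split.
      * apply H1; assumption.
      * apply H1; assumption.
      * destruct (H1 k H) as [_ [_ Hq]]. lra.
      * exact H2.
      * specialize (Hst s t ltac:(lra) ltac:(lra)). nra.
      * apply Rle_trans with (1 := H4). apply sum_n_le_le. intros k _. apply swept_mono. lra. }
destruct Pb as [n [p [q [M [H1 [H2 [H3 H4]]]]]]].
assert (Hlen : sum_n (fun k => q k - p k) n < delta).
{ apply Rle_lt_trans with (1 := H4). apply Rle_lt_trans with (delta / 2); [| lra].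
  apply Rle_trans with (2 := Htot M). apply sum_n_le_le. intros k _. apply swept_le, Huv. }
assert (H := Hsmall n p q H1 H2 Hlen). lra.
Qed.

Lemma locally_lipschitz_le (phi : R -> R) (K a b : R) :
  a <= b ->
  (forall t, a <= t <= b -> exists d, 0 < d /\
     forall s, Rabs (s - t) < d -> Rabs (phi s - phi t) <= K * Rabs (s - t)) ->
  Rabs (phi b - phi a) <= K * (b - a).
Proof.
intros Hab Hloc.
apply (real_induction (fun x => Rabs (phi x - phi a) <= K * (x - a)) a b Hab).
- rewrite !Rminus_diag, Rabs_R0. lra.
- intros c Hc. destruct (Hloc c Hc) as [d [Hd Hl]]. exists d. split; [exact Hd |].
  intros s t Hs Ht Hsd Htd Ps.
  assert (B1 := Hl s ltac:(apply Rabs_def1; lra)).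
  assert (B2 := Hl t ltac:(apply Rabs_def1; lra)).
  rewrite (Rabs_left1 (s - c)) in B1 by lra. rewrite (Rabs_pos_eq (t - c)) in B2 by lra.
  replace (phi t - phi a) with ((phi t - phi c) + (-(phi s - phi c)) + (phi s - phi a)) by ring.
  tri.
  eapply Rle_trans; [apply Rplus_le_compat_r, Rabs_triang |]. rewrite Rabs_Ropp. lra.
Qed.

(** * Solutions of Lipschitz systems *)

Lemma RInt_exp_bound_pos (f : R -> R) (K b t : R) :
  0 <= K -> 0 < b -> 0 <= t -> (forall r, continuous f r) ->
  (forall r, Rabs (f r) <= K * exp (b * Rabs r)) ->
  Rabs (RInt f 0 t) <= K * exp (b * t) / b.
Proof.
intros HK Hb Ht Hf Hbd.
assert (Hint : is_RInt (fun r => K * exp (b * r)) 0 t (K * exp (b * t) / b - K * exp (b * 0) / b)).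
{ apply (is_RInt_derive (fun r => K * exp (b * r) / b)).
  - intros x _. auto_derive; [easy | field; lra].
  - intros x _. apply (ex_derive_continuous (fun r => K * exp (b * r))). auto_derive. easy. }
apply Rle_trans with (RInt (fun r => K * exp (b * r)) 0 t).
- apply (norm_RInt_le f (fun r => K * exp (b * r)) 0 t (RInt f 0 t)
     (RInt (fun r => K * exp (b * r)) 0 t)); [exact Ht | | |].
  + intros x Hx. specialize (Hbd x). rewrite (Rabs_pos_eq x) in Hbd by lra. exact Hbd.
  + apply (RInt_correct f). apply (ex_RInt_continuous (V := R_CompleteNormedModule)). intros; apply Hf.
  + apply (RInt_correct (fun r => K * exp (b * r))). eexists; exact Hint.
- rewrite (is_RInt_unique _ _ _ _ Hint).
  assert (0 <= K * exp (b * 0) / b); [| lra].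
  apply Rmult_le_pos; [apply Rmult_le_pos; [exact HK | left; apply exp_pos] |].
  left; apply Rinv_0_lt_compat, Hb.
Qed.

(** In the weight exp (b |t|) integration is a contraction by the factor 1 / b, on the
    whole line at once. *)
Lemma RInt_exp_bound (f : R -> R) (K b t : R) :
  0 <= K -> 0 < b -> (forall r, continuous f r) ->
  (forall r, Rabs (f r) <= K * exp (b * Rabs r)) ->
  Rabs (RInt f 0 t) <= K * exp (b * Rabs t) / b.
Proof.
intros HK Hb Hf Hbd.
destruct (Rle_lt_dec 0 t) as [Ht | Ht].
- rewrite (Rabs_pos_eq t) by exact Ht. now apply RInt_exp_bound_pos.
- rewrite (Rabs_left t) by exact Ht.
  set (g := fun r => f (- r)).
  assert (Hg : forall r, continuous g r).
  { intros r. apply (continuous_comp Ropp f); [apply (continuous_opp (fun x : R => x)), continuous_id |].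
    apply Hf. }
  assert (E : RInt f 0 t = - RInt g 0 (- t)).
  { assert (H1 : ex_RInt f 0 t).
    { apply (ex_RInt_continuous (V := R_CompleteNormedModule)). intros; apply Hf. }
    assert (H2 := is_RInt_comp_opp f 0 (- t) (RInt f 0 t)).
    rewrite Ropp_0, Ropp_involutive in H2. specialize (H2 (RInt_correct f 0 t H1)).
    assert (H3 := is_RInt_opp _ _ _ _ H2).
    rewrite <- (Ropp_involutive (RInt f 0 t)). f_equal. symmetry.
    apply is_RInt_unique. apply (is_RInt_ext (fun y => opp (opp (f (- y))))); [| exact H3].
    intros x _. unfold g, opp; simpl. ring. }
  rewrite E, Rabs_Ropp. apply RInt_exp_bound_pos; try assumption; [lra |].
  intros r. unfold g. specialize (Hbd (- r)). now rewrite Rabs_Ropp in Hbd.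
Qed.

Lemma lim_of_geometric (s : nat -> R) (M : R) :
  (forall n, Rabs (s (S n) - s n) <= M / 2 ^ n) ->
  { l : R | forall n, Rabs (l - s n) <= 2 * M / 2 ^ n }.
Proof.
intros H.
assert (Hp : forall n, 0 < 2 ^ n) by (intros; apply pow_lt; lra).
assert (Htel : forall n k, Rabs (s (n + k)%nat - s n) <= 2 * M / 2 ^ n - 2 * M / 2 ^ (n + k)).
{ intros n k. induction k as [| k IH].
  - rewrite Nat.add_0_r, !Rminus_diag, Rabs_R0. lra.
  - replace (n + S k)%nat with (S (n + k)) by lia.
    replace (s (S (n + k)) - s n) with ((s (S (n + k)) - s (n + k)%nat) + (s (n + k)%nat - s n)) by ring.
    tri.
    specialize (H (n + k)%nat). specialize (Hp (n + k)%nat).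
    assert (2 * M / 2 ^ S (n + k) = M / 2 ^ (n + k)) by (simpl; field; lra).
    lra. }
assert (HM : 0 <= M).
{ specialize (H 0%nat). simpl in H. assert (B := Rabs_pos (s 1%nat - s 0%nat)). lra. }
assert (Hc : Cauchy_crit s).
{ intros eps Heps.
  destruct (pow_lt_1_zero (1 / 2) ltac:(rewrite Rabs_pos_eq; lra) (eps / (4 * M + 1))
     ltac:(apply Rdiv_lt_0_compat; lra)) as [n0 Hn0].
  assert (Hb : forall n, (n >= n0)%nat -> Rabs (s n - s n0) <= 2 * M / 2 ^ n0).
  { intros n Hn. replace n with (n0 + (n - n0))%nat by lia. eapply Rle_trans; [apply Htel |].
    assert (0 <= 2 * M / 2 ^ (n0 + (n - n0))); [| lra].
    apply Rmult_le_pos; [lra |]. left; apply Rinv_0_lt_compat, Hp. }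
  assert (H2 : 4 * M / 2 ^ n0 < eps).
  { specialize (Hn0 n0 (Nat.le_refl _)).
    rewrite Rabs_pos_eq in Hn0 by (apply pow_le; lra).
    replace ((1 / 2) ^ n0) with (/ 2 ^ n0) in Hn0.
    2:{ unfold Rdiv. rewrite Rmult_1_l. now rewrite pow_inv. }
    assert (/ 2 ^ n0 * (4 * M + 1) < eps).
    { apply Rlt_le_trans with (eps / (4 * M + 1) * (4 * M + 1)).
      - apply Rmult_lt_compat_r; lra.
      - right; field; lra. }
    assert (0 < / 2 ^ n0) by (apply Rinv_0_lt_compat, Hp). unfold Rdiv. lra. }
  exists n0. intros n m Hn Hm. unfold Rdist.
  replace (s n - s m) with ((s n - s n0) + - (s m - s n0)) by ring.
  eapply Rle_lt_trans; [apply Rabs_triang |]. rewrite Rabs_Ropp.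
  assert (B1 := Hb n Hn). assert (B2 := Hb m Hm).
  assert (2 * M / 2 ^ n0 + 2 * M / 2 ^ n0 = 4 * M / 2 ^ n0) by (field; specialize (Hp n0); lra).
  lra. }
destruct (Rcomplete.R_complete s Hc) as [l Hl]. exists l. intros n.
apply Rnot_lt_le. intros Hlt.
destruct (Hl (Rabs (l - s n) - 2 * M / 2 ^ n) ltac:(lra)) as [N HN].
specialize (HN (n + N)%nat ltac:(lia)). unfold Rdist in HN.
assert (B := Htel n N).
assert (0 <= 2 * M / 2 ^ (n + N)).
{ apply Rmult_le_pos; [lra |]. left; apply Rinv_0_lt_compat, Hp. }
assert (T := Rabs_triang (l - s (n + N)%nat) (s (n + N)%nat - s n)).
rewrite (Rabs_minus_sym l (s (n + N)%nat)) in T.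
replace (l - s (n + N)%nat + (s (n + N)%nat - s n)) with (l - s n) in T by ring. lra.
Qed.

Definition lipschitz3 (L : R) (F : R -> R -> R -> R) : Prop :=
  forall x y z x' y' z', Rabs (F x y z - F x' y' z') <=
    L * (Rabs (x - x') + Rabs (y - y') + Rabs (z - z')).

Lemma lipschitz3_continuous (L : R) (F : R -> R -> R -> R) (a b c : R -> R) (t : R) :
  0 < L -> lipschitz3 L F -> continuous a t -> continuous b t -> continuous c t ->
  continuous (fun r => F (a r) (b r) (c r)) t.
Proof.
intros HL HF Ha Hb Hc.
apply filterlim_locally. intros eps.
assert (He : 0 < eps / (3 * L)) by (apply Rdiv_lt_0_compat; [apply cond_pos | lra]).
set (e := mkposreal _ He).
assert (Ha' := proj1 (filterlim_locally _ _) Ha e).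
assert (Hb' := proj1 (filterlim_locally _ _) Hb e).
assert (Hc' := proj1 (filterlim_locally _ _) Hc e).
generalize (filter_and _ _ Ha' (filter_and _ _ Hb' Hc')).
apply filter_imp. intros r [h1 [h2 h3]].
unfold ball in *; simpl in *. unfold AbsRing_ball, abs, minus, plus, opp in *; simpl in *.
eapply Rle_lt_trans; [apply HF |].
unfold Rminus. apply Rlt_le_trans with (L * (3 * (eps / (3 * L)))).
- apply Rmult_lt_compat_l; [exact HL | lra].
- right. field. lra.
Qed.

Section Picard.
Variables (X : nat -> R -> R -> R -> R) (L : R) (c : nat -> R).
Hypothesis HL : 0 < L.
Hypothesis HX : forall i, lipschitz3 L (X i).

Fixpoint picard (n : nat) (i : nat) (t : R) : R :=
  match n with
  | O => c i
  | S m => c i + RInt (fun r => X i (picard m 0 r) (picard m 1 r) (picard m 2 r)) 0 t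
  end.

Let along (u : nat -> R -> R) (i : nat) (r : R) : R := X i (u 0%nat r) (u 1%nat r) (u 2%nat r).

Lemma along_continuous u i r :
  (forall j s, continuous (u j) s) -> continuous (along u i) r.
Proof. intros H. apply (lipschitz3_continuous L (X i)); auto. Qed.

Lemma integral_derive u i t :
  (forall j s, continuous (u j) s) ->
  is_derive (fun t => c i + RInt (along u i) 0 t) t (along u i t).
Proof.
intros H.
replace (along u i t) with (plus 0 (along u i t)) by apply (plus_zero_l (along u i t)).
apply (is_derive_plus (K := R_AbsRing) (V := R_NormedModule) (fun _ => c i) (RInt (along u i) 0) t 0);
  [apply (is_derive_const (V := R_NormedModule)) |].
apply (is_derive_RInt (along u i) (RInt (along u i) 0) 0 t).
- apply filter_forall. intros r. apply (RInt_correct (along u i)).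
  apply (ex_RInt_continuous (V := R_CompleteNormedModule)). intros; now apply along_continuous.
- now apply along_continuous.
Qed.

Lemma picard_continuous n i t : continuous (picard n i) t.
Proof.
revert i t. induction n as [| n IH]; intros i t.
- apply (continuous_const (V := R_UniformSpace)).
- apply (ex_derive_continuous (picard (S n) i)). eexists.
  apply (integral_derive (picard n)). exact IH.
Qed.

Lemma integral_close u v i t K :
  0 <= K -> (forall j s, continuous (u j) s) -> (forall j s, continuous (v j) s) ->
  (forall j s, Rabs (u j s - v j s) <= K * exp (6 * L * Rabs s)) ->
  Rabs ((c i + RInt (along u i) 0 t) - (c i + RInt (along v i) 0 t))
    <= K / 2 * exp (6 * L * Rabs t).
Proof.
intros HK Hu Hv Huv.
assert (E : (c i + RInt (along u i) 0 t) - (c i + RInt (along v i) 0 t) =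
   RInt (fun r => minus (along u i r) (along v i r)) 0 t).
{ assert (R : forall z, (forall j s, continuous (z j) s) -> is_RInt (along z i) 0 t (RInt (along z i) 0 t)).
  { intros z Hz. apply (RInt_correct (along z i)).
    apply (ex_RInt_continuous (V := R_CompleteNormedModule)). intros; now apply along_continuous. }
  symmetry. apply is_RInt_unique.
  replace (c i + RInt (along u i) 0 t - (c i + RInt (along v i) 0 t))
    with (minus (RInt (along u i) 0 t) (RInt (along v i) 0 t)) by (unfold minus, plus, opp; simpl; ring).
  apply (is_RInt_minus (V := R_NormedModule)); now apply R. }
rewrite E.
replace (K / 2 * exp (6 * L * Rabs t)) with ((3 * L * K) * exp (6 * L * Rabs t) / (6 * L))
  by (field; lra).
apply RInt_exp_bound; [nra | lra | |].
- intros r. apply (continuous_minus (along u i) (along v i)); now apply along_continuous.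
- intros r. unfold minus, plus, opp; simpl.
  eapply Rle_trans; [apply HX |].
  assert (B0 := Huv 0%nat r). assert (B1 := Huv 1%nat r). assert (B2 := Huv 2%nat r). nra.
Qed.

(** The weight exp (6 L |t|) makes the Picard map a contraction by one half, whence
    solutions for all times without any continuation argument. *)
Lemma picard_step :
  exists M, 0 <= M /\ forall n i t,
    (i < 3)%nat -> Rabs (picard (S n) i t - picard n i t) <= M * exp (6 * L * Rabs t) / 2 ^ n.
Proof.
set (m := Rabs (along (picard 0) 0 0) + Rabs (along (picard 0) 1 0) + Rabs (along (picard 0) 2 0)).
assert (Hm : forall i, (i < 3)%nat -> Rabs (along (picard 0) i 0) <= m).
{ intros i Hi. unfold m.
  assert (B0 := Rabs_pos (along (picard 0) 0 0)). assert (B1 := Rabs_pos (along (picard 0) 1 0)).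
  assert (B2 := Rabs_pos (along (picard 0) 2 0)).
  destruct i as [| [| [| i]]]; try lra. lia. }
assert (Hm0 : 0 <= m).
{ unfold m. assert (B0 := Rabs_pos (along (picard 0) 0 0)).
  assert (B1 := Rabs_pos (along (picard 0) 1 0)). assert (B2 := Rabs_pos (along (picard 0) 2 0)). lra. }
exists (m / (6 * L)). split; [apply Rmult_le_pos; [exact Hm0 | left; apply Rinv_0_lt_compat; lra] |].
intros n. induction n as [| n IH]; intros i t Hi.
- simpl pow. replace (m / (6 * L) * exp (6 * L * Rabs t) / 1) with (m * exp (6 * L * Rabs t) / (6 * L))
    by (field; lra).
  replace (picard 1 i t - picard 0 i t) with (RInt (along (picard 0) i) 0 t)
    by (symmetry; apply (Rplus_minus_l (c i) (RInt (along (picard 0) i) 0 t))).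
  apply RInt_exp_bound; [exact Hm0 | lra | |].
  + intros r. apply along_continuous. intros; apply picard_continuous.
  + intros r. change (Rabs (along (picard 0) i 0) <= m * exp (6 * L * Rabs r)).
    assert (1 <= exp (6 * L * Rabs r)).
    { rewrite <- exp_0. assert (0 <= 6 * L * Rabs r).
      { apply Rmult_le_pos; [lra | apply Rabs_pos]. }
      destruct H as [H | H]; [left; now apply exp_increasing | rewrite <- H; lra]. }
    specialize (Hm i Hi). nra.
- set (K := m / (6 * L) / 2 ^ n).
  assert (Hp : 0 < 2 ^ n) by (apply pow_lt; lra).
  replace (m / (6 * L) * exp (6 * L * Rabs t) / 2 ^ S n) with (K / 2 * exp (6 * L * Rabs t))
    by (unfold K; simpl; field; lra).
  assert (HK : 0 <= K).
  { unfold K. apply Rmult_le_pos; [apply Rmult_le_pos; [exact Hm0 | left; apply Rinv_0_lt_compat; lra] |].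
    left; apply Rinv_0_lt_compat, Hp. }
  set (trunc := fun (p : nat -> R -> R) j => match j with 0%nat => p 0%nat | 1%nat => p 1%nat | _ => p 2%nat end).
  apply (integral_close (trunc (picard (S n))) (trunc (picard n)) i t K HK).
  + intros j s. destruct j as [| [| j]]; apply picard_continuous.
  + intros j s. destruct j as [| [| j]]; apply picard_continuous.
  + intros j s. 
    replace (K * exp (6 * L * Rabs s)) with (m / (6 * L) * exp (6 * L * Rabs s) / 2 ^ n)
      by (unfold K; field; lra).
    destruct j as [| [| j]]; unfold trunc; apply IH; lia.
Qed.

Theorem picard_lindelof :
  exists u : nat -> R -> R, (forall i, (i < 3)%nat -> u i 0 = c i) /\
    forall i t, (i < 3)%nat -> is_derive (u i) t (X i (u 0%nat t) (u 1%nat t) (u 2%nat t)).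
Proof.
destruct picard_step as [M [HM Hstep]].
assert (Hlim : forall i t, (i < 3)%nat ->
   {l | forall n, Rabs (l - picard n i t) <= 2 * (M * exp (6 * L * Rabs t)) / 2 ^ n}).
{ intros i t Hi. apply lim_of_geometric. intros n. apply Hstep, Hi. }
set (red := fun j => match j with 0%nat => 0%nat | 1%nat => 1%nat | _ => 2%nat end).
assert (Hred : forall j, (red j < 3)%nat) by (intros [| [| j]]; simpl; lia).
set (u := fun j t => proj1_sig (Hlim (red j) t (Hred j))).
assert (Hu : forall j t n, Rabs (u j t - picard n (red j) t) <= 2 * M / 2 ^ n * exp (6 * L * Rabs t)).
{ intros j t n. unfold u. destruct (Hlim (red j) t (Hred j)) as [l Hl]. simpl.
  replace (2 * M / 2 ^ n * exp (6 * L * Rabs t)) with (2 * (M * exp (6 * L * Rabs t)) / 2 ^ n); [apply Hl |].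
  field. apply pow_nonzero; lra. }
assert (Hsmall : forall K eps, 0 <= K -> 0 < eps -> exists n, 2 * M / 2 ^ n * K < eps).
{ intros K eps HK Heps.
  destruct (pow_lt_1_zero (1 / 2) ltac:(rewrite Rabs_pos_eq; lra) (eps / (2 * M * K + 1))
     ltac:(apply Rdiv_lt_0_compat; nra)) as [n0 Hn0].
  exists n0. specialize (Hn0 n0 (Nat.le_refl _)).
  rewrite Rabs_pos_eq in Hn0 by (apply pow_le; lra).
  replace ((1 / 2) ^ n0) with (/ 2 ^ n0) in Hn0.
  2:{ unfold Rdiv. rewrite Rmult_1_l. now rewrite pow_inv. }
  assert (0 < / 2 ^ n0) by (apply Rinv_0_lt_compat, pow_lt; lra).
  assert (/ 2 ^ n0 * (2 * M * K + 1) < eps).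
  { apply Rlt_le_trans with (eps / (2 * M * K + 1) * (2 * M * K + 1)).
    - apply Rmult_lt_compat_r; nra.
    - right; field; nra. }
  unfold Rdiv. nra. }
assert (Hcont : forall j t, continuous (u j) t).
{ intros j t. apply filterlim_locally. intros eps.
  set (K := exp (6 * L * (Rabs t + 1))).
  destruct (Hsmall K (eps / 3)) as [n Hn]; [left; apply exp_pos | destruct eps as [e He]; simpl; lra |].
  assert (He3 : 0 < eps / 3) by (destruct eps as [e He]; simpl; lra).
  assert (Hp := proj1 (filterlim_locally _ _) (picard_continuous n (red j) t) (mkposreal _ He3)).
  assert (H1 : locally t (fun r => Rabs (r - t) < 1)) by (exists (mkposreal 1 Rlt_0_1); intros r Hr; exact Hr).
  generalize (filter_and _ _ Hp H1). apply filter_imp. intros r [h1 h2].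
  unfold ball in *; simpl in *. unfold AbsRing_ball, abs, minus, plus, opp in *; simpl in *.
  assert (Hr : forall s, Rabs s <= Rabs t + 1 -> Rabs (u j s - picard n (red j) s) < eps / 3).
  { intros s Hs. eapply Rle_lt_trans; [apply Hu |]. eapply Rle_lt_trans; [| exact Hn].
    apply Rmult_le_compat_l.
    - apply Rmult_le_pos; [lra |]. left; apply Rinv_0_lt_compat, pow_lt; lra.
    - unfold K. destruct Hs as [Hs | Hs]; [left; apply exp_increasing; nra | rewrite Hs; lra]. }
  assert (A1 := Hr r). assert (A2 := Hr t).
  assert (Hrt : Rabs r <= Rabs t + 1).
  { replace r with (t + (r - t)) by ring. tri. lra. }
  specialize (A1 Hrt). specialize (A2 ltac:(lra)).
  replace (u j r + - u j t) with ((u j r - picard n (red j) r) + (picard n (red j) r + - picard n (red j) t)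
     + - (u j t - picard n (red j) t)) by ring.
  eapply Rle_lt_trans; [apply Rabs_triang |].
  eapply Rle_lt_trans; [apply Rplus_le_compat_r, Rabs_triang |]. rewrite Rabs_Ropp. lra. }
assert (Heq : forall i t, (i < 3)%nat -> u i t = c i + RInt (along u i) 0 t).
{ intros i t Hi. apply Rminus_diag_uniq.
  set (K := exp (6 * L * Rabs t)).
  destruct (Req_dec (u i t - (c i + RInt (along u i) 0 t)) 0) as [E | E]; [exact E |].
  exfalso. apply Rabs_pos_lt in E.
  destruct (Hsmall K (Rabs (u i t - (c i + RInt (along u i) 0 t))) ltac:(left; apply exp_pos) E) as [n Hn].
  assert (Hri : red i = i) by (destruct i as [| [| [| i]]]; simpl; lia).
  assert (B1 := Hu i t (S n)). rewrite Hri in B1.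
  set (pn := fun j => picard n (red j)).
  assert (B2 := integral_close pn u i t (2 * M / 2 ^ n)
    ltac:(apply Rmult_le_pos; [lra | left; apply Rinv_0_lt_compat, pow_lt; lra])
    ltac:(intros; apply picard_continuous) Hcont
    ltac:(intros j s; rewrite Rabs_minus_sym; apply Hu)).
  change (c i + RInt (along pn i) 0 t) with (picard (S n) i t) in B2.
  assert (Hq : 2 * M / 2 ^ S n = 2 * M / 2 ^ n / 2) by (simpl; field; apply pow_nonzero; lra).
  rewrite Hq in B1. fold K in B1, B2.
  assert (T := Rabs_triang (u i t - picard (S n) i t) (picard (S n) i t - (c i + RInt (along u i) 0 t))).
  replace (u i t - picard (S n) i t + (picard (S n) i t - (c i + RInt (along u i) 0 t)))
    with (u i t - (c i + RInt (along u i) 0 t)) in T by ring. lra. }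
exists u. split.
- intros i Hi. rewrite Heq by exact Hi. rewrite RInt_point. unfold zero; simpl. ring.
- intros i t Hi.
  apply (is_derive_ext (fun t => c i + RInt (along u i) 0 t)); [intros s; symmetry; now apply Heq |].
  apply integral_derive. exact Hcont.
Qed.
End Picard.

(** * Curves with a velocity almost everywhere *)

Lemma derive_plus (f g : R -> R) (t a b : R) :
  is_derive f t a -> is_derive g t b -> is_derive (fun r => f r + g r) t (a + b).
Proof. apply (is_derive_plus (K := R_AbsRing) (V := R_NormedModule) f g). Qed.

Lemma derive_minus (f g : R -> R) (t a b : R) :
  is_derive f t a -> is_derive g t b -> is_derive (fun r => f r - g r) t (a - b).
Proof. apply (is_derive_minus (K := R_AbsRing) (V := R_NormedModule) f g). Qed.

Lemma derive_mult (f g : R -> R) (t a b : R) :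
  is_derive f t a -> is_derive g t b -> is_derive (fun r => f r * g r) t (a * g t + f t * b).
Proof. intros Hf Hg. apply (is_derive_mult f g t a b Hf Hg). intros; apply Rmult_comm. Qed.

Lemma null_set_empty : null_set (fun _ => False).
Proof.
intros eta Heta. exists (fun _ => 0), (fun _ => 0). split; [| split].
- intros n; lra.
- intros t [].
- intros n. replace (sum_n (fun _ => 0 - 0) n) with 0; [lra |].
  symmetry. induction n as [| n IH]; [rewrite sum_n_0 | rewrite sum_n_S, IH];
    match goal with |- @eq _ ?p ?q => change (@eq R p q) end; ring.
Qed.

Lemma null_set_sub (N N' : R -> Prop) :
  (forall t, N t -> N' t) -> null_set N' -> null_set N.
Proof.
intros H HN eta Heta. destruct (HN eta Heta) as [u [v [H1 [H2 H3]]]].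
exists u, v. repeat split; auto.
Qed.

Lemma null_set_sequence (c : nat -> R) : null_set (fun t => exists n, t = c n).
Proof.
intros eta Heta.
set (r := fun n => eta / 4 / 2 ^ n).
assert (Hp : forall n, 0 < 2 ^ n) by (intros; apply pow_lt; lra).
assert (Hr : forall n, 0 < r n) by (intros n; unfold r; apply Rdiv_lt_0_compat; [lra | apply Hp]).
exists (fun n => c n - r n), (fun n => c n + r n). repeat split.
- intros n. specialize (Hr n). lra.
- intros t [n ->]. exists n. specialize (Hr n). lra.
- intros n. assert (H : sum_n (fun k => c k + r k - (c k - r k)) n <= eta - 2 * r n).
  { induction n as [| n IH].
    - rewrite sum_n_0. unfold r. simpl. lra.
    - rewrite sum_n_S. assert (r n = 2 * r (S n)) by (unfold r; simpl; specialize (Hp n); field; lra). lra. }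
  specialize (Hr n). lra.
Qed.

Definition bounded_on (x : R -> R) (a b : R) : Prop :=
  exists M, 0 <= M /\ forall t, a <= t <= b -> Rabs (x t) <= M.

(** Boundedness is kept together with absolute continuity because products need it. *)
Definition bac (x : R -> R) (a b : R) : Prop := ac_on x a b /\ bounded_on x a b.

Lemma ac_on_dominated (phi x y : R -> R) (K a b : R) :
  0 <= K -> ac_on x a b -> ac_on y a b ->
  (forall t r, a <= t <= b -> a <= r <= b ->
     Rabs (phi t - phi r) <= K * (Rabs (x t - x r) + Rabs (y t - y r))) ->
  ac_on phi a b.
Proof.
intros HK Hx Hy Hphi eta Heta.
assert (He : 0 < eta / (2 * (K + 1))) by (apply Rdiv_lt_0_compat; lra).
destruct (Hx _ He) as [d1 [Hd1 H1]]. destruct (Hy _ He) as [d2 [Hd2 H2]].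
exists (Rmin d1 d2). split; [now apply Rmin_glb_lt |].
intros n u v Huv Hord Hs.
specialize (H1 n u v Huv Hord (Rlt_le_trans _ _ _ Hs (Rmin_l _ _))).
specialize (H2 n u v Huv Hord (Rlt_le_trans _ _ _ Hs (Rmin_r _ _))).
apply Rle_lt_trans with (K * (sum_n (fun k => Rabs (x (v k) - x (u k))) n
   + sum_n (fun k => Rabs (y (v k) - y (u k))) n)).
- clear Hord Hs H1 H2. induction n as [| n IH].
  + rewrite !sum_n_0. destruct (Huv 0%nat (Nat.le_refl _)) as [? [? ?]]. apply Hphi; lra.
  + rewrite !sum_n_S. destruct (Huv (S n) (Nat.le_refl _)) as [? [? ?]].
    assert (B := Hphi (v (S n)) (u (S n)) ltac:(lra) ltac:(lra)).
    assert (IH' := IH ltac:(intros; apply Huv; lia)). lra.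
- apply Rle_lt_trans with (K * (eta / (2 * (K + 1)) + eta / (2 * (K + 1)))).
  + apply Rmult_le_compat_l; [exact HK | lra].
  + replace (K * (eta / (2 * (K + 1)) + eta / (2 * (K + 1)))) with (eta * (K / (K + 1))) by (field; lra).
    assert (K / (K + 1) < 1) by (apply Rmult_lt_reg_r with (K + 1); [lra |]; field_simplify; lra).
    nra.
Qed.

Lemma bac_plus x y a b : bac x a b -> bac y a b -> bac (fun t => x t + y t) a b.
Proof.
intros [Hx [M [HM Bx]]] [Hy [M' [HM' By]]]. split.
- apply (ac_on_dominated _ x y 1); try assumption; [lra |].
  intros t r _ _. replace (x t + y t - (x r + y r)) with ((x t - x r) + (y t - y r)) by ring.
  rewrite Rmult_1_l. apply Rabs_triang.
- exists (M + M'). split; [lra |]. intros t Ht. tri.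
  apply Rplus_le_compat; auto.
Qed.

Lemma bac_mult x y a b : bac x a b -> bac y a b -> bac (fun t => x t * y t) a b.
Proof.
intros [Hx [M [HM Bx]]] [Hy [M' [HM' By]]]. split.
- apply (ac_on_dominated _ x y (M + M')); try assumption; [lra |].
  intros t r Ht Hr. replace (x t * y t - x r * y r) with ((x t - x r) * y t + x r * (y t - y r)) by ring.
  tri. rewrite !Rabs_mult.
  assert (B1 := By t Ht). assert (B2 := Bx r Hr).
  assert (P1 := Rabs_pos (x t - x r)). assert (P2 := Rabs_pos (y t - y r)). nra.
- exists (M * M'). split; [nra |]. intros t Ht. rewrite Rabs_mult.
  apply Rmult_le_compat; auto using Rabs_pos.
Qed.

Lemma bac_lipschitz x K a b :
  0 <= K -> a <= b ->
  (forall t r, a <= t <= b -> a <= r <= b -> Rabs (x t - x r) <= K * Rabs (t - r)) -> bac x a b.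
Proof.
intros HK Hab H. split.
- intros eta Heta. exists (eta / (K + 1)). split; [apply Rdiv_lt_0_compat; lra |].
  intros n u v Huv _ Hs.
  apply Rle_lt_trans with (K * sum_n (fun k => v k - u k) n).
  + clear Hs. induction n as [| n IH].
    * rewrite !sum_n_0. destruct (Huv 0%nat (Nat.le_refl _)) as [? [? ?]].
      eapply Rle_trans; [apply H; lra |]. rewrite Rabs_pos_eq by lra. lra.
    * rewrite !sum_n_S. destruct (Huv (S n) (Nat.le_refl _)) as [? [? ?]].
      assert (B := H (v (S n)) (u (S n)) ltac:(lra) ltac:(lra)). rewrite (Rabs_pos_eq (v (S n) - u (S n))) in B by lra.
      assert (IH' := IH ltac:(intros; apply Huv; lia)). lra.
  + apply Rle_lt_trans with (K * (eta / (K + 1))); [apply Rmult_le_compat_l; lra |].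
    replace (K * (eta / (K + 1))) with (eta * (K / (K + 1))) by (field; lra).
    assert (K / (K + 1) < 1) by (apply Rmult_lt_reg_r with (K + 1); [lra |]; field_simplify; lra).
    nra.
- exists (Rabs (x a) + K * (b - a)). split.
  + apply Rplus_le_le_0_compat; [apply Rabs_pos | apply Rmult_le_pos; lra].
  + intros t Ht. replace (x t) with (x a + (x t - x a)) by ring.
    tri. apply Rplus_le_compat_l.
    eapply Rle_trans; [apply H; lra |]. rewrite Rabs_pos_eq by lra. apply Rmult_le_compat_l; lra.
Qed.

Lemma derive_bound_increment (f f' : R -> R) (K a b : R) :
  (forall t, Rmin a b <= t <= Rmax a b -> is_derive f t (f' t)) ->
  (forall t, Rmin a b <= t <= Rmax a b -> Rabs (f' t) <= K) ->
  Rabs (f b - f a) <= K * Rabs (b - a).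
Proof.
intros Hd Hb.
destruct (MVT_gen f a b f') as [c [Hc E]].
- intros t Ht. apply Hd. lra.
- intros t Ht. apply continuity_pt_filterlim. apply (ex_derive_continuous f).
  eexists. apply Hd. exact Ht.
- rewrite E, Rabs_mult. apply Rmult_le_compat_r; [apply Rabs_pos | apply Hb, Hc].
Qed.

Lemma bac_smooth (f f' : R -> R) a b :
  a <= b -> (forall t, is_derive f t (f' t)) -> (forall t, continuous f' t) -> bac f a b.
Proof.
intros Hab Hd Hc.
assert (HM : exists M, 0 <= M /\ forall t, a <= t <= b -> Rabs (f' t) <= M).
{ destruct (continuity_ab_maj (fun t => Rabs (f' t)) a b Hab) as [m [Hm _]].
  - intros c _. apply continuity_pt_filterlim. apply (continuous_comp f' Rabs); [apply Hc |].
    apply continuous_Rabs.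
  - exists (Rabs (f' m)). split; [apply Rabs_pos |]. intros t Ht. apply Hm, Ht. }
destruct HM as [M [HM HB]].
apply (bac_lipschitz f M); try assumption.
intros t r Ht Hr. apply (derive_bound_increment f f').
- intros; apply Hd.
- intros s Hs. apply HB. revert Hs. unfold Rmin, Rmax. destruct (Rle_dec r t); lra.
Qed.

Lemma bac_sub x a b a' b' : a <= a' -> b' <= b -> bac x a b -> bac x a' b'.
Proof.
intros Ha Hb [H [M [HM B]]]. split.
- intros eta Heta. destruct (H eta Heta) as [d [Hd Hs]]. exists d. split; [exact Hd |].
  intros n u v Huv. apply Hs. intros k Hk. destruct (Huv k Hk) as [? [? ?]]. lra.
- exists M. split; [exact HM |]. intros t Ht. apply B. lra.
Qed.

Lemma ae_increment_le (phi : R -> R) (N : R -> Prop) (K a b : R) :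
  a <= b -> bac phi a b -> null_set N ->
  (forall t, a <= t <= b -> ~ N t -> exists l, is_derive phi t l /\ l <= K) ->
  phi b - phi a <= K * (b - a).
Proof.
intros Hab Hphi HN Hd.
assert (H : phi b + - K * b <= phi a + - K * a); [| lra].
apply (ac_nonincreasing (fun t => phi t + - K * t) a b N Hab); try assumption.
- apply bac_plus; [exact Hphi |].
  apply (bac_smooth (fun t => - K * t) (fun _ => - K) a b Hab).
  + intros t. auto_derive; [easy | unfold Rminus; ring].
  + intros t. apply continuous_const.
- intros t Ht Nt. destruct (Hd t Ht Nt) as [l [Hl Hle]]. exists (l + - K). split; [| lra].
  apply derive_plus; [exact Hl |].
  auto_derive; [easy | ring].
Qed.

Lemma ae_increment_abs_le (phi : R -> R) (N : R -> Prop) (K a b : R) :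
  a <= b -> bac phi a b -> null_set N ->
  (forall t, a <= t <= b -> ~ N t -> exists l, is_derive phi t l /\ Rabs l <= K) ->
  Rabs (phi b - phi a) <= K * (b - a).
Proof.
intros Hab Hphi HN Hd.
assert (H1 : phi b - phi a <= K * (b - a)).
{ apply (ae_increment_le phi N K a b Hab Hphi HN). intros t Ht Nt.
  destruct (Hd t Ht Nt) as [l [Hl Hle]]. exists l. split; [exact Hl |].
  eapply Rle_trans; [apply Rle_abs | exact Hle]. }
assert (H2 : -1 * phi b - -1 * phi a <= K * (b - a)).
{ apply (ae_increment_le (fun t => -1 * phi t) N K a b Hab); try assumption.
  - apply (bac_mult (fun _ => -1)); [| exact Hphi].
    apply (bac_lipschitz _ 0); try lra. intros. rewrite Rminus_diag, Rabs_R0. lra.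
  - intros t Ht Nt. destruct (Hd t Ht Nt) as [l [Hl Hle]]. exists (-1 * l). split.
    + apply (is_derive_scal phi t (-1) l Hl).
    + assert (B := Rle_abs (- l)). rewrite Rabs_Ropp in B. lra. }
apply Rabs_le. lra.
Qed.

(** Smooth trajectories and Filippov solutions are both of this kind, with different
    velocity conditions V. *)
Definition ae_curve (V : R -> R -> R -> R -> R -> R -> Prop) (x y s : R -> R) (a b : R) : Prop :=
  bac x a b /\ bac y a b /\ bac s a b /\
  exists N, null_set N /\ forall t, a <= t <= b -> ~ N t ->
    exists vx vy vs : R, is_derive x t vx /\ is_derive y t vy /\ is_derive s t vs /\
      V (x t) (y t) (s t) vx vy vs.

(** The distance from the unperturbed field (- y, x, - lam s), which is all that [drift]
    needs to know of a perturbation. *)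
Definition near_center (lam kappa : R) (x y s vx vy vs : R) : Prop :=
  Rabs (vx + y) <= kappa /\ Rabs (vy - x) <= kappa /\ Rabs (vs + lam * s) <= kappa.

Lemma Rabs_comb_le (p q c s K : R) :
  Rabs p <= K -> Rabs q <= K -> Rabs c <= 1 -> Rabs s <= 1 -> Rabs (p * c + q * s) <= 2 * K.
Proof.
intros Hp Hq Hc Hs. tri. rewrite !Rabs_mult.
assert (0 <= Rabs p) by apply Rabs_pos. assert (0 <= Rabs q) by apply Rabs_pos.
assert (0 <= Rabs c) by apply Rabs_pos. assert (0 <= Rabs s) by apply Rabs_pos. nra.
Qed.

Lemma Rabs_cos_le1 t : Rabs (cos t) <= 1.
Proof. apply Rabs_le. apply COS_bound. Qed.
Lemma Rabs_sin_le1 t : Rabs (sin t) <= 1.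
Proof. apply Rabs_le. apply SIN_bound. Qed.

Lemma exp_le_mono a b : a <= b -> exp a <= exp b.
Proof. intros [H | ->]; [left; now apply exp_increasing | lra]. Qed.

Lemma exp_Rabs_le (lam t H : R) : 0 <= t <= H -> exp (lam * t) <= exp (Rabs lam * H).
Proof.
intros Ht. apply exp_le_mono. assert (B := Rle_abs lam). assert (P := Rabs_pos lam). nra.
Qed.

Definition drift_const (lam : R) : R := 4 * exp (Rabs lam * 10) * exp (Rabs lam * 10).

Lemma drift_const_ge4 lam : 4 <= drift_const lam.
Proof.
unfold drift_const. assert (1 <= exp (Rabs lam * 10)); [| nra].
rewrite <- exp_0. apply exp_le_mono. assert (P := Rabs_pos lam). lra.
Qed.

(** Variation of constants: in the rotating frame, and with s multiplied by exp (lam t),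
    the velocity reduces to the error, of size kappa. *)
Lemma drift (lam kappa : R) (x y s : R -> R) (a b : R) :
  a <= b <= a + 10 -> 0 <= kappa -> ae_curve (near_center lam kappa) x y s a b ->
  Rabs (x b - (x a * cos (b - a) - y a * sin (b - a))) <= drift_const lam * kappa * (b - a) /\
  Rabs (y b - (x a * sin (b - a) + y a * cos (b - a))) <= drift_const lam * kappa * (b - a) /\
  Rabs (s b - s a * exp (- lam * (b - a))) <= drift_const lam * kappa * (b - a).
Proof.
intros Hab Hk [Hx [Hy [Hs [N [HN HV]]]]].
assert (Hab' : a <= b) by lra.
assert (Bcos : bac (fun t => cos (t - a)) a b).
{ apply (bac_smooth _ (fun t => - sin (t - a)) a b Hab').
  - intros t. auto_derive; [easy | unfold Rminus; ring].
  - intros t. apply (ex_derive_continuous (fun t => - sin (t - a))). auto_derive. easy. }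
assert (Bsin : bac (fun t => sin (t - a)) a b).
{ apply (bac_smooth _ (fun t => cos (t - a)) a b Hab').
  - intros t. auto_derive; [easy | unfold Rminus; ring].
  - intros t. apply (ex_derive_continuous (fun t => cos (t - a))). auto_derive. easy. }
assert (Bnsin : bac (fun t => - sin (t - a)) a b).
{ apply (bac_smooth _ (fun t => - cos (t - a)) a b Hab').
  - intros t. auto_derive; [easy | unfold Rminus; ring].
  - intros t. apply (ex_derive_continuous (fun t => - cos (t - a))). auto_derive. easy. }
assert (Bexp : bac (fun t => exp (lam * (t - a))) a b).
{ apply (bac_smooth _ (fun t => lam * exp (lam * (t - a))) a b Hab').
  - intros t. auto_derive; [easy | unfold Rminus; ring].
  - intros t. apply (ex_derive_continuous (fun t => lam * exp (lam * (t - a)))). auto_derive. easy. }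
assert (dcos : forall t, is_derive (fun t => cos (t - a)) t (- sin (t - a))) by (intros; (auto_derive; [easy | unfold Rminus; ring])).
assert (dsin : forall t, is_derive (fun t => sin (t - a)) t (cos (t - a))) by (intros; (auto_derive; [easy | unfold Rminus; ring])).
assert (dnsin : forall t, is_derive (fun t => - sin (t - a)) t (- cos (t - a))) by (intros; (auto_derive; [easy | unfold Rminus; ring])).
assert (dexp : forall t, is_derive (fun t => exp (lam * (t - a))) t (lam * exp (lam * (t - a))))
  by (intros; (auto_derive; [easy | unfold Rminus; ring])).
(* the rotating frame *)
set (c1 := fun t => x t * cos (t - a) + y t * sin (t - a)).
set (c2 := fun t => x t * - sin (t - a) + y t * cos (t - a)).
set (c3 := fun t => s t * exp (lam * (t - a))).
assert (E1 : Rabs (c1 b - c1 a) <= 2 * kappa * (b - a)).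
{ apply (ae_increment_abs_le c1 N); try assumption.
  - apply bac_plus; apply bac_mult; assumption.
  - intros t Ht Nt. destruct (HV t Ht Nt) as [vx [vy [vs [d1 [d2 [d3 [h1 [h2 h3]]]]]]]].
    exists ((vx * cos (t - a) + x t * - sin (t - a)) + (vy * sin (t - a) + y t * cos (t - a))). split.
    + unfold c1. apply derive_plus; [apply (derive_mult x (fun t => cos (t - a))) | apply (derive_mult y (fun t => sin (t - a)))]; auto.
    + replace (vx * cos (t - a) + x t * - sin (t - a) + (vy * sin (t - a) + y t * cos (t - a)))
        with ((vx + y t) * cos (t - a) + (vy - x t) * sin (t - a)) by ring.
      apply Rabs_comb_le; auto using Rabs_cos_le1, Rabs_sin_le1. }
assert (E2 : Rabs (c2 b - c2 a) <= 2 * kappa * (b - a)).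
{ apply (ae_increment_abs_le c2 N); try assumption.
  - apply bac_plus; apply bac_mult; assumption.
  - intros t Ht Nt. destruct (HV t Ht Nt) as [vx [vy [vs [d1 [d2 [d3 [h1 [h2 h3]]]]]]]].
    exists ((vx * - sin (t - a) + x t * - cos (t - a)) + (vy * cos (t - a) + y t * - sin (t - a))). split.
    + unfold c2. apply derive_plus; [apply (derive_mult x (fun t => - sin (t - a))) | apply (derive_mult y (fun t => cos (t - a)))]; auto.
    + replace (vx * - sin (t - a) + x t * - cos (t - a) + (vy * cos (t - a) + y t * - sin (t - a)))
        with ((vx + y t) * - sin (t - a) + (vy - x t) * cos (t - a)) by ring.
      apply Rabs_comb_le; auto using Rabs_cos_le1. rewrite Rabs_Ropp. apply Rabs_sin_le1. }
set (A := exp (Rabs lam * 10)).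
assert (E3 : Rabs (c3 b - c3 a) <= kappa * A * (b - a)).
{ apply (ae_increment_abs_le c3 N); try assumption.
  - apply bac_mult; assumption.
  - intros t Ht Nt. destruct (HV t Ht Nt) as [vx [vy [vs [d1 [d2 [d3 [h1 [h2 h3]]]]]]]].
    exists (vs * exp (lam * (t - a)) + s t * (lam * exp (lam * (t - a)))). split.
    + apply (derive_mult s (fun t => exp (lam * (t - a)))); auto.
    + replace (vs * exp (lam * (t - a)) + s t * (lam * exp (lam * (t - a))))
        with ((vs + lam * s t) * exp (lam * (t - a))) by ring.
      rewrite Rabs_mult. rewrite (Rabs_pos_eq (exp _)) by (left; apply exp_pos).
      apply Rmult_le_compat; auto using Rabs_pos; [left; apply exp_pos |].
      apply exp_Rabs_le. lra. }
assert (HA : 1 <= A).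
{ unfold A. rewrite <- exp_0. apply exp_le_mono. assert (P := Rabs_pos lam). lra. }
assert (HD : 4 * A <= drift_const lam) by (unfold drift_const; fold A; nra).
assert (HK : 2 * (2 * kappa * (b - a)) <= drift_const lam * kappa * (b - a)).
{ assert (4 <= drift_const lam) by apply drift_const_ge4.
  assert (0 <= kappa * (b - a)) by pos. nra. }
assert (Ca1 : c1 a = x a) by (unfold c1; rewrite Rminus_diag, cos_0, sin_0; ring).
assert (Ca2 : c2 a = y a) by (unfold c2; rewrite Rminus_diag, cos_0, sin_0; ring).
assert (Ca3 : c3 a = s a) by (unfold c3; rewrite Rminus_diag, Rmult_0_r, exp_0; ring).
assert (SC := sin2_cos2 (b - a)). unfold Rsqr in SC.
repeat split.
- replace (x b - (x a * cos (b - a) - y a * sin (b - a)))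
    with ((c1 b - c1 a) * cos (b - a) + (c2 b - c2 a) * - sin (b - a)).
  2:{ rewrite Ca1, Ca2. unfold c1, c2.
      transitivity (x b * (sin (b - a) * sin (b - a) + cos (b - a) * cos (b - a)) - x a * cos (b - a) + y a * sin (b - a)).
      - ring.
      - rewrite SC. ring. }
  eapply Rle_trans; [| exact HK].
  apply Rabs_comb_le; auto using Rabs_cos_le1. rewrite Rabs_Ropp. apply Rabs_sin_le1.
- replace (y b - (x a * sin (b - a) + y a * cos (b - a)))
    with ((c1 b - c1 a) * sin (b - a) + (c2 b - c2 a) * cos (b - a)).
  2:{ rewrite Ca1, Ca2. unfold c1, c2.
      transitivity (y b * (sin (b - a) * sin (b - a) + cos (b - a) * cos (b - a)) - x a * sin (b - a) - y a * cos (b - a)).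
      - ring.
      - rewrite SC. ring. }
  eapply Rle_trans; [| exact HK].
  apply Rabs_comb_le; auto using Rabs_cos_le1, Rabs_sin_le1.
- assert (EE : exp (lam * (b - a)) * exp (- lam * (b - a)) = 1).
  { rewrite <- exp_plus. replace (lam * (b - a) + - lam * (b - a)) with 0 by ring. apply exp_0. }
  replace (s b - s a * exp (- lam * (b - a))) with ((c3 b - c3 a) * exp (- lam * (b - a))).
  2:{ rewrite Ca3. unfold c3.
      transitivity (s b * (exp (lam * (b - a)) * exp (- lam * (b - a))) - s a * exp (- lam * (b - a))).
      - ring.
      - rewrite EE. ring. }
  rewrite Rabs_mult. rewrite (Rabs_pos_eq (exp _)) by (left; apply exp_pos).
  assert (B : exp (- lam * (b - a)) <= A).
  { unfold A. rewrite <- (Rabs_Ropp lam). apply exp_Rabs_le. lra. }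
  assert (P := Rabs_pos (c3 b - c3 a)). assert (Pe := exp_pos (- lam * (b - a))).
  assert (0 <= kappa * (b - a)) by pos.
  apply Rle_trans with ((kappa * A * (b - a)) * A); [apply Rmult_le_compat; lra |].
  unfold drift_const. fold A. nra.
Qed.

(** * The flow in the coordinates x, y, s *)

(** Polynomials as a closure rather than as tables of coefficients: bounds, continuity
    and control follow by induction. *)
Inductive poly3 : (R -> R -> R -> R) -> Prop :=
| poly3_const c : poly3 (fun _ _ _ => c)
| poly3_x : poly3 (fun x _ _ => x)
| poly3_y : poly3 (fun _ y _ => y)
| poly3_z : poly3 (fun _ _ z => z)
| poly3_add F G : poly3 F -> poly3 G -> poly3 (fun x y z => F x y z + G x y z)
| poly3_mul F G : poly3 F -> poly3 G -> poly3 (fun x y z => F x y z * G x y z).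

Definition clamp (B u : R) : R := Rmax (- B) (Rmin B u).

Lemma clamp_bound B u : 0 <= B -> Rabs (clamp B u) <= B.
Proof.
intros HB. unfold clamp. apply Rabs_le. split; [apply Rmax_l |].
apply Rmax_lub; [lra | apply Rmin_l].
Qed.

Lemma clamp_id B u : Rabs u <= B -> clamp B u = u.
Proof.
intros H. apply Rabs_le_between in H. unfold clamp.
rewrite Rmin_right by lra. apply Rmax_right. lra.
Qed.

Lemma clamp_1lip B u v : Rabs (clamp B u - clamp B v) <= Rabs (u - v).
Proof.
assert (H1 : forall p q, Rabs (Rmin B p - Rmin B q) <= Rabs (p - q)).
{ intros p q. unfold Rmin. destruct (Rle_dec B p), (Rle_dec B q);
  unfold Rabs; repeat match goal with |- context [Rcase_abs ?a] => destruct (Rcase_abs a) end; lra. }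
assert (H2 : forall p q, Rabs (Rmax (- B) p - Rmax (- B) q) <= Rabs (p - q)).
{ intros p q. unfold Rmax. destruct (Rle_dec (- B) p), (Rle_dec (- B) q);
  unfold Rabs; repeat match goal with |- context [Rcase_abs ?a] => destruct (Rcase_abs a) end; lra. }
unfold clamp. eapply Rle_trans; [apply H2 | apply H1].
Qed.

Lemma poly3_box F : poly3 F -> forall B, 0 <= B -> exists K, 0 <= K /\
  forall x y z x' y' z', Rabs x <= B -> Rabs y <= B -> Rabs z <= B ->
    Rabs x' <= B -> Rabs y' <= B -> Rabs z' <= B ->
    Rabs (F x y z) <= K /\
    Rabs (F x y z - F x' y' z') <= K * (Rabs (x - x') + Rabs (y - y') + Rabs (z - z')).
Proof.
intros HF B HB.
assert (P3 : forall x y z x' y' z' : R, 0 <= Rabs (x - x') /\ 0 <= Rabs (y - y') /\ 0 <= Rabs (z - z')).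
{ intros; repeat split; apply Rabs_pos. }
induction HF as [c | | | | F G _ [K [HK IHF]] _ [K' [HK' IHG]] | F G _ [K [HK IHF]] _ [K' [HK' IHG]]].
- exists (Rabs c). split; [apply Rabs_pos |]. intros. split; [lra |].
  rewrite Rminus_diag, Rabs_R0. destruct (P3 x y z x' y' z') as [? [? ?]].
  apply Rmult_le_pos; [apply Rabs_pos | lra].
- exists (B + 1). split; [lra |]. intros. destruct (P3 x y z x' y' z') as [? [? ?]]. split; [lra | nra].
- exists (B + 1). split; [lra |]. intros. destruct (P3 x y z x' y' z') as [? [? ?]]. split; [lra | nra].
- exists (B + 1). split; [lra |]. intros. destruct (P3 x y z x' y' z') as [? [? ?]]. split; [lra | nra].
- exists (K + K'). split; [lra |]. intros x y z x' y' z' h1 h2 h3 h4 h5 h6.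
  destruct (IHF x y z x' y' z') as [A1 A2]; try assumption.
  destruct (IHG x y z x' y' z') as [B1 B2]; try assumption. split.
  + eapply Rle_trans; [apply Rabs_triang | lra].
  + replace (F x y z + G x y z - (F x' y' z' + G x' y' z'))
      with ((F x y z - F x' y' z') + (G x y z - G x' y' z')) by ring.
    eapply Rle_trans; [apply Rabs_triang | lra].
- exists (2 * K * K'). split; [nra |]. intros x y z x' y' z' h1 h2 h3 h4 h5 h6.
  destruct (IHF x y z x' y' z') as [A1 A2]; try assumption.
  destruct (IHG x y z x' y' z') as [B1 B2]; try assumption.
  destruct (IHF x' y' z' x y z) as [A3 _]; try assumption. split.
  + rewrite Rabs_mult. assert (Q1 := Rabs_pos (F x y z)). assert (Q2 := Rabs_pos (G x y z)). nra.
  + replace (F x y z * G x y z - F x' y' z' * G x' y' z')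
      with ((F x y z - F x' y' z') * G x y z + F x' y' z' * (G x y z - G x' y' z')) by ring.
    tri. rewrite !Rabs_mult.
    set (S := Rabs (x - x') + Rabs (y - y') + Rabs (z - z')) in *.
    apply Rle_trans with (K * S * K' + K * (K' * S)); [| right; ring].
    apply Rplus_le_compat; apply Rmult_le_compat; auto using Rabs_pos.
Qed.

(** Freezing the arguments outside a box makes a polynomial bounded and Lipschitz, so
    that its flow exists for all times. The trajectories of interest stay in the box,
    where nothing has changed. *)
Definition clamped (B : R) (F : R -> R -> R -> R) : R -> R -> R -> R :=
  fun x y z => F (clamp B x) (clamp B y) (clamp B z).

Definition tame (K : R) (F : R -> R -> R -> R) : Prop :=
  lipschitz3 K F /\ forall x y z, Rabs (F x y z) <= K.

Lemma clamped_tame F B : poly3 F -> 0 <= B -> exists K, 0 <= K /\ tame K (clamped B F).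
Proof.
intros HF HB. destruct (poly3_box F HF B HB) as [K [HK H]]. exists K. split; [exact HK |]. split.
- intros x y z x' y' z'. unfold clamped.
  destruct (H (clamp B x) (clamp B y) (clamp B z) (clamp B x') (clamp B y') (clamp B z')) as [_ H2];
    try (now apply clamp_bound).
  eapply Rle_trans; [exact H2 |]. apply Rmult_le_compat_l; [exact HK |].
  assert (B1 := clamp_1lip B x x'). assert (B2 := clamp_1lip B y y'). assert (B3 := clamp_1lip B z z'). lra.
- intros x y z. unfold clamped.
  now destruct (H (clamp B x) (clamp B y) (clamp B z) (clamp B x) (clamp B y) (clamp B z)) as [H1 _];
    try (now apply clamp_bound).
Qed.

Lemma tame_mono F K K' : K <= K' -> tame K F -> tame K' F.
Proof.
intros HK [H1 H2]. split.
- intros x y z x' y' z'. eapply Rle_trans; [apply H1 |]. apply Rmult_le_compat_r; [| exact HK].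
  assert (A1 := Rabs_pos (x - x')). assert (A2 := Rabs_pos (y - y')). assert (A3 := Rabs_pos (z - z')). lra.
- intros. eapply Rle_trans; [apply H2 | exact HK].
Qed.

Section Flow.
Variables (lam K : R) (G1 G2 G3 : R -> R -> R -> R).
Hypothesis HK : 1 <= K.
Hypothesis T1 : tame K G1.
Hypothesis T2 : tame K G2.
Hypothesis T3 : tame K G3.

Definition velocity (eps x y s vx vy vs : R) : Prop :=
  vx = - y + eps * G1 x y s /\ vy = x + eps * G2 x y s /\ vs = - lam * s + eps * G3 x y s.

Definition is_flow (eps : R) (x y s : R -> R) : Prop := forall t,
  is_derive x t (- y t + eps * G1 (x t) (y t) (s t)) /\
  is_derive y t (x t + eps * G2 (x t) (y t) (s t)) /\
  is_derive s t (- lam * s t + eps * G3 (x t) (y t) (s t)).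

Lemma flow_exists eps a b c : exists x y s, is_flow eps x y s /\ x 0 = a /\ y 0 = b /\ s 0 = c.
Proof.
set (X := fun (i : nat) x y s => match i with
  | 0%nat => - y + eps * G1 x y s
  | 1%nat => x + eps * G2 x y s
  | _ => - lam * s + eps * G3 x y s end).
set (L := 1 + Rabs lam + Rabs eps * K).
assert (P : 0 <= Rabs eps /\ 0 <= Rabs lam) by (split; apply Rabs_pos).
assert (HL : 0 < L) by (unfold L; nra).
assert (HX : forall i, lipschitz3 L (X i)).
{ intros i x y z x' y' z'.
  assert (P1 := Rabs_pos (x - x')). assert (P2 := Rabs_pos (y - y')). assert (P3 := Rabs_pos (z - z')).
  assert (E : forall F, tame K F -> Rabs (eps * F x y z - eps * F x' y' z') <=
     Rabs eps * K * (Rabs (x - x') + Rabs (y - y') + Rabs (z - z'))).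
  { intros F [HF _]. rewrite <- Rmult_minus_distr_l, Rabs_mult, Rmult_assoc.
    apply Rmult_le_compat_l; [apply Rabs_pos | apply HF]. }
  assert (E1 := E G1 T1). assert (E2 := E G2 T2). assert (E3 := E G3 T3). clear E.
  unfold L. destruct i as [| [| i]]; simpl.
  - replace (- y + eps * G1 x y z - (- y' + eps * G1 x' y' z'))
      with (- (y - y') + (eps * G1 x y z - eps * G1 x' y' z')) by ring.
    tri. rewrite Rabs_Ropp. nra.
  - replace (x + eps * G2 x y z - (x' + eps * G2 x' y' z'))
      with ((x - x') + (eps * G2 x y z - eps * G2 x' y' z')) by ring.
    tri. nra.
  - replace (- lam * z + eps * G3 x y z - (- lam * z' + eps * G3 x' y' z'))
      with (- lam * (z - z') + (eps * G3 x y z - eps * G3 x' y' z')) by ring.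
    tri. rewrite Rabs_mult, Rabs_Ropp. nra. }
destruct (picard_lindelof X L (fun i => match i with 0%nat => a | 1%nat => b | _ => c end) HL HX) as [u [U0 U]].
exists (u 0%nat), (u 1%nat), (u 2%nat). split; [| split; [| split]].
- intros t. split; [| split].
  + exact (U 0%nat t ltac:(lia)).
  + exact (U 1%nat t ltac:(lia)).
  + exact (U 2%nat t ltac:(lia)).
- exact (U0 0%nat ltac:(lia)).
- exact (U0 1%nat ltac:(lia)).
- exact (U0 2%nat ltac:(lia)).
Qed.

Lemma is_flow_shift eps x y s c :
  is_flow eps x y s -> is_flow eps (fun t => x (t + c)) (fun t => y (t + c)) (fun t => s (t + c)).
Proof.
intros H t.
assert (E : forall (f : R -> R) (l : R), is_derive f (t + c) l -> is_derive (fun t => f (t + c)) t l).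
{ intros f l Hl. replace l with (1 * l) by ring.
  apply (is_derive_comp f (fun t => t + c) t l 1 Hl). auto_derive; [easy | ring]. }
destruct (H (t + c)) as [d1 [d2 d3]]. split; [| split]; [apply (E x) | apply (E y) | apply (E s)]; assumption.
Qed.

Lemma is_flow_continuous eps x y s t : is_flow eps x y s -> continuous x t /\ continuous y t /\ continuous s t.
Proof.
intros H. destruct (H t) as [d1 [d2 d3]]. split; [| split].
- apply (ex_derive_continuous x). eexists; exact d1.
- apply (ex_derive_continuous y). eexists; exact d2.
- apply (ex_derive_continuous s). eexists; exact d3.
Qed.

Lemma is_flow_ae eps x y s a b : a <= b -> is_flow eps x y s -> ae_curve (velocity eps) x y s a b.
Proof.
intros Hab H.
assert (Hc := fun t => is_flow_continuous eps x y s t H).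
assert (HG : forall F t, tame K F -> continuous (fun r => F (x r) (y r) (s r)) t).
{ intros F t [HF _]. destruct (Hc t) as [c1 [c2 c3]]. apply (lipschitz3_continuous K F); auto; lra. }
repeat split.
1-2: apply (bac_smooth x (fun t => - y t + eps * G1 (x t) (y t) (s t)) a b Hab); [apply H |];
  intros t; apply (continuous_plus (fun t => - y t) (fun t => eps * G1 (x t) (y t) (s t)));
  [apply (continuous_opp y), Hc | apply (continuous_scal_r eps (fun t => G1 (x t) (y t) (s t))), HG, T1].
1-2: apply (bac_smooth y (fun t => x t + eps * G2 (x t) (y t) (s t)) a b Hab); [apply H |];
  intros t; apply (continuous_plus x (fun t => eps * G2 (x t) (y t) (s t)));
  [apply Hc | apply (continuous_scal_r eps (fun t => G2 (x t) (y t) (s t))), HG, T2].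
1-2: apply (bac_smooth s (fun t => - lam * s t + eps * G3 (x t) (y t) (s t)) a b Hab); [apply H |];
  intros t; apply (continuous_plus (fun t => - lam * s t) (fun t => eps * G3 (x t) (y t) (s t)));
  [apply (continuous_scal_r (- lam) s), Hc | apply (continuous_scal_r eps (fun t => G3 (x t) (y t) (s t))), HG, T3].
exists (fun _ => False). split; [apply null_set_empty |].
intros t _ _. destruct (H t) as [d1 [d2 d3]].
exists (- y t + eps * G1 (x t) (y t) (s t)), (x t + eps * G2 (x t) (y t) (s t)),
  (- lam * s t + eps * G3 (x t) (y t) (s t)).
split; [exact d1 | split; [exact d2 | split; [exact d3 |]]]. repeat split.
Qed.

Lemma ae_curve_weaken (V V' : R -> R -> R -> R -> R -> R -> Prop) x y s a b :
  (forall x y s vx vy vs, V x y s vx vy vs -> V' x y s vx vy vs) ->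
  ae_curve V x y s a b -> ae_curve V' x y s a b.
Proof.
intros HV [Hx [Hy [Hs [N [HN H]]]]]. repeat split; try apply Hx; try apply Hy; try apply Hs.
exists N. split; [exact HN |]. intros t Ht Nt.
destruct (H t Ht Nt) as [vx [vy [vs [d1 [d2 [d3 h]]]]]]. exists vx, vy, vs. auto.
Qed.

Lemma velocity_near_center eps x y s vx vy vs :
  velocity eps x y s vx vy vs -> near_center lam (K * Rabs eps) x y s vx vy vs.
Proof.
intros [-> [-> ->]]. unfold near_center.
assert (E : forall F, tame K F -> Rabs (eps * F x y s) <= K * Rabs eps).
{ intros F [_ HF]. rewrite Rabs_mult, Rmult_comm. apply Rmult_le_compat_r; [apply Rabs_pos | apply HF]. }
repeat split.
- replace (- y + eps * G1 x y s + y) with (eps * G1 x y s) by ring. now apply E.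
- replace (x + eps * G2 x y s - x) with (eps * G2 x y s) by ring. now apply E.
- replace (- lam * s + eps * G3 x y s + lam * s) with (eps * G3 x y s) by ring. now apply E.
Qed.

Definition gronwall_rate : R := 2 * Rabs lam + 6 * K.
Definition gronwall_const : R := 3 * exp (gronwall_rate * 10).

(** The squared distance, damped by exp (- g t), has nonpositive derivative almost
    everywhere. Only one of the two curves is a smooth trajectory; the other one may be
    a Filippov solution. *)
Lemma gronwall eps x y s x' y' s' a b :
  Rabs eps <= 1 -> a <= b <= a + 10 ->
  ae_curve (velocity eps) x y s a b -> is_flow eps x' y' s' ->
  Rabs (x b - x' b) + Rabs (y b - y' b) + Rabs (s b - s' b) <=
    gronwall_const * (Rabs (x a - x' a) + Rabs (y a - y' a) + Rabs (s a - s' a)).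
Proof.
intros Heps Hab [Hx [Hy [Hs [N [HN HV]]]]] Hf.
assert (Hab' : a <= b) by lra.
destruct (is_flow_ae eps x' y' s' a b Hab' Hf) as [Hx' [Hy' [Hs' _]]].
assert (minus_bac : forall u v, bac u a b -> bac v a b -> bac (fun t => u t - v t) a b).
{ intros u v Hu Hv. apply (bac_plus u (fun t => - v t) a b Hu).
  destruct Hv as [Hv [M [HM Bv]]]. split.
  - apply (ac_on_dominated _ v v 1); try assumption; [lra |]. intros t r _ _.
    replace (- v t - - v r) with (- (v t - v r)) by ring. rewrite Rabs_Ropp.
    assert (P := Rabs_pos (v t - v r)). lra.
  - exists M. split; [exact HM |]. intros t Ht. rewrite Rabs_Ropp. auto. }
assert (B1 := minus_bac x x' Hx Hx'). assert (B2 := minus_bac y y' Hy Hy'). assert (B3 := minus_bac s s' Hs Hs').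
set (sq := fun t => (x t - x' t) * (x t - x' t) + (y t - y' t) * (y t - y' t) + (s t - s' t) * (s t - s' t)).
set (g := gronwall_rate).
set (phi := fun t => sq t * exp (- g * t)).
assert (Hsq : bac sq a b) by (repeat apply bac_plus; apply bac_mult; assumption).
assert (Hexp : bac (fun t => exp (- g * t)) a b).
{ apply (bac_smooth _ (fun t => - g * exp (- g * t)) a b Hab').
  - intros t. auto_derive; [easy | ring].
  - intros t. apply (ex_derive_continuous (fun t => - g * exp (- g * t))). auto_derive. easy. }
assert (Hmono : phi b - phi a <= 0 * (b - a)).
{ apply (ae_increment_le phi N); try assumption; [now apply bac_mult |].
  intros t Ht Nt. destruct (HV t Ht Nt) as [vx [vy [vs [d1 [d2 [d3 [e1 [e2 e3]]]]]]]].
  destruct (Hf t) as [d1' [d2' d3']].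
  assert (D1 := derive_minus _ _ _ _ _ d1 d1'). assert (D2 := derive_minus _ _ _ _ _ d2 d2').
  assert (D3 := derive_minus _ _ _ _ _ d3 d3').
  assert (Dsq := derive_plus _ _ _ _ _ (derive_plus _ _ _ _ _ (derive_mult _ _ _ _ _ D1 D1) (derive_mult _ _ _ _ _ D2 D2))
     (derive_mult _ _ _ _ _ D3 D3)). simpl in Dsq.
  assert (De : is_derive (fun t => exp (- g * t)) t (- g * exp (- g * t))) by (auto_derive; [easy | ring]).
  eexists. split; [exact (derive_mult _ _ _ _ _ Dsq De) |]. clear De Dsq D1 D2 D3 d1 d2 d3 d1' d2' d3'. simpl.
  subst vx vy vs.
  set (dx := x t - x' t). set (dy := y t - y' t). set (ds := s t - s' t).
  set (g1 := G1 (x t) (y t) (s t) - G1 (x' t) (y' t) (s' t)).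
  set (g2 := G2 (x t) (y t) (s t) - G2 (x' t) (y' t) (s' t)).
  set (g3 := G3 (x t) (y t) (s t) - G3 (x' t) (y' t) (s' t)).
  set (S := Rabs dx + Rabs dy + Rabs ds).
  assert (b1 : Rabs g1 <= K * S) by apply T1. assert (b2 : Rabs g2 <= K * S) by apply T2.
  assert (b3 : Rabs g3 <= K * S) by apply T3.
  set (q := dx * dx + dy * dy + ds * ds).
  assert (main : 2 * eps * (dx * g1 + dy * g2 + ds * g3) - 2 * lam * ds * ds <= g * q).
  { assert (m1 : eps * (dx * g1 + dy * g2 + ds * g3) <= K * S * S).
    { eapply Rle_trans; [apply Rle_abs |]. rewrite Rabs_mult.
      apply Rle_trans with (1 * (K * S * S)); [| lra].
      apply Rmult_le_compat; try apply Rabs_pos; [exact Heps |].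
      tri.
      eapply Rle_trans; [apply Rplus_le_compat_r, Rabs_triang |]. rewrite !Rabs_mult.
      assert (Rabs dx * Rabs g1 <= Rabs dx * (K * S)) by (apply Rmult_le_compat_l; [apply Rabs_pos | exact b1]).
      assert (Rabs dy * Rabs g2 <= Rabs dy * (K * S)) by (apply Rmult_le_compat_l; [apply Rabs_pos | exact b2]).
      assert (Rabs ds * Rabs g3 <= Rabs ds * (K * S)) by (apply Rmult_le_compat_l; [apply Rabs_pos | exact b3]).
      replace (K * S * S) with (Rabs dx * (K * S) + Rabs dy * (K * S) + Rabs ds * (K * S)) by (unfold S; ring). lra. }
    assert (m2 : S * S <= 3 * q).
    { assert (sqa : forall r, r * r = Rabs r * Rabs r) by (intros r; rewrite <- Rabs_mult; symmetry; apply Rabs_pos_eq; nra).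
      unfold q. rewrite (sqa dx), (sqa dy), (sqa ds). unfold S.
      generalize (Rabs dx) (Rabs dy) (Rabs ds). intros p1 p2 p3.
      assert (0 <= (p1 - p2) * (p1 - p2)) by apply Rle_0_sqr.
      assert (0 <= (p1 - p3) * (p1 - p3)) by apply Rle_0_sqr.
      assert (0 <= (p2 - p3) * (p2 - p3)) by apply Rle_0_sqr. lra. }
    assert (m3 : - lam * (ds * ds) <= Rabs lam * q).
    { assert (B := Rle_abs (- lam)). rewrite Rabs_Ropp in B. assert (P := Rabs_pos lam).
      assert (0 <= ds * ds) by nra. assert (ds * ds <= q) by (unfold q; nra).
      apply Rle_trans with (Rabs lam * (ds * ds)); [apply Rmult_le_compat_r; lra | apply Rmult_le_compat_l; lra]. }
    unfold g, gronwall_rate. assert (K * (S * S) <= K * (3 * q)) by mono. lra. }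
  assert (pe := exp_pos (- g * t)).
  apply Rle_trans with ((2 * eps * (dx * g1 + dy * g2 + ds * g3) - 2 * lam * ds * ds - g * q) * exp (- g * t)).
  - right. unfold dx, dy, ds, g1, g2, g3, q. ring_simplify. unfold dx, dy, ds. ring.
  - assert (0 <= (g * q - (2 * eps * (dx * g1 + dy * g2 + ds * g3) - 2 * lam * ds * ds)) * exp (- g * t)).
    { apply Rmult_le_pos; lra. } lra. }
unfold phi in Hmono.
assert (Hg : 0 <= g) by (unfold g, gronwall_rate; assert (P := Rabs_pos lam); lra).
assert (pb := exp_pos (- g * b)).
assert (Hb : sq b <= sq a * exp (g * 10)).
{ apply Rmult_le_reg_r with (exp (- g * b)); [exact pb |].
  rewrite Rmult_assoc, <- exp_plus.
  apply Rle_trans with (sq a * exp (- g * a)); [lra |].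
  apply Rmult_le_compat_l.
  - unfold sq. repeat apply Rplus_le_le_0_compat; apply Rle_0_sqr.
  - apply exp_le_mono. assert (g * (b - a) <= g * 10) by mono. lra. }
set (E := exp (g * 10)) in *.
assert (HE : 1 <= E) by (unfold E; rewrite <- exp_0; apply exp_le_mono; nra).
assert (HC : gronwall_const = 3 * E) by reflexivity. rewrite HC. clear HC.
unfold sq in Hb.
set (u1 := x b - x' b) in *. set (u2 := y b - y' b) in *. set (u3 := s b - s' b) in *.
set (v1 := x a - x' a) in *. set (v2 := y a - y' a) in *. set (v3 := s a - s' a) in *.
assert (sqa : forall r, Rabs r * Rabs r = r * r) by (intros r; rewrite <- Rabs_mult; apply Rabs_pos_eq; nra).
rewrite <- (sqa u1), <- (sqa u2), <- (sqa u3), <- (sqa v1), <- (sqa v2), <- (sqa v3) in Hb.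
assert (P1 := Rabs_pos u1). assert (P2 := Rabs_pos u2). assert (P3 := Rabs_pos u3).
assert (P4 := Rabs_pos v1). assert (P5 := Rabs_pos v2). assert (P6 := Rabs_pos v3).
set (w1 := Rabs u1) in *. set (w2 := Rabs u2) in *. set (w3 := Rabs u3) in *.
set (z1 := Rabs v1) in *. set (z2 := Rabs v2) in *. set (z3 := Rabs v3) in *.
clearbody w1 w2 w3 z1 z2 z3 E.
apply Rsqr_incr_0_var; [| repeat apply Rmult_le_pos; lra]. unfold Rsqr.
apply Rle_trans with (3 * (w1 * w1 + w2 * w2 + w3 * w3)).
{ assert (0 <= (w1 - w2) * (w1 - w2)) by apply Rle_0_sqr.
  assert (0 <= (w1 - w3) * (w1 - w3)) by apply Rle_0_sqr.
  assert (0 <= (w2 - w3) * (w2 - w3)) by apply Rle_0_sqr. lra. }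
set (Z := z1 * z1 + z2 * z2 + z3 * z3) in *.
assert (HZ : Z <= (z1 + z2 + z3) * (z1 + z2 + z3)).
{ unfold Z. assert (0 <= z1 * z2) by nra. assert (0 <= z1 * z3) by nra. assert (0 <= z2 * z3) by nra. lra. }
assert (HZ0 : 0 <= Z) by (unfold Z; repeat apply Rplus_le_le_0_compat; apply Rle_0_sqr).
apply Rle_trans with (3 * (Z * E)); [lra |].
replace (3 * E * (z1 + z2 + z3) * (3 * E * (z1 + z2 + z3))) with (9 * E * E * ((z1 + z2 + z3) * (z1 + z2 + z3))) by ring.
apply Rle_trans with (9 * E * E * Z); [| apply Rmult_le_compat_l; [| exact HZ]].
- assert (0 <= E * Z) by pos.
  assert (1 * (E * Z) <= E * (E * Z)) by mono. lra.
- repeat apply Rmult_le_pos; lra.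
Qed.

End Flow.

(** * Estimates along a trajectory *)

Lemma ivt_lipschitz (f : R -> R) (K a b : R) :
  a <= b -> 0 <= K ->
  (forall t r, a <= t <= b -> a <= r <= b -> Rabs (f t - f r) <= K * Rabs (t - r)) ->
  f a * f b <= 0 -> exists c, a <= c <= b /\ f c = 0.
Proof.
intros Hab HK Hf Hs.
set (p := fun t => Rmax a (Rmin b t)).
assert (Hp : forall t, a <= p t <= b).
{ intros t. unfold p. split; [apply Rmax_l |]. apply Rmax_lub; [lra | apply Rmin_l]. }
assert (Hpid : forall t, a <= t <= b -> p t = t).
{ intros t Ht. unfold p. rewrite Rmin_right by lra. apply Rmax_right. lra. }
assert (Hp1 : forall t r, Rabs (p t - p r) <= Rabs (t - r)).
{ intros t r. unfold p.
  assert (H1 : forall u v, Rabs (Rmin b u - Rmin b v) <= Rabs (u - v)).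
  { intros u v. unfold Rmin. destruct (Rle_dec b u), (Rle_dec b v);
    unfold Rabs; repeat match goal with |- context [Rcase_abs ?a] => destruct (Rcase_abs a) end; lra. }
  assert (H2 : forall u v, Rabs (Rmax a u - Rmax a v) <= Rabs (u - v)).
  { intros u v. unfold Rmax. destruct (Rle_dec a u), (Rle_dec a v);
    unfold Rabs; repeat match goal with |- context [Rcase_abs ?a] => destruct (Rcase_abs a) end; lra. }
  eapply Rle_trans; [apply H2 | apply H1]. }
set (g := fun t => f (p t)).
assert (Hg : continuity g).
{ intros t eps Heps. exists (eps / (K + 1)). split; [apply Rdiv_lt_0_compat; lra |].
  intros r [_ Hr]. simpl in *. unfold Rdist in *. unfold g.
  eapply Rle_lt_trans; [apply Hf; apply Hp |].
  apply Rle_lt_trans with (K * Rabs (r - t)); [apply Rmult_le_compat_l; [exact HK | apply Hp1] |].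
  apply Rle_lt_trans with (K * (eps / (K + 1))); [apply Rmult_le_compat_l; lra |].
  apply Rmult_lt_reg_r with (K + 1); [lra |].
  replace (K * (eps / (K + 1)) * (K + 1)) with (K * eps) by (field; lra). lra. }
destruct (IVT_cor g a b Hg Hab) as [c [Hc E]].
- unfold g. rewrite !Hpid by lra. exact Hs.
- exists c. split; [exact Hc |]. unfold g in E. rewrite Hpid in E by exact Hc. exact E.
Qed.

(** A linear bound up to a fixed distance from pi: it makes the product of sines in
    [half_turn_spec] comparable with t (T - t). *)
Lemma sin_ge_linear alpha : 0 < alpha < PI / 2 ->
  exists m, 0 < m <= 1 /\ forall u, 0 <= u <= PI - alpha -> m * u <= sin u.
Proof.
intros Ha.
assert (HPI := PI2_3_2). assert (HPI4 := PI_4).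
assert (Hsa : 0 < sin alpha) by (apply sin_gt_0; lra).
(* the sine is at least u / 2 up to 1, and at least the smaller of its values at 1 and
   at pi - alpha from there on *)
set (m0 := Rmin (1 / 2) (sin alpha)).
assert (Hm0 : 0 < m0) by (apply Rmin_glb_lt; lra).
assert (m1 := Rmin_l (1 / 2) (sin alpha)). assert (m2 := Rmin_r (1 / 2) (sin alpha)). fold m0 in m1, m2.
assert (low : forall u, 0 <= u <= 1 -> u / 2 <= sin u).
{ intros u Hu.
  destruct (MVT_gen sin 0 u cos) as [c [Hc E]].
  - intros x _. auto_derive; [easy | ring].
  - intros x _. apply continuity_pt_filterlim. apply (ex_derive_continuous sin). auto_derive. easy.
  - rewrite Rmin_left, Rmax_right in Hc by lra. rewrite sin_0 in E.
    assert (1 / 2 <= cos c). { rewrite <- cos_PI3. apply cos_decr_1; lra. }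
    nra. }
exists (m0 / 4). split; [lra |]. intros u Hu.
destruct (Rle_lt_dec u 1) as [Hu1 | Hu1].
- specialize (low u ltac:(lra)). nra.
- assert (m0 <= sin u); [| nra].
  destruct (Rle_lt_dec u (PI / 2)) as [Hu2 | Hu2].
  + apply Rle_trans with (1 / 2); [exact m1 |].
    apply Rle_trans with (sin 1); [apply Rle_trans with (1 / 2); [lra | apply low; lra] |].
    apply sin_incr_1; lra.
  + apply Rle_trans with (sin alpha); [exact m2 |].
    rewrite <- (sin_PI_x alpha). apply sin_decr_1; lra.
Qed.

Section Leg.
Variables (lam K : R) (G1 G2 G3 : R -> R -> R -> R).
Hypothesis HK : 1 <= K.
Hypothesis T1 : tame K G1.
Hypothesis T2 : tame K G2.
Hypothesis T3 : tame K G3.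
Let is_flow := is_flow lam G1 G2 G3.

(** The rotation preserves rho, and s is itself of order eps: this is why their
    increments carry a factor eps, while those of x and y do not. *)
Lemma flow_bounds (M Omega : R) : 0 <= M -> 0 <= Omega -> exists C, 1 <= C /\
  forall eps x y s, Rabs eps <= 1 -> is_flow eps x y s ->
    Rabs (x 0) <= M -> Rabs (y 0) <= M -> Rabs (s 0) <= Omega * Rabs eps ->
    (forall t, 0 <= t <= 10 ->
       Rabs (x t - (x 0 * cos t - y 0 * sin t)) <= C * Rabs eps * t /\
       Rabs (y t - (x 0 * sin t + y 0 * cos t)) <= C * Rabs eps * t /\
       Rabs (x t) <= C /\ Rabs (y t) <= C /\ Rabs (s t) <= C * Rabs eps) /\
    (forall t r, 0 <= t <= 10 -> 0 <= r <= 10 ->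
       Rabs (x t - x r) <= C * Rabs (t - r) /\
       Rabs (y t - y r) <= C * Rabs (t - r) /\
       Rabs (s t - s r) <= C * Rabs eps * Rabs (t - r) /\
       Rabs ((x t * x t + y t * y t) - (x r * x r + y r * y r)) <= C * Rabs eps * Rabs (t - r)).
Proof.
intros HM HO.
set (D := drift_const lam). assert (HD : 4 <= D) by apply drift_const_ge4.
set (E := exp (Rabs lam * 10)).
assert (HE : 1 <= E) by (unfold E; rewrite <- exp_0; apply exp_le_mono; assert (P := Rabs_pos lam); lra).
set (C1 := 2 * M + 10 * D * K).
set (C2 := 10 * D * K + Omega * E).
assert (Hlam := Rabs_pos lam).
assert (HDK : 4 <= D * K) by nra.
assert (HC1 : 0 <= C1) by (unfold C1; lra).
assert (HOE : 0 <= Omega * E) by pos.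
assert (HC2 : 0 <= C2) by (unfold C2; lra).
assert (p1 : 0 <= Rabs lam * C2) by pos.
assert (p2 : 0 <= 4 * C1 * K) by pos.
exists (C1 + C2 + D * K + K + Rabs lam * C2 + 4 * C1 * K).
split; [lra |].
set (C := C1 + C2 + D * K + K + Rabs lam * C2 + 4 * C1 * K).
intros eps x y s Heps Hf Hx0 Hy0 Hs0.
assert (He := Rabs_pos eps). set (e := Rabs eps) in *.
assert (A : forall t, 0 <= t <= 10 ->
  Rabs (x t - (x 0 * cos t - y 0 * sin t)) <= D * K * e * t /\
  Rabs (y t - (x 0 * sin t + y 0 * cos t)) <= D * K * e * t /\
  Rabs (x t) <= C1 /\ Rabs (y t) <= C1 /\ Rabs (s t) <= C2 * e).
{ intros t Ht.
  assert (Hae := is_flow_ae lam K G1 G2 G3 HK T1 T2 T3 eps x y s 0 t ltac:(lra) Hf).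
  apply (ae_curve_weaken _ (near_center lam (K * Rabs eps))) in Hae.
  2:{ intros. now apply (velocity_near_center lam K G1 G2 G3 T1 T2 T3). }
  destruct (drift lam (K * e) x y s 0 t ltac:(lra) ltac:(nra) Hae) as [d1 [d2 d3]].
  rewrite Rminus_0_r in d1, d2, d3. fold D in d1, d2, d3.
  rewrite <- Rmult_assoc in d1, d2, d3.
  assert (hb : D * K * e * t <= 10 * D * K).
  { assert (e * t <= 10) by nra. assert (0 <= D * K) by lra.
    replace (D * K * e * t) with (D * K * (e * t)) by ring. nra. }
  assert (hc := Rabs_cos_le1 t). assert (hs := Rabs_sin_le1 t).
  repeat split; try assumption.
  - replace (x t) with ((x t - (x 0 * cos t - y 0 * sin t)) + (x 0 * cos t + y 0 * - sin t)) by ring.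
    tri.
    assert (B := Rabs_comb_le (x 0) (y 0) (cos t) (- sin t) M Hx0 Hy0 hc ltac:(rewrite Rabs_Ropp; exact hs)).
    unfold C1. lra.
  - replace (y t) with ((y t - (x 0 * sin t + y 0 * cos t)) + (x 0 * sin t + y 0 * cos t)) by ring.
    tri.
    assert (B := Rabs_comb_le (x 0) (y 0) (sin t) (cos t) M Hx0 Hy0 hs hc). unfold C1. lra.
  - replace (s t) with ((s t - s 0 * exp (- lam * t)) + s 0 * exp (- lam * t)) by ring.
    tri. rewrite (Rabs_mult (s 0)).
    rewrite (Rabs_pos_eq (exp _)) by (left; apply exp_pos).
    assert (B : exp (- lam * t) <= E) by (unfold E; rewrite <- (Rabs_Ropp lam); apply exp_Rabs_le; lra).
    assert (B' : Rabs (s 0) * exp (- lam * t) <= (Omega * e) * E).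
    { apply Rmult_le_compat; try assumption; [apply Rabs_pos | left; apply exp_pos]. }
    assert (D * K * e * t <= 10 * D * K * e).
    { replace (D * K * e * t) with (D * K * e * t) by ring. assert (0 <= D * K * e) by nra. nra. }
    unfold C2. nra. }
split.
- intros t Ht. destruct (A t Ht) as [a1 [a2 [a3 [a4 a5]]]].
  assert (D * K * e * t <= C * e * t).
  { apply Rmult_le_compat_r; [lra |]. apply Rmult_le_compat_r; [exact He | unfold C; lra]. }
  assert (C2 * e <= C * e) by (apply Rmult_le_compat_r; [exact He | unfold C; lra]).
  assert (C1 <= C) by (unfold C; lra).
  repeat split; lra.
- intros t r Ht Hr.
  assert (rng : forall c, Rmin r t <= c <= Rmax r t -> 0 <= c <= 10).
  { intros c. unfold Rmin, Rmax. destruct (Rle_dec r t); lra. }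
  assert (dG : forall F c, tame K F -> Rabs (eps * F (x c) (y c) (s c)) <= K * e).
  { intros F c [_ HF]. rewrite Rabs_mult, Rmult_comm. apply Rmult_le_compat_r; [exact He | apply HF]. }
  assert (Ke : K * e <= K) by nra.
  repeat split.
  + apply Rle_trans with ((C1 + K) * Rabs (t - r)).
    2:{ apply Rmult_le_compat_r; [apply Rabs_pos | unfold C; lra]. }
    apply (derive_bound_increment x (fun t => - y t + eps * G1 (x t) (y t) (s t))).
    * intros c _. apply (Hf c).
    * intros c Hc. destruct (A c (rng c Hc)) as [a1 [a2 [a3 [a4 a5]]]].
      tri. rewrite Rabs_Ropp. assert (B := dG G1 c T1). lra.
  + apply Rle_trans with ((C1 + K) * Rabs (t - r)).
    2:{ apply Rmult_le_compat_r; [apply Rabs_pos | unfold C; lra]. }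
    apply (derive_bound_increment y (fun t => x t + eps * G2 (x t) (y t) (s t))).
    * intros c _. apply (Hf c).
    * intros c Hc. destruct (A c (rng c Hc)) as [a1 [a2 [a3 [a4 a5]]]].
      tri. assert (B := dG G2 c T2). lra.
  + apply Rle_trans with ((Rabs lam * C2 * e + K * e) * Rabs (t - r)).
    2:{ apply Rmult_le_compat_r; [apply Rabs_pos |]. rewrite <- Rmult_plus_distr_r.
        apply Rmult_le_compat_r; [exact He | unfold C; lra]. }
    apply (derive_bound_increment s (fun t => - lam * s t + eps * G3 (x t) (y t) (s t))).
    * intros c _. apply (Hf c).
    * intros c Hc. destruct (A c (rng c Hc)) as [a1 [a2 [a3 [a4 a5]]]].
      tri. assert (B := dG G3 c T3).
      rewrite Rabs_mult, Rabs_Ropp. assert (Rabs lam * Rabs (s c) <= Rabs lam * (C2 * e)) by mono.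
      lra.
  + apply Rle_trans with ((4 * C1 * K * e) * Rabs (t - r)).
    2:{ apply Rmult_le_compat_r; [apply Rabs_pos |].
        apply Rmult_le_compat_r; [exact He | unfold C; lra]. }
    apply (derive_bound_increment (fun t => x t * x t + y t * y t)
      (fun t => (((- y t + eps * G1 (x t) (y t) (s t)) * x t + x t * (- y t + eps * G1 (x t) (y t) (s t)))
         + ((x t + eps * G2 (x t) (y t) (s t)) * y t + y t * (x t + eps * G2 (x t) (y t) (s t)))))).
    * intros c _. destruct (Hf c) as [h1 [h2 _]].
      apply derive_plus; apply derive_mult; assumption.
    * intros c Hc. destruct (A c (rng c Hc)) as [a1 [a2 [a3 [a4 a5]]]].
      replace (((- y c + eps * G1 (x c) (y c) (s c)) * x c + x c * (- y c + eps * G1 (x c) (y c) (s c)))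
         + ((x c + eps * G2 (x c) (y c) (s c)) * y c + y c * (x c + eps * G2 (x c) (y c) (s c))))
        with (2 * (x c * (eps * G1 (x c) (y c) (s c))) + 2 * (y c * (eps * G2 (x c) (y c) (s c)))) by ring.
      tri. rewrite !(Rabs_mult 2), (Rabs_pos_eq 2) by lra.
      rewrite !(Rabs_mult (x c)), !(Rabs_mult (y c)).
      assert (B1 := dG G1 c T1). assert (B2 := dG G2 c T2).
      assert (Rabs (x c) * Rabs (eps * G1 (x c) (y c) (s c)) <= C1 * (K * e)) by (apply Rmult_le_compat; auto using Rabs_pos).
      assert (Rabs (y c) * Rabs (eps * G2 (x c) (y c) (s c)) <= C1 * (K * e)) by (apply Rmult_le_compat; auto using Rabs_pos).
      lra.
Qed.

End Leg.

(** * The switching surface and the exit from one side *)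

Lemma cos_1lip a b : Rabs (cos a - cos b) <= Rabs (a - b).
Proof.
rewrite <- (Rmult_1_l (Rabs (a - b))). apply (derive_bound_increment cos (fun t => - sin t)).
- intros v _. auto_derive; [easy | ring].
- intros v _. rewrite Rabs_Ropp. apply Rabs_sin_le1.
Qed.

Lemma sin_1lip a b : Rabs (sin a - sin b) <= Rabs (a - b).
Proof.
rewrite <- (Rmult_1_l (Rabs (a - b))). apply (derive_bound_increment sin cos).
- intros v _. auto_derive; [easy | ring].
- intros v _. apply Rabs_cos_le1.
Qed.

(** The switching surface near the paraboloid, as the graph y = sw_y rho + sw_k s over
    the invariants rho and s, for rho between sw_lo and sw_hi. The gap bounds rho - sw_y
    rho ^ 2 from below, so that every circle meets the surface transversally; the margin
    leaves room for perturbations. *)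
Record switching := {
  sw_y : R -> R;
  sw_d : R -> R;
  sw_k : R;
  sw_lo : R;
  sw_hi : R;
  sw_margin : R;
  sw_lip : R;
  sw_gap : R;
  sw_margin_pos : 0 < sw_margin;
  sw_lo_pos : 0 < sw_lo;
  sw_hi_lo : sw_lo <= sw_hi;
  sw_lip_ge1 : 1 <= sw_lip;
  sw_gap_pos : 0 < sw_gap <= 1;
  sw_k_le1 : Rabs sw_k <= 1;
  sw_derive : forall r, sw_lo <= r <= sw_hi -> is_derive sw_y r (sw_d r);
  sw_d_bound : forall r, sw_lo <= r <= sw_hi -> Rabs (sw_d r) <= sw_lip;
  sw_d_lip : forall r r', sw_lo <= r <= sw_hi -> sw_lo <= r' <= sw_hi ->
    Rabs (sw_d r - sw_d r') <= sw_lip * Rabs (r - r');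
  sw_transversal : forall r, sw_lo <= r <= sw_hi -> sw_gap <= r - sw_y r * sw_y r
}.

Definition core (g : switching) (r : R) : Prop := sw_lo g + sw_margin g <= r <= sw_hi g - sw_margin g.

Definition height (g : switching) (r w : R) : R := sw_y g r + sw_k g * w.

Definition abscissa (g : switching) (r w : R) : R := sqrt (r - height g r w * height g r w).

(** The time that the rotation takes from (sigma X, Y) to (- sigma X, Y): the points of
    the circle above the chord if sigma = 1, below it if sigma = -1. *)
Definition half_turn (sigma X Y : R) : R := PI - 2 * (sigma * atan (Y / X)).

Lemma sw_y_lip g r r' : sw_lo g <= r <= sw_hi g -> sw_lo g <= r' <= sw_hi g ->
  Rabs (sw_y g r - sw_y g r') <= sw_lip g * Rabs (r - r').
Proof.
intros Hr Hr'. apply (derive_bound_increment (sw_y g) (sw_d g)); intros t Ht;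
  [apply sw_derive | apply sw_d_bound]; revert Ht; unfold Rmin, Rmax; destruct (Rle_dec r' r); lra.
Qed.

Lemma height_lip g r w r' w' : sw_lo g <= r <= sw_hi g -> sw_lo g <= r' <= sw_hi g ->
  Rabs (height g r w - height g r' w') <= sw_lip g * (Rabs (r - r') + Rabs (w - w')).
Proof.
intros Hr Hr'. unfold height.
replace (sw_y g r + sw_k g * w - (sw_y g r' + sw_k g * w'))
  with ((sw_y g r - sw_y g r') + sw_k g * (w - w')) by ring.
tri. rewrite Rabs_mult.
assert (B := sw_y_lip g r r' Hr Hr'). assert (K1 := sw_k_le1 g). assert (L1 := sw_lip_ge1 g).
assert (P := Rabs_pos (w - w')). nra.
Qed.

Lemma sw_y_bound g r : sw_lo g <= r <= sw_hi g -> Rabs (sw_y g r) <= sw_hi g + 1.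
Proof.
intros Hr. assert (B := sw_transversal g r Hr). assert (P := sw_gap_pos g).
apply Rabs_le. nra.
Qed.

Lemma abscissa_bounds g r w : sw_lo g <= r <= sw_hi g ->
  (2 * sw_hi g + 3) * Rabs w <= sw_gap g / 2 -> Rabs w <= 1 ->
  sw_gap g / 2 <= r - height g r w * height g r w /\
  sw_gap g / 2 <= abscissa g r w <= sw_hi g + 2 /\ Rabs (height g r w) <= sw_hi g + 2 /\
  abscissa g r w * abscissa g r w + height g r w * height g r w = r.
Proof.
intros Hr Hw Hw1.
assert (B := sw_transversal g r Hr). assert (P := sw_gap_pos g). assert (K1 := sw_k_le1 g).
assert (Y1 := sw_y_bound g r Hr).
assert (Hkw : Rabs (sw_k g * w) <= Rabs w).
{ rewrite Rabs_mult. assert (Q := Rabs_pos w). assert (Q' := Rabs_pos (sw_k g)). nra. }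
set (v := sw_k g * w) in *.
assert (Q := Rabs_pos v). assert (Q' := Rabs_pos (sw_y g r)).
assert (main : sw_gap g / 2 <= r - height g r w * height g r w).
{ unfold height. fold v.
  assert (2 * (sw_y g r * v) + v * v <= (2 * sw_hi g + 3) * Rabs w).
  { apply Rle_trans with ((2 * sw_hi g + 3) * Rabs v); [| apply Rmult_le_compat_l; lra].
    assert (b1 : sw_y g r * v <= (sw_hi g + 1) * Rabs v).
    { eapply Rle_trans; [apply Rle_abs |]. rewrite Rabs_mult. apply Rmult_le_compat_r; lra. }
    assert (b2 : v * v <= 1 * Rabs v).
    { eapply Rle_trans; [apply Rle_abs |]. rewrite Rabs_mult. apply Rmult_le_compat_r; lra. }
    lra. }
  nra. }
assert (Hh : Rabs (height g r w) <= sw_hi g + 2).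
{ unfold height. fold v. tri. lra. }
assert (Sq : abscissa g r w * abscissa g r w = r - height g r w * height g r w).
{ unfold abscissa. apply sqrt_sqrt. lra. }
assert (S0 : 0 <= abscissa g r w) by apply sqrt_pos.
split; [exact main |]. split; [| split; [exact Hh | lra]].
split.
- apply Rnot_lt_le. intros Hlt. nra.
- apply Rnot_lt_le. intros Hlt. nra.
Qed.

Lemma polar_atan X Y : 0 < X ->
  exists r, X <= r /\ X = r * cos (atan (Y / X)) /\ Y = r * sin (atan (Y / X)).
Proof.
intros HX. set (q := Y / X).
assert (Hq : 1 <= sqrt (1 + q ^ 2)).
{ rewrite <- sqrt_1 at 1. apply sqrt_le_1; nra. }
exists (X * sqrt (1 + q ^ 2)). split; [nra |].
rewrite cos_atan, sin_atan. unfold Rsqr. replace (q * q) with (q ^ 2) by ring.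
split; [field; lra |]. unfold q at 2. field. split; lra.
Qed.

(** In polar form the height over the chord is a product of two sines, which shows its
    sign between the two crossings. *)
Lemma half_turn_spec sigma X Y t : sigma * sigma = 1 -> 0 < X ->
  exists r, X <= r /\
  sigma * X * cos (half_turn sigma X Y) - Y * sin (half_turn sigma X Y) = - (sigma * X) /\
  sigma * X * sin (half_turn sigma X Y) + Y * cos (half_turn sigma X Y) = Y /\
  sigma * (sigma * X * sin t + Y * cos t - Y) = 2 * r * (sin (t / 2) * sin ((half_turn sigma X Y - t) / 2)).
Proof.
intros Hs HX. destruct (polar_atan X Y HX) as [r [Hr [EX EY]]]. exists r. split; [exact Hr |].
set (th := atan (Y / X)) in *. unfold half_turn. fold th.
assert (Hs' := sign_cases sigma Hs).
assert (Es : sin (sigma * th) = sigma * sin th).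
{ destruct Hs' as [-> | ->]; [now rewrite !Rmult_1_l |].
  replace (-1 * th) with (- th) by ring. rewrite sin_neg. ring. }
assert (Ec : cos (sigma * th) = cos th).
{ destruct Hs' as [-> | ->]; [now rewrite Rmult_1_l |].
  replace (-1 * th) with (- th) by ring. apply cos_neg. }
assert (SC := sin2_cos2 th). unfold Rsqr in SC.
assert (EC : cos (PI - 2 * (sigma * th)) = - (1 - 2 * (sin th * sin th))).
{ replace (PI - 2 * (sigma * th)) with (- (2 * (sigma * th) - PI)) by ring.
  rewrite cos_neg, cos_minus, cos_PI, sin_PI. rewrite cos_2a_sin, Es.
  replace (2 * (sigma * sin th) * (sigma * sin th)) with (2 * (sigma * sigma) * (sin th * sin th)) by ring.
  rewrite Hs. ring. }
assert (ES : sin (PI - 2 * (sigma * th)) = 2 * sigma * sin th * cos th).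
{ rewrite sin_PI_x, sin_2a, Es, Ec. ring. }
rewrite EC, ES. split; [| split].
- rewrite EX at 1. rewrite EY at 1. rewrite EX.
  transitivity (- sigma * r * cos th * (1 - 2 * (sin th * sin th) + 2 * (sin th * sin th))); [ring | ring].
- rewrite EX at 1. rewrite EY.
  replace (sigma * (r * cos th) * (2 * sigma * sin th * cos th)) with (2 * (sigma * sigma) * r * sin th * (cos th * cos th)) by ring.
  rewrite Hs. replace (cos th * cos th) with (1 - sin th * sin th) by lra. ring.
- replace ((PI - 2 * (sigma * th) - t) / 2) with (PI / 2 - (sigma * th + t / 2)) by field.
  rewrite sin_shift, cos_plus, Es, Ec.
  replace t with (2 * (t / 2)) at 1 2 by field. rewrite sin_2a, cos_2a_sin.
  rewrite EX at 1. rewrite EY at 1 2.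
  transitivity (2 * r * (sin (t / 2) * ((sigma * sigma) * cos th * cos (t / 2) - sigma * sin th * sin (t / 2)))); [ring |].
  rewrite Hs. ring.
Qed.

Lemma atan_1lip u v : Rabs (atan u - atan v) <= Rabs (u - v).
Proof.
rewrite <- (Rmult_1_l (Rabs (u - v))).
apply (derive_bound_increment atan (fun x => / (1 + x ^ 2))).
- intros t _. apply is_derive_Reals.
  apply derivable_pt_lim_atan.
- intros t _. assert (0 < 1 + t ^ 2) by nra. rewrite Rabs_pos_eq by (left; now apply Rinv_0_lt_compat).
  rewrite <- Rinv_1. apply Rinv_le_contravar; nra.
Qed.

Section Exit.
Variables (lam K : R) (G1 G2 G3 : R -> R -> R -> R).
Hypothesis HK : 1 <= K.
Hypothesis T1 : tame K G1.
Hypothesis T2 : tame K G2.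
Hypothesis T3 : tame K G3.
Variable g : switching.

Definition above (x y s : R) : R := y - height g (x * x + y * y) s.

Definition departs (sigma eps r w : R) (x y s : R -> R) : Prop :=
  is_flow lam G1 G2 G3 eps x y s /\
  x 0 = sigma * abscissa g r w /\ y 0 = height g r w /\ s 0 = w.

Definition exits (sigma : R) (x y s : R -> R) (T : R) : Prop :=
  0 < T /\ above (x T) (y T) (s T) = 0 /\
  forall t, 0 < t < T -> 0 < sigma * above (x t) (y t) (s t).

(** Unperturbed, the height over the chord is at least c t (T - t). This dominates the
    perturbation, of size C eps t, until T - t is of order eps; from then on x is close
    to - sigma X and the height decreases at a definite speed. So the trajectory leaves
    its side exactly once, within O(eps) of the half turn. *)
Lemma leg_exit (sigma Omega : R) : sigma * sigma = 1 -> 0 <= Omega ->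
  exists C e1, 1 <= C /\ 0 < e1 <= 1 /\ (forall eps r w x y s,
    Rabs eps <= e1 -> core g r -> Rabs w <= Omega * Rabs eps -> departs sigma eps r w x y s ->
    exists T, exits sigma x y s T /\ T <= 10 /\ / C <= T /\
      Rabs (T - half_turn sigma (abscissa g r w) (height g r w)) <= C * Rabs eps /\
      sigma * x T <= 0 /\ forall t, 0 <= t <= 10 -> Rabs (x t * x t + y t * y t - r) <= C * Rabs eps /\ Rabs (s t) <= C * Rabs eps).
Proof.
intros Hsig HO.
assert (P := sw_gap_pos g). assert (L0 := sw_lo_pos g). assert (L1 := sw_lip_ge1 g).
assert (Hm := sw_margin_pos g). assert (Hhl := sw_hi_lo g).
set (M := sw_hi g + 2). assert (HM : 2 <= M) by (unfold M; lra).
destruct (flow_bounds lam K G1 G2 G3 HK T1 T2 T3 M Omega ltac:(lra) HO) as [C [HC FB]].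
set (chi := sw_gap g / 2). assert (Hchi : 0 < chi <= 1 / 2) by (unfold chi; lra).
assert (HPI4 := PI_4).
(* all half turns lie between 2 alpha and 2 pi - 2 alpha *)
set (alpha := PI / 2 - atan (M / chi)).
assert (Hat := atan_bound (M / chi)).
assert (HMc : 0 < M / chi) by (apply Rdiv_lt_0_compat; lra).
assert (Hat0 : 0 < atan (M / chi)) by (rewrite <- atan_0; apply atan_increasing; exact HMc).
assert (Hal : 0 < alpha < PI / 2) by (unfold alpha; lra).
destruct (sin_ge_linear alpha Hal) as [m [Hm0 Hsin]].
set (L := sw_lip g) in *.
set (CF := C * (1 + 2 * L)).
assert (HCF : 1 <= CF) by (unfold CF; nra).
set (c1 := chi * m * m / 2).
assert (Hc1 : 0 < c1) by (unfold c1; assert (0 < chi * m) by nra; nra).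
set (C3 := CF / c1 + 32 * CF / chi).
assert (HC3a : CF <= c1 * C3).
{ unfold C3. rewrite Rmult_plus_distr_l. replace (c1 * (CF / c1)) with CF by (field; lra).
  assert (0 <= c1 * (32 * CF / chi)); [| lra]. apply Rmult_le_pos; [lra |].
  apply Rdiv_le_0_compat; lra. }
assert (HC3b : 8 * CF <= chi / 4 * C3).
{ unfold C3. rewrite Rmult_plus_distr_l. replace (chi / 4 * (32 * CF / chi)) with (8 * CF) by (field; lra).
  assert (0 <= chi / 4 * (CF / c1)); [| lra]. apply Rmult_le_pos; [lra |].
  apply Rdiv_le_0_compat; lra. }
assert (HC3 : 0 < C3) by nra.
set (Cend := 10 * C + 2 * M * C3).
assert (HCend : 0 < Cend) by (unfold Cend; nra).
assert (n1 : 0 <= (2 * sw_hi g + 3) * Omega) by pos.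
destruct (small_enough _ chi n1 ltac:(lra)) as [e1 [he1 E1]].
destruct (small_enough Omega 1 HO ltac:(lra)) as [e2 [he2 E2]].
destruct (small_enough (10 * C) (sw_margin g) ltac:(lra) Hm) as [e3 [he3 E3]].
destruct (small_enough C3 alpha ltac:(lra) ltac:(lra)) as [e4 [he4 E4]].
destruct (small_enough Cend (chi / 4) ltac:(lra) ltac:(lra)) as [e5 [he5 E5]].
destruct (small_enough K (chi / 4) ltac:(lra) ltac:(lra)) as [e6 [he6 E6]].
destruct (small_enough (2 * L * C) (chi / 4) ltac:(nra) ltac:(lra)) as [e7 [he7 E7]].
set (e0 := Rmin 1 (Rmin e1 (Rmin e2 (Rmin e3 (Rmin e4 (Rmin e5 (Rmin e6 e7))))))).
assert (He0 : 0 < e0 <= 1 /\ e0 <= e1 /\ e0 <= e2 /\ e0 <= e3 /\ e0 <= e4 /\ e0 <= e5 /\ e0 <= e6 /\ e0 <= e7).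
{ unfold e0. split; [split; [repeat apply Rmin_glb_lt; lra | apply Rmin_l] |].
  repeat split; Rmin_le. }
exists (C3 + Cend + / alpha + 1), e0.
assert (Ha' : 0 < / alpha) by (apply Rinv_0_lt_compat; lra).
split; [lra |]. split; [apply He0 |].
intros eps r w x y s Heps Hr Hw [Hf [Hx0 [Hy0 Hs0]]].
set (e := Rabs eps) in *. assert (He := Rabs_pos eps). fold e in He.
destruct He0 as [He01 [q1 [q2 [q3 [q4 [q5 [q6 q7]]]]]]].
specialize (E1 e ltac:(lra)). specialize (E2 e ltac:(lra)). specialize (E3 e ltac:(lra)).
specialize (E4 e ltac:(lra)). specialize (E5 e ltac:(lra)). specialize (E6 e ltac:(lra)).
specialize (E7 e ltac:(lra)).
unfold core in Hr.
assert (Hr' : sw_lo g <= r <= sw_hi g) by lra.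
destruct (abscissa_bounds g r w Hr') as [A1 [A2 [A3 A4]]].
{ apply Rle_trans with ((2 * sw_hi g + 3) * (Omega * e)); [apply Rmult_le_compat_l; lra |]. fold chi. lra. }
{ lra. }
fold chi in A1, A2. fold M in A2, A3.
set (X := abscissa g r w) in *. set (Y := height g r w) in *.
destruct (FB eps x y s) as [FB1 FB2]; try assumption.
{ fold e; lra. }
{ rewrite Hx0, sign_abs, Rabs_pos_eq by lra. lra. }
{ rewrite Hy0. exact A3. }
{ rewrite Hs0. exact Hw. }
clear FB. fold e in FB1, FB2. rewrite Hx0, Hy0 in FB1.
assert (HT := half_turn_spec sigma X Y). set (Th := half_turn sigma X Y) in *.
assert (Hth : 2 * alpha <= Th <= 2 * PI - 2 * alpha).
{ assert (HYX : Rabs (Y / X) <= M / chi).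
  { unfold Rdiv. rewrite Rabs_mult. apply Rmult_le_compat; try apply Rabs_pos; [exact A3 |].
    rewrite Rabs_inv. rewrite Rabs_pos_eq by lra. apply Rinv_le_contravar; lra. }
  apply Rabs_le_between in HYX.
  assert (u1 : atan (Y / X) <= atan (M / chi)).
  { destruct (proj2 HYX) as [h | h]; [left; now apply atan_increasing | rewrite h; lra]. }
  assert (u2 : - atan (M / chi) <= atan (Y / X)).
  { rewrite <- atan_opp. destruct (proj1 HYX) as [h | h]; [left; now apply atan_increasing | rewrite h; lra]. }
  assert (u3 : Rabs (sigma * atan (Y / X)) <= atan (M / chi)).
  { rewrite sign_abs by exact Hsig. apply Rabs_le. lra. }
  apply Rabs_le_between in u3. unfold Th, half_turn, alpha. lra. }
set (F := fun t => above (x t) (y t) (s t)).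
assert (ten : forall t, 0 <= t <= 10 -> C * e * t <= 10 * C * e).
{ intros t Ht. replace (10 * C * e) with (C * e * 10) by ring. mono. }
assert (start : sigma * X * (sigma * X) + Y * Y = r).
{ rewrite <- A4. transitivity (sigma * sigma * (X * X) + Y * Y); [ring |]. rewrite Hsig. ring. }
assert (Hr1 : forall t, 0 <= t <= 10 -> Rabs (x t * x t + y t * y t - r) <= 10 * C * e).
{ intros t Ht. destruct (FB2 t 0 Ht ltac:(lra)) as [_ [_ [_ B]]].
  rewrite Hx0, Hy0, Rminus_0_r, (Rabs_pos_eq t), start in B by lra. specialize (ten t Ht). lra. }
assert (Hrho : forall t, 0 <= t <= 10 -> sw_lo g <= x t * x t + y t * y t <= sw_hi g).
{ intros t Ht. assert (B := Hr1 t Ht). apply Rabs_le_between in B. lra. }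
assert (Hheight : forall t u, 0 <= t <= 10 -> 0 <= u <= 10 ->
  Rabs (height g (x t * x t + y t * y t) (s t) - height g (x u * x u + y u * y u) (s u)) <= 2 * L * C * e * Rabs (t - u)).
{ intros t u Ht Hu. eapply Rle_trans; [apply height_lip; now apply Hrho |].
  destruct (FB2 t u Ht Hu) as [_ [_ [b1 b2]]]. fold L.
  replace (2 * L * C * e * Rabs (t - u)) with (L * (C * e * Rabs (t - u) + C * e * Rabs (t - u))) by ring.
  apply Rmult_le_compat_l; lra. }
assert (HFclose : forall t, 0 <= t <= 10 -> Rabs (F t - (sigma * X * sin t + Y * cos t - Y)) <= CF * e * t).
{ intros t Ht. destruct (FB1 t Ht) as [_ [b1 _]].
  assert (b2 := Hheight t 0 Ht ltac:(lra)).
  rewrite Rminus_0_r, (Rabs_pos_eq t) in b2 by lra. rewrite Hx0, Hy0, Hs0 in b2.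
  rewrite start in b2. fold Y in b2.
  unfold F, above.
  replace (y t - height g (x t * x t + y t * y t) (s t) - (sigma * X * sin t + Y * cos t - Y))
    with ((y t - (sigma * X * sin t + Y * cos t)) + - (height g (x t * x t + y t * y t) (s t) - Y)) by ring.
  tri. rewrite Rabs_Ropp.
  replace (CF * e * t) with (C * e * t + 2 * L * C * e * t) by (unfold CF; ring). lra. }
assert (HF0 : forall t, 0 <= t <= Th -> c1 * (t * (Th - t)) <= sigma * (sigma * X * sin t + Y * cos t - Y)).
{ intros t Ht. destruct (HT t Hsig ltac:(lra)) as [rr [Hrr [_ [_ E]]]]. rewrite E.
  assert (s1 : m * (t / 2) <= sin (t / 2)) by (apply Hsin; lra).
  assert (s2 : m * ((Th - t) / 2) <= sin ((Th - t) / 2)) by (apply Hsin; lra).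
  assert (z1 : 0 <= m * (t / 2)) by pos.
  assert (z2 : 0 <= m * ((Th - t) / 2)) by pos.
  replace (c1 * (t * (Th - t))) with (2 * chi * ((m * (t / 2)) * (m * ((Th - t) / 2)))) by (unfold c1; field).
  apply Rmult_le_compat; [lra | now apply Rmult_le_pos | lra |]. now apply Rmult_le_compat. }
(* d is the length of the time window in which the exit takes place *)
set (d := C3 * e). assert (Hd : 0 <= d) by (unfold d; nra). fold d in E4.
assert (hpos1 : forall t, 0 <= t < Th - d -> 0 < t -> 0 < sigma * F t).
{ intros t Ht Ht0. assert (B := HF0 t ltac:(lra)). assert (B' := HFclose t ltac:(lra)).
  assert (B2 : Rabs (sigma * F t - sigma * (sigma * X * sin t + Y * cos t - Y)) <= CF * e * t).
  { rewrite <- Rmult_minus_distr_l, sign_abs by exact Hsig. exact B'. }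
  apply Rabs_le_between in B2.
  assert (B3 : CF * e <= c1 * d) by (unfold d; rewrite <- Rmult_assoc; apply Rmult_le_compat_r; lra).
  assert (B4 : 0 < t * (c1 * (Th - t) - CF * e)).
  { apply Rmult_lt_0_compat; [exact Ht0 |].
    assert (c1 * d < c1 * (Th - t)) by (apply Rmult_lt_compat_l; lra). lra. }
  lra. }
assert (hend : 0 <= sigma * F (Th - d)).
{ assert (B := HF0 (Th - d) ltac:(lra)). assert (B' := HFclose (Th - d) ltac:(lra)).
  assert (B2 : Rabs (sigma * F (Th - d) - sigma * (sigma * X * sin (Th - d) + Y * cos (Th - d) - Y)) <= CF * e * (Th - d)).
  { rewrite <- Rmult_minus_distr_l, sign_abs by exact Hsig. exact B'. }
  apply Rabs_le_between in B2.
  assert (B3 : CF * e <= c1 * d) by (unfold d; rewrite <- Rmult_assoc; apply Rmult_le_compat_r; lra).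
  assert (B4 : 0 <= (Th - d) * (c1 * (Th - (Th - d)) - CF * e)).
  { apply Rmult_le_pos; [lra |]. replace (Th - (Th - d)) with d by ring. lra. }
  lra. }
assert (hx : forall t, Th - d <= t <= Th + d -> Rabs (x t + sigma * X) <= Cend * e).
{ intros t Ht. destruct (FB1 t ltac:(lra)) as [b1 _]. destruct (HT t Hsig ltac:(lra)) as [rr [Hrr [E [_ _]]]].
  replace (x t + sigma * X) with ((x t - (sigma * X * cos t - Y * sin t))
     + ((sigma * X * (cos t - cos Th) + Y * - (sin t - sin Th)))) by lra.
  tri.
  assert (k1 := cos_1lip t Th). assert (k2 := sin_1lip t Th).
  assert (k3 : Rabs (t - Th) <= d) by (apply Rabs_le; lra).
  assert (k4 : Rabs (sigma * X * (cos t - cos Th) + Y * - (sin t - sin Th)) <= 2 * M * d).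
  { replace (2 * M * d) with (M * d + M * d) by ring. apply Rabs_add_le; apply Rabs_prod; [| lra | exact A3 | rewrite Rabs_Ropp; lra].
    rewrite sign_abs, Rabs_pos_eq by lra. lra. }
  assert (tt := ten t ltac:(lra)). unfold Cend. replace ((10 * C + 2 * M * C3) * e) with (10 * C * e + 2 * M * d) by (unfold d; ring). lra. }
assert (hdec : forall t u, Th - d <= t -> t <= u -> u <= Th + d -> chi / 4 * (u - t) <= sigma * F t - sigma * F u).
{ intros t u Ht Htu Hu.
  assert (dy : chi / 2 * (u - t) <= sigma * y t - sigma * y u).
  { destruct (MVT_gen y t u (fun t => x t + eps * G2 (x t) (y t) (s t))) as [c [Hc E]].
    - intros c _. apply (Hf c).
    - intros c _. apply continuity_pt_filterlim. now apply (is_flow_continuous lam G1 G2 G3 eps x y s c).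
    - rewrite Rmin_left, Rmax_right in Hc by lra.
      assert (b := hx c ltac:(lra)).
      assert (bg : Rabs (eps * G2 (x c) (y c) (s c)) <= chi / 4).
      { rewrite Rabs_mult. fold e. apply Rle_trans with (K * e); [| lra]. rewrite Rmult_comm.
        apply Rmult_le_compat_r; [exact He | apply T2]. }
      assert (bs : sigma * (x c + eps * G2 (x c) (y c) (s c)) <= - (chi / 2)).
      { replace (sigma * (x c + eps * G2 (x c) (y c) (s c)))
          with (sigma * (x c + sigma * X) + sigma * (eps * G2 (x c) (y c) (s c)) - sigma * sigma * X) by ring.
        rewrite Hsig.
        assert (i1 : sigma * (x c + sigma * X) <= chi / 4).
        { eapply Rle_trans; [apply Rle_abs |]. rewrite sign_abs by exact Hsig. lra. }
        assert (i2 : sigma * (eps * G2 (x c) (y c) (s c)) <= chi / 4).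
        { eapply Rle_trans; [apply Rle_abs |]. rewrite sign_abs by exact Hsig. lra. }
        lra. }
      rewrite <- Rmult_minus_distr_l. replace (y t - y u) with (- (y u - y t)) by ring. rewrite E.
      replace (sigma * - ((x c + eps * G2 (x c) (y c) (s c)) * (u - t)))
        with (- (sigma * (x c + eps * G2 (x c) (y c) (s c))) * (u - t)) by ring.
      apply Rmult_le_compat_r; lra. }
  assert (b2 := Hheight t u ltac:(lra) ltac:(lra)).
  assert (b3 : Rabs (sigma * (height g (x t * x t + y t * y t) (s t) - height g (x u * x u + y u * y u) (s u))) <= chi / 4 * (u - t)).
  { rewrite sign_abs by exact Hsig. eapply Rle_trans; [exact b2 |].
    rewrite Rabs_left1 by lra. replace (- (t - u)) with (u - t) by ring.
    apply Rmult_le_compat_r; lra. }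
  apply Rabs_le_between in b3. unfold F, above. lra. }
assert (hend2 : sigma * F (Th + d) <= 0).
{ assert (B := hdec Th (Th + d) ltac:(lra) ltac:(lra) ltac:(lra)).
  assert (B' := HFclose Th ltac:(lra)). destruct (HT Th Hsig ltac:(lra)) as [rr [Hrr [_ [E _]]]].
  replace (sigma * X * sin Th + Y * cos Th - Y) with 0 in B' by lra.
  assert (B2 : sigma * F Th <= CF * e * Th).
  { eapply Rle_trans; [apply Rle_abs |]. rewrite sign_abs by exact Hsig.
    replace (F Th) with (F Th - 0) by ring. exact B'. }
  assert (B3 : CF * e * Th <= CF * e * 8) by (apply Rmult_le_compat_l; [nra | lra]).
  assert (B4 : 8 * CF * e <= chi / 4 * C3 * e) by mono.
  replace (Th + d - Th) with d in B by ring. unfold d in *. lra. }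
destruct (ivt_lipschitz (fun t => sigma * F t) (C + 2 * L * C * e) (Th - d) (Th + d)) as [T [HTr HT0]].
- lra.
- assert (0 <= 2 * L * C * e) by pos. lra.
- intros t u Ht Hu. rewrite <- Rmult_minus_distr_l, sign_abs by exact Hsig.
  unfold F, above.
  assert (b2 := Hheight t u ltac:(lra) ltac:(lra)).
  destruct (FB2 t u ltac:(lra) ltac:(lra)) as [_ [b1 _]].
  replace (y t - height g (x t * x t + y t * y t) (s t) - (y u - height g (x u * x u + y u * y u) (s u)))
    with ((y t - y u) + - (height g (x t * x t + y t * y t) (s t) - height g (x u * x u + y u * y u) (s u))) by ring.
  tri. rewrite Rabs_Ropp. lra.
- nra.
- assert (FT : F T = 0).
  { apply Rmult_eq_reg_l with sigma; [lra |]. intros H0. rewrite H0 in Hsig. lra. }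
  exists T. split; [split; [lra | split; [exact FT |]] |].
  + intros t Ht. destruct (Rlt_le_dec t (Th - d)) as [h | h].
    * apply hpos1; lra.
    * assert (B := hdec t T h ltac:(lra) ltac:(lra)). rewrite FT in B.
      assert (0 < chi / 4 * (T - t)) by (apply Rmult_lt_0_compat; lra). unfold F in B. lra.
  + split; [lra |]. split; [| split; [| split]].
    * apply Rle_trans with alpha; [| lra].
      apply Rle_trans with (/ / alpha); [| rewrite Rinv_inv; lra].
      apply Rinv_le_contravar; lra.
    * apply Rle_trans with d; [apply Rabs_le; lra |]. unfold d. apply Rmult_le_compat_r; lra.
    * assert (b := hx T ltac:(lra)). assert (b' : Rabs (sigma * (x T + sigma * X)) <= chi / 4) by (rewrite sign_abs by exact Hsig; lra).
      replace (sigma * (x T + sigma * X)) with (sigma * x T + sigma * sigma * X) in b' by ring. rewrite Hsig in b'.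
      apply Rabs_le_between in b'. lra.
    * assert (HMC3 : 0 <= M * C3) by pos.
      assert (u1 : 10 * C * e <= (C3 + Cend + / alpha + 1) * e) by (apply Rmult_le_compat_r; [exact He | unfold Cend; lra]).
      assert (u2 : C * e <= 10 * C * e) by mono. intros t Ht. split; [specialize (Hr1 t Ht); lra |].
      destruct (FB1 t Ht) as [_ [_ [_ [_ b5]]]]. lra.
Qed.

End Exit.

(** * A calculus of second differences *)

(** For two trajectories b = true, false, q b is a perturbed quantity and q0 b its
    unperturbed value. Here e is the size of the perturbation, d the distance of the two
    unperturbed situations and h a bound for products of both: the deviation q - q0 is
    required to differ by at most C h between the trajectories. This replaces a
    Lipschitz bound on the O(eps) remainder. *)
Definition quad (C e d h : R) (q q0 : bool -> R) : Prop :=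
  (forall b, Rabs (q0 b) <= C) /\ (forall b, Rabs (q b - q0 b) <= C * e) /\
  Rabs (q0 true - q0 false) <= C * d /\
  Rabs ((q true - q0 true) - (q false - q0 false)) <= C * h.

(** An index is a pair of trajectories under comparison. Ranging over all of them makes
    the constants in [ctrl] uniform. *)
Record context := {
  idx :> Type;
  ok : idx -> Prop;
  ee : idx -> R;
  dd : idx -> R;
  hh : idx -> R;
  ctx_ok : forall j, ok j -> 0 <= ee j <= 1 /\ 0 <= dd j /\ 0 <= hh j /\ ee j * dd j <= hh j
}.

Definition ev (J : context) (P : J -> Prop) : Prop :=
  exists e1, 0 < e1 /\ forall j, ok J j -> ee J j <= e1 -> P j.

Lemma ev_and (J : context) (P Q : J -> Prop) : ev J P -> ev J Q -> ev J (fun j => P j /\ Q j).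
Proof.
intros [e1 [H1 HP]] [e2 [H2 HQ]]. exists (Rmin e1 e2). split; [now apply Rmin_glb_lt |].
intros j Hj He. split; [apply HP | apply HQ]; auto; eapply Rle_trans; [exact He | apply Rmin_l | exact He | apply Rmin_r].
Qed.

Lemma ev_imp (J : context) (P Q : J -> Prop) : (forall j, ok J j -> P j -> Q j) -> ev J P -> ev J Q.
Proof. intros H [e1 [H1 HP]]. exists e1. split; [exact H1 |]. auto. Qed.

Lemma ev_ok (J : context) (P : J -> Prop) : (forall j, ok J j -> P j) -> ev J P.
Proof. intros H. exists 1. split; [lra | auto]. Qed.

Lemma ev_small (J : context) (q b : R) : 0 < b -> ev J (fun j => q * ee J j <= b).
Proof.
intros Hb. exists (b / (Rabs q + 1)). assert (P := Rabs_pos q). split; [apply Rdiv_lt_0_compat; lra |].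
intros j Hj He. destruct (ctx_ok J j Hj) as [he _]. assert (B := Rle_abs q).
apply Rle_trans with ((Rabs q + 1) * (b / (Rabs q + 1))); [| right; field; lra].
apply Rle_trans with ((Rabs q + 1) * ee J j); mono.
Qed.

Ltac near H := generalize H; apply ev_imp; intros j Hj.

Definition ctrl (J : context) (q q0 : J -> bool -> R) : Prop :=
  exists C, 1 <= C /\ ev J (fun j => quad C (ee J j) (dd J j) (hh J j) (q j) (q0 j)).

Lemma quad_weaken C C' e d h q q0 :
  0 <= e -> 0 <= d -> 0 <= h -> C <= C' -> quad C e d h q q0 -> quad C' e d h q q0.
Proof.
intros He Hd Hh HC [h1 [h2 [h3 h4]]]. repeat split; try (intros b; eapply Rle_trans; [apply h1 || apply h2 | mono]);
  eapply Rle_trans; [exact h3 | mono | exact h4 | mono].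
Qed.

Lemma quad_diff C e d h q q0 : quad C e d h q q0 -> Rabs (q true - q false) <= C * (d + h).
Proof.
intros [_ [_ [h3 h4]]]. rewrite Rmult_plus_distr_l. apply (Rabs_tri3 _ _ _ _ _ h3 h4). ring.
Qed.

Lemma ctrl_intro (J : context) (q q0 : J -> bool -> R) C :
  ev J (fun j => quad C (ee J j) (dd J j) (hh J j) (q j) (q0 j)) -> ctrl J q q0.
Proof.
intros H. exists (Rabs C + 1). assert (P := Rabs_pos C). assert (B := Rle_abs C). split; [lra |]. near H.
destruct (ctx_ok J j Hj) as [he [hd [hh1 _]]]. apply quad_weaken; lra.
Qed.

Lemma ctrl_zero (J : context) (q : J -> bool -> R) C :
  ev J (fun j => (forall b, Rabs (q j b) <= C * ee J j) /\ Rabs (q j true - q j false) <= C * hh J j) ->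
  ctrl J q (fun _ _ => 0).
Proof.
intros H. apply (ctrl_intro J _ _ (Rabs C)). near H. intros [h1 h2]. destruct (ctx_ok J j Hj) as [he [hd [hh1 _]]].
assert (B := Rle_abs C). unfold quad. rewrite !Rminus_0_r, Rabs_R0. repeat split; try intros b; try pos.
- rewrite Rminus_0_r. eapply Rle_trans; [apply h1 | mono].
- eapply Rle_trans; [exact h2 | mono].
Qed.

Lemma ctrl_base (J : context) (q : J -> bool -> R) C :
  ev J (fun j => (forall b, Rabs (q j b) <= C) /\ Rabs (q j true - q j false) <= C * dd J j) -> ctrl J q q.
Proof.
intros H. apply (ctrl_intro J _ _ (Rabs C)). near H. intros [h1 h2]. destruct (ctx_ok J j Hj) as [he [hd [hh1 _]]].
assert (B := Rle_abs C). unfold quad. rewrite !Rminus_diag, Rabs_R0. repeat split; try intros b; try pos.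
- specialize (h1 b). lra.
- rewrite Rminus_diag, Rabs_R0. pos.
- eapply Rle_trans; [exact h2 | mono].
Qed.

Lemma ctrl_limit (J : context) (q q0 : J -> bool -> R) : ctrl J q q0 -> ctrl J q0 q0.
Proof. intros [C [HC H]]. apply (ctrl_base J _ C). near H. now intros [h1 [_ [h3 _]]]. Qed.

Lemma ctrl_const (J : context) (c : R) : ctrl J (fun _ _ => c) (fun _ _ => c).
Proof.
apply (ctrl_base J _ (Rabs c)), ev_ok. intros j Hj. destruct (ctx_ok J j Hj) as [_ [hd _]].
rewrite Rminus_diag, Rabs_R0. split; [intros _; apply Rle_refl | pos].
Qed.

Lemma ctrl_ext (J : context) (q q0 r r0 : J -> bool -> R) :
  (forall j b, ok J j -> q j b = r j b /\ q0 j b = r0 j b) -> ctrl J q q0 -> ctrl J r r0.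
Proof.
intros E [C [HC H]]. exists C. split; [exact HC |]. near H. unfold quad.
destruct (E j true Hj) as [<- <-]. destruct (E j false Hj) as [<- <-]. intros [h1 [h2 h3]].
split; [| split; [| exact h3]]; intros b; destruct (E j b Hj) as [e1 e2]; rewrite <- ?e1, <- e2; auto.
Qed.

Lemma ctrl_add (J : context) (q q0 r r0 : J -> bool -> R) : ctrl J q q0 -> ctrl J r r0 ->
  ctrl J (fun j b => q j b + r j b) (fun j b => q0 j b + r0 j b).
Proof.
intros [C [HC H]] [C' [HC' H']]. exists (C + C'). split; [lra |]. near (ev_and J _ _ H H').
intros [[h1 [h2 [h3 h4]]] [k1 [k2 [k3 k4]]]]. unfold quad. rewrite !Rmult_plus_distr_r. split; [| split; [| split]].
- intros b. now apply Rabs_add_le.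
- intros b. apply (Rabs_tri3 _ _ _ _ _ (h2 b) (k2 b)). ring.
- apply (Rabs_tri3 _ _ _ _ _ h3 k3). ring.
- apply (Rabs_tri3 _ _ _ _ _ h4 k4). ring.
Qed.

Lemma quad_mul C e d h q q0 r r0 :
  0 <= e <= 1 -> 0 <= d -> 0 <= h -> e * d <= h -> 0 <= C -> quad C e d h q q0 -> quad C e d h r r0 ->
  quad (6 * (C * C)) e d h (fun b => q b * r b) (fun b => q0 b * r0 b).
Proof.
intros He Hd Hh Hed HC [h1 [h2 [h3 h4]]] [k1 [k2 [k3 k4]]].
assert (CC : 0 <= C * C) by nra.
assert (CCe : 0 <= C * C * e) by pos. assert (CCd : 0 <= C * C * d) by pos. assert (CCh : 0 <= C * C * h) by pos.
assert (CCed : C * C * (e * d) <= C * C * h) by mono.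
assert (CCee : C * C * (e * e) <= C * C * e) by (apply Rmult_le_compat_l; nra).
assert (CCeh : C * C * (e * h) <= C * C * h) by (apply Rmult_le_compat_l; nra).
assert (big : forall b, Rabs (r b) <= C + C * e).
{ intros b. apply (Rabs_tri3 _ _ _ _ _ (k1 b) (k2 b)). ring. }
split; [| split; [| split]].
- intros b. eapply Rle_trans; [now apply Rabs_prod | lra].
- intros b. replace (q b * r b - q0 b * r0 b) with ((q b - q0 b) * r b + q0 b * (r b - r0 b)) by ring.
  eapply Rle_trans; [apply Rabs_add_le; apply Rabs_prod; [apply h2 | apply big | apply h1 | apply k2] |]. nra.
- replace (q0 true * r0 true - q0 false * r0 false)
    with ((q0 true - q0 false) * r0 true + q0 false * (r0 true - r0 false)) by ring.
  eapply Rle_trans; [apply Rabs_add_le; apply Rabs_prod; [exact h3 | apply k1 | apply h1 | exact k3] |]. nra.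
- replace (q true * r true - q0 true * r0 true - (q false * r false - q0 false * r0 false))
    with ((((q true - q0 true) - (q false - q0 false)) * r true +
           (q false - q0 false) * ((r0 true - r0 false) + ((r true - r0 true) - (r false - r0 false)))) +
          (q0 true * ((r true - r0 true) - (r false - r0 false)) + (q0 true - q0 false) * (r false - r0 false))) by ring.
  eapply Rle_trans.
  + apply Rabs_add_le; apply Rabs_add_le; apply Rabs_prod; [exact h4 | apply big | apply h2 |
      apply Rabs_add_le; [exact k3 | exact k4] | apply h1 | exact k4 | exact h3 | apply k2].
  + nra.
Qed.

Lemma ctrl_mul (J : context) (q q0 r r0 : J -> bool -> R) : ctrl J q q0 -> ctrl J r r0 ->
  ctrl J (fun j b => q j b * r j b) (fun j b => q0 j b * r0 j b).
Proof.
intros [C [HC H]] [C' [HC' H']]. exists (6 * ((C + C') * (C + C'))). split; [nra |]. near (ev_and J _ _ H H').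
intros [k k']. destruct (ctx_ok J j Hj) as [he [hd [hh1 hed]]].
apply quad_mul; try assumption; [lra | |]; eapply quad_weaken; [.. | exact k | | | | | exact k']; lra.
Qed.

Lemma ctrl_sub (J : context) (q q0 r r0 : J -> bool -> R) : ctrl J q q0 -> ctrl J r r0 ->
  ctrl J (fun j b => q j b - r j b) (fun j b => q0 j b - r0 j b).
Proof.
intros H H'. eapply ctrl_ext; [| exact (ctrl_add J _ _ _ _ H (ctrl_mul J _ _ _ _ (ctrl_const J (-1)) H'))].
intros j b _. split; ring.
Qed.

Lemma ctrl_poly3 (J : context) F (x x0 y y0 z z0 : J -> bool -> R) :
  poly3 F -> ctrl J x x0 -> ctrl J y y0 -> ctrl J z z0 ->
  ctrl J (fun j b => F (x j b) (y j b) (z j b)) (fun j b => F (x0 j b) (y0 j b) (z0 j b)).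
Proof.
intros HF Hx Hy Hz. induction HF as [c | | | | F G _ IHF _ IHG | F G _ IHF _ IHG]; try assumption.
- apply ctrl_const.
- now apply (ctrl_add J).
- now apply (ctrl_mul J).
Qed.

(** A Lipschitz derivative maps second differences to second differences. *)
Lemma quad_C11 (f f' : R -> R) (L lo hi C e d h : R) (q q0 : bool -> R) :
  1 <= L -> 1 <= C -> 0 <= e <= 1 -> 0 <= d -> 0 <= h -> e * d <= h ->
  (forall t, lo <= t <= hi -> is_derive f t (f' t) /\ Rabs (f' t) <= L /\ Rabs (f t) <= L) ->
  (forall t u, lo <= t <= hi -> lo <= u <= hi -> Rabs (f' t - f' u) <= L * Rabs (t - u)) ->
  (forall b, lo <= q b <= hi /\ lo <= q0 b <= hi) ->
  quad C e d h q q0 -> quad (3 * L * (C * C)) e d h (fun b => f (q b)) (fun b => f (q0 b)).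
Proof.
intros HL HC He Hd Hh Hed Hf Hf' I [h1 [h2 [h3 h4]]].
assert (lip : forall t u a, lo <= t <= hi -> lo <= u <= hi -> Rabs (t - u) <= a -> Rabs (f t - f u) <= L * a).
{ intros t u a Ht Hu Ha. apply Rle_trans with (L * Rabs (t - u)); [| mono].
  apply (derive_bound_increment f f'); intros v Hv; apply Hf; apply (between_range _ _ _ _ _ Hu Ht Hv). }
assert (LC : 1 <= L * (C * C)) by nra.
assert (LC1 : L * C <= L * (C * C)) by (apply Rmult_le_compat_l; nra).
assert (LCx : forall x, 0 <= x -> L * (C * x) <= 3 * L * (C * C) * x).
{ intros x Hx. assert (L * C * x <= L * (C * C) * x) by mono. nra. }
split; [| split; [| split]].
- intros b. destruct (Hf (q0 b) (proj2 (I b))) as [_ [_ B]]. nra.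
- intros b. eapply Rle_trans; [apply lip; [apply I | apply I | apply h2] | apply LCx; lra].
- eapply Rle_trans; [apply lip; [apply I | apply I | exact h3] | apply LCx; lra].
- (* the second difference is the increment over s in [0,1] along the segments from q0 to q *)
  set (u := fun b s => q0 b + s * (q b - q0 b)).
  assert (Iu : forall b s, 0 <= s <= 1 -> lo <= u b s <= hi) by (intros b s Hs; destruct (I b); unfold u; nra).
  assert (B := derive_bound_increment (fun s => f (u true s) - f (u false s))
    (fun s => (q true - q0 true) * f' (u true s) - (q false - q0 false) * f' (u false s)) (3 * L * (C * C) * h) 0 1).
  cbv beta in B.
  assert (u1 : forall b, u b 1 = q b) by (intros b; unfold u; ring).
  assert (u0 : forall b, u b 0 = q0 b) by (intros b; unfold u; ring).
  rewrite !u1, !u0, Rminus_0_r, Rabs_R1, Rmult_1_r, Rmin_left, Rmax_right in B by lra.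
  replace (f (q true) - f (q0 true) - (f (q false) - f (q0 false)))
    with (f (q true) - f (q false) - (f (q0 true) - f (q0 false))) by ring.
  apply B; clear B u1 u0; intros s Hs; assert (It := Iu true s Hs); assert (If := Iu false s Hs).
  + apply derive_minus;
      [apply (is_derive_comp f (u true) s); [apply Hf, It |] | apply (is_derive_comp f (u false) s); [apply Hf, If |]];
      unfold u; auto_derive; easy || ring.
  + replace ((q true - q0 true) * f' (u true s) - (q false - q0 false) * f' (u false s))
      with (((q true - q0 true) - (q false - q0 false)) * f' (u true s) + (q false - q0 false) * (f' (u true s) - f' (u false s))) by ring.
    assert (Huu : Rabs (u true s - u false s) <= C * d + C * h).
    { apply (Rabs_tri3 (q0 true - q0 false) (s * ((q true - q0 true) - (q false - q0 false))));
        [exact h3 | | unfold u; ring].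
      rewrite Rabs_mult, (Rabs_pos_eq s) by lra. assert (P := Rabs_pos (q true - q0 true - (q false - q0 false))). nra. }
    eapply Rle_trans.
    { apply Rabs_add_le; apply Rabs_prod; [exact h4 | apply Hf, It | apply h2 |].
      eapply Rle_trans; [now apply Hf' | apply Rmult_le_compat_l; [lra | exact Huu]]. }
    assert (L * (C * C) * (e * d) <= L * (C * C) * h) by mono.
    assert (L * (C * C) * (e * h) <= L * (C * C) * h) by (apply Rmult_le_compat_l; nra).
    assert (L * C * h <= L * (C * C) * h) by mono. nra.
Qed.

Lemma ctrl_C11 (J : context) (f f' : R -> R) (L lo hi : R) (q q0 : J -> bool -> R) :
  1 <= L ->
  (forall t, lo <= t <= hi -> is_derive f t (f' t) /\ Rabs (f' t) <= L /\ Rabs (f t) <= L) ->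
  (forall t u, lo <= t <= hi -> lo <= u <= hi -> Rabs (f' t - f' u) <= L * Rabs (t - u)) ->
  ev J (fun j => forall b, lo <= q j b <= hi /\ lo <= q0 j b <= hi) ->
  ctrl J q q0 -> ctrl J (fun j b => f (q j b)) (fun j b => f (q0 j b)).
Proof.
intros HL Hf Hf' HI [C [HC H]]. exists (3 * L * (C * C)). split; [nra |]. near (ev_and J _ _ HI H).
intros [hi' hq]. destruct (ctx_ok J j Hj) as [he [hd [hh1 hed]]]. now apply (quad_C11 f f' L lo hi).
Qed.

Lemma sqrt_C11 (c hi : R) : 0 < c <= 1 -> 1 <= hi ->
  (forall t, c <= t <= hi -> is_derive sqrt t (/ (2 * sqrt t)) /\ Rabs (/ (2 * sqrt t)) <= hi / (c * c * c) /\ Rabs (sqrt t) <= hi / (c * c * c)) /\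
  (forall t u, c <= t <= hi -> c <= u <= hi -> Rabs (/ (2 * sqrt t) - / (2 * sqrt u)) <= hi / (c * c * c) * Rabs (t - u)).
Proof.
intros Hc Hhi.
assert (Hcc2 : 0 < c * c <= 1) by nra. assert (Hcc : 0 < c * c * c <= 1).
{ split; [apply Rmult_lt_0_compat; lra |]. assert (c * c * c <= 1 * 1) by (apply Rmult_le_compat; lra). lra. }
assert (Hi1 : 1 <= / (c * c * c)) by (rewrite <- Rinv_1 at 1; apply Rinv_le_contravar; lra).
assert (HL : / (c * c * c) <= hi / (c * c * c)) by (unfold Rdiv; nra).
assert (HL2 : hi <= hi / (c * c * c)) by (unfold Rdiv; nra).
assert (sq : forall t, c <= t <= hi -> c <= sqrt t <= hi).
{ intros t Ht. assert (S := sqrt_sqrt t ltac:(lra)). assert (P := sqrt_pos t). split; apply Rnot_lt_le; intros Hl; nra. }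
split.
- intros t Ht. destruct (sq t Ht) as [s1 s2]. split; [| split].
  + auto_derive; [lra | field; lra].
  + rewrite Rabs_pos_eq by (left; apply Rinv_0_lt_compat; lra).
    apply Rle_trans with (/ (c * c * c)); [| exact HL]. apply Rinv_le_contravar; [lra |]. assert (c * (c * c) <= c * 1) by mono. lra.
  + rewrite Rabs_pos_eq; lra.
- intros t u Ht Hu. destruct (sq t Ht) as [s1 s2]. destruct (sq u Hu) as [s3 s4].
  assert (St := sqrt_sqrt t ltac:(lra)). assert (Su := sqrt_sqrt u ltac:(lra)).
  set (a := sqrt t) in *. set (b := sqrt u) in *.
  replace (/ (2 * a) - / (2 * b)) with ((u - t) * / (2 * a * b * (a + b))).
  2:{ rewrite <- St, <- Su. field. repeat split; lra. }
  rewrite Rabs_mult, Rabs_minus_sym, Rmult_comm. apply Rmult_le_compat_r; [apply Rabs_pos |].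
  assert (c * c <= a * b) by nra.
  assert (m : 0 < a * b * (a + b)) by (apply Rmult_lt_0_compat; nra).
  rewrite Rabs_pos_eq.
  2:{ left; apply Rinv_0_lt_compat. nra. }
  apply Rle_trans with (/ (c * c * c)).
  + apply Rinv_le_contravar; [nra |]. assert (c * c * c <= a * b * (a + b)) by (apply Rmult_le_compat; nra). nra.
  + exact HL.
Qed.

(** * Comparison of two trajectories *)

Lemma bac_minus u v a b : bac u a b -> bac v a b -> bac (fun t => u t - v t) a b.
Proof.
intros Hu Hv. apply (bac_plus u (fun t => - v t) a b Hu).
destruct Hv as [Hv [M [HM Bv]]]. split.
- apply (ac_on_dominated _ v v 1); try assumption; [lra |]. intros t r _ _.
  replace (- v t - - v r) with (- (v t - v r)) by ring. rewrite Rabs_Ropp.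
  assert (P := Rabs_pos (v t - v r)). lra.
- exists M. split; [exact HM |]. intros t Ht. rewrite Rabs_Ropp. auto.
Qed.

Section Diff.
Variables (lam K : R) (G1 G2 G3 : R -> R -> R -> R).
Hypothesis HK : 1 <= K.
Hypothesis T1 : tame K G1.
Hypothesis T2 : tame K G2.
Hypothesis T3 : tame K G3.
Let is_flow := is_flow lam G1 G2 G3.

(** Deviation from the unperturbed motion with the same initial values. *)
Definition defect_x (x y : R -> R) (t : R) : R := x t - (x 0 * cos t - y 0 * sin t).
Definition defect_y (x y : R -> R) (t : R) : R := y t - (x 0 * sin t + y 0 * cos t).
Definition defect_s (s : R -> R) (t : R) : R := s t - s 0 * exp (- lam * t).

Lemma flow_defect_lip (M Omega : R) : 0 <= M -> 0 <= Omega -> exists C, 1 <= C /\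
  forall eps x y s, Rabs eps <= 1 -> is_flow eps x y s ->
    Rabs (x 0) <= M -> Rabs (y 0) <= M -> Rabs (s 0) <= Omega * Rabs eps ->
    forall t u, 0 <= t <= 10 -> 0 <= u <= 10 ->
      Rabs (defect_y x y t - defect_y x y u) <= C * Rabs eps * Rabs (t - u) /\
      Rabs (defect_s s t - defect_s s u) <= C * Rabs eps * Rabs (t - u).
Proof.
intros HM HO. destruct (flow_bounds lam K G1 G2 G3 HK T1 T2 T3 M Omega HM HO) as [C [HC FB]].
set (E := exp (Rabs lam * 10)).
assert (HE : 1 <= E) by (unfold E; rewrite <- exp_0; apply exp_le_mono; assert (P := Rabs_pos lam); lra).
assert (Pl := Rabs_pos lam).
assert (q1 : 0 <= Rabs lam * (C + Omega * E)) by (apply Rmult_le_pos; [lra |]; assert (0 <= Omega * E) by pos; lra).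
exists (10 * C + K + Rabs lam * (C + Omega * E)). split; [lra |].
intros eps x y s Heps Hf Hx Hy Hs. destruct (FB eps x y s Heps Hf Hx Hy Hs) as [F1 _]. clear FB.
set (e := Rabs eps) in *. assert (He : 0 <= e) by apply Rabs_pos.
intros t u Ht Hu.
assert (rng : forall c, Rmin u t <= c <= Rmax u t -> 0 <= c <= 10) by (intros c; now apply between_range).
assert (dG : forall F c, tame K F -> Rabs (eps * F (x c) (y c) (s c)) <= K * e).
{ intros F c [_ HF]. rewrite Rabs_mult, Rmult_comm. apply Rmult_le_compat_r; [exact He | apply HF]. }
assert (fin : forall q, q <= 10 * C + K + Rabs lam * (C + Omega * E) -> q * e * Rabs (t - u) <=
   (10 * C + K + Rabs lam * (C + Omega * E)) * e * Rabs (t - u)).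
{ intros q Hq. apply Rmult_le_compat_r; [apply Rabs_pos |]. apply Rmult_le_compat_r; [exact He | exact Hq]. }
assert (ten : forall c, 0 <= c <= 10 -> C * e * c <= 10 * C * e).
{ intros c Hc. replace (10 * C * e) with (C * e * 10) by ring. apply Rmult_le_compat_l; [apply Rmult_le_pos; lra | lra]. }
split.
- eapply Rle_trans; [| apply (fin (10 * C + K)); lra].
  apply (derive_bound_increment (defect_y x y) (fun t => (x t + eps * G2 (x t) (y t) (s t)) - (x 0 * cos t - y 0 * sin t))).
  + intros c _. unfold defect_y. apply (derive_minus y); [apply (Hf c) |]. auto_derive; [easy | ring].
  + intros c Hc. destruct (F1 c (rng c Hc)) as [b1 _].
    replace (x c + eps * G2 (x c) (y c) (s c) - (x 0 * cos c - y 0 * sin c))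
      with ((x c - (x 0 * cos c - y 0 * sin c)) + eps * G2 (x c) (y c) (s c)) by ring.
    tri. assert (B := dG G2 c T2). assert (B' := ten c (rng c Hc)). lra.
- eapply Rle_trans; [| apply (fin (K + Rabs lam * (C + Omega * E))); lra].
  apply (derive_bound_increment (defect_s s) (fun t => (- lam * s t + eps * G3 (x t) (y t) (s t)) - s 0 * (- lam * exp (- lam * t)))).
  + intros c _. unfold defect_s. apply (derive_minus s); [apply (Hf c) |]. auto_derive; [easy | ring].
  + intros c Hc. destruct (F1 c (rng c Hc)) as [_ [_ [_ [_ b5]]]].
    replace (- lam * s c + eps * G3 (x c) (y c) (s c) - s 0 * (- lam * exp (- lam * c)))
      with (- lam * (s c + - (s 0 * exp (- lam * c))) + eps * G3 (x c) (y c) (s c)) by ring.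
    tri. assert (B := dG G3 c T3).
    rewrite Rabs_mult, Rabs_Ropp.
    assert (B1 : Rabs (s c + - (s 0 * exp (- lam * c))) <= C * e + Omega * e * E).
    { tri. rewrite Rabs_Ropp, (Rabs_mult (s 0)), (Rabs_pos_eq (exp _)) by (left; apply exp_pos).
      apply Rplus_le_compat; [exact b5 |]. apply Rmult_le_compat; [apply Rabs_pos | left; apply exp_pos | exact Hs |].
      unfold E. rewrite <- (Rabs_Ropp lam). apply exp_Rabs_le. apply rng, Hc. }
    assert (B2 : Rabs lam * Rabs (s c + - (s 0 * exp (- lam * c))) <= Rabs lam * (C * e + Omega * e * E)) by mono.
    replace ((K + Rabs lam * (C + Omega * E)) * e) with (Rabs lam * (C * e + Omega * e * E) + K * e) by ring. lra.
Qed.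

(** The difference of two trajectories obeys the linear unperturbed system up to eps
    times the difference of the perturbing terms, hence, by [gronwall], up to eps times
    the initial distance; so [drift] applies to it. This is the source of the products
    of e and d in the calculus of second differences. *)
Lemma flow_difference (M : R) : 0 <= M -> exists C, 1 <= C /\
  forall eps x y s x' y' s', Rabs eps <= 1 -> is_flow eps x y s -> is_flow eps x' y' s' ->
    (forall t, 0 <= t <= 10 -> Rabs (x t) <= M /\ Rabs (y t) <= M /\ Rabs (x' t) <= M /\ Rabs (y' t) <= M) ->
    forall S t, Rabs (x 0 - x' 0) + Rabs (y 0 - y' 0) + Rabs (s 0 - s' 0) <= S -> 0 <= t <= 10 ->
      Rabs (x t - x' t) + Rabs (y t - y' t) + Rabs (s t - s' t) <= C * S /\
      Rabs (defect_x x y t - defect_x x' y' t) <= C * Rabs eps * S /\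
      Rabs (defect_y x y t - defect_y x' y' t) <= C * Rabs eps * S /\
      Rabs (defect_s s t - defect_s s' t) <= C * Rabs eps * S /\
      Rabs ((x t * x t + y t * y t - (x 0 * x 0 + y 0 * y 0)) - (x' t * x' t + y' t * y' t - (x' 0 * x' 0 + y' 0 * y' 0)))
        <= C * Rabs eps * S.
Proof.
intros HM.
set (Ga := gronwall_const lam K).
assert (HGa : 1 <= Ga).
{ unfold Ga, gronwall_const. assert (1 <= exp (gronwall_rate lam K * 10)); [| lra].
  rewrite <- exp_0. apply exp_le_mono. unfold gronwall_rate. assert (P := Rabs_pos lam). lra. }
set (D := drift_const lam). assert (HD : 4 <= D) by apply drift_const_ge4.
set (C1 := 10 * D * K * Ga). set (C2 := 40 * (K + M * K) * Ga).
assert (HKG : 1 <= K * Ga) by nra.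
assert (HC1 : 1 <= C1) by (unfold C1; nra).
assert (HMK : 0 <= M * K) by pos.
assert (HC2 : 1 <= C2) by (unfold C2; nra).
exists (Ga + C1 + C2). split; [lra |].
intros eps x y s x' y' s' Heps Hf Hf' HB S t HS Ht.
set (e := Rabs eps) in *. assert (He : 0 <= e) by apply Rabs_pos.
assert (gw : forall u, 0 <= u <= 10 -> Rabs (x u - x' u) + Rabs (y u - y' u) + Rabs (s u - s' u) <= Ga * S).
{ intros u Hu. eapply Rle_trans.
  - apply (gronwall lam K G1 G2 G3 HK T1 T2 T3 eps x y s x' y' s' 0 u Heps ltac:(lra)); [| exact Hf'].
    apply (is_flow_ae lam K G1 G2 G3 HK T1 T2 T3); [lra | exact Hf].
  - apply Rmult_le_compat_l; [fold Ga; lra | exact HS]. }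
assert (HS0 : 0 <= S).
{ assert (P1 := Rabs_pos (x 0 - x' 0)). assert (P2 := Rabs_pos (y 0 - y' 0)). assert (P3 := Rabs_pos (s 0 - s' 0)). lra. }
assert (HeS : 0 <= e * S) by pos.
assert (dG : forall F u, tame K F -> 0 <= u <= 10 ->
  Rabs (eps * F (x u) (y u) (s u) - eps * F (x' u) (y' u) (s' u)) <= K * Ga * e * S).
{ intros F u [HF _] Hu. rewrite <- Rmult_minus_distr_l, Rabs_mult. fold e.
  replace (K * Ga * e * S) with (e * (K * (Ga * S))) by ring. apply Rmult_le_compat_l; [exact He |].
  eapply Rle_trans; [apply HF |]. apply Rmult_le_compat_l; [lra | now apply gw]. }
assert (fin : forall q, 0 <= q <= Ga + C1 + C2 -> q * e * S <= (Ga + C1 + C2) * e * S).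
{ intros q Hq. rewrite !Rmult_assoc. apply Rmult_le_compat_r; lra. }
split. { assert (B := gw t Ht). assert (Ga * S <= (Ga + C1 + C2) * S) by mono. lra. }
assert (Hae : ae_curve (near_center lam (K * Ga * e * S)) (fun t => x t - x' t) (fun t => y t - y' t) (fun t => s t - s' t) 0 t).
{ destruct (is_flow_ae lam K G1 G2 G3 HK T1 T2 T3 eps x y s 0 t ltac:(lra) Hf) as [bx [by_ [bs _]]].
  destruct (is_flow_ae lam K G1 G2 G3 HK T1 T2 T3 eps x' y' s' 0 t ltac:(lra) Hf') as [bx' [by' [bs' _]]].
  split; [now apply bac_minus | split; [now apply bac_minus | split; [now apply bac_minus |]]].
  exists (fun _ => False). split; [apply null_set_empty |]. intros u Hu _.
  destruct (Hf u) as [d1 [d2 d3]]. destruct (Hf' u) as [d1' [d2' d3']].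
  eexists _, _, _. split; [exact (derive_minus _ _ _ _ _ d1 d1') |].
  split; [exact (derive_minus _ _ _ _ _ d2 d2') |]. split; [exact (derive_minus _ _ _ _ _ d3 d3') |].
  assert (Hu10 : 0 <= u <= 10) by lra.
  repeat split.
  - replace (- y u + eps * G1 (x u) (y u) (s u) - (- y' u + eps * G1 (x' u) (y' u) (s' u)) + (y u - y' u))
      with (eps * G1 (x u) (y u) (s u) - eps * G1 (x' u) (y' u) (s' u)) by ring. now apply dG.
  - replace (x u + eps * G2 (x u) (y u) (s u) - (x' u + eps * G2 (x' u) (y' u) (s' u)) - (x u - x' u))
      with (eps * G2 (x u) (y u) (s u) - eps * G2 (x' u) (y' u) (s' u)) by ring. now apply dG.
  - replace (- lam * s u + eps * G3 (x u) (y u) (s u) - (- lam * s' u + eps * G3 (x' u) (y' u) (s' u)) + lam * (s u - s' u))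
      with (eps * G3 (x u) (y u) (s u) - eps * G3 (x' u) (y' u) (s' u)) by ring. now apply dG. }
assert (HKap : 0 <= K * Ga * e * S) by (rewrite Rmult_assoc; apply Rmult_le_pos; lra).
destruct (drift lam (K * Ga * e * S) _ _ _ 0 t ltac:(lra) HKap Hae) as [d1 [d2 d3]].
rewrite Rminus_0_r in d1, d2, d3. fold D in d1, d2, d3.
assert (ten : D * (K * Ga * e * S) * t <= (Ga + C1 + C2) * e * S).
{ apply Rle_trans with (C1 * e * S); [| apply fin; lra].
  replace (C1 * e * S) with (D * (K * Ga * e * S) * 10) by (unfold C1; ring).
  apply Rmult_le_compat_l; [apply Rmult_le_pos; lra | lra]. }
split; [| split; [| split]].
- replace (defect_x x y t - defect_x x' y' t) with (x t - x' t - ((x 0 - x' 0) * cos t - (y 0 - y' 0) * sin t))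
    by (unfold defect_x; ring). lra.
- replace (defect_y x y t - defect_y x' y' t) with (y t - y' t - ((x 0 - x' 0) * sin t + (y 0 - y' 0) * cos t))
    by (unfold defect_y; ring). lra.
- replace (defect_s s t - defect_s s' t) with (s t - s' t - (s 0 - s' 0) * exp (- lam * t))
    by (unfold defect_s; ring). lra.
- set (f := fun t => (x t * x t + y t * y t) - (x' t * x' t + y' t * y' t)).
  replace (x t * x t + y t * y t - (x 0 * x 0 + y 0 * y 0) - (x' t * x' t + y' t * y' t - (x' 0 * x' 0 + y' 0 * y' 0)))
    with (f t - f 0) by (unfold f; ring).
  apply Rle_trans with (C2 * e * S); [| apply fin; lra].
  apply Rle_trans with (4 * (K + M * K) * Ga * e * S * Rabs (t - 0)).
  + apply (derive_bound_increment f (fun t => 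
      (((- y t + eps * G1 (x t) (y t) (s t)) * x t + x t * (- y t + eps * G1 (x t) (y t) (s t)))
         + ((x t + eps * G2 (x t) (y t) (s t)) * y t + y t * (x t + eps * G2 (x t) (y t) (s t)))) -
      (((- y' t + eps * G1 (x' t) (y' t) (s' t)) * x' t + x' t * (- y' t + eps * G1 (x' t) (y' t) (s' t)))
         + ((x' t + eps * G2 (x' t) (y' t) (s' t)) * y' t + y' t * (x' t + eps * G2 (x' t) (y' t) (s' t)))))).
    * intros c _. destruct (Hf c) as [h1 [h2 _]]. destruct (Hf' c) as [h1' [h2' _]].
      unfold f. apply derive_minus; apply derive_plus; apply derive_mult; assumption.
    * intros c Hc. rewrite Rmin_left, Rmax_right in Hc by lra.
      assert (Hc10 : 0 <= c <= 10) by lra. destruct (HB c Hc10) as [m1 [m2 [m3 m4]]].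
      assert (gc := gw c Hc10).
      assert (P1 := Rabs_pos (x c - x' c)). assert (P2 := Rabs_pos (y c - y' c)). assert (P3 := Rabs_pos (s c - s' c)).
      assert (gx : Rabs (x c - x' c) <= Ga * S) by lra. assert (gy : Rabs (y c - y' c) <= Ga * S) by lra.
      assert (D1 := dG G1 c T1 Hc10). assert (D2 := dG G2 c T2 Hc10).
      assert (bG : forall F, tame K F -> Rabs (eps * F (x c) (y c) (s c)) <= K * e).
      { intros F [_ HF]. rewrite Rabs_mult, Rmult_comm. apply Rmult_le_compat_r; [exact He | apply HF]. }
      assert (B1 := bG G1 T1). assert (B2 := bG G2 T2).
      set (g1 := eps * G1 (x c) (y c) (s c)) in *. set (g2 := eps * G2 (x c) (y c) (s c)) in *.
      set (k1 := eps * G1 (x' c) (y' c) (s' c)) in *. set (k2 := eps * G2 (x' c) (y' c) (s' c)) in *.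
      match goal with |- Rabs ?z <= _ => replace z with
        (2 * ((x c - x' c) * g1 + x' c * (g1 - k1)) + 2 * ((y c - y' c) * g2 + y' c * (g2 - k2))) by ring end.
      assert (R2 : Rabs 2 <= 2) by (rewrite Rabs_pos_eq; lra).
      eapply Rle_trans.
      { apply Rabs_add_le; apply Rabs_prod; [exact R2 | | exact R2 |]; apply Rabs_add_le; apply Rabs_prod;
        [exact gx | exact B1 | exact m3 | exact D1 | exact gy | exact B2 | exact m4 | exact D2]. }
      right. ring.
  + rewrite Rminus_0_r, Rabs_pos_eq by lra. unfold C2.
    replace (40 * (K + M * K) * Ga * e * S) with (4 * (K + M * K) * Ga * e * S * 10) by ring.
    apply Rmult_le_compat_l; [| lra]. replace (4 * (K + M * K) * Ga * e * S) with (4 * (K + M * K) * Ga * (e * S)) by ring. pos.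
Qed.
End Diff.

(** * Points of the switching surface and half turns *)

Lemma half_turn_lip sigma chi M X Y X' Y' :
  sigma * sigma = 1 -> 0 < chi -> chi <= X -> chi <= X' -> Rabs Y <= M -> Rabs Y' <= M ->
  Rabs (half_turn sigma X Y - half_turn sigma X' Y') <= (2 / chi + 2 * M / (chi * chi)) * (Rabs (X - X') + Rabs (Y - Y')).
Proof.
intros Hs Hc HX HX' HY HY'.
unfold half_turn.
replace (PI - 2 * (sigma * atan (Y / X)) - (PI - 2 * (sigma * atan (Y' / X'))))
  with (- (2 * (sigma * (atan (Y / X) - atan (Y' / X'))))) by ring.
rewrite Rabs_Ropp, Rabs_mult, sign_abs, (Rabs_pos_eq 2) by lra.
assert (B := atan_1lip (Y / X) (Y' / X')).
assert (PX := Rabs_pos (X - X')). assert (PY := Rabs_pos (Y - Y')). assert (PM := Rabs_pos Y').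
assert (Ic : 0 < / chi) by (apply Rinv_0_lt_compat; lra).
assert (IX : 0 < / X <= / chi) by (split; [apply Rinv_0_lt_compat; lra | apply Rinv_le_contravar; lra]).
assert (IX' : 0 < / X' <= / chi) by (split; [apply Rinv_0_lt_compat; lra | apply Rinv_le_contravar; lra]).
assert (E : Rabs (Y / X - Y' / X') <= / chi * Rabs (Y - Y') + M * (/ chi * / chi) * Rabs (X - X')).
{ replace (Y / X - Y' / X') with (/ X * (Y - Y') + Y' * (/ X * / X') * (X' - X)) by (field; lra).
  tri. rewrite !Rabs_mult.
  rewrite (Rabs_pos_eq (/ X)), (Rabs_pos_eq (/ X')) by lra. rewrite (Rabs_minus_sym X' X).
  apply Rplus_le_compat.
  - apply Rmult_le_compat_r; lra.
  - apply Rmult_le_compat_r; [lra |]. apply Rmult_le_compat; try lra.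
    + apply Rmult_le_pos; lra.
    + apply Rmult_le_compat; lra. }
replace (2 / chi + 2 * M / (chi * chi)) with (2 * (/ chi + M * (/ chi * / chi))) by (field; lra).
assert (m0 : 0 <= M * (/ chi * / chi)) by pos.
assert (0 <= / chi * Rabs (X - X')) by pos.
assert (0 <= M * (/ chi * / chi) * Rabs (Y - Y')) by pos.
lra.
Qed.

Lemma half_turn_range sigma X Y : sigma * sigma = 1 -> 0 < half_turn sigma X Y < 2 * PI.
Proof.
intros Hs. assert (B := atan_bound (Y / X)). unfold half_turn. destruct (sign_cases _ Hs) as [-> | ->]; lra.
Qed.

(** Deeper than [core] by one margin: small perturbations of deep values are core
    values, and small perturbations of core values stay in the domain of the surface. *)
Definition deep (g : switching) (r : R) : Prop := sw_lo g + 2 * sw_margin g <= r <= sw_hi g - 2 * sw_margin g.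

Lemma exits_unique g sigma x y s T T' : exits g sigma x y s T -> exits g sigma x y s T' -> T = T'.
Proof.
intros [h1 [h2 h3]] [k1 [k2 k3]]. destruct (Rtotal_order T T') as [h | [h | h]]; [| exact h |].
- specialize (k3 T ltac:(lra)). rewrite h2 in k3. lra.
- specialize (h3 T' ltac:(lra)). rewrite k2 in h3. lra.
Qed.

Definition circle_x (g : switching) (sigma r t : R) : R := sigma * abscissa g r 0 * cos t - height g r 0 * sin t.
Definition circle_y (g : switching) (sigma r t : R) : R := sigma * abscissa g r 0 * sin t + height g r 0 * cos t.

Definition turn (g : switching) (sigma r : R) : R := half_turn sigma (abscissa g r 0) (height g r 0).

(** First-order change of rho / 2 per unit of eps along one leg, with Q = x G1 + y G2.
    *)
Definition melnikov (g : switching) (Q : R -> R -> R -> R) (sigma r : R) : R :=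
  RInt (fun t => Q (circle_x g sigma r t) (circle_y g sigma r t) 0) 0 (turn g sigma r).

Lemma height_0 g r : height g r 0 = sw_y g r.
Proof. unfold height. ring. Qed.

Lemma base_bounds g r : sw_lo g <= r <= sw_hi g ->
  sw_gap g / 2 <= abscissa g r 0 <= sw_hi g + 2 /\ Rabs (height g r 0) <= sw_hi g + 2 /\
  abscissa g r 0 * abscissa g r 0 + height g r 0 * height g r 0 = r.
Proof.
intros Hr. assert (P := sw_gap_pos g).
destruct (abscissa_bounds g r 0 Hr) as [_ [A2 [A3 A4]]]; rewrite ?Rabs_R0; [lra | lra |].
split; [exact A2 | split; [exact A3 | exact A4]].
Qed.

Section StartCtrl.
Variables (g : switching) (J : context) (r r0 w : J -> bool -> R).
Hypothesis Hd : forall j b, ok J j -> deep g (r0 j b).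
Hypothesis Hr : ctrl J r r0.
Hypothesis Hw : ctrl J w (fun _ _ => 0).

Lemma ev_core : ev J (fun j => forall b, core g (r j b)).
Proof.
assert (Hm := sw_margin_pos g). destruct Hr as [C [HC HQ]].
near (ev_and J _ _ HQ (ev_small J C (sw_margin g) Hm)). intros [[_ [h _]] hs] b.
assert (d := Hd j b Hj). specialize (h b). unfold deep in d. unfold core. apply Rabs_le_between in h. lra.
Qed.

Lemma ctrl_height : ctrl J (fun j b => height g (r j b) (w j b)) (fun j b => height g (r0 j b) 0).
Proof.
unfold height. apply ctrl_add; [| apply ctrl_mul; [apply ctrl_const | exact Hw]].
assert (L1 := sw_lip_ge1 g). assert (L0 := sw_lo_pos g). assert (Hl := sw_hi_lo g). assert (Hm := sw_margin_pos g).
apply (ctrl_C11 J (sw_y g) (sw_d g) (sw_lip g + sw_hi g + 1) (sw_lo g) (sw_hi g)); try assumption.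
- lra.
- intros t Ht. split; [now apply sw_derive |].
  split; eapply Rle_trans; [now apply sw_d_bound | lra | now apply sw_y_bound | lra].
- intros t u Ht Hu. eapply Rle_trans; [now apply sw_d_lip | mono].
- near ev_core. intros h b. specialize (h b). assert (d := Hd j b Hj). unfold core in h. unfold deep in d. lra.
Qed.

Lemma ev_abscissa : ev J (fun j => forall b, sw_gap g / 2 <= r j b - height g (r j b) (w j b) * height g (r j b) (w j b) /\
  sw_gap g / 2 <= abscissa g (r j b) (w j b) <= sw_hi g + 2 /\ Rabs (height g (r j b) (w j b)) <= sw_hi g + 2 /\
  abscissa g (r j b) (w j b) * abscissa g (r j b) (w j b) + height g (r j b) (w j b) * height g (r j b) (w j b) = r j b).
Proof.
assert (P := sw_gap_pos g). assert (L0 := sw_lo_pos g). assert (Hl := sw_hi_lo g). assert (Hm := sw_margin_pos g).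
destruct Hw as [C [HC HQ]].
near (ev_and J _ _ (ev_and J _ _ ev_core HQ)
  (ev_and J _ _ (ev_small J ((2 * sw_hi g + 3) * C) (sw_gap g / 2) ltac:(lra)) (ev_small J C 1 ltac:(lra)))).
intros [[c [_ [h _]]] [e1 e2]] b. specialize (c b). specialize (h b). rewrite Rminus_0_r in h. unfold core in c.
apply abscissa_bounds; [lra | | lra]. apply Rle_trans with ((2 * sw_hi g + 3) * (C * ee J j)); [mono | lra].
Qed.

Lemma ctrl_abscissa : ctrl J (fun j b => abscissa g (r j b) (w j b)) (fun j b => abscissa g (r0 j b) 0).
Proof.
assert (P := sw_gap_pos g). assert (L0 := sw_lo_pos g). assert (Hl := sw_hi_lo g). assert (Hm := sw_margin_pos g).
set (chi := sw_gap g / 2). assert (Hchi : 0 < chi <= 1) by (unfold chi; lra).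
destruct (sqrt_C11 chi (sw_hi g + 1) Hchi ltac:(lra)) as [S1 S2].
apply (ctrl_C11 J sqrt (fun t => / (2 * sqrt t)) ((sw_hi g + 1) / (chi * chi * chi)) chi (sw_hi g + 1)); try assumption.
- assert (0 < chi * chi <= 1) by nra. assert (0 < chi * chi * chi) by (apply Rmult_lt_0_compat; lra).
  assert (chi * chi * chi <= 1 * 1) by (apply Rmult_le_compat; lra).
  assert (1 <= / (chi * chi * chi)) by (rewrite <- Rinv_1 at 1; apply Rinv_le_contravar; lra).
  unfold Rdiv. nra.
- near (ev_and J _ _ ev_abscissa ev_core). intros [A c] b. assert (d := Hd j b Hj).
  destruct (A b) as [A1 _]. specialize (c b). unfold core in c. unfold deep in d.
  destruct (abscissa_bounds g (r0 j b) 0 ltac:(lra)) as [A2 _]; rewrite ?Rabs_R0; [lra | lra |].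
  assert (sq : forall a, 0 <= a * a) by (intros; apply Rle_0_sqr).
  assert (S3 := sq (height g (r j b) (w j b))). assert (S4 := sq (height g (r0 j b) 0)). fold chi in A1, A2. lra.
- apply ctrl_sub; [exact Hr |]. apply (ctrl_mul J); apply ctrl_height.
Qed.
End StartCtrl.

(** * Control of one leg *)

Lemma cos_small_1lip a b r : Rabs a <= r -> Rabs b <= r -> Rabs (cos a - cos b) <= r * Rabs (a - b).
Proof.
intros Ha Hb. apply Rabs_le_between in Ha. apply Rabs_le_between in Hb.
apply (derive_bound_increment cos (fun t => - sin t)).
- intros v _. auto_derive; [easy | ring].
- intros v Hv. rewrite Rabs_Ropp. eapply Rle_trans.
  + replace (sin v) with (sin v - sin 0) by (rewrite sin_0; ring). apply sin_1lip.
  + rewrite Rminus_0_r. apply Rabs_le. revert Hv. unfold Rmin, Rmax. destruct (Rle_dec b a); lra.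
Qed.

Lemma sin_expand a b : Rabs a <= 1 -> Rabs b <= 1 -> Rabs (a - b) <= 2 * Rabs (sin a - sin b).
Proof.
intros Ha Hb. apply Rabs_le_between in Ha. apply Rabs_le_between in Hb.
assert (HPI := PI2_3_2).
destruct (MVT_gen sin b a cos) as [c [Hc E]].
- intros x _. auto_derive; [easy | ring].
- intros x _. apply continuity_pt_filterlim. apply (ex_derive_continuous sin). auto_derive. easy.
- assert (Hc1 : -1 <= c <= 1) by (revert Hc; unfold Rmin, Rmax; destruct (Rle_dec b a); lra).
  assert (H : 1 / 2 <= cos c).
  { rewrite <- cos_PI3. destruct (Rle_lt_dec 0 c) as [h | h].
    - apply cos_decr_1; lra.
    - rewrite <- (cos_neg c). apply cos_decr_1; lra. }
  rewrite E, Rabs_mult, (Rabs_pos_eq (cos c)) by lra. assert (P := Rabs_pos (a - b)). nra.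
Qed.

Lemma exp_lip lam t u : 0 <= t <= 10 -> 0 <= u <= 10 ->
  Rabs (exp (- lam * t) - exp (- lam * u)) <= Rabs lam * exp (Rabs lam * 10) * Rabs (t - u).
Proof.
intros Ht Hu. apply (derive_bound_increment (fun t => exp (- lam * t)) (fun t => - lam * exp (- lam * t))).
- intros v _. auto_derive; [easy | ring].
- intros v Hv. rewrite Rabs_mult, Rabs_Ropp. apply Rmult_le_compat_l; [apply Rabs_pos |].
  rewrite Rabs_pos_eq by (left; apply exp_pos). rewrite <- (Rabs_Ropp lam). apply exp_Rabs_le.
  apply (between_range _ _ _ _ _ Hu Ht Hv).
Qed.

Lemma poly3_continuous F (a b c : R -> R) t : poly3 F ->
  continuous a t -> continuous b t -> continuous c t -> continuous (fun r => F (a r) (b r) (c r)) t.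
Proof.
intros HF Ha Hb Hc. induction HF as [k | | | | F G _ IHF _ IHG | F G _ IHF _ IHG]; try assumption.
- apply continuous_const.
- now apply (continuous_plus (fun r => F (a r) (b r) (c r)) (fun r => G (a r) (b r) (c r))).
- now apply (continuous_mult (fun r => F (a r) (b r) (c r)) (fun r => G (a r) (b r) (c r))).
Qed.

(** A time joins the index, for estimates uniform along trajectories. *)
Definition timed (J : context) (D : R -> Prop) : context.
Proof.
refine (Build_context (idx J * R) (fun p => ok J (fst p) /\ D (snd p))
  (fun p => ee J (fst p)) (fun p => dd J (fst p)) (fun p => hh J (fst p)) _).
intros [j t] [Hj _]. apply (ctx_ok J j Hj).
Defined.

Lemma ev_timed (J : context) (D : R -> Prop) (P : J -> R -> Prop) :
  ev J (fun j => forall t, D t -> P j t) -> ev (timed J D) (fun p => P (fst p) (snd p)).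
Proof. intros [e1 [He H]]. exists e1. split; [exact He |]. intros [j t] [Hj Ht] he. now apply H. Qed.

Lemma ctrl_timed (J : context) (D : R -> Prop) (q q0 : J -> bool -> R) : ctrl J q q0 ->
  ctrl (timed J D) (fun p => q (fst p)) (fun p => q0 (fst p)).
Proof. intros [C [HC [e1 [He H]]]]. exists C. split; [exact HC |]. exists e1. split; [exact He |]. intros [j t] [Hj _]. now apply H. Qed.

Lemma timed_ev (J : context) (D : R -> Prop) (P : J -> R -> Prop) :
  ev (timed J D) (fun p => P (fst p) (snd p)) -> ev J (fun j => forall t, D t -> P j t).
Proof. intros [e1 [He H]]. exists e1. split; [exact He |]. intros j Hj he t Ht. now apply (H (j, t)). Qed.

Section LegCtrl.
Variables (lam K : R) (G1 G2 G3 : R -> R -> R -> R) (Q : R -> R -> R -> R) (g : switching) (sigma : R).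
Hypothesis HK : 1 <= K.
Hypothesis HT1 : tame K G1.
Hypothesis HT2 : tame K G2.
Hypothesis HT3 : tame K G3.
Hypothesis HQ : poly3 Q.
Hypothesis HQG : forall x y s, Rabs x <= 2 * sw_hi g + 6 -> Rabs y <= 2 * sw_hi g + 6 ->
  Rabs s <= 2 * sw_hi g + 6 -> x * G1 x y s + y * G2 x y s = Q x y s.
Hypothesis Hsig : sigma * sigma = 1.

Variable (J : context).
Variables (eps : J -> R) (r r0 w T : J -> bool -> R) (x y s : J -> bool -> R -> R).
Hypothesis Heps : forall j, ok J j -> Rabs (eps j) = ee J j /\ eps j <> 0.
Hypothesis Hdeep : forall j b, ok J j -> deep g (r0 j b).
Hypothesis Hr : ctrl J r r0.
Hypothesis Hw : ctrl J w (fun _ _ => 0).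
Hypothesis Hdep : forall j b, ok J j -> departs lam G1 G2 G3 g sigma (eps j) (r j b) (w j b) (x j b) (y j b) (s j b).
Hypothesis Hex : forall j b, ok J j -> exits g sigma (x j b) (y j b) (s j b) (T j b).

Let X (j : J) (b : bool) : R := abscissa g (r j b) (w j b).
Let Y (j : J) (b : bool) : R := height g (r j b) (w j b).
Let X0 (j : J) (b : bool) : R := abscissa g (r0 j b) 0.
Let Y0 (j : J) (b : bool) : R := height g (r0 j b) 0.
Let b0 (j : J) (b : bool) : R := turn g sigma (r0 j b).
Let tau (j : J) (b : bool) : R := T j b - b0 j b.
Let rho (j : J) (b : bool) (t : R) : R := x j b t * x j b t + y j b t * y j b t.
Let dx (j : J) (b : bool) (t : R) : R := defect_x (x j b) (y j b) t.
Let dy (j : J) (b : bool) (t : R) : R := defect_y (x j b) (y j b) t.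
Let ds (j : J) (b : bool) (t : R) : R := defect_s lam (s j b) t.
Let M := sw_hi g + 2.
Let span (t : R) : Prop := 0 <= t <= 10.
Let CX : ctrl J X X0 := ctrl_abscissa g J r r0 w Hdeep Hr Hw.
Let CY : ctrl J Y Y0 := ctrl_height g J r r0 w Hdeep Hr Hw.

(** All the estimates on a pair of legs, with a common constant. [lf_diff] and [lf_ds]
    compare the two trajectories at equal times, [lf_lip] the same trajectory at
    different times. *)
Record leg_facts (C : R) (j : J) : Prop := {
  lf_w : forall b, Rabs (w j b) <= C * ee J j;
  lf_dw : Rabs (w j true - w j false) <= C * hh J j;
  lf_turn : forall b, 0 < b0 j b <= 8;
  lf_dturn : Rabs (b0 j true - b0 j false) <= C * dd J j;
  lf_time : forall b, span (T j b);
  lf_tau : forall b, Rabs (tau j b) <= C * ee J j;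
  lf_start : forall b, rho j b 0 = r j b;
  lf_box : forall b t, span t -> Rabs (x j b t) <= 2 * M + 1 /\ Rabs (y j b t) <= 2 * M + 1 /\ Rabs (s j b t) <= 1;
  lf_size : forall b t, span t -> Rabs (dx j b t) <= C * ee J j /\ Rabs (dy j b t) <= C * ee J j /\
    Rabs (s j b t) <= C * ee J j /\ Rabs (rho j b t - r j b) <= C * ee J j;
  lf_lip : forall b t u, span t -> span u ->
    Rabs (dy j b t - dy j b u) <= C * ee J j * Rabs (t - u) /\ Rabs (ds j b t - ds j b u) <= C * ee J j * Rabs (t - u) /\
    Rabs (s j b t - s j b u) <= C * ee J j * Rabs (t - u) /\ Rabs (rho j b t - rho j b u) <= C * ee J j * Rabs (t - u);
  lf_diff : forall t, span t -> Rabs (dx j true t - dx j false t) <= C * hh J j /\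
    Rabs (dy j true t - dy j false t) <= C * hh J j /\ Rabs (s j true t - s j false t) <= C * hh J j /\
    Rabs ((rho j true t - r j true) - (rho j false t - r j false)) <= C * hh J j;
  lf_ds : forall t, span t -> Rabs (ds j true t - ds j false t) <= C * ee J j * (dd J j + hh J j)
}.

Lemma base_turn : forall j b, ok J j -> 0 < b0 j b <= 8 /\ sw_gap g / 2 <= X0 j b <= M /\ Rabs (Y0 j b) <= M.
Proof.
intros j b Hj. assert (d := Hdeep j b Hj). unfold deep in d. assert (Hm := sw_margin_pos g).
destruct (base_bounds g (r0 j b) ltac:(lra)) as [a1 [a2 _]]. assert (P4 := PI_4).
assert (R1 := half_turn_range sigma (X0 j b) (Y0 j b) Hsig). split; [| split; assumption].
change (b0 j b) with (half_turn sigma (X0 j b) (Y0 j b)). lra.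
Qed.

Lemma facts : exists C, 1 <= C /\ ev J (leg_facts C).
Proof.
assert (P := sw_gap_pos g). assert (L0 := sw_lo_pos g). assert (Hl := sw_hi_lo g).
assert (HM : 2 <= M) by (unfold M; lra).
destruct CX as [C1 [HC1 E1]]. destruct CY as [C2 [HC2 E2]]. destruct Hw as [Om [HOm E3]].
destruct (leg_exit lam K G1 G2 G3 HK HT1 HT2 HT3 g sigma Om Hsig ltac:(lra)) as [C3 [e1 [HC3 [He1 LE]]]].
destruct (flow_bounds lam K G1 G2 G3 HK HT1 HT2 HT3 M Om ltac:(lra) ltac:(lra)) as [C4 [HC4 FB]].
destruct (flow_defect_lip lam K G1 G2 G3 HK HT1 HT2 HT3 M Om ltac:(lra) ltac:(lra)) as [C5 [HC5 FD]].
destruct (flow_difference lam K G1 G2 G3 HK HT1 HT2 HT3 (2 * M + 1) ltac:(lra)) as [C6 [HC6 FF]].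
set (chi := sw_gap g / 2). set (k := 2 / chi + 2 * M / (chi * chi)). assert (Hchi : 0 < chi) by (unfold chi; lra).
assert (Hk : 0 <= k) by (unfold k; apply Rplus_le_le_0_compat; apply Rdiv_le_0_compat; nra).
set (A := exp (Rabs lam * 10)).
assert (p1 : 0 <= k * (C1 + C2)) by pos. assert (p2 : 0 <= C6 * (C1 + C2 + Om)) by pos. assert (p3 : 0 <= Om * A) by pos.
set (C := Om + C3 + k * (C1 + C2) + 10 * C4 + C5 + 2 * (C6 * (C1 + C2 + Om)) + Om * A).
exists C. split; [unfold C; lra |].
near (ev_and J _ _ (ev_and J _ _ (ev_and J _ _ E1 E2) (ev_and J _ _ E3 (ev_small J (10 * C4) 1 ltac:(lra))))
  (ev_and J _ _ (ev_and J _ _ (ev_core g J r r0 Hdeep Hr) (ev_abscissa g J r r0 w Hdeep Hr Hw))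
    (ev_and J _ _ (ev_small J 1 e1 ltac:(lra)) (ev_small J (C4 * Om) 1 ltac:(lra))))).
intros [[[qX qY] [qw sm1]] [[core A0] [sm2 _]]].
destruct (Heps j Hj) as [he _]. destruct (ctx_ok J j Hj) as [hee [hd [hh1 hed]]].
assert (qX' := quad_diff _ _ _ _ _ _ qX). assert (qY' := quad_diff _ _ _ _ _ _ qY).
destruct qX as [_ [X2 [X3 _]]]. destruct qY as [_ [Y2 [Y3 _]]]. destruct qw as [_ [w2 [_ w4]]]. rewrite !Rminus_0_r in w4.
assert (hw : forall b, Rabs (w j b) <= Om * ee J j) by (intros b; rewrite <- (Rminus_0_r (w j b)); apply w2).
assert (up : forall c z, 0 <= z -> c <= C -> c * z <= C * z) by (intros; mono).
assert (A1 : forall b, chi <= X j b <= M /\ Rabs (Y j b) <= M /\ X j b * X j b + Y j b * Y j b = r j b) by (intros b; apply (A0 b)).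
assert (BT := fun b => base_turn j b Hj). fold chi in BT.
assert (ht : forall u v u' v', chi <= u -> chi <= u' -> Rabs v <= M -> Rabs v' <= M ->
  Rabs (half_turn sigma u v - half_turn sigma u' v') <= k * (Rabs (u - u') + Rabs (v - v')))
  by (intros; now apply half_turn_lip).
assert (f1 : forall b, x j b 0 = sigma * X j b) by (intros b; apply (Hdep j b Hj)).
assert (f2 : forall b, y j b 0 = Y j b) by (intros b; apply (Hdep j b Hj)).
assert (f3 : forall b, s j b 0 = w j b) by (intros b; apply (Hdep j b Hj)).
assert (start : forall b, rho j b 0 = r j b).
{ intros b. unfold rho. rewrite f1, f2, <- (proj2 (proj2 (A1 b))).
  transitivity (sigma * sigma * (X j b * X j b) + Y j b * Y j b); [ring |]. rewrite Hsig. ring. }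
assert (sx : forall b, Rabs (x j b 0) <= M).
{ intros b. destruct (A1 b). rewrite f1, sign_abs, Rabs_pos_eq; lra. }
assert (sy : forall b, Rabs (y j b 0) <= M) by (intros b; rewrite f2; apply A1).
assert (ss : forall b, Rabs (s j b 0) <= Om * Rabs (eps j)) by (intros b; rewrite f3, he; apply hw).
assert (fl := fun b => proj1 (Hdep j b Hj)).
assert (B := fun b => FB (eps j) (x j b) (y j b) (s j b) ltac:(lra) (fl b) (sx b) (sy b) (ss b)).
assert (D := fun b => FD (eps j) (x j b) (y j b) (s j b) ltac:(lra) (fl b) (sx b) (sy b) (ss b)).
assert (EX : forall b, T j b <= 10 /\ Rabs (tau j b) <= (C3 + k * (C1 + C2)) * ee J j).
{ intros b. destruct (LE (eps j) (r j b) (w j b) (x j b) (y j b) (s j b)) as [t1 [u1 [u2 [_ [u3 _]]]]];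
    [lra | apply core | rewrite he; apply hw | now apply Hdep |].
  rewrite <- (exits_unique _ _ _ _ _ _ _ (Hex j b Hj) u1), ?he in *. split; [exact u2 |].
  rewrite Rmult_plus_distr_r. apply (Rabs_tri3 _ (half_turn sigma (X j b) (Y j b) - b0 j b) _ _ _ u3); [| unfold tau, X, Y; ring].
  destruct (A1 b) as [a1 [a2 _]]. destruct (BT b) as [_ [a3 a4]]. eapply Rle_trans; [apply (ht (X j b) (Y j b) (X0 j b) (Y0 j b)); assumption || lra |].
  specialize (X2 b). specialize (Y2 b). apply Rle_trans with (k * (C1 * ee J j + C2 * ee J j)); [mono | right; ring]. }
assert (ten : forall t, span t -> C4 * ee J j * t <= 10 * C4 * ee J j).
{ intros t [Ht Ht']. replace (10 * C4 * ee J j) with (C4 * ee J j * 10) by ring. mono. }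
assert (dfx : forall b t, span t -> Rabs (dx j b t) <= 10 * C4 * ee J j /\ Rabs (dy j b t) <= 10 * C4 * ee J j).
{ intros b t Ht. destruct (proj1 (B b) t Ht) as [b1 [b2 _]]. rewrite he in b1, b2. assert (tt := ten t Ht).
  split; eapply Rle_trans; [exact b1 | exact tt | exact b2 | exact tt]. }
assert (box : forall b t, span t -> Rabs (x j b t) <= 2 * M + 1 /\ Rabs (y j b t) <= 2 * M + 1).
{ intros b t Ht. destruct (dfx b t Ht) as [b1 b2]. rewrite (Rplus_comm (2 * M)).
  assert (k1 := Rabs_cos_le1 t). assert (k2 := Rabs_sin_le1 t).
  assert (k3 : Rabs (- sin t) <= 1) by (rewrite Rabs_Ropp; exact k2).
  split; [apply (Rabs_tri3 (dx j b t) (x j b 0 * cos t + y j b 0 * - sin t)) | apply (Rabs_tri3 (dy j b t) (x j b 0 * sin t + y j b 0 * cos t))];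
    try lra; try (now apply Rabs_comb_le; auto); unfold dx, dy, defect_x, defect_y; ring. }
assert (HS : Rabs (x j true 0 - x j false 0) + Rabs (y j true 0 - y j false 0) + Rabs (s j true 0 - s j false 0) <=
   (C1 + C2 + Om) * (dd J j + hh J j)).
{ rewrite !f1, !f2, !f3, <- Rmult_minus_distr_l, sign_abs by exact Hsig.
  assert (Om * hh J j <= Om * (dd J j + hh J j)) by mono. lra. }
assert (F := fun t => FF (eps j) _ _ _ _ _ _ ltac:(lra) (fl true) (fl false)
  ltac:(intros u Hu; split; [apply (box true u Hu) | split; [apply (box true u Hu) | apply (box false u Hu)]]) _ t HS).
rewrite he in F.
assert (eh : ee J j * (dd J j + hh J j) <= 2 * hh J j) by (assert (ee J j * hh J j <= 1 * hh J j) by mono; lra).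
assert (strong : forall z, z <= C6 * ee J j * ((C1 + C2 + Om) * (dd J j + hh J j)) -> z <= C6 * (C1 + C2 + Om) * ee J j * (dd J j + hh J j)).
{ intros z Hz. eapply Rle_trans; [exact Hz | right; ring]. }
assert (weak : forall z, z <= C6 * ee J j * ((C1 + C2 + Om) * (dd J j + hh J j)) -> z <= 2 * (C6 * (C1 + C2 + Om)) * hh J j).
{ intros z Hz. apply strong in Hz. assert (C6 * (C1 + C2 + Om) * (ee J j * (dd J j + hh J j)) <= C6 * (C1 + C2 + Om) * (2 * hh J j)) by mono. lra. }
split.
- intros b. eapply Rle_trans; [apply hw | apply up; unfold C; lra].
- eapply Rle_trans; [exact w4 | apply up; unfold C; lra].
- intros b. apply BT.
- destruct (BT true) as [_ [a1 a2]]. destruct (BT false) as [_ [a3 a4]].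
  eapply Rle_trans; [apply (ht (X0 j true) (Y0 j true) (X0 j false) (Y0 j false)); assumption || lra |]. apply Rle_trans with (k * (C1 + C2) * dd J j); [| apply up; unfold C; lra].
  rewrite Rmult_assoc. apply Rmult_le_compat_l; [exact Hk | lra].
- intros b. split; [left; apply (Hex j b Hj) | apply EX].
- intros b. eapply Rle_trans; [apply EX | apply up; unfold C; lra].
- exact start.
- intros b t Ht. destruct (box b t Ht). destruct (proj1 (B b) t Ht) as [_ [_ [_ [_ b5]]]]. rewrite he in b5.
  repeat split; try assumption. lra.
- intros b t Ht. destruct (dfx b t Ht) as [b1 b2]. destruct (proj1 (B b) t Ht) as [_ [_ [_ [_ b5]]]].
  destruct (proj2 (B b) t 0 Ht ltac:(unfold span; lra)) as [_ [_ [_ b6]]]. fold (rho j b t) (rho j b 0) in b6.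
  rewrite start, Rminus_0_r, (Rabs_pos_eq t), he in b6 by apply Ht. rewrite he in b5. assert (tt := ten t Ht).
  assert (u1 : 10 * C4 * ee J j <= C * ee J j) by (apply up; unfold C; lra).
  assert (u2 : C4 * ee J j <= C * ee J j) by (apply up; unfold C; lra). repeat split; lra.
- intros b t u Ht Hu. destruct (D b t u Ht Hu) as [b1 b2]. destruct (proj2 (B b) t u Ht Hu) as [_ [_ [b3 b4]]]. rewrite he in *.
  assert (up2 : forall c, c <= C -> c * ee J j * Rabs (t - u) <= C * ee J j * Rabs (t - u)) by (intros; mono).
  assert (u1 := up2 C5 ltac:(unfold C; lra)). assert (u2 := up2 C4 ltac:(unfold C; lra)).
  split; [exact (Rle_trans _ _ _ b1 u1) | split; [exact (Rle_trans _ _ _ b2 u1) |]].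
  split; [exact (Rle_trans _ _ _ b3 u2) | exact (Rle_trans _ _ _ b4 u2)].
- intros t Ht. destruct (F t Ht) as [_ [b1 [b2 [b3 b4]]]].
  assert (u1 : 2 * (C6 * (C1 + C2 + Om)) * hh J j <= C * hh J j) by (apply up; unfold C; lra).
  split; [exact (Rle_trans _ _ _ (weak _ b1) u1) | split; [exact (Rle_trans _ _ _ (weak _ b2) u1) |]].
  split; [| rewrite <- !start; exact (Rle_trans _ _ _ (weak _ b4) u1)].
  apply Rle_trans with ((2 * (C6 * (C1 + C2 + Om)) + Om * A) * hh J j); [| apply up; unfold C; lra].
  rewrite Rmult_plus_distr_r. apply (Rabs_tri3 (ds j true t - ds j false t) ((w j true - w j false) * exp (- lam * t)));
    [exact (weak _ b3) | | unfold ds, defect_s; rewrite !f3; ring].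
  replace (Om * A * hh J j) with (Om * hh J j * A) by ring. apply Rabs_prod; [exact w4 |].
  rewrite Rabs_pos_eq by (left; apply exp_pos). unfold A. rewrite <- (Rabs_Ropp lam). now apply exp_Rabs_le.
- intros t Ht. destruct (F t Ht) as [_ [_ [_ [b3 _]]]]. apply strong in b3. eapply Rle_trans; [exact b3 |].
  apply Rmult_le_compat_r; [lra |]. apply up; unfold C; lra.
Qed.

(** The exit times of the two legs differ by an amount that is not controlled yet. It is
    first added to the admissible size of second differences; [exit_time_ctrl] then
    shows that this has changed nothing. *)
Definition time_context : context.
Proof.
refine (Build_context (idx J) (ok J) (ee J) (dd J) (fun j => hh J j + ee J j * Rabs (tau j true - tau j false)) _).
intros j Hj. destruct (ctx_ok J j Hj) as [he [hd [hh1 hed]]].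
assert (0 <= ee J j * Rabs (tau j true - tau j false)) by pos. repeat split; lra.
Defined.
Let J2 := time_context.

Lemma ctrl_J2 (q q0 : J -> bool -> R) : ctrl J q q0 -> ctrl J2 q q0.
Proof.
intros [C [HC H]]. exists C. split; [exact HC |].
change (ev J (fun j => quad C (ee J j) (dd J j) (hh J j + ee J j * Rabs (tau j true - tau j false)) (q j) (q0 j))).
near H. intros [h1 [h2 [h3 h4]]]. destruct (ctx_ok J j Hj) as [he _].
assert (0 <= C * (ee J j * Rabs (tau j true - tau j false))) by (repeat apply Rmult_le_pos; lra || apply Rabs_pos).
repeat split; auto. lra.
Qed.

(** Compare at equal times, then move along one of the trajectories. *)
Lemma at_exit (f : J -> bool -> R -> R) (C : R) : 0 <= C ->
  ev J (fun j => (forall b t, span t -> Rabs (f j b t) <= C * ee J j) /\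
    (forall t, span t -> Rabs (f j true t - f j false t) <= C * hh J j) /\
    (forall t u, span t -> span u -> Rabs (f j false t - f j false u) <= C * ee J j * Rabs (t - u))) ->
  ctrl J2 (fun j b => f j b (T j b)) (fun _ _ => 0).
Proof.
intros HC H. destruct facts as [C1 [HC1 F]].
apply (ctrl_zero J2 _ (C * (2 + C1))).
change (ev J (fun j => (forall b, Rabs (f j b (T j b)) <= C * (2 + C1) * ee J j) /\
  Rabs (f j true (T j true) - f j false (T j false)) <= C * (2 + C1) * (hh J j + ee J j * Rabs (tau j true - tau j false)))).
near (ev_and J _ _ H F). intros [[h1 [h2 h3]] L]. assert (dt := lf_dturn _ _ L). assert (Ti := lf_time _ _ L). destruct (ctx_ok J j Hj) as [he [hd [hh1 hed]]].
set (z := Rabs (tau j true - tau j false)) in *. split.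
- intros b. eapply Rle_trans; [apply h1, Ti |]. apply Rmult_le_compat_r; [lra | nra].
- assert (B : Rabs (T j true - T j false) <= C1 * dd J j + z).
  { apply (Rabs_tri3 _ (tau j true - tau j false) _ _ _ dt); [apply Rle_refl | unfold tau; ring]. }
  apply Rle_trans with (C * hh J j + C * ee J j * (C1 * dd J j + z)).
  + apply (Rabs_tri3 _ _ _ _ _ (h2 _ (Ti true)) (Rle_trans _ _ _ (h3 _ _ (Ti true) (Ti false))
      (Rmult_le_compat_l _ _ _ (Rmult_le_pos _ _ HC (proj1 he)) B))). ring.
  + assert (0 <= ee J j * z) by pos. assert (C * C1 * (ee J j * dd J j) <= C * C1 * hh J j) by (apply Rmult_le_compat_l; [pos | lra]).
    assert (0 <= C * (ee J j * z)) by pos. assert (0 <= C * C1 * (ee J j * z)) by (apply Rmult_le_pos; [apply Rmult_le_pos; lra | lra]).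
    assert (0 <= C * hh J j) by pos. lra.
Qed.

Lemma exit_rho_J2 : ctrl J2 (fun j b => rho j b (T j b)) r0.
Proof.
destruct facts as [C [HC F]].
assert (Z : ctrl J2 (fun j b => rho j b (T j b) - r j b) (fun _ _ => 0)).
{ apply (at_exit (fun j b t => rho j b t - r j b) C); [lra |]. near F. intros L. split; [| split].
  - intros b t Ht. apply (lf_size _ _ L b t Ht).
  - intros t Ht. apply (lf_diff _ _ L t Ht).
  - intros t u Ht Hu. replace (rho j false t - r j false - (rho j false u - r j false)) with (rho j false t - rho j false u) by ring.
    apply (lf_lip _ _ L false t u Ht Hu). }
eapply ctrl_ext; [| exact (ctrl_add J2 _ _ _ _ (ctrl_J2 _ _ Hr) Z)]. intros j b _. split; ring.
Qed.

Lemma exit_s_J2 : ctrl J2 (fun j b => s j b (T j b)) (fun _ _ => 0).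
Proof.
destruct facts as [C [HC F]]. apply (at_exit s C); [lra |]. near F. intros L. split; [| split].
- intros b t Ht. apply (lf_size _ _ L b t Ht).
- intros t Ht. apply (lf_diff _ _ L t Ht).
- intros t u Ht Hu. apply (lf_lip _ _ L false t u Ht Hu).
Qed.

Lemma exit_defect_J2 : ctrl J2 (fun j b => dy j b (T j b)) (fun _ _ => 0).
Proof.
destruct facts as [C [HC F]]. apply (at_exit dy C); [lra |]. near F. intros L. split; [| split].
- intros b t Ht. apply (lf_size _ _ L b t Ht).
- intros t Ht. apply (lf_diff _ _ L t Ht).
- intros t u Ht Hu. apply (lf_lip _ _ L false t u Ht Hu).
Qed.

Lemma ctrl_turn : ctrl J b0 b0.
Proof.
destruct facts as [C [HC F]]. apply (ctrl_base J b0 (8 + C)). near F. intros L. assert (h := lf_turn _ _ L). assert (h' := lf_dturn _ _ L).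
destruct (ctx_ok J j Hj) as [_ [hd _]]. split; [| eapply Rle_trans; [exact h' | mono]].
intros b. destruct (h b). rewrite Rabs_pos_eq; lra.
Qed.

Lemma ctrl_lip (Jc : context) (f : R -> R) (q : Jc -> bool -> R) : (forall t, Rabs (f t) <= 1) ->
  (forall t u, Rabs (f t - f u) <= Rabs (t - u)) -> ctrl Jc q q -> ctrl Jc (fun j b => f (q j b)) (fun j b => f (q j b)).
Proof.
intros Hf Hl [C [HC H]]. apply (ctrl_base Jc _ C). near H. intros [_ [_ [h _]]].
split; [intros b; specialize (Hf (q j b)); lra | exact (Rle_trans _ _ _ (Hl _ _) h)].
Qed.

Let XL (j : J) (b : bool) : R := sigma * X j b * cos (b0 j b) - Y j b * sin (b0 j b).
Let YL (j : J) (b : bool) : R := sigma * X j b * sin (b0 j b) + Y j b * cos (b0 j b).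

Lemma turned_ctrl : ctrl J XL (fun j b => - (sigma * X0 j b)) /\ ctrl J YL Y0.
Proof.
assert (Cc := ctrl_lip J cos _ Rabs_cos_le1 cos_1lip ctrl_turn). assert (Cs := ctrl_lip J sin _ Rabs_sin_le1 sin_1lip ctrl_turn).
assert (CsX := ctrl_mul J _ _ _ _ (ctrl_const J sigma) CX). assert (P := sw_gap_pos g).
assert (H : forall j b, ok J j -> sigma * X0 j b * cos (b0 j b) - Y0 j b * sin (b0 j b) = - (sigma * X0 j b) /\
   sigma * X0 j b * sin (b0 j b) + Y0 j b * cos (b0 j b) = Y0 j b).
{ intros j b Hj. destruct (base_turn j b Hj) as [_ [a _]].
  destruct (half_turn_spec sigma (X0 j b) (Y0 j b) 0 Hsig ltac:(lra)) as [z [_ [h1 [h2 _]]]]. now split. }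
split; [eapply ctrl_ext; [| exact (ctrl_sub J _ _ _ _ (ctrl_mul J _ _ _ _ CsX Cc) (ctrl_mul J _ _ _ _ CY Cs))] |
  eapply ctrl_ext; [| exact (ctrl_add J _ _ _ _ (ctrl_mul J _ _ _ _ CsX Cs) (ctrl_mul J _ _ _ _ CY Cc))]];
  intros j b Hj; split; reflexivity || apply (H j b Hj).
Qed.

(** The exit condition in the frame turned by the unperturbed half turn: only tau = T -
    b0 appears. *)
Lemma exit_equation j b : ok J j ->
  XL j b * sin (tau j b) + YL j b * cos (tau j b) = height g (rho j b (T j b)) (s j b (T j b)) - dy j b (T j b).
Proof.
intros Hj. destruct (Hdep j b Hj) as [_ [f1 [f2 _]]]. destruct (Hex j b Hj) as [_ [ha _]]. unfold above in ha.
assert (hy : y j b (T j b) = height g (rho j b (T j b)) (s j b (T j b))) by (unfold rho; lra). rewrite <- hy.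
unfold dy, defect_y. rewrite f1, f2. fold (X j b) (Y j b). unfold XL, YL, tau. rewrite sin_minus, cos_minus.
assert (SC := sin2_cos2 (b0 j b)). unfold Rsqr in SC.
transitivity ((sigma * X j b * sin (T j b) + Y j b * cos (T j b)) * (sin (b0 j b) * sin (b0 j b) + cos (b0 j b) * cos (b0 j b))); [ring |].
rewrite SC. ring.
Qed.

(** The exit equation is solved for sin tau, sine being expanding near 0 up to a factor
    2. The difference of the two values of tau comes back on the right with a factor e.
    *)
Lemma exit_time_ctrl : ctrl J T b0.
Proof.
destruct turned_ctrl as [[C2 [HC2 E2]] CYL].
assert (CN := ctrl_sub J2 _ _ _ _ (ctrl_sub J2 _ _ _ _ (ctrl_height g J2 _ _ _ Hdeep exit_rho_J2 exit_s_J2) exit_defect_J2) (ctrl_J2 _ _ CYL)).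
destruct CN as [C1 [HC1 E1]]. change (ev J2) with (ev J) in E1. destruct CYL as [C3 [HC3 E3]]. destruct facts as [C4 [HC4 E4]].
assert (P := sw_gap_pos g). set (chi := sw_gap g / 2). assert (Hchi : 0 < chi) by (unfold chi; lra).
assert (HC42 : 0 <= C4 * C2) by pos. assert (HC43 : 0 <= C4 * C3) by pos.
set (D := C1 + 2 * C4 * C2 + 2 * C4 * C3 + 2 * C3 * C4).
set (F := 4 / chi * D). assert (HF : 0 <= F) by (apply Rmult_le_pos; [apply Rdiv_le_0_compat; lra | unfold D; lra]).
apply (ctrl_intro J _ _ (8 + C4 + 2 * F)).
near (ev_and J _ _ (ev_and J _ _ (ev_and J _ _ E1 E2) (ev_and J _ _ E3 E4))
  (ev_and J _ _ (ev_small J C4 1 ltac:(lra)) (ev_and J _ _ (ev_small J F (1 / 2) ltac:(lra)) (ev_small J C2 (chi / 2) ltac:(lra))))).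
intros [[[n q] [c L]] [sm1 [sm2 sm3]]]. assert (t1 := lf_turn _ _ L). assert (t2 := lf_dturn _ _ L). assert (t3 := lf_tau _ _ L). destruct (ctx_ok J j Hj) as [he [hd [hh1 hed]]].
set (e := ee J j) in *. set (z := Rabs (tau j true - tau j false)).
set (N := fun b => height g (rho j b (T j b)) (s j b (T j b)) - dy j b (T j b) - YL j b).
assert (nN : Rabs (N true - N false) <= C1 * (hh J j + e * z)).
{ destruct n as [_ [_ [_ n]]]. eapply Rle_trans; [| exact n]. right. f_equal. unfold N, Y0. ring. }
assert (p : forall b, XL j b * sin (tau j b) = N b - YL j b * (cos (tau j b) - 1)).
{ intros b. assert (E := exit_equation j b Hj). unfold N. lra. }
assert (key : XL j true * (sin (tau j true) - sin (tau j false)) =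
  ((N true - N false) + - (sin (tau j false) * (XL j true - XL j false))) +
  - ((YL j true - YL j false) * (cos (tau j true) - cos 0) + YL j false * (cos (tau j true) - cos (tau j false)))).
{ rewrite cos_0. assert (p1 := p true). assert (p2 := p false). lra. }
assert (s1 : Rabs (sin (tau j false)) <= C4 * e).
{ rewrite <- (Rminus_0_r (sin _)), <- sin_0. eapply Rle_trans; [apply sin_1lip |]. rewrite Rminus_0_r. apply t3. }
assert (s2 : Rabs (cos (tau j true) - cos 0) <= C4 * e).
{ eapply Rle_trans; [apply cos_1lip |]. rewrite Rminus_0_r. apply t3. }
assert (s3 := cos_small_1lip _ _ _ (t3 true) (t3 false)). fold e z in s3.
assert (hY : Rabs (YL j false) <= 2 * C3).
{ destruct c as [c2 [c4 _]]. apply Rle_trans with (C3 + C3 * e); [apply (Rabs_tri3 _ _ _ _ _ (c2 false) (c4 false)); cbv beta; lra |].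
  assert (C3 * e <= C3 * 1) by mono. lra. }
assert (hed2 : e * (dd J j + hh J j) <= 2 * hh J j) by (assert (e * hh J j <= 1 * hh J j) by mono; lra).
assert (bound : Rabs (XL j true * (sin (tau j true) - sin (tau j false))) <= D * (hh J j + e * z)).
{ rewrite key. eapply Rle_trans.
  { apply Rabs_add_le; [apply Rabs_add_le; [exact nN |] |]; rewrite Rabs_Ropp;
      [| apply Rabs_add_le]; apply Rabs_prod; [exact s1 | exact (quad_diff _ _ _ _ _ _ q) | exact (quad_diff _ _ _ _ _ _ c) | exact s2 | exact hY | exact s3]. }
  assert (C4 * C2 * (e * (dd J j + hh J j)) <= C4 * C2 * (2 * hh J j)) by mono.
  assert (C4 * C3 * (e * (dd J j + hh J j)) <= C4 * C3 * (2 * hh J j)) by mono.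
  assert (0 <= C4 * C2 * (e * z)) by pos. assert (0 <= C4 * C3 * (e * z)) by pos.
  assert (0 <= C4 * C3 * hh J j) by pos. unfold D. lra. }
assert (hX : chi / 2 <= Rabs (XL j true)).
{ destruct (base_turn j true Hj) as [_ [a1 _]]. fold chi in a1. destruct q as [_ [b3 _]]. specialize (b3 true).
  assert (B := Rabs_triang_inv (- (sigma * X0 j true)) (XL j true)). rewrite Rabs_minus_sym in b3. fold e in b3.
  rewrite Rabs_Ropp, sign_abs, (Rabs_pos_eq (X0 j true)) in B by lra. cbv beta in b3. lra. }
assert (bound2 : z <= F * (hh J j + e * z)).
{ assert (a1 := t3 true). assert (a2 := t3 false). fold e in a1, a2. assert (ex := sin_expand (tau j true) (tau j false) ltac:(lra) ltac:(lra)).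
  rewrite Rabs_mult in bound. assert (Ps := Rabs_pos (sin (tau j true) - sin (tau j false))). fold z in ex.
  assert (chi / 2 * Rabs (sin (tau j true) - sin (tau j false)) <= D * (hh J j + e * z)).
  { eapply Rle_trans; [apply Rmult_le_compat_r; [exact Ps | exact hX] | exact bound]. }
  apply Rmult_le_reg_l with (chi / 4); [lra |].
  replace (chi / 4 * (F * (hh J j + e * z))) with (D * (hh J j + e * z)) by (unfold F; field; lra). nra. }
(* the term with e z is absorbed on the left *)
assert (fin : z <= 2 * F * hh J j).
{ assert (F * e * z <= 1 / 2 * z) by mono. lra. }
assert (up : forall c v, 0 <= v -> c <= 8 + C4 + 2 * F -> c * v <= (8 + C4 + 2 * F) * v) by (intros; mono).
split; [| split; [| split]].
- intros b. destruct (t1 b). rewrite Rabs_pos_eq; lra.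
- intros b. eapply Rle_trans; [apply (t3 b) | apply up; lra].
- eapply Rle_trans; [exact t2 | apply up; lra].
- eapply Rle_trans; [exact fin | apply up; lra].
Qed.

Lemma ctrl_of_J2 (q q0 : J -> bool -> R) : ctrl J2 q q0 -> ctrl J q q0.
Proof.
intros [C [HC E]]. change (ev J2) with (ev J) in E. destruct exit_time_ctrl as [C2 [HC2 E2]].
exists (C * (1 + C2)). split; [nra |]. near (ev_and J _ _ E E2). intros [[h1 [h2 [h3 h4]]] [_ [_ [_ k4]]]].
destruct (ctx_ok J j Hj) as [he [hd [hh1 _]]]. assert (CC : C <= C * (1 + C2)) by nra. split; [| split; [| split]].
- intros b. specialize (h1 b). lra.
- intros b. eapply Rle_trans; [apply (h2 b) |]. apply Rmult_le_compat_r; [apply he | lra].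
- eapply Rle_trans; [exact h3 |]. apply Rmult_le_compat_r; [apply hd | lra].
- eapply Rle_trans; [exact h4 |]. rewrite Rmult_assoc. apply Rmult_le_compat_l; [lra |].
  change (hh J2 j) with (hh J j + ee J j * Rabs (tau j true - tau j false)). fold (tau j true) (tau j false) in k4.
  assert (ee J j * Rabs (tau j true - tau j false) <= 1 * (C2 * hh J j)) by (apply Rmult_le_compat; lra || apply Rabs_pos). lra.
Qed.

(** The remainder has Lipschitz constant O(eps), more than control alone would give; the
    contraction or expansion of s by mu has to dominate it. *)
Lemma exit_s_linear : exists C, 1 <= C /\ ev J (fun j =>
  (forall b, 0 < b0 j b <= 8) /\ Rabs (b0 j true - b0 j false) <= C * dd J j /\
  (forall b, Rabs (s j b (T j b) - exp (- lam * b0 j b) * w j b) <= C * ee J j) /\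
  Rabs ((s j true (T j true) - exp (- lam * b0 j true) * w j true) - (s j false (T j false) - exp (- lam * b0 j false) * w j false)) <=
    C * ee J j * (dd J j + hh J j)).
Proof.
destruct facts as [C [HC E1]]. destruct exit_time_ctrl as [C2 [HC2 E2]].
set (L := Rabs lam * exp (Rabs lam * 10)). assert (HL : 0 <= L) by (unfold L; pos).
assert (g1 : 0 <= C * (L * C)) by pos. assert (g2 : 0 <= C * C2) by pos. assert (g3 : 0 <= C * (L * (C2 + C))) by pos.
assert (g4 : 0 <= C * (L * 20)) by pos. set (F := 10 * C + C * (L * 20) + C * C2 + C * (L * C) + C * (L * (C2 + C))).
exists F. split; [unfold F; lra |].
near (ev_and J _ _ E1 E2). intros [Lf q]. destruct (ctx_ok J j Hj) as [hee [hd [hh1 hed]]].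
apply quad_diff in q. assert (tu := lf_turn _ _ Lf). assert (ti := lf_time _ _ Lf). unfold span in ti.
set (e := ee J j) in *. set (S := dd J j + hh J j) in *. assert (HS : 0 <= S) by (unfold S; lra).
assert (up : forall c z, 0 <= z -> c <= F -> c * z <= F * z) by (intros; mono).
set (Xp := fun b => exp (- lam * T j b) - exp (- lam * b0 j b)).
assert (hb : forall b, 0 <= b0 j b <= 10) by (intros b; destruct (tu b); lra).
assert (hX : forall b, Rabs (Xp b) <= L * Rabs (tau j b)) by (intros b; now apply exp_lip).
assert (eq : forall b, s j b (T j b) - exp (- lam * b0 j b) * w j b = ds j b (T j b) + w j b * Xp b).
{ intros b. destruct (Hdep j b Hj) as [_ [_ [_ f3]]]. unfold ds, defect_s, Xp. rewrite f3. ring. }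
rewrite !eq. split; [exact tu |]. split; [eapply Rle_trans; [apply (lf_dturn _ _ Lf) | apply up; unfold F; lra] |]. split.
- intros b. rewrite eq. apply Rle_trans with (10 * C * e + C * e * (L * 20)).
  + apply Rabs_add_le; [| apply Rabs_prod; [apply (lf_w _ _ Lf) |]].
    * destruct (lf_lip _ _ Lf b (T j b) 0 (ti b) ltac:(unfold span; lra)) as [_ [h _]]. fold e in h.
      replace (ds j b 0) with 0 in h by (unfold ds, defect_s; rewrite Rmult_0_r, exp_0; ring).
      rewrite !Rminus_0_r, (Rabs_pos_eq (T j b)) in h by apply ti. specialize (ti b).
      assert (C * e * T j b <= C * e * 10) by mono. lra.
    * eapply Rle_trans; [apply hX |]. apply Rmult_le_compat_l; [exact HL |].
      specialize (ti b). specialize (hb b). unfold tau. apply Rabs_le. lra.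
  + replace (10 * C * e + C * e * (L * 20)) with ((10 * C + C * (L * 20)) * e) by ring. apply up; [apply hee | unfold F; lra].
- assert (hX1 : Rabs (Xp true) <= L * (C * e)).
  { eapply Rle_trans; [apply hX |]. apply Rmult_le_compat_l; [exact HL | apply (lf_tau _ _ Lf)]. }
  assert (hX2 : Rabs (Xp true - Xp false) <= L * (C2 * S) + L * (C * S)).
  { apply (Rabs_tri3 (exp (- lam * T j true) - exp (- lam * T j false)) (- (exp (- lam * b0 j true) - exp (- lam * b0 j false))));
      [| rewrite Rabs_Ropp | unfold Xp; ring]; (eapply Rle_trans; [now apply exp_lip | apply Rmult_le_compat_l; [exact HL |]]).
    - exact q.
    - eapply Rle_trans; [apply (lf_dturn _ _ Lf) | apply Rmult_le_compat_l; unfold S; lra]. }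
  destruct (lf_lip _ _ Lf false _ _ (ti true) (ti false)) as [_ [h1 _]].
  replace (ds j true (T j true) + w j true * Xp true - (ds j false (T j false) + w j false * Xp false)) with
    (((ds j true (T j true) - ds j false (T j true)) + (ds j false (T j true) - ds j false (T j false)))
      + ((w j true - w j false) * Xp true + w j false * (Xp true - Xp false))) by ring.
  eapply Rle_trans.
  { apply Rabs_add_le; apply Rabs_add_le; [apply (lf_ds _ _ Lf), ti | exact h1 |
      apply Rabs_prod; [apply (lf_dw _ _ Lf) | exact hX1] | apply Rabs_prod; [apply (lf_w _ _ Lf) | exact hX2]]. }
  fold e S. assert (i1 : C * e * Rabs (T j true - T j false) <= C * e * (C2 * S)) by (apply Rmult_le_compat_l; [pos | exact q]).
  assert (i2 : C * (L * C) * (e * hh J j) <= C * (L * C) * (e * S)) by (apply Rmult_le_compat_l; [exact g1 | apply Rmult_le_compat_l; unfold S; lra]).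
  assert (0 <= C * (L * 20) * (e * S)) by pos. assert (0 <= C * (e * S)) by pos. unfold F. lra.
Qed.

Let q (j : J) (b : bool) (t : R) : R := Q (circle_x g sigma (r0 j b) t) (circle_y g sigma (r0 j b) t) 0.

(** The phase phi allows the unperturbed circles to be compared from their end points as
    well as from their starting points. *)
Lemma rotated_ctrl (D : R -> Prop) (U U0 V V0 phi : J -> bool -> R) : ctrl J U U0 -> ctrl J V V0 -> ctrl J phi phi ->
  let co := fun p b => cos (phi (fst p) b + snd p) in let si := fun p b => sin (phi (fst p) b + snd p) in
  ctrl (timed J D) (fun p b => sigma * U (fst p) b * co p b - V (fst p) b * si p b)
    (fun p b => sigma * U0 (fst p) b * co p b - V0 (fst p) b * si p b) /\
  ctrl (timed J D) (fun p b => sigma * U (fst p) b * si p b + V (fst p) b * co p b)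
    (fun p b => sigma * U0 (fst p) b * si p b + V0 (fst p) b * co p b).
Proof.
intros HU HV [C [HC Hphi]] co si.
apply (ctrl_timed J D) in HU. apply (ctrl_timed J D) in HV. assert (HsU := ctrl_mul _ _ _ _ _ (ctrl_const _ sigma) HU).
assert (trig : forall f, (forall t, Rabs (f t) <= 1) -> (forall t u, Rabs (f t - f u) <= Rabs (t - u)) ->
  ctrl (timed J D) (fun p b => f (phi (fst p) b + snd p)) (fun p b => f (phi (fst p) b + snd p))).
{ intros f Hf Hl. apply (ctrl_base _ _ C).
  apply (ev_timed J D (fun j t => (forall b, Rabs (f (phi j b + t)) <= C) /\ Rabs (f (phi j true + t) - f (phi j false + t)) <= C * dd J j)).
  near Hphi. intros [_ [_ [h _]]] t _. split; [intros b; specialize (Hf (phi j b + t)); lra |].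
  eapply Rle_trans; [apply Hl |]. replace (phi j true + t - (phi j false + t)) with (phi j true - phi j false) by ring. exact h. }
assert (Hc := trig cos Rabs_cos_le1 cos_1lip). assert (Hs := trig sin Rabs_sin_le1 sin_1lip).
split; [exact (ctrl_sub _ _ _ _ _ (ctrl_mul _ _ _ _ _ HsU Hc) (ctrl_mul _ _ _ _ _ HV Hs)) |
  exact (ctrl_add _ _ _ _ _ (ctrl_mul _ _ _ _ _ HsU Hs) (ctrl_mul _ _ _ _ _ HV Hc))].
Qed.

Lemma along_circle (phi : J -> bool -> R) : ctrl J phi phi -> exists C, 1 <= C /\ ev J (fun j => forall t, True ->
  (forall b, Rabs (q j b (phi j b + t)) <= C) /\ Rabs (q j true (phi j true + t) - q j false (phi j false + t)) <= C * dd J j).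
Proof.
intros Hphi. destruct (rotated_ctrl (fun _ => True) X0 X0 Y0 Y0 phi (ctrl_limit _ _ _ CX) (ctrl_limit _ _ _ CY) Hphi) as [Fx Fy].
destruct (ctrl_poly3 _ Q _ _ _ _ _ _ HQ Fx Fy (ctrl_const _ 0)) as [C [HC H]].
exists C. split; [exact HC |]. apply (timed_ev J (fun _ => True) (fun j t => _ /\ _)). near H. now intros [h1 [_ [h3 _]]].
Qed.

Lemma along_flow : exists C, 1 <= C /\ ev J (fun j => forall t, span t ->
  (forall b, Rabs (Q (x j b t) (y j b t) (s j b t) - q j b t) <= C * ee J j) /\
  Rabs ((Q (x j true t) (y j true t) (s j true t) - q j true t) - (Q (x j false t) (y j false t) (s j false t) - q j false t)) <= C * hh J j).
Proof.
destruct facts as [C [HC E]].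
assert (Z : forall f : J -> bool -> R -> R, (forall j, ok J j -> leg_facts C j -> forall t, span t ->
    (forall b, Rabs (f j b t) <= C * ee J j) /\ Rabs (f j true t - f j false t) <= C * hh J j) ->
  ctrl (timed J span) (fun p b => f (fst p) b (snd p)) (fun _ _ => 0)).
{ intros f Hf. apply (ctrl_zero _ _ C).
  apply (ev_timed J span (fun j t => (forall b, Rabs (f j b t) <= C * ee J j) /\ Rabs (f j true t - f j false t) <= C * hh J j)).
  near E. now apply Hf. }
assert (Dx := Z dx ltac:(intros j Hj L t Ht; split; [intros b; apply (lf_size _ _ L b t Ht) | apply (lf_diff _ _ L t Ht)])).
assert (Dy := Z dy ltac:(intros j Hj L t Ht; split; [intros b; apply (lf_size _ _ L b t Ht) | apply (lf_diff _ _ L t Ht)])).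
assert (Ds := Z s ltac:(intros j Hj L t Ht; split; [intros b; apply (lf_size _ _ L b t Ht) | apply (lf_diff _ _ L t Ht)])).
destruct (rotated_ctrl span X X0 Y Y0 (fun _ _ => 0) CX CY (ctrl_const J 0)) as [Rx Ry].
assert (Fx : ctrl (timed J span) (fun p b => x (fst p) b (snd p)) (fun p b => circle_x g sigma (r0 (fst p) b) (snd p))).
{ eapply ctrl_ext; [| exact (ctrl_add _ _ _ _ _ Rx Dx)]. intros [j t] b [Hj _]. destruct (Hdep j b Hj) as [_ [f1 [f2 _]]].
  simpl. unfold dx, defect_x, circle_x, X0, Y0, X, Y. rewrite f1, f2, Rplus_0_l. split; ring. }
assert (Fy : ctrl (timed J span) (fun p b => y (fst p) b (snd p)) (fun p b => circle_y g sigma (r0 (fst p) b) (snd p))).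
{ eapply ctrl_ext; [| exact (ctrl_add _ _ _ _ _ Ry Dy)]. intros [j t] b [Hj _]. destruct (Hdep j b Hj) as [_ [f1 [f2 _]]].
  simpl. unfold dy, defect_y, circle_y, X0, Y0, X, Y. rewrite f1, f2, Rplus_0_l. split; ring. }
destruct (ctrl_poly3 _ Q _ _ _ _ _ _ HQ Fx Fy Ds) as [C5 [HC5 H]].
exists C5. split; [exact HC5 |]. apply (timed_ev J span (fun j t => _ /\ _)). near H. now intros [_ [h2 [_ h4]]].
Qed.

(** The rotation does not contribute to x x' + y y', so that (rho - r) / (2 eps) is the
    integral of Q along the trajectory. It is compared with the integral along the
    circle up to the same time, and the latter with the integral up to b0. *)
Lemma exit_gain_ctrl : ctrl J (fun j b => (rho j b (T j b) - r j b) / (2 * eps j)) (fun j b => melnikov g Q sigma (r0 j b)).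
Proof.
destruct (along_circle (fun _ _ => 0) (ctrl_const J 0)) as [C1 [HC1 E1]]. destruct (along_circle b0 ctrl_turn) as [C2 [HC2 E2]].
destruct along_flow as [C3 [HC3 E3]]. destruct facts as [C4 [HC4 E4]]. destruct exit_time_ctrl as [C5 [HC5 E5]].
assert (HM : 2 <= M) by (assert (L0 := sw_lo_pos g); assert (Hl := sw_hi_lo g); unfold M; lra).
assert (p1 : 0 <= C1 * C4) by pos. assert (p2 : 0 <= C2 * C4) by pos. assert (p3 : 0 <= C3 * C5) by pos. assert (p4 : 0 <= C1 * C5) by pos.
set (F := 10 * C1 + 10 * C3 + C1 * C4 + C2 * C4 + 2 * (C3 * C5) + C1 * C5).
apply (ctrl_intro J _ _ F).
near (ev_and J _ _ (ev_and J _ _ E1 E2) (ev_and J _ _ E3 (ev_and J _ _ E4 E5))).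
intros [[A1 A2] [A3 [L q5]]]. destruct (ctx_ok J j Hj) as [he [hd [hh1 hed]]]. destruct (Heps j Hj) as [_ heps].
assert (qT := quad_diff _ _ _ _ _ _ q5). destruct q5 as [_ [_ [_ q6]]]. fold (tau j true) (tau j false) in q6.
assert (tu := lf_turn _ _ L). assert (dtu := lf_dturn _ _ L). assert (ti := lf_time _ _ L). assert (ta := lf_tau _ _ L).
assert (qb : forall b t, Rabs (q j b t) <= C1) by (intros b t; rewrite <- (Rplus_0_l t); now apply A1).
assert (qd : forall t, Rabs (q j true t - q j false t) <= C1 * dd J j) by (intros t; rewrite <- (Rplus_0_l t); now apply A1).
set (Mn := fun b t => RInt (q j b) 0 t). set (I := fun b t => (rho j b t - r j b) / (2 * eps j)).
assert (q_cont : forall b t, continuous (q j b) t).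
{ intros b t. apply (poly3_continuous Q (circle_x g sigma (r0 j b)) (circle_y g sigma (r0 j b)) (fun _ => 0));
    [exact HQ | apply (ex_derive_continuous (circle_x g sigma (r0 j b))); unfold circle_x; auto_derive; easy |
      apply (ex_derive_continuous (circle_y g sigma (r0 j b))); unfold circle_y; auto_derive; easy | apply continuous_const]. }
assert (dM : forall b t, is_derive (Mn b) t (q j b t)).
{ intros b t. apply (is_derive_RInt (q j b) _ 0 t); [| apply q_cont]. apply filter_forall. intros v.
  apply (RInt_correct (q j b)). apply (ex_RInt_continuous (V := R_CompleteNormedModule)). intros z _. apply q_cont. }
assert (M0 : forall b, Mn b 0 = 0) by (intros b; apply (RInt_point (V := R_CompleteNormedModule) 0 (q j b))).
assert (I0 : forall b, I b 0 = 0) by (intros b; unfold I; rewrite (lf_start _ _ L); unfold Rdiv; ring).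
assert (dI : forall b t, span t -> is_derive (I b) t (Q (x j b t) (y j b t) (s j b t))).
{ intros b t Ht. destruct (lf_box _ _ L b t Ht) as [b1 [b2 b3]]. destruct (Hdep j b Hj) as [Hf _]. destruct (Hf t) as [d1 [d2 _]].
  assert (D := derive_minus _ _ _ _ _ (derive_plus _ _ _ _ _ (derive_mult _ _ _ _ _ d1 d1) (derive_mult _ _ _ _ _ d2 d2))
    (is_derive_const (K := R_AbsRing) (V := R_NormedModule) (r j b) t)).
  assert (D2 := derive_mult _ _ _ _ _ D (is_derive_const (K := R_AbsRing) (V := R_NormedModule) (/ (2 * eps j)) t)).
  rewrite <- HQG by (unfold M in *; lra). unfold I, rho, Rdiv.
  match type of D2 with is_derive _ _ ?l => match goal with |- is_derive _ _ ?l' => replace l' with l; [exact D2 |] end end.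
  unfold zero; simpl. field. exact heps. }
assert (rng : forall t u c, span t -> span u -> Rmin u t <= c <= Rmax u t -> span c) by (intros t u c Ht Hu; now apply between_range).
assert (near1 : forall b t u, span t -> span u -> Rabs ((I b t - Mn b t) - (I b u - Mn b u)) <= C3 * ee J j * Rabs (t - u)).
{ intros b t u Ht Hu. apply (derive_bound_increment (fun t => I b t - Mn b t) (fun t => Q (x j b t) (y j b t) (s j b t) - q j b t)); intros c Hc.
  - apply derive_minus; [apply dI; now apply (rng t u) | apply dM].
  - apply (A3 c). now apply (rng t u). }
assert (z0 : span 0) by (unfold span; lra).
assert (near2 : forall t, span t -> Rabs ((I true t - Mn true t) - (I false t - Mn false t)) <= C3 * hh J j * Rabs (t - 0)).
{ intros t Ht. assert (B := derive_bound_increment (fun t => (I true t - Mn true t) - (I false t - Mn false t))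
    (fun t => (Q (x j true t) (y j true t) (s j true t) - q j true t) - (Q (x j false t) (y j false t) (s j false t) - q j false t)) (C3 * hh J j) 0 t).
  cbv beta in B. rewrite !I0, !M0, !Rminus_diag, Rminus_0_r in B. apply B; intros c Hc.
  - apply derive_minus; apply derive_minus; [apply dI; now apply (rng t 0) | apply dM | apply dI; now apply (rng t 0) | apply dM].
  - apply (A3 c). now apply (rng t 0). }
assert (Mlip : forall b t u, Rabs (Mn b t - Mn b u) <= C1 * Rabs (t - u)).
{ intros b t u. apply (derive_bound_increment (Mn b) (q j b)); intros c _; [apply dM | apply qb]. }
assert (MM : forall t, Rabs (Mn true t - Mn false t) <= C1 * dd J j * Rabs t).
{ intros t. assert (B := derive_bound_increment (fun t => Mn true t - Mn false t) (fun t => q j true t - q j false t) (C1 * dd J j) 0 t).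
  cbv beta in B. rewrite !M0, !Rminus_0_r in B. apply B; intros c _; [apply derive_minus; apply dM | apply qd]. }
(* move both end points by the same amount tau, so that only densities at corresponding phases are compared *)
assert (Mtau : Rabs ((Mn true (b0 j true + tau j true) - Mn false (b0 j false + tau j true)) -
    (Mn true (b0 j true + 0) - Mn false (b0 j false + 0))) <= C2 * dd J j * Rabs (tau j true - 0)).
{ apply (derive_bound_increment (fun u => Mn true (b0 j true + u) - Mn false (b0 j false + u))
    (fun u => q j true (b0 j true + u) - q j false (b0 j false + u))).
  - assert (shift : forall b c, is_derive (fun u => Mn b (b0 j b + u)) c (q j b (b0 j b + c))).
    { intros b c. rewrite <- Rmult_1_l. apply (is_derive_comp (Mn b) (fun u => b0 j b + u) c _ 1); [apply dM | auto_derive; [easy | ring]]. }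
    intros c _. apply derive_minus; apply shift.
  - intros c _. now apply A2. }
rewrite !Rplus_0_r, Rminus_0_r in Mtau. replace (b0 j true + tau j true) with (T j true) in Mtau by (unfold tau; ring).
assert (len : forall c b, 0 <= c -> c * Rabs (T j b - 0) <= 10 * c).
{ intros c b Hc. destruct (ti b). rewrite Rminus_0_r, Rabs_pos_eq by lra. assert (c * T j b <= c * 10) by mono. lra. }
assert (e3 : 0 <= C3 * ee J j) by pos. assert (h3 : 0 <= C3 * hh J j) by pos.
assert (stay : forall b, Rabs (I b (T j b) - Mn b (T j b)) <= 10 * (C3 * ee J j)).
{ intros b. assert (B := near1 b (T j b) 0 (ti b) z0). rewrite I0, M0, Rminus_diag, Rminus_0_r in B. exact (Rle_trans _ _ _ B (len _ b e3)). }
assert (up : forall c z, 0 <= z -> c <= F -> c * z <= F * z) by (intros; mono).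
assert (MT : forall b, Rabs (Mn b (b0 j b)) <= C1 * 8).
{ intros b. assert (B := Mlip b (b0 j b) 0). destruct (tu b). rewrite M0, !Rminus_0_r, (Rabs_pos_eq (b0 j b)) in B by lra.
  eapply Rle_trans; [exact B | mono]. }
change (quad F (ee J j) (dd J j) (hh J j) (fun b => I b (T j b)) (fun b => Mn b (b0 j b))).
split; [intros b; eapply Rle_trans; [apply MT | unfold F; lra] |]. split; [| split].
- intros b. apply Rle_trans with ((10 * C3 + C1 * C4) * ee J j); [| apply up; unfold F; lra]. rewrite Rmult_plus_distr_r.
  apply (Rabs_tri3 (I b (T j b) - Mn b (T j b)) (Mn b (T j b) - Mn b (b0 j b))); [specialize (stay b); lra | | ring].
  eapply Rle_trans; [apply Mlip |]. rewrite Rmult_assoc. apply Rmult_le_compat_l; [lra | apply ta].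
- apply Rle_trans with ((8 * C1 + C1 * C4) * dd J j); [| apply up; unfold F; lra]. rewrite Rmult_plus_distr_r.
  apply (Rabs_tri3 (Mn true (b0 j true) - Mn false (b0 j true)) (Mn false (b0 j true) - Mn false (b0 j false))); [| | ring].
  + eapply Rle_trans; [apply MM |]. destruct (tu true). rewrite Rabs_pos_eq by lra.
    assert (C1 * dd J j * b0 j true <= C1 * dd J j * 8) by mono. lra.
  + eapply Rle_trans; [apply Mlip |]. rewrite Rmult_assoc. apply Rmult_le_compat_l; [lra | exact dtu].
- apply Rle_trans with ((10 * C3 + 2 * (C3 * C5) + (C2 * C4 + C1 * C5)) * hh J j); [| apply up; unfold F; lra].
  rewrite 2!Rmult_plus_distr_r.
  apply (Rabs_tri3 (((I true (T j true) - Mn true (T j true)) - (I false (T j true) - Mn false (T j true))) +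
      ((I false (T j true) - Mn false (T j true)) - (I false (T j false) - Mn false (T j false))))
    (((Mn true (T j true) - Mn false (b0 j false + tau j true)) - (Mn true (b0 j true) - Mn false (b0 j false))) +
      (Mn false (b0 j false + tau j true) - Mn false (T j false)))); [| | ring].
  + apply Rabs_add_le.
    * eapply Rle_trans; [apply (near2 _ (ti true)) |]. eapply Rle_trans; [apply (len _ true h3) | lra].
    * eapply Rle_trans; [apply (near1 false _ _ (ti true) (ti false)) |].
      apply Rle_trans with (C3 * ee J j * (C5 * (dd J j + hh J j))); [apply Rmult_le_compat_l; [exact e3 | exact qT] |].
      assert (ee J j * hh J j <= 1 * hh J j) by mono.
      assert (C3 * C5 * (ee J j * (dd J j + hh J j)) <= C3 * C5 * (2 * hh J j)) by mono. lra.
  + rewrite Rmult_plus_distr_r. apply Rabs_add_le.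
    * eapply Rle_trans; [exact Mtau |]. apply Rle_trans with (C2 * dd J j * (C4 * ee J j)); [apply Rmult_le_compat_l; [pos | apply ta] |].
      assert (C2 * C4 * (ee J j * dd J j) <= C2 * C4 * hh J j) by mono. lra.
    * eapply Rle_trans; [apply Mlip |]. replace (b0 j false + tau j true - T j false) with (tau j true - tau j false) by (unfold tau; ring).
      rewrite Rmult_assoc. apply Rmult_le_compat_l; [lra | exact q6].
Qed.

Theorem leg_ctrl : ctrl J (fun j b => rho j b (T j b)) r0 /\ ctrl J (fun j b => s j b (T j b)) (fun _ _ => 0) /\
  ctrl J (fun j b => (rho j b (T j b) - r j b) / (2 * eps j)) (fun j b => melnikov g Q sigma (r0 j b)).
Proof. split; [apply ctrl_of_J2, exit_rho_J2 | split; [apply ctrl_of_J2, exit_s_J2 | exact exit_gain_ctrl]]. Qed.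
End LegCtrl.

(** * Legs, coordinates of R^3 and periodic extensions *)

Definition leg (lam : R) (G1 G2 G3 : R -> R -> R -> R) (g : switching) (sigma eps r w : R)
  (x y s : R -> R) (T r1 w1 : R) : Prop :=
  departs lam G1 G2 G3 g sigma eps r w x y s /\ exits g sigma x y s T /\
  r1 = x T * x T + y T * y T /\ w1 = s T /\
  x T = - sigma * abscissa g r1 w1 /\ y T = height g r1 w1.

Section LegFacts.
Variables (lam K : R) (G1 G2 G3 : R -> R -> R -> R) (g : switching) (sigma Omega : R).
Hypothesis HK : 1 <= K.
Hypothesis T1 : tame K G1.
Hypothesis T2 : tame K G2.
Hypothesis T3 : tame K G3.
Hypothesis Hsig : sigma * sigma = 1.
Hypothesis HO : 0 <= Omega.

Lemma leg_exists : exists C e1, 1 <= C /\ 0 < e1 <= 1 /\ forall eps r w,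
  Rabs eps <= e1 -> core g r -> Rabs w <= Omega * Rabs eps ->
  exists x y s T r1 w1, leg lam G1 G2 G3 g sigma eps r w x y s T r1 w1.
Proof.
destruct (leg_exit lam K G1 G2 G3 HK T1 T2 T3 g sigma Omega Hsig HO) as [C [e1 [HC [He1 LE]]]].
exists C, e1. split; [exact HC |]. split; [exact He1 |]. intros eps r w Heps Hr Hw.
destruct (flow_exists lam K G1 G2 G3 HK T1 T2 T3 eps (sigma * abscissa g r w) (height g r w) w) as [x [y [s Hf]]].
destruct (LE eps r w x y s Heps Hr Hw Hf) as [T [Hex [_ [_ [_ [Hx _]]]]]].
assert (hyT : y T = height g (x T * x T + y T * y T) (s T)) by (destruct Hex as [_ [ha _]]; unfold above in ha; lra).
exists x, y, s, T, (x T * x T + y T * y T), (s T). repeat split; try apply Hf; try apply Hex; [| exact hyT].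
unfold abscissa. rewrite <- hyT. replace (x T * x T + y T * y T - y T * y T) with (Rsqr (sigma * x T)).
2:{ unfold Rsqr. transitivity (sigma * sigma * (x T * x T)); [ring | rewrite Hsig; ring]. }
rewrite sqrt_Rsqr_abs, Rabs_left1 by exact Hx. transitivity (sigma * sigma * x T); [rewrite Hsig; ring | ring].
Qed.

Lemma leg_bounds : exists C e1, 1 <= C /\ 0 < e1 <= 1 /\ forall eps r w x y s T r1 w1,
  Rabs eps <= e1 -> core g r -> Rabs w <= Omega * Rabs eps -> leg lam G1 G2 G3 g sigma eps r w x y s T r1 w1 ->
  / C <= T <= 10 /\ forall t, 0 <= t <= T -> Rabs (x t * x t + y t * y t - r) <= C * Rabs eps /\ Rabs (s t) <= C * Rabs eps.
Proof.
destruct (leg_exit lam K G1 G2 G3 HK T1 T2 T3 g sigma Omega Hsig HO) as [C [e1 [HC [He1 LE]]]].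
exists C, e1. split; [exact HC |]. split; [exact He1 |]. intros eps r w x y s T r1 w1 Heps Hr Hw [Hdep [Hex _]].
destruct (LE eps r w x y s Heps Hr Hw Hdep) as [T' [Hex' [HT [HT2 [_ [_ B]]]]]].
rewrite <- (exits_unique g sigma x y s T T' Hex Hex') in *. split; [lra |]. intros t Ht. apply B. lra.
Qed.
End LegFacts.

Record round := {
  xp : R -> R; yp : R -> R; sp : R -> R; Tp : R; rp : R; wp : R;
  xm : R -> R; ym : R -> R; sm : R -> R; Tm : R; rm : R; wm : R
}.

Lemma Rabs_add_same a b : 0 <= a * b -> Rabs (a + b) = Rabs a + Rabs b.
Proof.
intros H. destruct (Rle_lt_dec 0 a) as [ha | ha], (Rle_lt_dec 0 b) as [hb | hb].
- rewrite !Rabs_pos_eq; lra.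
- assert (a = 0) by nra. subst a. rewrite Rabs_R0, !Rplus_0_l. reflexivity.
- assert (b = 0) by nra. subst b. rewrite Rabs_R0, !Rplus_0_r. reflexivity.
- rewrite !Rabs_left; lra.
Qed.

Lemma Rabs_add_opposite a b : a * b <= 0 -> Rabs b <= Rabs a -> Rabs (a + b) = Rabs a - Rabs b.
Proof.
intros H Hab.
assert (E : Rabs (a + b) + Rabs (- b) = Rabs a).
{ rewrite <- Rabs_add_same; [f_equal; ring |].
  assert (b * b <= - (a * b)); [| lra].
  replace (- (a * b)) with (Rabs a * Rabs b).
  - replace (b * b) with (Rabs b * Rabs b) by (rewrite <- Rabs_mult; apply Rabs_pos_eq, Rle_0_sqr).
    apply Rmult_le_compat_r; [apply Rabs_pos | exact Hab].
  - rewrite <- Rabs_mult. now apply Rabs_left1. }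
rewrite Rabs_Ropp in E. lra.
Qed.

Definition px (p : R3) : R := fst (fst p).
Definition py (p : R3) : R := snd (fst p).
Definition pz (p : R3) : R := snd p.
Definition ps (p : R3) : R := pz p - (px p * px p + py p * py p).
Definition lift (x y s : R) : R3 := (x, y, s + (x * x + y * y)).

Lemma lift_ps p : lift (px p) (py p) (ps p) = p.
Proof. destruct p as [[x y] z]. unfold lift, ps, px, py, pz. simpl. f_equal. ring. Qed.

Lemma ps_lift x y s : ps (lift x y s) = s.
Proof. unfold lift, ps, px, py, pz. simpl. ring. Qed.

Lemma R_norm_minus (a b : R) : norm (minus a b) = Rabs (a - b).
Proof. reflexivity. Qed.

Lemma R3_norm_ge (p q : R3) :
  Rabs (px p - px q) <= norm (minus p q) /\ Rabs (py p - py q) <= norm (minus p q) /\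
  Rabs (pz p - pz q) <= norm (minus p q).
Proof.
destruct p as [[x y] z], q as [[x' y'] z']. unfold px, py, pz. simpl fst. simpl snd.
destruct (norm_prod (minus (x, y) (x', y') : prod_NormedModule R_AbsRing R_NormedModule R_NormedModule) (minus z z' : R_NormedModule)) as [h1 _].
destruct (norm_prod (minus x x' : R_NormedModule) (minus y y' : R_NormedModule)) as [h2 _].
change (norm (minus (x, y, z) (x', y', z') : R3)) with
  (norm (minus (x, y) (x', y') : prod_NormedModule R_AbsRing R_NormedModule R_NormedModule, minus z z' : R_NormedModule)).
change (minus (x, y) (x', y') : prod_NormedModule R_AbsRing R_NormedModule R_NormedModule) with
  ((minus x x' : R_NormedModule, minus y y' : R_NormedModule)) in h1 |- *.
rewrite <- !R_norm_minus. repeat split.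
- eapply Rle_trans; [| exact h1]. eapply Rle_trans; [| apply Rmax_l]. eapply Rle_trans; [| exact h2]. apply Rmax_l.
- eapply Rle_trans; [| exact h1]. eapply Rle_trans; [| apply Rmax_l]. eapply Rle_trans; [| exact h2]. apply Rmax_r.
- eapply Rle_trans; [| exact h1]. apply Rmax_r.
Qed.

Lemma R3_norm_le (p q : R3) :
  norm (minus p q) <= 4 * (Rabs (px p - px q) + Rabs (py p - py q) + Rabs (pz p - pz q)).
Proof.
destruct p as [[x y] z], q as [[x' y'] z']. unfold px, py, pz. simpl fst. simpl snd.
destruct (norm_prod (minus (x, y) (x', y') : prod_NormedModule R_AbsRing R_NormedModule R_NormedModule) (minus z z' : R_NormedModule)) as [_ h1].
destruct (norm_prod (minus x x' : R_NormedModule) (minus y y' : R_NormedModule)) as [_ h2].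
change (norm (minus (x, y, z) (x', y', z') : R3)) with
  (norm (minus (x, y) (x', y') : prod_NormedModule R_AbsRing R_NormedModule R_NormedModule, minus z z' : R_NormedModule)).
change (minus (x, y) (x', y') : prod_NormedModule R_AbsRing R_NormedModule R_NormedModule) with
  ((minus x x' : R_NormedModule, minus y y' : R_NormedModule)) in h1 |- *.
assert (s0 := sqrt_pos 2).
assert (s2 : sqrt 2 <= 2). { assert (A := sqrt_sqrt 2 ltac:(lra)). nra. }
eapply Rle_trans; [exact h1 |]. rewrite <- !R_norm_minus.
assert (N1 := norm_ge_0 (minus x x' : R_NormedModule)). assert (N2 := norm_ge_0 (minus y y' : R_NormedModule)). assert (N3 := norm_ge_0 (minus z z' : R_NormedModule)).
assert (A := Rmax_l (norm (minus x x' : R_NormedModule)) (norm (minus y y' : R_NormedModule))).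
assert (B : Rmax (norm (minus x x' : R_NormedModule)) (norm (minus y y' : R_NormedModule)) <= norm (minus x x') + norm (minus y y')).
{ apply Rmax_lub; lra. }
set (m := Rmax (norm (minus x x' : R_NormedModule)) (norm (minus y y' : R_NormedModule))) in *.
apply Rle_trans with (2 * Rmax (norm (minus x x' : R_NormedModule, minus y y' : R_NormedModule)) (norm (minus z z'))).
- apply Rmult_le_compat_r; [| exact s2]. eapply Rle_trans; [exact N3 | apply Rmax_r].
- assert (h3 : norm (minus x x' : R_NormedModule, minus y y' : R_NormedModule) <= 2 * m).
  { eapply Rle_trans; [exact h2 |]. apply Rmult_le_compat_r; lra. }
  assert (h4 : Rmax (norm (minus x x' : R_NormedModule, minus y y' : R_NormedModule)) (norm (minus z z')) <= 2 * m + norm (minus z z' : R_NormedModule)).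
  { assert (m0 : 0 <= m) by exact (Rle_trans _ _ _ N1 A). apply Rmax_lub.
    - eapply Rle_trans; [exact h3 |]. rewrite <- (Rplus_0_r (2 * m)) at 1. apply Rplus_le_compat_l. exact N3.
    - rewrite <- (Rplus_0_l (norm (minus z z'))) at 1. apply Rplus_le_compat_r. lra. }
  eapply Rle_trans; [apply Rmult_le_compat_l; [lra | exact h4] |].
  apply Rle_trans with (4 * (m + norm (minus z z' : R_NormedModule))); [lra |].
  apply Rmult_le_compat_l; [lra |]. apply Rplus_le_compat_r. exact B.
Qed.

Lemma is_derive_coords (c : R -> R3) t (v : R3) : is_derive c t v ->
  is_derive (fun t => px (c t)) t (px v) /\ is_derive (fun t => py (c t)) t (py v) /\
  is_derive (fun t => pz (c t)) t (pz v).
Proof.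
intros H.
assert (H1 : is_derive (fun t => fst (c t)) t (fst v)).
{ exact (filterdiff_comp' c (fun q => fst q) t _ (fun q => fst q) H (filterdiff_linear _ is_linear_fst)). }
split; [| split].
- exact (filterdiff_comp' (fun t => fst (c t)) (fun q => fst q) t _ (fun q => fst q) H1 (filterdiff_linear _ is_linear_fst)).
- exact (filterdiff_comp' (fun t => fst (c t)) (fun q => snd q) t _ (fun q => snd q) H1 (filterdiff_linear _ is_linear_snd)).
- exact (filterdiff_comp' c (fun q => snd q) t _ (fun q => snd q) H (filterdiff_linear _ is_linear_snd)).
Qed.

Lemma is_derive_pair (U V : NormedModule R_AbsRing) (a : R -> U) (b : R -> V) t (va : U) (vb : V) :
  is_derive a t va -> is_derive b t vb ->
  is_derive (fun t => (a t, b t) : prod_NormedModule R_AbsRing U V) t (va, vb).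
Proof.
intros Ha Hb.
refine (filterdiff_comp'_2 a b (fun u v => (u, v) : prod_NormedModule R_AbsRing U V) t _ _ (fun u v => (u, v)) Ha Hb _).
apply (filterdiff_ext_lin _ (fun q => q)); [| now intros [u w]].
apply (filterdiff_ext (fun q => q)); [now intros [u w] |]. apply filterdiff_id.
Qed.

Lemma is_derive_R3 (a b c : R -> R) t va vb vc :
  is_derive a t va -> is_derive b t vb -> is_derive c t vc ->
  is_derive (fun t => (a t, b t, c t) : R3) t (va, vb, vc).
Proof. intros Ha Hb Hc. apply (is_derive_pair _ _ (fun t => (a t, b t)) c); [now apply (is_derive_pair _ _ a b) | exact Hc]. Qed.

Lemma ac_coords (c : R -> R3) a b : a < b -> absolutely_continuous c ->
  ac_on (fun t => px (c t)) a b /\ ac_on (fun t => py (c t)) a b /\ ac_on (fun t => pz (c t)) a b.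
Proof.
intros Hab H.
assert (K : forall pr : R3 -> R, (forall p q, Rabs (pr p - pr q) <= norm (minus p q)) -> ac_on (fun t => pr (c t)) a b).
{ intros pr Hpr eta Heta. destruct (H a b eta Hab Heta) as [d [Hd HH]]. exists d. split; [exact Hd |].
  intros n u v h1 h2 h3. eapply Rle_lt_trans; [| exact (HH n u v h1 h2 h3)]. apply sum_n_le_le. intros k _. apply Hpr. }
repeat split; apply K; intros p q; apply (R3_norm_ge p q).
Qed.

Lemma absolutely_continuous_lipschitz (c : R -> R3) L : 0 <= L ->
  (forall t u, u <= t -> norm (minus (c t) (c u)) <= L * (t - u)) -> absolutely_continuous c.
Proof.
intros HL H a b eta Hab Heta. exists (eta / (L + 1)). split; [apply Rdiv_lt_0_compat; lra |].
intros n u v Huv Hord Hs.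
apply Rle_lt_trans with (L * sum_n (fun k => v k - u k) n).
- clear Hord Hs. induction n as [| n IH].
  + rewrite !sum_n_0. destruct (Huv 0%nat (Nat.le_refl _)) as [? [? ?]]. now apply H.
  + rewrite !sum_n_S. destruct (Huv (S n) (Nat.le_refl _)) as [? [? ?]].
    assert (IH' := IH ltac:(intros; apply Huv; lia)). assert (B := H (v (S n)) (u (S n)) ltac:(lra)). lra.
- apply Rle_lt_trans with (L * (eta / (L + 1))); [apply Rmult_le_compat_l; lra |].
  apply Rmult_lt_reg_r with (L + 1); [lra |].
  replace (L * (eta / (L + 1)) * (L + 1)) with (L * eta) by (field; lra). nra.
Qed.

Lemma null_set_add (N : R -> Prop) c : null_set N -> null_set (fun t => N t \/ t = c).
Proof.
intros H eta Heta. destruct (H (eta / 2) ltac:(lra)) as [u [v [h1 [h2 h3]]]].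
exists (fun n => match n with O => c - eta / 4 | S m => u m end), (fun n => match n with O => c + eta / 4 | S m => v m end).
split; [| split].
- intros [| n]; [lra | apply h1].
- intros t [Ht | ->]; [| exists 0%nat; lra]. destruct (h2 t Ht) as [n Hn]. now exists (S n).
- set (F := fun k => match k with O => c + eta / 4 | S m => v m end - match k with O => c - eta / 4 | S m => u m end).
  assert (E : forall n, sum_n F (S n) = eta / 2 + sum_n (fun k => v k - u k) n).
  { induction n as [| n IH].
    - rewrite sum_n_S, !sum_n_0. cbv beta iota delta [F]. lra.
    - rewrite sum_n_S, IH, (sum_n_S (fun k => v k - u k)). cbv beta iota delta [F]. lra. }
  intros [| n].
  + change (sum_n F 0 <= eta). rewrite sum_n_0. cbv beta iota delta [F]. lra.
  + change (sum_n F (S n) <= eta). rewrite E. specialize (h3 n). lra.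
Qed.

Lemma rotation_angle a b c d : 0 < a * a + b * b -> c * c + d * d = a * a + b * b ->
  exists t, 0 <= t <= 2 * PI /\ a * cos t - b * sin t = c /\ a * sin t + b * cos t = d.
Proof.
intros HR E. set (R2 := a * a + b * b) in *.
set (u := (a * c + b * d) / R2). set (v := (a * d - b * c) / R2).
assert (Euv : u * u + v * v = 1).
{ unfold u, v. replace 1 with ((a * a + b * b) * (c * c + d * d) / (R2 * R2)).
  - field. lra.
  - rewrite E. fold R2. field. lra. }
assert (K : exists t, 0 <= t <= 2 * PI /\ cos t = u /\ sin t = v).
{ assert (Hu : -1 <= u <= 1) by nra. assert (B := acos_bound u).
  assert (S : sin (acos u) = Rabs v).
  { rewrite sin_acos by exact Hu. replace (1 - u²) with (v²) by (unfold Rsqr; lra). apply sqrt_Rsqr_abs. }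
  destruct (Rle_lt_dec 0 v) as [h | h].
  - exists (acos u). split; [assert (C := PI_RGT_0); lra |]. split; [now apply cos_acos |]. rewrite S. now apply Rabs_pos_eq.
  - exists (2 * PI - acos u). split; [assert (C := PI_RGT_0); lra |].
    assert (C := sin_2PI). assert (D := cos_2PI). rewrite cos_minus, sin_minus, C, D, S, cos_acos by exact Hu.
    rewrite (Rabs_left v h). split; ring. }
destruct K as [t [Ht [ec es]]]. exists t. split; [exact Ht |]. rewrite ec, es. unfold u, v.
split; (apply Rmult_eq_reg_r with R2; [| lra]); field_simplify; try lra; unfold R2; ring.
Qed.

Lemma euclid (T v : R) : 0 < T -> exists z : Z, 0 <= v - T * IZR z < T.
Proof.
intros HT. exists (Int_part (v / T)). destruct (base_Int_part (v / T)) as [h1 h2].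
set (k := IZR (Int_part (v / T))) in *. assert (E : v = v / T * T) by (field; lra).
set (q := v / T) in *. split; nra.
Qed.

Lemma euclid_nat (T v : R) : 0 < T -> 0 <= v -> exists n : nat, 0 <= v - INR n * T < T.
Proof.
intros HT Hv. destruct (euclid T v HT) as [z Hz].
assert (Hz0 : (0 <= z)%Z).
{ apply Z.lt_succ_r. apply lt_IZR. rewrite succ_IZR. assert (0 < T * (IZR z + 1)) by lra.
  destruct (Rlt_le_dec 0 (IZR z + 1)) as [h | h]; [exact h | nra]. }
exists (Z.to_nat z). rewrite INR_IZR_INZ, Z2Nat.id by exact Hz0. lra.
Qed.

Definition join (T : R) (a b : R -> R) (u : R) : R := if Rle_dec u T then a u else b (u - T).

Definition lip_on (L : R) (c : R -> R) (T : R) : Prop :=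
  forall u v, 0 <= u <= T -> 0 <= v <= T -> Rabs (c u - c v) <= L * Rabs (u - v).

Definition periodic_ext {A : Type} (T : R) (c : R -> A) (t : R) : A := c (t - T * IZR (Int_part (t / T))).

Lemma periodic_ext_eq {A : Type} T (c : R -> A) z t : 0 < T -> c 0 = c T -> 0 <= t - T * IZR z <= T ->
  periodic_ext T c t = c (t - T * IZR z).
Proof.
intros HT Hc Hz. unfold periodic_ext. set (z' := Int_part (t / T)).
assert (H' : 0 <= t - T * IZR z' < T).
{ destruct (base_Int_part (t / T)) as [h1 h2]. fold z' in h1, h2. assert (E : t = t / T * T) by (field; lra).
  set (q := t / T) in *. split; nra. }
assert (D : z' = z \/ z' = (z + 1)%Z).
{ assert (h1 : (z - 1 < z')%Z) by (apply lt_IZR; rewrite minus_IZR; nra).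
  assert (h2 : (z' <= z + 1)%Z) by (apply le_IZR; rewrite plus_IZR; nra). lia. }
destruct D as [-> | E]; [reflexivity |]. rewrite E in *. rewrite plus_IZR in *.
replace (t - T * (IZR z + 1)) with 0 by lra. rewrite Hc. f_equal. lra.
Qed.

Lemma periodic_ext_periodic {A : Type} T (c : R -> A) t : 0 < T -> c 0 = c T -> periodic_ext T c (t + T) = periodic_ext T c t.
Proof.
intros HT Hc. destruct (euclid T t HT) as [z Hz].
rewrite (periodic_ext_eq T c z t HT Hc ltac:(lra)).
rewrite (periodic_ext_eq T c (z + 1) (t + T) HT Hc); rewrite plus_IZR; [f_equal; ring | lra].
Qed.

Lemma periodic_ext_lip T c L : 0 < T -> c 0 = c T -> lip_on L c T ->
  forall t u, u <= t -> Rabs (periodic_ext T c t - periodic_ext T c u) <= L * (t - u).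
Proof.
intros HT Hc HL t u Hut. apply (locally_lipschitz_le (periodic_ext T c)); [exact Hut |].
clear Hut. intros t0 _. clear t. rename t0 into t. destruct (euclid T t HT) as [z Hz].
destruct (Req_dec (t - T * IZR z) 0) as [h | h].
- exists T. split; [exact HT |]. intros s Hs. apply Rabs_lt_between in Hs.
  destruct (Rle_lt_dec t s) as [hs | hs].
  + rewrite (periodic_ext_eq T c z t), (periodic_ext_eq T c z s) by (assumption || lra).
    replace (s - t) with (s - T * IZR z - (t - T * IZR z)) by ring. apply HL; lra.
  + rewrite (periodic_ext_eq T c (z - 1) t), (periodic_ext_eq T c (z - 1) s); rewrite ?minus_IZR; try assumption; try lra.
    replace (s - t) with (s - T * (IZR z - 1) - (t - T * (IZR z - 1))) by ring. apply HL; lra.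
- exists (Rmin (t - T * IZR z) (T - (t - T * IZR z))). split; [apply Rmin_glb_lt; lra |].
  intros s Hs. apply Rabs_lt_between in Hs. assert (A := Rmin_l (t - T * IZR z) (T - (t - T * IZR z))).
  assert (B := Rmin_r (t - T * IZR z) (T - (t - T * IZR z))).
  rewrite (periodic_ext_eq T c z t), (periodic_ext_eq T c z s) by (assumption || lra).
  replace (s - t) with (s - T * IZR z - (t - T * IZR z)) by ring. apply HL; lra.
Qed.

Lemma is_derive_shift (c : R -> R3) a t (v : R3) : is_derive c (t - a) v -> is_derive (fun t => c (t - a)) t v.
Proof.
intros H. rewrite <- (scal_one v). apply (is_derive_comp c (fun t => t - a)); [exact H |].
auto_derive; [exact I | reflexivity].
Qed.

Lemma periodic_ext_derive T (c : R -> R3) z t (v : R3) : 0 < T -> c 0 = c T -> 0 < t - T * IZR z < T ->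
  is_derive c (t - T * IZR z) v -> is_derive (periodic_ext T c) t v.
Proof.
intros HT Hc Hz Hd. apply (is_derive_ext_loc (fun t => c (t - T * IZR z))); [| now apply is_derive_shift].
assert (hp : 0 < Rmin (t - T * IZR z) (T - (t - T * IZR z))) by (apply Rmin_glb_lt; lra).
exists (mkposreal _ hp). intros s Hs. change (Rabs (s - t) < Rmin (t - T * IZR z) (T - (t - T * IZR z))) in Hs.
apply Rabs_lt_between in Hs. assert (A := Rmin_l (t - T * IZR z) (T - (t - T * IZR z))).
assert (B := Rmin_r (t - T * IZR z) (T - (t - T * IZR z))).
symmetry. apply periodic_ext_eq; try assumption. lra.
Qed.

(** The seams of a periodic curve made of two arcs. *)
Lemma null_set_lattice T a : null_set (fun t => exists z : Z, t = T * IZR z \/ t = T * IZR z + a).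
Proof.
apply (null_set_sub _ (fun t => exists n, t = let '(i, m) := of_nat n in let '(p, q) := of_nat m in
  T * IZR (Z.of_nat p - Z.of_nat q) + (match i with O => 0 | _ => a end))); [| apply null_set_sequence].
intros t [z Hz].
assert (E : exists p q, z = (Z.of_nat p - Z.of_nat q)%Z) by (exists (Z.to_nat z), (Z.to_nat (- z)); lia).
destruct E as [p [q ->]].
destruct Hz as [-> | ->].
- exists (to_nat (0%nat, to_nat (p, q))). rewrite !cancel_of_to. ring.
- exists (to_nat (1%nat, to_nat (p, q))). rewrite !cancel_of_to. ring.
Qed.

Lemma flow_lipschitz lam K G1 G2 G3 eps x y s : 1 <= K -> tame K G1 -> tame K G2 -> tame K G3 -> 0 < Rabs eps <= 1 ->
  is_flow lam G1 G2 G3 eps x y s -> exists L, 0 <= L /\ forall T, T <= 10 ->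
  lip_on L x T /\ lip_on L y T /\ lip_on L (fun t => s t + (x t * x t + y t * y t)) T.
Proof.
intros HK T1 T2 T3 He Hf.
assert (A1 := Rabs_pos (x 0)). assert (A2 := Rabs_pos (y 0)). assert (A3 := Rabs_pos (s 0)).
assert (HO : 0 <= Rabs (s 0) / Rabs eps) by (apply Rdiv_le_0_compat; lra).
destruct (flow_bounds lam K G1 G2 G3 HK T1 T2 T3 (Rabs (x 0) + Rabs (y 0)) _ ltac:(lra) HO) as [C [HC FB]].
destruct (FB eps x y s ltac:(lra) Hf ltac:(lra) ltac:(lra)) as [_ B].
{ right. field. lra. }
exists (2 * C). split; [lra |]. intros T HT.
assert (up : forall u v, 0 <= u <= T -> 0 <= v <= T -> C * Rabs eps * Rabs (u - v) <= C * Rabs (u - v)).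
{ intros u v _ _. apply Rmult_le_compat_r; [apply Rabs_pos |]. rewrite <- (Rmult_1_r C) at 2. apply Rmult_le_compat_l; lra. }
split; [| split]; intros u v Hu Hv; destruct (B u v ltac:(lra) ltac:(lra)) as [b1 [b2 [b3 b4]]];
  assert (U := up u v Hu Hv); assert (W := Rabs_pos (u - v)).
- assert (0 <= C * Rabs (u - v)) by pos. lra.
- assert (0 <= C * Rabs (u - v)) by pos. lra.
- replace (s u + (x u * x u + y u * y u) - (s v + (x v * x v + y v * y v))) with
    ((s u - s v) + (x u * x u + y u * y u - (x v * x v + y v * y v))) by ring.
  eapply Rle_trans; [apply Rabs_add_le; [exact b3 | exact b4] |]. lra.
Qed.

Lemma join_lipschitz T1 T2 a b L : 0 <= T1 -> 0 <= L -> lip_on L a T1 -> lip_on L b T2 -> a T1 = b 0 -> lip_on L (join T1 a b) (T1 + T2).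
Proof.
intros h1 HL Ha Hb Hab.
assert (K : forall u v, 0 <= u <= T1 -> T1 <= v <= T1 + T2 -> Rabs (a u - b (v - T1)) <= L * Rabs (u - v)).
{ intros u v Hu Hv. replace (a u - b (v - T1)) with ((a u - a T1) + (b 0 - b (v - T1))) by (rewrite Hab; ring).
  eapply Rle_trans; [apply Rabs_add_le; [apply Ha | apply Hb]; lra |].
  rewrite (Rabs_left1 (u - T1)), (Rabs_left1 (0 - (v - T1))), (Rabs_left1 (u - v)) by lra. right. ring. }
intros u v Hu Hv. unfold join. destruct (Rle_dec u T1) as [hu | hu], (Rle_dec v T1) as [hv | hv].
- apply Ha; lra.
- apply K; lra.
- rewrite Rabs_minus_sym, (Rabs_minus_sym u v). apply K; lra.
- replace (u - v) with (u - T1 - (v - T1)) by ring. apply Hb; lra.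
Qed.

Definition circle (r : R) (p : R3) : Prop := px p * px p + py p * py p = r /\ pz p = r.

Lemma sqrt_ratio a b lo : 0 < lo -> lo <= b -> 0 <= a -> exists k, 0 <= k /\ k * k = a / b /\ Rabs (k - 1) <= / lo * Rabs (a - b).
Proof.
intros Hlo Hb Ha. assert (Hq : 0 <= a / b) by (apply Rdiv_le_0_compat; lra).
exists (sqrt (a / b)). assert (S := sqrt_pos (a / b)). split; [exact S |]. split; [now apply sqrt_sqrt |].
set (k := sqrt (a / b)) in *. assert (E : (k - 1) * (k + 1) = (a - b) / b).
{ replace ((k - 1) * (k + 1)) with (k * k - 1) by ring. unfold k. rewrite sqrt_sqrt by exact Hq. field. lra. }
apply Rle_trans with (Rabs (k - 1) * (k + 1)).
- rewrite <- (Rmult_1_r (Rabs (k - 1))) at 1. apply Rmult_le_compat_l; [apply Rabs_pos | lra].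
- rewrite <- (Rabs_pos_eq (k + 1)), <- Rabs_mult, E by lra. unfold Rdiv. rewrite Rabs_mult, Rmult_comm, Rabs_inv, (Rabs_pos_eq b) by lra.
  apply Rmult_le_compat_r; [apply Rabs_pos |]. now apply Rinv_le_contravar.
Qed.

(** * The return map *)

Section Return.
Variables (lam K : R) (P1 P2 P3 M1 M2 M3 : R -> R -> R -> R) (Qp Qm : R -> R -> R -> R) (g : switching).
Hypothesis HK : 1 <= K.
Hypothesis TP1 : tame K P1.
Hypothesis TP2 : tame K P2.
Hypothesis TP3 : tame K P3.
Hypothesis TM1 : tame K M1.
Hypothesis TM2 : tame K M2.
Hypothesis TM3 : tame K M3.
Hypothesis HQp : poly3 Qp.
Hypothesis HQm : poly3 Qm.
Hypothesis HQGp : forall x y s, Rabs x <= 2 * sw_hi g + 6 -> Rabs y <= 2 * sw_hi g + 6 ->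
  Rabs s <= 2 * sw_hi g + 6 -> x * P1 x y s + y * P2 x y s = Qp x y s.
Hypothesis HQGm : forall x y s, Rabs x <= 2 * sw_hi g + 6 -> Rabs y <= 2 * sw_hi g + 6 ->
  Rabs s <= 2 * sw_hi g + 6 -> x * M1 x y s + y * M2 x y s = Qm x y s.

Definition is_round (eps r w : R) (o : round) : Prop :=
  leg lam P1 P2 P3 g 1 eps r w (xp o) (yp o) (sp o) (Tp o) (rp o) (wp o) /\
  leg lam M1 M2 M3 g (-1) eps (rp o) (wp o) (xm o) (ym o) (sm o) (Tm o) (rm o) (wm o).

Lemma round_exists Omega : 0 <= Omega -> exists e1, 0 < e1 <= 1 /\ forall eps r w,
  Rabs eps <= e1 -> deep g r -> Rabs w <= Omega * Rabs eps -> exists o, is_round eps r w o.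
Proof.
intros HO. assert (Hm := sw_margin_pos g).
destruct (leg_exists lam K P1 P2 P3 g 1 Omega HK TP1 TP2 TP3 ltac:(ring) HO) as [_ [e1 [_ [He1 L1]]]].
destruct (leg_bounds lam K P1 P2 P3 g 1 Omega HK TP1 TP2 TP3 ltac:(ring) HO) as [C [e2 [HC [He2 B]]]].
destruct (leg_exists lam K M1 M2 M3 g (-1) C HK TM1 TM2 TM3 ltac:(ring) ltac:(lra)) as [_ [e3 [_ [He3 L2]]]].
destruct (small_enough C (sw_margin g) ltac:(lra) Hm) as [e4 [He4 E4]].
exists (Rmin e1 (Rmin e2 (Rmin e3 e4))).
split; [split; [repeat apply Rmin_glb_lt; lra | eapply Rle_trans; [apply Rmin_l | lra]] |].
intros eps r w Heps Hr Hw.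
assert (q : Rabs eps <= e1 /\ Rabs eps <= e2 /\ Rabs eps <= e3 /\ Rabs eps <= e4) by (repeat split; (below Heps)).
destruct q as [q1 [q2 [q3 q4]]]. specialize (E4 _ q4).
assert (Hc : core g r) by (unfold deep in Hr; unfold core; lra).
destruct (L1 eps r w q1 Hc Hw) as [x [y [s [T [r1 [w1 Hl]]]]]].
destruct (B _ _ _ _ _ _ _ _ _ q2 Hc Hw Hl) as [HT B']. assert (0 < / C) by (apply Rinv_0_lt_compat; lra).
destruct (B' T ltac:(lra)) as [hr hw]. assert (Hl' := Hl). destruct Hl' as [_ [_ [h1 [h2 _]]]]. rewrite <- h1 in hr. rewrite <- h2 in hw.
assert (Hc1 : core g r1). { apply Rabs_le_between in hr. unfold deep in Hr. unfold core. lra. }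
destruct (L2 eps r1 w1 q3 Hc1 hw) as [x2 [y2 [s2 [T2 [r2 [w2 Hl2]]]]]].
exists (Build_round x y s T r1 w1 x2 y2 s2 T2 r2 w2). now split.
Qed.

(** First-order change of rho in one turn, divided by 2 eps. *)
Definition gain (r : R) : R := melnikov g Qp 1 r + melnikov g Qm (-1) r.
(** Multiplier of s in one unperturbed turn. *)
Definition mu : R := exp (- lam * (2 * PI)).

Record pair_data := { pe : R; pr : bool -> R; pw : bool -> R; po : bool -> round }.

Definition pair_context (Omega : R) : context.
Proof.
refine (Build_context pair_data (fun p => 0 < Rabs (pe p) <= 1 /\
    forall b, deep g (pr p b) /\ Rabs (pw p b) <= Omega * Rabs (pe p) /\ is_round (pe p) (pr p b) (pw p b) (po p b))
  (fun p => Rabs (pe p)) (fun p => Rabs (pr p true - pr p false))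
  (fun p => Rabs (pe p) * Rabs (pr p true - pr p false) + Rabs (pw p true - pw p false)) _).
intros p [He _]. assert (A1 := Rabs_pos (pr p true - pr p false)). assert (A2 := Rabs_pos (pw p true - pw p false)).
assert (0 <= Rabs (pe p) * Rabs (pr p true - pr p false)) by pos. repeat split; lra.
Defined.

(** The estimates of the two legs composed. The two half turns add up to 2 pi, which is
    why s is multiplied by exactly mu. *)
Lemma return_estimates Omega : 0 <= Omega -> exists C e1, 1 <= C /\ 0 < e1 <= 1 /\
  forall eps r w o r' w' o', 0 < Rabs eps <= e1 -> deep g r -> deep g r' ->
    Rabs w <= Omega * Rabs eps -> Rabs w' <= Omega * Rabs eps ->
    is_round eps r w o -> is_round eps r' w' o' ->
    Rabs (gain r - gain r') <= C * Rabs (r - r') /\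
    Rabs ((rm o - r) / (2 * eps) - gain r) <= C * Rabs eps /\
    Rabs (((rm o - r) / (2 * eps) - gain r) - ((rm o' - r') / (2 * eps) - gain r')) <=
      C * (Rabs eps * Rabs (r - r') + Rabs (w - w')) /\
    Rabs (wm o - mu * w) <= C * Rabs eps /\
    Rabs ((wm o - mu * w) - (wm o' - mu * w')) <= C * Rabs eps * (Rabs (r - r') + Rabs (w - w')).
Proof.
intros HO. set (J := pair_context Omega).
assert (Hm := sw_margin_pos g). assert (L0 := sw_lo_pos g). assert (Hl := sw_hi_lo g).
assert (Heps : forall j, ok J j -> Rabs (pe j) = ee J j /\ pe j <> 0).
{ intros j [h _]. split; [reflexivity |]. intros h0. rewrite h0, Rabs_R0 in h. lra. }
assert (Hdeep : forall j b, ok J j -> deep g (pr j b)) by (intros j b [_ h]; apply h).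
assert (Hr : ctrl J pr pr).
{ apply (ctrl_base J _ (sw_hi g + 1)), ev_ok. intros j Hj. split.
  - intros b. assert (d := Hdeep j b Hj). unfold deep in d. apply Rabs_le. lra.
  - change (dd J j) with (Rabs (pr j true - pr j false)). assert (Q := Rabs_pos (pr j true - pr j false)). nra. }
assert (Hw : ctrl J pw (fun _ _ => 0)).
{ apply (ctrl_zero J _ (Omega + 1)), ev_ok. intros j Hj. destruct (ctx_ok J j Hj) as [he [hd [hh1 hed]]]. split.
  - intros b. eapply Rle_trans; [apply Hj |]. change (Omega * ee J j <= (Omega + 1) * ee J j). mono.
  - apply Rle_trans with (hh J j); [| nra]. change (hh J j) with (ee J j * dd J j + Rabs (pw j true - pw j false)).
    assert (0 <= ee J j * dd J j) by pos. lra. }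
assert (one : 1 * 1 = 1) by ring. assert (mone : -1 * -1 = 1) by ring.
assert (leg1 : forall j b, ok J j -> leg lam P1 P2 P3 g 1 (pe j) (pr j b) (pw j b) (xp (po j b)) (yp (po j b)) (sp (po j b))
  (Tp (po j b)) (rp (po j b)) (wp (po j b))) by (intros j b [_ h]; apply h).
assert (leg2 : forall j b, ok J j -> leg lam M1 M2 M3 g (-1) (pe j) (rp (po j b)) (wp (po j b)) (xm (po j b)) (ym (po j b)) (sm (po j b))
  (Tm (po j b)) (rm (po j b)) (wm (po j b))) by (intros j b [_ h]; apply h).
assert (d1 := fun j b Hj => proj1 (leg1 j b Hj)). assert (x1 := fun j b Hj => proj1 (proj2 (leg1 j b Hj))).
assert (d2 := fun j b Hj => proj1 (leg2 j b Hj)). assert (x2 := fun j b Hj => proj1 (proj2 (leg2 j b Hj))).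
destruct (leg_ctrl lam K P1 P2 P3 Qp g 1 HK TP1 TP2 TP3 HQp HQGp one J pe pr pr pw _ _ _ _ Heps Hdeep Hr Hw d1 x1) as [R1 [W1 I1]].
destruct (exit_s_linear lam K P1 P2 P3 g 1 HK TP1 TP2 TP3 one J pe pr pr pw _ _ _ _ Heps Hdeep Hr Hw d1 x1) as [C2 [HC2 E2]].
apply (ctrl_ext J _ _ (fun j b => rp (po j b)) pr) in R1; [| intros j b Hj; split; [symmetry; apply (leg1 j b Hj) | reflexivity]].
apply (ctrl_ext J _ _ (fun j b => wp (po j b)) (fun _ _ => 0)) in W1; [| intros j b Hj; split; [symmetry; apply (leg1 j b Hj) | reflexivity]].
destruct (leg_ctrl lam K M1 M2 M3 Qm g (-1) HK TM1 TM2 TM3 HQm HQGm mone J pe _ pr _ _ _ _ _ Heps Hdeep R1 W1 d2 x2) as [_ [_ I2]].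
destruct (exit_s_linear lam K M1 M2 M3 g (-1) HK TM1 TM2 TM3 mone J pe _ pr _ _ _ _ _ Heps Hdeep R1 W1 d2 x2) as [C3 [HC3 E3]].
assert (G : ctrl J (fun j b => (rm (po j b) - pr j b) / (2 * pe j)) (fun j b => gain (pr j b))).
{ eapply ctrl_ext; [| exact (ctrl_add J _ _ _ _ I1 I2)]. intros j b Hj. split; [| reflexivity].
  destruct (leg1 j b Hj) as [_ [_ [<- _]]]. destruct (leg2 j b Hj) as [_ [_ [<- _]]]. field. apply (Heps j Hj). }
destruct G as [C1 [HC1 E1]].
set (A := exp (Rabs lam * 10)). assert (HA : 1 <= A).
{ unfold A. rewrite <- exp_0. apply exp_le_mono. assert (Q := Rabs_pos lam). lra. }
set (L := Rabs lam * A). assert (HL : 0 <= L) by pos.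
destruct (ev_and J _ _ E1 (ev_and J _ _ E2 E3)) as [e1 [He1 E]].
assert (pA : 0 <= C2 * A) by pos. assert (pL : 0 <= C2 * (L * C3)) by pos.
exists (C1 + 2 * (C2 * A) + C2 * (L * C3) + 2 * C3), (Rmin e1 1). split; [lra |].
split; [split; [apply Rmin_glb_lt; lra | apply Rmin_r] |].
intros eps r w o r' w' o' He Hd Hd' hw hw' ho ho'. assert (He1' : Rabs eps <= 1) by (eapply Rle_trans; [apply He | apply Rmin_r]).
set (p := Build_pair_data eps (fun b : bool => if b then r else r') (fun b : bool => if b then w else w') (fun b : bool => if b then o else o')).
assert (Hp : ok J p) by (split; [simpl; lra | intros [|]; (split; [assumption | split; assumption])]).
destruct (E p Hp (Rle_trans _ _ _ (proj2 He) (Rmin_l _ _))) as [[_ [f3 [f5 f6]]] [[_ [_ [g1 g3]]] [u1 [u3 [k1 k3]]]]].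
assert (leg1p := leg1 p true Hp). assert (leg1q := leg1 p false Hp). assert (leg2p := leg2 p true Hp). assert (leg2q := leg2 p false Hp).
assert (g1p := g1 true). assert (g1q := g1 false). specialize (k1 true). specialize (f3 true). assert (u1p := u1 true). assert (u1q := u1 false). clear g1 u1.
simpl in leg1p, leg1q, leg2p, leg2q, f3, f5, f6, g1p, g1q, g3, k1, k3, u1p, u1q, u3.
destruct leg1p as [_ [_ [_ [w1 _]]]]. destruct leg1q as [_ [_ [_ [w1' _]]]]. destruct leg2p as [_ [_ [_ [w2 _]]]]. destruct leg2q as [_ [_ [_ [w2' _]]]].
rewrite <- ?w1, <- ?w1', <- ?w2, <- ?w2' in *. clear w1 w1' w2 w2' leg1 leg2 d1 d2 x1 x2.
set (e := Rabs eps) in *. set (dl := Rabs (r - r')) in *. set (W := Rabs (w - w')) in *.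
assert (Hdl : 0 <= dl) by apply Rabs_pos. assert (HW : 0 <= W) by apply Rabs_pos.
assert (hed : e * dl <= 1 * dl) by mono. assert (Hed0 : 0 <= e * dl) by pos.
set (CC := C1 + 2 * (C2 * A) + C2 * (L * C3) + 2 * C3).
assert (up : forall z, 0 <= z -> C1 * z <= CC * z) by (intros z Hz; apply Rmult_le_compat_r; [exact Hz | unfold CC; lra]).
split; [eapply Rle_trans; [exact f5 | now apply up] |].
split; [eapply Rle_trans; [exact f3 | apply up; lra] |].
split; [eapply Rle_trans; [exact f6 | apply up; lra] |].
assert (Emu : forall rr, exp (- lam * turn g (-1) rr) * exp (- lam * turn g 1 rr) = mu).
{ intros rr. rewrite <- exp_plus. unfold mu, turn, half_turn. f_equal. ring. }
assert (bexp : forall t, 0 < t <= 8 -> Rabs (exp (- lam * t)) <= A).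
{ intros t Ht. rewrite Rabs_pos_eq by (left; apply exp_pos). unfold A. rewrite <- (Rabs_Ropp lam). apply exp_Rabs_le. lra. }
set (a := wp o - exp (- lam * turn g 1 r) * w) in *.
set (a' := wp o' - exp (- lam * turn g 1 r') * w') in *.
set (b := wm o - exp (- lam * turn g (-1) r) * wp o) in *.
set (b' := wm o' - exp (- lam * turn g (-1) r') * wp o') in *.
assert (q1 : wm o - mu * w = exp (- lam * turn g (-1) r) * a + b) by (unfold a, b; rewrite <- (Emu r); ring).
assert (q2 : wm o' - mu * w' = exp (- lam * turn g (-1) r') * a' + b') by (unfold a', b'; rewrite <- (Emu r'); ring).
rewrite q1, q2.
assert (x3 := exp_lip lam (turn g (-1) r) (turn g (-1) r') ltac:(lra) ltac:(lra)). fold A in x3. fold L in x3.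
split.
- apply Rle_trans with (A * (C2 * e) + C3 * e).
  + apply Rabs_add_le; [apply Rabs_prod; [now apply bexp | exact g1p] | exact k1].
  + assert (0 <= C1 * e) by pos. assert (0 <= C2 * A * e) by pos.
    assert (0 <= C2 * (L * C3) * e) by pos. assert (0 <= C3 * e) by pos.
    unfold CC. lra.
- replace (exp (- lam * turn g (-1) r) * a + b - (exp (- lam * turn g (-1) r') * a' + b'))
    with ((exp (- lam * turn g (-1) r) * (a - a') + (exp (- lam * turn g (-1) r) - exp (- lam * turn g (-1) r')) * a') + (b - b')) by ring.
  assert (S0 : dl + (e * dl + W) <= 2 * (dl + W)) by lra.
  eapply Rle_trans.
  { apply Rabs_add_le; [apply Rabs_add_le; apply Rabs_prod; [now apply bexp | exact g3 | | exact g1q] | exact k3].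
    eapply Rle_trans; [exact x3 |]. apply Rmult_le_compat_l; [exact HL | exact u3]. }
  assert (HS : 0 <= dl + W) by lra.
  assert (i1 : A * (C2 * e * (dl + (e * dl + W))) <= (C2 * A) * e * (2 * (dl + W))).
  { replace (A * (C2 * e * (dl + (e * dl + W)))) with ((C2 * A) * e * (dl + (e * dl + W))) by ring.
    apply Rmult_le_compat_l; [apply Rmult_le_pos; lra | lra]. }
  assert (i2 : L * (C3 * dl) * (C2 * e) <= C2 * (L * C3) * e * (dl + W)).
  { replace (L * (C3 * dl) * (C2 * e)) with (C2 * (L * C3) * e * dl) by ring.
    apply Rmult_le_compat_l; [apply Rmult_le_pos; lra | lra]. }
  assert (i3 : C3 * e * (dl + (e * dl + W)) <= C3 * e * (2 * (dl + W))).
  { apply Rmult_le_compat_l; [apply Rmult_le_pos; lra | lra]. }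
  assert (i4 : 0 <= C1 * e * (dl + W)) by (apply Rmult_le_pos; [apply Rmult_le_pos; lra | lra]).
  unfold CC. lra.
Qed.

Variables (rs kap slope sg : R).
Hypothesis kap_pos : 0 < kap.
Hypothesis near_deep : forall r, Rabs (r - rs) <= kap -> deep g r.
Hypothesis slope_pos : 0 < slope.
Hypothesis sg_sign : sg = 1 \/ sg = -1.
Hypothesis gain_root : gain rs = 0.
Hypothesis gain_slope : forall r r', Rabs (r - rs) <= kap -> Rabs (r' - rs) <= kap -> r' <= r ->
  slope * (r - r') <= sg * (gain r - gain r').
Hypothesis mu_neq_1 : mu <> 1.

Lemma gain_expands r r' : Rabs (r - rs) <= kap -> Rabs (r' - rs) <= kap ->
  slope * Rabs (r - r') <= Rabs (gain r - gain r').
Proof.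
intros Hr Hr'. destruct (Rle_dec r' r) as [h | h].
- assert (B := gain_slope r r' Hr Hr' h). rewrite (Rabs_pos_eq (r - r')) by lra.
  eapply Rle_trans; [exact B |]. destruct sg_sign as [-> | ->].
  + rewrite Rmult_1_l. apply Rle_abs.
  + replace (-1 * (gain r - gain r')) with (- (gain r - gain r')) by ring. rewrite <- Rabs_Ropp. apply Rle_abs.
- assert (h' : r <= r') by lra. assert (B := gain_slope r' r Hr' Hr h').
  rewrite (Rabs_minus_sym r r'), (Rabs_pos_eq (r' - r)), (Rabs_minus_sym (gain r)) by lra.
  eapply Rle_trans; [exact B |]. destruct sg_sign as [-> | ->].
  + rewrite Rmult_1_l. apply Rle_abs.
  + replace (-1 * (gain r' - gain r)) with (- (gain r' - gain r)) by ring. rewrite <- Rabs_Ropp. apply Rle_abs.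
Qed.

Let nu := Rabs (mu - 1).
Lemma nu_pos : 0 < nu.
Proof. apply Rabs_pos_lt. intros h. apply mu_neq_1. lra. Qed.

Definition round_inh : inhabited round :=
  inhabits (Build_round (fun _ => 0) (fun _ => 0) (fun _ => 0) 0 0 0 (fun _ => 0) (fun _ => 0) (fun _ => 0) 0 0 0).

(** The intermediate value theorem twice. For fixed r, since mu <> 1, the increment of s
    has opposite signs at w = Omega |eps| and w = - Omega |eps|. A zero of it is chosen
    for each r; the estimates make it Lipschitz in r, so that along these zeros the
    increment of rho is continuous, and at the ends of the interval around rs it has the
    sign of the gain. *)
Theorem fixed_exists : exists Omega C e1, 0 <= Omega /\ 1 <= C /\ 0 < e1 <= 1 /\
  forall eps, 0 < Rabs eps <= e1 -> exists r w o, Rabs (r - rs) <= C * Rabs eps /\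
    Rabs (r - rs) <= kap / 2 /\
    Rabs w <= Omega * Rabs eps /\ is_round eps r w o /\ rm o = r /\ wm o = w.
Proof.
assert (Hnu := nu_pos).
destruct (return_estimates 1 ltac:(lra)) as [Ca [ea [HCa [Hea RA]]]].
set (Omega := 2 * Ca / nu + 1).
assert (HO : 0 <= Omega).
{ unfold Omega. assert (0 <= 2 * Ca / nu) by (apply Rdiv_le_0_compat; lra). lra. }
assert (HOnu : Ca <= nu / 2 * Omega).
{ unfold Omega. replace (nu / 2 * (2 * Ca / nu + 1)) with (Ca + nu / 2) by (field; lra). lra. }
destruct (return_estimates Omega HO) as [C [e1 [HC [He1 RE]]]].
destruct (round_exists Omega HO) as [e2 [He2 EX]].
destruct (small_enough C (nu / 4) ltac:(lra) ltac:(lra)) as [e3 [He3 E3]].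
destruct (small_enough C (slope * (kap / 2)) ltac:(lra) ltac:(nra)) as [e4 [He4 E4]].
set (e0 := Rmin ea (Rmin e1 (Rmin e2 (Rmin e3 e4)))).
assert (Hl : e0 <= ea /\ e0 <= e1 /\ e0 <= e2 /\ e0 <= e3 /\ e0 <= e4) by (unfold e0; repeat split; Rmin_le).
exists Omega, (C / slope + 1), e0. split; [exact HO |]. split.
{ assert (0 <= C / slope) by (apply Rdiv_le_0_compat; lra). lra. }
split; [split; [unfold e0; repeat apply Rmin_glb_lt; lra | lra] |].
intros eps Heps. set (e := Rabs eps) in *. destruct Hl as [l1 [l2 [l3 [l4 l5]]]].
specialize (E3 e ltac:(lra)). specialize (E4 e ltac:(lra)).
assert (HOe : 0 <= Omega * e) by pos.
(* for each r, balance the transverse coordinate *)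
assert (step1 : forall r, Rabs (r - rs) <= kap -> exists w o, Rabs w <= Omega * e /\ is_round eps r w o /\ wm o = w).
{ intros r Hr. assert (Hd := near_deep r Hr).
  set (ro := fun w => epsilon round_inh (fun o => is_round eps r w o)).
  assert (Hro : forall w, Rabs w <= Omega * e -> is_round eps r w (ro w)).
  { intros w Hw. unfold ro. apply epsilon_spec. destruct (EX eps r w ltac:(fold e; lra) Hd Hw) as [o ho]. now exists o. }
  assert (H0 : Rabs 0 <= Omega * e) by (rewrite Rabs_R0; exact HOe).
  assert (b0 : Rabs (wm (ro 0)) <= Ca * e).
  { destruct (RA eps r 0 (ro 0) r 0 (ro 0) ltac:(fold e; lra) Hd Hd) as [_ [_ [_ [h _]]]].
    - rewrite Rabs_R0. fold e. lra.
    - rewrite Rabs_R0. fold e. lra.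
    - now apply Hro.
    - now apply Hro.
    - rewrite Rmult_0_r, Rminus_0_r in h. exact h. }
  assert (lip : forall w w', Rabs w <= Omega * e -> Rabs w' <= Omega * e ->
    Rabs ((wm (ro w) - mu * w) - (wm (ro w') - mu * w')) <= nu / 4 * Rabs (w - w')).
  { intros w w' hw hw'. destruct (RE eps r w (ro w) r w' (ro w') ltac:(fold e; lra) Hd Hd hw hw' (Hro w hw) (Hro w' hw')) as [_ [_ [_ [_ h]]]].
    fold mu in h. eapply Rle_trans; [exact h |]. rewrite Rminus_diag, Rabs_R0, Rplus_0_l. fold e.
    apply Rmult_le_compat_r; [apply Rabs_pos | exact E3]. }
  set (f := fun w => wm (ro w) - w).
  (* on the boundary of the interval the linear part (mu - 1) w dominates *)
  assert (far : forall w, Rabs w = Omega * e -> Rabs (f w - (mu - 1) * w) <= nu * (Omega * e)).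
  { intros w hw. unfold f.
    replace (wm (ro w) - w - (mu - 1) * w) with (((wm (ro w) - mu * w) - (wm (ro 0) - mu * 0)) + wm (ro 0)) by ring.
    assert (h := lip w 0 ltac:(lra) H0). rewrite Rminus_0_r, hw in h.
    eapply Rle_trans; [apply Rabs_add_le; [exact h | exact b0] |].
    assert (Ca * e <= nu / 2 * Omega * e) by mono. nra. }
  assert (f1 := far (Omega * e) ltac:(apply Rabs_pos_eq; exact HOe)).
  assert (f2 := far (- (Omega * e)) ltac:(rewrite Rabs_Ropp; apply Rabs_pos_eq; exact HOe)).
  apply Rabs_le_between in f1. apply Rabs_le_between in f2.
  destruct (ivt_lipschitz f (nu + nu / 4) (- (Omega * e)) (Omega * e)) as [w [hw fw]].
  - lra.
  - lra.
  - intros t u Ht Hu. unfold f.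
    replace (wm (ro t) - t - (wm (ro u) - u)) with (((wm (ro t) - mu * t) - (wm (ro u) - mu * u)) + (mu - 1) * (t - u)) by ring.
    replace ((nu + nu / 4) * Rabs (t - u)) with (nu / 4 * Rabs (t - u) + nu * Rabs (t - u)) by ring.
    apply Rabs_add_le; [apply lip; apply Rabs_le; lra | right; apply Rabs_mult].
  - unfold nu, Rabs in f1, f2. destruct (Rcase_abs (mu - 1)) as [hm | hm].
    + assert (0 <= f (- (Omega * e))) by nra. assert (f (Omega * e) <= 0) by nra. nra.
    + assert (f (- (Omega * e)) <= 0) by nra. assert (0 <= f (Omega * e)) by nra. nra.
  - assert (hw' : Rabs w <= Omega * e) by (apply Rabs_le; lra).
    exists w, (ro w). split; [exact hw' |]. split; [now apply Hro |]. unfold f in fw. lra. }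
set (pick := fun r => epsilon (inhabits (0, epsilon round_inh (fun _ => True)))
   (fun q : R * round => Rabs (fst q) <= Omega * e /\ is_round eps r (fst q) (snd q) /\ wm (snd q) = fst q)).
assert (Hpick : forall r, Rabs (r - rs) <= kap ->
  Rabs (fst (pick r)) <= Omega * e /\ is_round eps r (fst (pick r)) (snd (pick r)) /\ wm (snd (pick r)) = fst (pick r)).
{ intros r Hr. unfold pick. apply epsilon_spec. destruct (step1 r Hr) as [w [o H]]. now exists (w, o). }
set (B := fun r => (rm (snd (pick r)) - r) / (2 * eps)).
assert (HB : forall r, Rabs (r - rs) <= kap -> Rabs (B r - gain r) <= C * e).
{ intros r Hr. destruct (Hpick r Hr) as [h1 [h2 h3]]. assert (Hd := near_deep r Hr).
  now destruct (RE eps r _ _ r _ _ ltac:(fold e; lra) Hd Hd h1 h1 h2 h2) as [_ [h _]]. }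
assert (HBl : forall r r', Rabs (r - rs) <= kap -> Rabs (r' - rs) <= kap ->
  Rabs (B r - B r') <= (2 * C + 2 * C * C / nu) * Rabs (r - r')).
{ intros r r' Hr Hr'. destruct (Hpick r Hr) as [h1 [h2 h3]]. destruct (Hpick r' Hr') as [h1' [h2' h3']].
  destruct (RE eps r _ _ r' _ _ ltac:(fold e; lra) (near_deep r Hr) (near_deep r' Hr') h1 h1' h2 h2') as [k1 [_ [k3 [_ k5]]]].
  fold e mu gain in k1, k3, k5. rewrite h3, h3' in k5.
  set (w := fst (pick r)) in *. set (w' := fst (pick r')) in *.
  set (dl := Rabs (r - r')) in *. assert (Hdl : 0 <= dl) by apply Rabs_pos.
  replace (w - mu * w - (w' - mu * w')) with (- ((mu - 1) * (w - w'))) in k5 by ring.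
  rewrite Rabs_Ropp, Rabs_mult in k5. fold nu in k5. assert (HW := Rabs_pos (w - w')).
  assert (k6 : Rabs (w - w') <= 2 * C / nu * dl).
  { assert (j1 : C * e * (dl + Rabs (w - w')) <= C * dl + nu / 4 * Rabs (w - w')).
    { rewrite Rmult_plus_distr_l. apply Rplus_le_compat.
      - assert (C * e <= C * 1) by mono. apply Rmult_le_compat_r; lra.
      - apply Rmult_le_compat_r; lra. }
    apply Rmult_le_reg_l with nu; [exact Hnu |]. replace (nu * (2 * C / nu * dl)) with (2 * C * dl) by (field; lra).
    assert (0 <= C * dl) by pos. assert (0 <= nu * Rabs (w - w')) by pos. lra. }
  replace (B r - B r') with ((B r - gain r - (B r' - gain r')) + (gain r - gain r')) by ring.
  eapply Rle_trans; [apply Rabs_add_le; [exact k3 | exact k1] |]. fold dl.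
  assert (e * dl <= 1 * dl) by mono.
  apply Rle_trans with (C * (1 * dl + 2 * C / nu * dl) + C * dl).
  - apply Rplus_le_compat_r. apply Rmult_le_compat_l; lra.
  - right. field. lra. }
assert (rin : forall r, rs - kap <= r <= rs + kap -> Rabs (r - rs) <= kap) by (intros r Hr; apply Rabs_le; lra).
assert (rin2 : forall r, rs - kap / 2 <= r <= rs + kap / 2 -> Rabs (r - rs) <= kap) by (intros r Hr; apply Rabs_le; lra).
assert (i1 : Rabs (rs + kap / 2 - rs) <= kap) by (apply rin2; lra).
assert (i2 : Rabs (rs - kap / 2 - rs) <= kap) by (apply rin2; lra).
assert (i3 : Rabs (rs - rs) <= kap) by (apply rin2; lra).
assert (g1 := gain_slope (rs + kap / 2) rs i1 i3 ltac:(lra)).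
assert (g2 := gain_slope rs (rs - kap / 2) i3 i2 ltac:(lra)).
rewrite gain_root in g1, g2. rewrite Rminus_0_r in g1.
assert (b1 := HB _ i1). assert (b2 := HB _ i2).
apply Rabs_le_between in b1. apply Rabs_le_between in b2.
destruct (ivt_lipschitz B (2 * C + 2 * C * C / nu) (rs - kap / 2) (rs + kap / 2)) as [r [hr Br]].
- lra.
- assert (0 <= 2 * C * C / nu) by (apply Rdiv_le_0_compat; [apply Rmult_le_pos; lra | exact Hnu]). lra.
- intros t u Ht Hu. apply HBl; apply rin2; lra.
- destruct sg_sign as [-> | ->].
  + assert (0 <= B (rs + kap / 2)) by nra. assert (B (rs - kap / 2) <= 0) by nra. nra.
  + assert (B (rs + kap / 2) <= 0) by nra. assert (0 <= B (rs - kap / 2)) by nra. nra.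
- assert (Hr := rin2 r hr). destruct (Hpick r Hr) as [h1 [h2 h3]].
  exists r, (fst (pick r)), (snd (pick r)). 
  assert (b3 := HB r Hr). rewrite Br, Rminus_0_l, Rabs_Ropp in b3.
  assert (b4 := gain_expands r rs Hr i3). rewrite gain_root, Rminus_0_r in b4.
  split; [| split; [| split; [exact h1 | split; [exact h2 | split; [| exact h3]]]]].
  + apply Rmult_le_reg_l with slope; [exact slope_pos |].
    replace (slope * ((C / slope + 1) * e)) with (C * e + slope * e) by (field; lra).
    assert (0 <= slope * e) by pos. lra.
  + apply Rabs_le. lra.
  + unfold B in Br. assert (heps : 2 * eps <> 0).
    { intros h0. assert (eps = 0) by lra. unfold e in Heps. rewrite H, Rabs_R0 in Heps. lra. }
    apply Rmult_integral in Br. destruct Br as [Br | Br]; [lra |].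
    exfalso. now apply (Rinv_neq_0_compat _ heps).
Qed.

(** Near the fixed point each of the distances |r - rb| and |w - wb| is expanded or
    contracted, and the effect of one on the other is smaller. Hence a combination of
    the two, with signs according to expansion or contraction, increases along every
    orbit and can only be periodic when it vanishes. *)
Theorem fixed_unique Omega : 0 <= Omega -> exists e1, 0 < e1 <= 1 /\
  forall eps rb wb ob, 0 < Rabs eps <= e1 -> Rabs (rb - rs) <= kap -> Rabs wb <= Omega * Rabs eps ->
  is_round eps rb wb ob -> rm ob = rb -> wm ob = wb ->
  forall (rn wn : nat -> R) (on : nat -> round) N,
    (forall n, Rabs (rn n - rs) <= kap /\ Rabs (wn n) <= Omega * Rabs eps /\ is_round eps (rn n) (wn n) (on n) /\
       rn (S n) = rm (on n) /\ wn (S n) = wm (on n)) ->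
    rn (S N) = rn 0%nat -> wn (S N) = wn 0%nat -> rn 0%nat = rb /\ wn 0%nat = wb.
Proof.
intros HO. assert (Hnu := nu_pos).
destruct (return_estimates Omega HO) as [C [e1 [HC [He1 RE]]]].
set (beta := slope / (4 * C)). assert (Hbeta : 0 < beta) by (apply Rdiv_lt_0_compat; lra).
assert (HbC : 2 * beta * C = slope / 2) by (unfold beta; field; lra).
clearbody beta.
destruct (small_enough C (slope / 4) ltac:(lra) ltac:(lra)) as [e2 [He2 E2]].
destruct (small_enough (2 * C + 2 * beta * C) (beta * nu / 2) ltac:(nra) ltac:(nra)) as [e3 [He3 E3]].
destruct (small_enough (2 * C) 1 ltac:(nra) ltac:(lra)) as [e4 [He4 E4]].
set (e0 := Rmin e1 (Rmin e2 (Rmin e3 e4))).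
assert (Hl : e0 <= e1 /\ e0 <= e2 /\ e0 <= e3 /\ e0 <= e4) by (unfold e0; repeat split; Rmin_le).
exists e0. split; [split; [unfold e0; repeat apply Rmin_glb_lt; lra | lra] |].
intros eps rb wb ob Heps Hrb Hwb Hob Frb Fwb rn wn on N Hseq Hr0 Hw0.
set (e := Rabs eps) in *. destruct Hl as [l1 [l2 [l3 l4]]].
specialize (E2 e ltac:(lra)). specialize (E3 e ltac:(lra)). specialize (E4 e ltac:(lra)).
assert (heps : eps <> 0). { intros h0. unfold e in Heps. rewrite h0, Rabs_R0 in Heps. lra. }
set (V := fun n => Rabs (rn n - rb)). set (W := fun n => Rabs (wn n - wb)).
assert (HV : forall n, 0 <= V n) by (intros; apply Rabs_pos). assert (HW : forall n, 0 <= W n) by (intros; apply Rabs_pos).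
(* s1 is 1 if r is expanded and -1 if it is contracted, which depends on the signs of
   the slope and of eps; s2 below plays the same part for w *)
assert (Hs1 : exists s1, (s1 = 1 \/ s1 = -1) /\ forall n, s1 * V n + 2 * slope * e * V n - 2 * C * e * (e * V n + W n) <= s1 * V (S n)).
{ exists (if Rlt_dec 0 (sg * eps) then 1 else -1). split; [destruct Rlt_dec; auto |]. intros n.
  destruct (Hseq n) as [h1 [h2 [h3 [h4 h5]]]].
  destruct (RE eps _ _ _ rb wb ob ltac:(fold e; lra) (near_deep _ h1) (near_deep _ Hrb) h2 Hwb h3 Hob) as [k1 [_ [k3 _]]].
  rewrite <- h4, Frb in k3. fold gain e in k1, k3. fold (V n) (W n) in k1, k3.
  set (v := rn n - rb) in *.
  set (err := (rn (S n) - rn n) / (2 * eps) - gain (rn n) - ((rb - rb) / (2 * eps) - gain rb)) in *.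
  assert (eqn : rn (S n) - rb = v + 2 * eps * (gain (rn n) - gain rb) + 2 * eps * err) by (unfold err, v; field; exact heps).
  assert (herr : Rabs (2 * eps * err) <= 2 * C * e * (e * V n + W n)).
  { rewrite !Rabs_mult, (Rabs_pos_eq 2) by lra. fold e.
    replace (2 * C * e * (e * V n + W n)) with (2 * e * (C * (e * V n + W n))) by ring.
    apply Rmult_le_compat_l; [lra | exact k3]. }
  assert (hgp : Rabs (2 * eps * (gain (rn n) - gain rb)) <= V n).
  { rewrite !Rabs_mult, (Rabs_pos_eq 2) by lra. fold e.
    apply Rle_trans with (2 * e * (C * V n)); [apply Rmult_le_compat_l; lra |].
    replace (2 * e * (C * V n)) with (2 * C * e * V n) by ring.
    rewrite <- (Rmult_1_l (V n)) at 2. apply Rmult_le_compat_r; [apply HV | exact E4]. }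
  assert (hexp : 2 * slope * e * V n <= Rabs (2 * eps * (gain (rn n) - gain rb))).
  { rewrite !Rabs_mult, (Rabs_pos_eq 2) by lra. fold e.
    replace (2 * slope * e * V n) with (2 * e * (slope * V n)) by ring. apply Rmult_le_compat_l; [lra |].
    apply gain_expands; assumption. }
  (* the gain increment has the sign of sg * eps * v *)
  assert (hsign : 0 <= sg * eps * (2 * eps * (gain (rn n) - gain rb)) * v).
  { assert (q : 0 <= sg * (gain (rn n) - gain rb) * v).
    { unfold v. destruct (Rle_dec rb (rn n)) as [hh | hh].
      - assert (B := gain_slope (rn n) rb h1 Hrb hh). assert (0 <= sg * (gain (rn n) - gain rb)) by nra. apply Rmult_le_pos; lra.
      - assert (B := gain_slope rb (rn n) Hrb h1 ltac:(lra)).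
        replace (sg * (gain (rn n) - gain rb) * (rn n - rb)) with (sg * (gain rb - gain (rn n)) * (rb - rn n)) by ring.
        assert (0 <= sg * (gain rb - gain (rn n))) by nra. apply Rmult_le_pos; lra. }
    replace (sg * eps * (2 * eps * (gain (rn n) - gain rb)) * v) with (2 * (eps * eps) * (sg * (gain (rn n) - gain rb) * v)) by ring.
    apply Rmult_le_pos; [nra | exact q]. }
  change (V (S n)) with (Rabs (rn (S n) - rb)). rewrite eqn.
  set (gp := 2 * eps * (gain (rn n) - gain rb)) in *. set (er := 2 * eps * err) in *.
  assert (Hv : Rabs v = V n) by reflexivity. clearbody gp er v. rewrite <- Hv in *. clear k1 k3 eqn h1 h2 h3 h4 h5 Hseq.
  assert (T1 := Rabs_triang (v + gp + er) (- er)). replace (v + gp + er + - er) with (v + gp) in T1 by ring. rewrite Rabs_Ropp in T1.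
  assert (T2 := Rabs_triang (v + gp) er).
  destruct Rlt_dec as [hs | hs].
  - assert (E : Rabs (v + gp) = Rabs v + Rabs gp).
    { assert (0 <= gp * v) by (apply Rmult_le_reg_l with (sg * eps); [exact hs | lra]).
      apply Rabs_add_same. lra. }
    lra.
  - assert (hs' : sg * eps < 0). { destruct sg_sign as [-> | ->]; destruct (Rtotal_order eps 0) as [? | [? | ?]]; lra. }
    assert (E : Rabs (v + gp) = Rabs v - Rabs gp).
    { assert (v * gp <= 0).
      { apply Rmult_le_reg_l with (- (sg * eps)); [lra |]. lra. }
      now apply Rabs_add_opposite. }
    lra. }
assert (Hs2 : exists s2, (s2 = 1 \/ s2 = -1) /\ forall n, s2 * W n + nu * W n - C * e * (V n + W n) <= s2 * W (S n)).
{ exists (if Rlt_dec 0 (mu - 1) then 1 else -1). split; [destruct Rlt_dec; auto |]. intros n.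
  destruct (Hseq n) as [h1 [h2 [h3 [h4 h5]]]].
  destruct (RE eps _ _ _ rb wb ob ltac:(fold e; lra) (near_deep _ h1) (near_deep _ Hrb) h2 Hwb h3 Hob) as [_ [_ [_ [_ k]]]].
  rewrite <- h5, Fwb in k. fold mu e in k. fold (V n) (W n) in k.
  replace (wn (S n) - mu * wn n - (wb - mu * wb)) with ((wn (S n) - wb) - mu * (wn n - wb)) in k by ring.
  assert (Hmu0 : 0 < mu) by apply exp_pos.
  assert (E : Rabs (mu * (wn n - wb)) = mu * W n) by (rewrite Rabs_mult, (Rabs_pos_eq mu) by lra; reflexivity).
  assert (T1 := Rabs_triang (wn (S n) - wb - mu * (wn n - wb)) (mu * (wn n - wb))).
  assert (T2 := Rabs_triang (- (wn (S n) - wb - mu * (wn n - wb))) (wn (S n) - wb)).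
  replace (wn (S n) - wb - mu * (wn n - wb) + mu * (wn n - wb)) with (wn (S n) - wb) in T1 by ring.
  replace (- (wn (S n) - wb - mu * (wn n - wb)) + (wn (S n) - wb)) with (mu * (wn n - wb)) in T2 by ring.
  rewrite Rabs_Ropp in T2. fold (W (S n)) in T1, T2. rewrite E in T1, T2.
  destruct Rlt_dec as [h | h].
  - assert (En : nu = mu - 1) by (unfold nu; apply Rabs_pos_eq; lra). rewrite En. lra.
  - assert (En : nu = 1 - mu) by (unfold nu; rewrite Rabs_left1 by lra; ring). rewrite En. lra. }
destruct Hs1 as [s1 [_ H1]]. destruct Hs2 as [s2 [_ H2]].
set (Ly := fun n => s1 * V n + s2 * beta * W n).
assert (HL : forall n, Ly n + (slope * e * V n + beta * nu / 2 * W n) <= Ly (S n)).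
{ intros n. unfold Ly. specialize (H1 n). specialize (H2 n).
  assert (A1 := HV n). assert (A2 := HW n).
  assert (H2' : beta * (s2 * W n + nu * W n - C * e * (V n + W n)) <= beta * (s2 * W (S n))) by mono.
  assert (i1 : C * e * (e * V n) <= slope / 4 * (e * V n)) by (apply Rmult_le_compat_r; [apply Rmult_le_pos; lra | exact E2]).
  assert (i2 : (2 * C + 2 * beta * C) * e * W n <= beta * nu / 2 * W n) by mono.
  assert (i3 : 2 * beta * C * (e * V n) = slope / 2 * (e * V n)) by (rewrite HbC; reflexivity).
  assert (i4 : 0 <= beta * C * e * W n) by pos.
  assert (i5 : 0 <= slope * (e * V n)) by pos.
  lra. }
assert (Hmono : forall n, Ly 1%nat <= Ly (S n)).
{ induction n as [| n IH]; [lra |]. specialize (HL (S n)).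
  assert (0 <= slope * e * V (S n)) by (apply Rmult_le_pos; [nra | apply HV]).
  assert (0 <= beta * nu / 2 * W (S n)) by (apply Rmult_le_pos; [nra | apply HW]). lra. }
assert (Hper : Ly (S N) = Ly 0%nat) by (unfold Ly, V, W; rewrite Hr0, Hw0; reflexivity).
specialize (Hmono N). specialize (HL 0%nat).
assert (A1 := HV 0%nat). assert (A2 := HW 0%nat).
assert (pce : 0 < slope * e) by (apply Rmult_lt_0_compat; lra).
assert (pbn : 0 < beta * nu / 2) by nra.
assert (z1 : V 0%nat = 0) by nra. assert (z2 : W 0%nat = 0) by nra.
unfold V in z1. unfold W in z2.
apply Rcomplements.Rabs_eq_0 in z1 || (destruct (Req_dec (rn 0%nat - rb) 0) as [h | h]; [| apply Rabs_no_R0 in h; lra]).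
apply Rcomplements.Rabs_eq_0 in z2 || (destruct (Req_dec (wn 0%nat - wb) 0) as [h' | h']; [| apply Rabs_no_R0 in h'; lra]).
lra.
Qed.

(** * Filippov solutions near the paraboloid *)

Definition in_region (x y s : R) : Prop := sw_lo g <= x * x + y * y <= sw_hi g /\ Rabs s <= 1.

(** The field in the coordinates x, y, s. Only its values in the region matter, so that
    the perturbing terms may be cut off outside. *)
Definition represents (F : vector_field) (G1 G2 G3 : R -> R -> R -> R) (eps : R) : Prop :=
  forall x y s, in_region x y s -> exists vx vy vs, velocity lam G1 G2 G3 eps x y s vx vy vs /\
    F (lift x y s) = (vx, vy, vs + (2 * x * vx + 2 * y * vy)).

Definition separates (f : R3 -> R) : Prop := forall x y s, in_region x y s ->
  (0 < f (lift x y s) <-> 0 < above g x y s) /\ (f (lift x y s) < 0 <-> above g x y s < 0).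

(** On the surface itself only the distance from the unperturbed field is retained: it
    is the same for all convex combinations, and it suffices to show that the surface is
    crossed at once. *)
Definition broken (eps x y s vx vy vs : R) : Prop :=
  (0 < above g x y s -> velocity lam P1 P2 P3 eps x y s vx vy vs) /\
  (above g x y s < 0 -> velocity lam M1 M2 M3 eps x y s vx vy vs) /\
  near_center lam (K * Rabs eps) x y s vx vy vs.

Lemma Rabs_convex s a b k : 0 <= s <= 1 -> Rabs a <= k -> Rabs b <= k -> Rabs (s * a + (1 - s) * b) <= k.
Proof. intros Hs Ha Hb. apply Rabs_le_between in Ha. apply Rabs_le_between in Hb. apply Rabs_le. nra. Qed.

Lemma filippov_broken f Xp Xm eps x y s v : in_region x y s -> separates f ->
  represents Xp P1 P2 P3 eps -> represents Xm M1 M2 M3 eps ->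
  filippov_velocity f Xp Xm (lift x y s) v ->
  broken eps x y s (px v) (py v) (pz v - (2 * x * px v + 2 * y * py v)).
Proof.
intros Hr Hf HP HM [F1 [F2 F3]]. destruct (Hf x y s Hr) as [S1 S2].
destruct (HP x y s Hr) as [ax [ay [az [Va Ea]]]]. destruct (HM x y s Hr) as [bx [by_ [bz [Vb Eb]]]].
assert (Na := velocity_near_center lam K P1 P2 P3 TP1 TP2 TP3 eps _ _ _ _ _ _ Va).
assert (Nb := velocity_near_center lam K M1 M2 M3 TM1 TM2 TM3 eps _ _ _ _ _ _ Vb).
assert (EP : v = Xp (lift x y s) -> px v = ax /\ py v = ay /\ pz v - (2 * x * px v + 2 * y * py v) = az).
{ intros ->. rewrite Ea. unfold px, py, pz. simpl. repeat split. ring. }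
assert (EM : v = Xm (lift x y s) -> px v = bx /\ py v = by_ /\ pz v - (2 * x * px v + 2 * y * py v) = bz).
{ intros ->. rewrite Eb. unfold px, py, pz. simpl. repeat split. ring. }
split; [| split].
- intros h. destruct (EP (F1 (proj2 S1 h))) as [-> [-> ->]]. exact Va.
- intros h. destruct (EM (F2 (proj2 S2 h))) as [-> [-> ->]]. exact Vb.
- destruct (Rtotal_order (f (lift x y s)) 0) as [h | [h | h]].
  + destruct (EM (F2 h)) as [-> [-> ->]]. exact Nb.
  + destruct (F3 h) as [t [Ht ->]]. rewrite Ea, Eb. unfold px, py, pz. simpl.
    unfold plus, scal, mult; simpl. unfold mult; simpl.
    destruct Na as [n1 [n2 n3]]. destruct Nb as [m1 [m2 m3]]. split; [| split].
    * replace (t * ax + (1 - t) * bx + y) with (t * (ax + y) + (1 - t) * (bx + y)) by ring. now apply Rabs_convex.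
    * replace (t * ay + (1 - t) * by_ - x) with (t * (ay - x) + (1 - t) * (by_ - x)) by ring. now apply Rabs_convex.
    * match goal with |- Rabs ?A <= _ => replace A with (t * (az + lam * s) + (1 - t) * (bz + lam * s)) by ring end. now apply Rabs_convex.
  + destruct (EP (F1 h)) as [-> [-> ->]]. exact Na.
Qed.

Lemma region_bound x y s : in_region x y s -> Rabs x <= sw_hi g + 1 /\ Rabs y <= sw_hi g + 1.
Proof.
intros [[_ h] _]. assert (A := sw_lo_pos g). assert (B := sw_hi_lo g).
split; apply Rabs_le; split; nra.
Qed.

(** The change of coordinates is smooth, hence compatible with velocities almost
    everywhere; on the surface the velocity is a convex combination of the two fields,
    whose distance from the unperturbed field is still O(eps). *)
Lemma filippov_chart f Xp Xm eps c : separates f -> represents Xp P1 P2 P3 eps -> represents Xm M1 M2 M3 eps ->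
  filippov_solution f Xp Xm c -> (forall t, in_region (px (c t)) (py (c t)) (ps (c t))) ->
  forall a b, a <= b -> ae_curve (broken eps) (fun t => px (c t)) (fun t => py (c t)) (fun t => ps (c t)) a b.
Proof.
intros Hf HP HM [Hac HN] Hr a b Hab.
destruct (ac_coords c a (b + 1) ltac:(lra) Hac) as [A1 [A2 A3]].
assert (B1 : bac (fun t => px (c t)) a (b + 1)).
{ split; [exact A1 |]. exists (sw_hi g + 1). assert (A := sw_lo_pos g). assert (B := sw_hi_lo g).
  split; [lra |]. intros t _. apply (region_bound _ _ _ (Hr t)). }
assert (B2 : bac (fun t => py (c t)) a (b + 1)).
{ split; [exact A2 |]. exists (sw_hi g + 1). assert (A := sw_lo_pos g). assert (B := sw_hi_lo g).
  split; [lra |]. intros t _. apply (region_bound _ _ _ (Hr t)). }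
assert (B3 : bac (fun t => pz (c t)) a (b + 1)).
{ split; [exact A3 |]. exists (1 + sw_hi g). assert (A := sw_lo_pos g). assert (B := sw_hi_lo g).
  split; [lra |]. intros t _. destruct (Hr t) as [h1 h2].
  replace (pz (c t)) with (ps (c t) + (px (c t) * px (c t) + py (c t) * py (c t))) by (unfold ps; ring).
  apply Rabs_add_le; [exact h2 |]. rewrite Rabs_pos_eq; lra. }
assert (B4 : bac (fun t => ps (c t)) a (b + 1)).
{ unfold ps. apply bac_minus; [exact B3 |]. apply bac_plus; now apply bac_mult. }
split; [apply (bac_sub _ a (b + 1)); [lra | lra | exact B1] |].
split; [apply (bac_sub _ a (b + 1)); [lra | lra | exact B2] |].
split; [apply (bac_sub _ a (b + 1)); [lra | lra | exact B4] |].
eexists. split; [exact HN |]. intros t _ Ht. apply NNPP in Ht. destruct Ht as [v [D V]].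
destruct (is_derive_coords c t v D) as [d1 [d2 d3]].
exists (px v), (py v), (pz v - (2 * px (c t) * px v + 2 * py (c t) * py v)).
split; [exact d1 |]. split; [exact d2 |]. split.
- unfold ps. replace (pz v - (2 * px (c t) * px v + 2 * py (c t) * py v)) with
    (pz v - ((px v * px (c t) + px (c t) * px v) + (py v * py (c t) + py (c t) * py v))) by ring.
  apply derive_minus; [exact d3 |]. apply derive_plus; now apply derive_mult.
- apply (filippov_broken f Xp Xm); try assumption; [apply Hr |]. now rewrite lift_ps.
Qed.

Lemma round_bounds Omega : 0 <= Omega -> exists C e1, 1 <= C /\ 0 < e1 <= 1 /\ forall eps r w o,
  Rabs eps <= e1 -> deep g r -> Rabs w <= Omega * Rabs eps -> is_round eps r w o ->
  / C <= Tp o <= 10 /\ / C <= Tm o <= 10 /\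
  (forall t, 0 <= t <= Tp o -> Rabs (xp o t * xp o t + yp o t * yp o t - r) <= C * Rabs eps /\ Rabs (sp o t) <= C * Rabs eps) /\
  (forall t, 0 <= t <= Tm o -> Rabs (xm o t * xm o t + ym o t * ym o t - r) <= C * Rabs eps /\ Rabs (sm o t) <= C * Rabs eps).
Proof.
intros HO. assert (Hm := sw_margin_pos g).
destruct (leg_bounds lam K P1 P2 P3 g 1 Omega HK TP1 TP2 TP3 ltac:(ring) HO) as [C1 [e1 [HC1 [He1 L1]]]].
destruct (leg_bounds lam K M1 M2 M3 g (-1) C1 HK TM1 TM2 TM3 ltac:(ring) ltac:(lra)) as [C2 [e2 [HC2 [He2 L2]]]].
destruct (small_enough C1 (sw_margin g) ltac:(lra) Hm) as [e3 [he3 E3]].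
exists (C1 + C2), (Rmin e1 (Rmin e2 e3)). split; [lra |].
split; [split; [repeat apply Rmin_glb_lt; lra | eapply Rle_trans; [apply Rmin_l | lra]] |].
intros eps r w o Heps Hr Hw [Hp Hmm].
assert (q1 : Rabs eps <= e1) by (below Heps).
assert (q2 : Rabs eps <= e2) by (below Heps).
assert (q3 : Rabs eps <= e3) by (below Heps).
specialize (E3 _ q3). assert (He := Rabs_pos eps).
assert (Hc : core g r) by (unfold deep in Hr; unfold core; lra).
destruct (L1 _ _ _ _ _ _ _ _ _ q1 Hc Hw Hp) as [hT1 B1].
destruct (B1 (Tp o)) as [B2 B3]. { assert (0 < / C1) by (apply Rinv_0_lt_compat; lra). lra. }
assert (Hp' := Hp). destruct Hp' as [_ [_ [h1 [h2 _]]]]. rewrite <- h1 in B2. rewrite <- h2 in B3.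
assert (Hc1 : core g (rp o)). { apply Rabs_le_between in B2. unfold deep in Hr. unfold core. lra. }
destruct (L2 _ _ _ _ _ _ _ _ _ q2 Hc1 B3 Hmm) as [hT2 B4].
assert (i1 : / (C1 + C2) <= / C1) by (apply Rinv_le_contravar; lra).
assert (i2 : / (C1 + C2) <= / C2) by (apply Rinv_le_contravar; lra).
assert (u1 : 0 <= C1 * Rabs eps) by pos.
assert (u2 : 0 <= C2 * Rabs eps) by pos.
split; [lra |]. split; [lra |]. split.
- intros t Ht. destruct (B1 t Ht). split; lra.
- intros t Ht. destruct (B4 t Ht) as [k1 k2]. split; [| lra].
  replace (xm o t * xm o t + ym o t * ym o t - r) with ((xm o t * xm o t + ym o t * ym o t - rp o) + (rp o - r)) by ring.
  replace ((C1 + C2) * Rabs eps) with (C2 * Rabs eps + C1 * Rabs eps) by ring. now apply Rabs_add_le.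
Qed.

Definition loop (o : round) (u : R) : R3 :=
  lift (join (Tp o) (xp o) (xm o) u) (join (Tp o) (yp o) (ym o) u) (join (Tp o) (sp o) (sm o) u).
Definition period (o : round) : R := Tp o + Tm o.

Lemma loop_left o u : u <= Tp o -> loop o u = lift (xp o u) (yp o u) (sp o u).
Proof. intros H. unfold loop, join. destruct Rle_dec; [reflexivity | lra]. Qed.

Lemma round_seam eps r w o : is_round eps r w o -> xp o (Tp o) = xm o 0 /\ yp o (Tp o) = ym o 0 /\ sp o (Tp o) = sm o 0.
Proof.
intros [[_ [_ [_ [h2 [h3 h4]]]]] [[_ [k1 [k2 k3]]] _]]. rewrite h3, h4, k1, k2, k3, <- h2. repeat split.
Qed.

Lemma loop_right eps r w o u : is_round eps r w o -> Tp o <= u ->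
  loop o u = lift (xm o (u - Tp o)) (ym o (u - Tp o)) (sm o (u - Tp o)).
Proof.
intros Ho H. unfold loop, join. destruct Rle_dec as [h | h]; [| reflexivity].
replace u with (Tp o) by lra. rewrite Rminus_diag. destruct (round_seam _ _ _ _ Ho) as [-> [-> ->]]. reflexivity.
Qed.

Lemma loop_ends eps r w o : is_round eps r w o -> 0 < Tp o -> 0 < Tm o -> rm o = r -> wm o = w -> loop o (period o) = loop o 0.
Proof.
intros Ho h1 h2 hr hw. rewrite (loop_right _ _ _ _ _ Ho), loop_left by (unfold period; lra).
replace (period o - Tp o) with (Tm o) by (unfold period; ring).
destruct Ho as [[[_ [k1 [k2 k3]]] _] [_ [_ [_ [j2 [j3 j4]]]]]].
rewrite j3, j4, <- j2, k1, k2, k3, hr, hw. f_equal. ring.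
Qed.

Section Orbit.
Variables (f : R3 -> R) (Xp Xm : vector_field).
Hypothesis Hsep : separates f.

Lemma above_velocity X G1 G2 G3 eps x y s vx vy vs : represents X G1 G2 G3 eps -> in_region x y s ->
  velocity lam G1 G2 G3 eps x y s vx vy vs -> X (lift x y s) = (vx, vy, vs + (2 * x * vx + 2 * y * vy)).
Proof.
intros HX Hr [-> [-> ->]]. destruct (HX x y s Hr) as [vx [vy [vs [[-> [-> ->]] E]]]]. exact E.
Qed.

Lemma lift_derive (x y s : R -> R) t vx vy vs : is_derive x t vx -> is_derive y t vy -> is_derive s t vs ->
  is_derive (fun t => lift (x t) (y t) (s t)) t (vx, vy, vs + (2 * x t * vx + 2 * y t * vy)).
Proof.
intros d1 d2 d3. unfold lift. apply is_derive_R3; [exact d1 | exact d2 |].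
apply derive_plus; [exact d3 |].
replace (2 * x t * vx + 2 * y t * vy) with ((vx * x t + x t * vx) + (vy * y t + y t * vy)) by ring.
apply derive_plus; now apply derive_mult.
Qed.

Lemma loop_periodic_orbit eps r w o : 0 < Rabs eps <= 1 -> represents Xp P1 P2 P3 eps -> represents Xm M1 M2 M3 eps ->
  is_round eps r w o -> rm o = r -> wm o = w -> Tp o <= 10 -> Tm o <= 10 -> 0 < abscissa g r w -> 0 < abscissa g (rp o) (wp o) ->
  (forall t, 0 <= t <= Tp o -> in_region (xp o t) (yp o t) (sp o t)) ->
  (forall t, 0 <= t <= Tm o -> in_region (xm o t) (ym o t) (sm o t)) ->
  let c := periodic_ext (period o) (loop o) in
  filippov_solution f Xp Xm c /\ (forall t, c (t + period o) = c t) /\ c (Tp o) <> c 0 /\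
  (forall u, 0 <= u <= period o -> c u = loop o u) /\ forall t, exists u, 0 <= u <= period o /\ c t = loop o u.
Proof.
intros He HXp HXm Ho Fr Fw hTp hTm Ha0 Ha1 Rp Rm c.
assert (Ho' := Ho). destruct Ho' as [[[f1 [a1 [a2 a3]]] [x1 [b1 [b2 [b3 b4]]]]] [[f2 [c1 [c2 c3]]] [x2 [d1 [d2 [d3 d4]]]]]].
assert (h1 : 0 < Tp o) by apply x1. assert (h2 : 0 < Tm o) by apply x2.
assert (HT : 0 < period o) by (unfold period; lra).
assert (Hc := loop_ends eps r w o Ho h1 h2 Fr Fw). symmetry in Hc.
assert (S := round_seam eps r w o Ho).
assert (RR := fun u => loop_right eps r w o u Ho).
assert (Hcu : forall u, 0 <= u <= period o -> c u = loop o u).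
{ intros u Hu. unfold c. rewrite (periodic_ext_eq _ _ 0 u HT Hc); rewrite Rmult_0_r, Rminus_0_r; [reflexivity | exact Hu]. }
split; [split | split; [| split; [| split]]].
- destruct (flow_lipschitz lam K P1 P2 P3 eps _ _ _ HK TP1 TP2 TP3 He f1) as [L1 [HL1 F1]].
  destruct (flow_lipschitz lam K M1 M2 M3 eps _ _ _ HK TM1 TM2 TM3 He f2) as [L2 [HL2 F2]].
  destruct (F1 (Tp o) hTp) as [i1 [i2 i3]]. destruct (F2 (Tm o) hTm) as [j1 [j2 j3]].
  set (L := L1 + L2). destruct S as [S1 [S2 S3]].
  assert (up : forall a b, lip_on L1 a (Tp o) -> lip_on L2 b (Tm o) -> a (Tp o) = b 0 -> lip_on L (join (Tp o) a b) (period o)).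
  { intros a b Ha Hb Hab. unfold period. apply join_lipschitz; [lra | unfold L; lra | | | exact Hab].
    - intros u v Hu Hv. eapply Rle_trans; [now apply Ha |]. apply Rmult_le_compat_r; [apply Rabs_pos | unfold L; lra].
    - intros u v Hu Hv. eapply Rle_trans; [now apply Hb |]. apply Rmult_le_compat_r; [apply Rabs_pos | unfold L; lra]. }
  assert (q1 := up _ _ i1 j1 S1). assert (q2 := up _ _ i2 j2 S2).
  assert (q3 := up _ _ i3 j3 ltac:(cbv beta; rewrite S1, S2, S3; reflexivity)).
  assert (q3' : lip_on L (fun u => pz (loop o u)) (period o)).
  { intros u v Hu Hv. assert (Q := q3 u v Hu Hv). unfold loop, pz, lift, join in *. simpl snd.
    destruct (Rle_dec u (Tp o)), (Rle_dec v (Tp o)); exact Q. }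
  assert (pr : forall pr : R3 -> R, lip_on L (fun u => pr (loop o u)) (period o) -> forall t u, u <= t -> Rabs (pr (c t) - pr (c u)) <= L * (t - u)).
  { intros pr Hpr t u Hut. apply (periodic_ext_lip (period o) (fun u => pr (loop o u)) L HT); [now rewrite Hc | exact Hpr | exact Hut]. }
  apply (absolutely_continuous_lipschitz c (12 * L)); [unfold L; lra |]. intros t u Hut.
  eapply Rle_trans; [apply R3_norm_le |].
  assert (p1 := pr px q1 t u Hut). assert (p2 := pr py q2 t u Hut). assert (p3 := pr pz q3' t u Hut). lra.
- apply (null_set_sub _ (fun t => exists z : Z, t = period o * IZR z \/ t = period o * IZR z + Tp o)); [| apply null_set_lattice].
  intros t Ht. apply NNPP. intros Hn. apply Ht. clear Ht.
  destruct (euclid (period o) t HT) as [z Hz]. set (u := t - period o * IZR z) in *.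
  assert (n0 : u <> 0) by (intros h; apply Hn; exists z; left; unfold u in h; lra).
  assert (n1 : u <> Tp o) by (intros h; apply Hn; exists z; right; unfold u in h; lra).
  assert (Ect : c t = loop o u) by (apply periodic_ext_eq; [exact HT | exact Hc | fold u; lra]).
  destruct (Rlt_le_dec u (Tp o)) as [h | h].
  + destruct (f1 u) as [k1 [k2 k3]]. assert (Hin := Rp u ltac:(lra)). assert (Hab := proj2 (proj2 x1) u ltac:(lra)).
    rewrite loop_left in Ect by lra. eexists. split.
    * apply (periodic_ext_derive (period o) (loop o) z t _ HT Hc); [fold u; lra |]. fold u.
      apply (is_derive_ext_loc (fun u => lift (xp o u) (yp o u) (sp o u))); [| exact (lift_derive _ _ _ _ _ _ _ k1 k2 k3)].
      assert (hp : 0 < Tp o - u) by lra. exists (mkposreal _ hp). intros v Hv. change (Rabs (v - u) < Tp o - u) in Hv.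
      apply Rabs_lt_between in Hv. symmetry. apply loop_left. lra.
    * rewrite Ect. destruct (Hsep _ _ _ Hin) as [s1 _]. assert (fp := proj2 s1 ltac:(lra)).
      split; [| split; intros; lra]. intros _. symmetry. apply (above_velocity Xp P1 P2 P3 eps); [exact HXp | exact Hin |].
      repeat split.
  + set (v := u - Tp o). assert (Hv : 0 < v < Tm o) by (unfold v, period in *; lra).
    destruct (f2 v) as [k1 [k2 k3]]. assert (Hin := Rm v ltac:(lra)). assert (Hab := proj2 (proj2 x2) v ltac:(lra)).
    rewrite RR in Ect by lra. fold v in Ect. eexists. split.
    * apply (periodic_ext_derive (period o) (loop o) z t _ HT Hc); [fold u; lra |]. fold u.
      apply (is_derive_ext_loc (fun u => lift (xm o (u - Tp o)) (ym o (u - Tp o)) (sm o (u - Tp o)))).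
      { assert (hp : 0 < v) by lra. exists (mkposreal _ hp). intros q Hq. change (Rabs (q - u) < v) in Hq.
        apply Rabs_lt_between in Hq. symmetry. apply RR. unfold v in Hq. lra. }
      apply (is_derive_shift (fun v => lift (xm o v) (ym o v) (sm o v)) (Tp o) u). fold v.
      exact (lift_derive _ _ _ _ _ _ _ k1 k2 k3).
    * rewrite Ect. destruct (Hsep _ _ _ Hin) as [_ s1]. assert (fp := proj2 s1 ltac:(lra)).
      split; [intros; lra | split; [| intros; lra]]. intros _. symmetry. apply (above_velocity Xm M1 M2 M3 eps); [exact HXm | exact Hin |].
      repeat split.
- intros t. now apply periodic_ext_periodic.
- rewrite !Hcu, !loop_left by (unfold period; lra). intros E. assert (E' := f_equal px E). unfold px, lift in E'. simpl in E'.
  rewrite b3, a1 in E'. lra.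
- exact Hcu.
- intros t. destruct (euclid (period o) t HT) as [z Hz]. exists (t - period o * IZR z). split; [lra |].
  apply periodic_ext_eq; [exact HT | exact Hc | lra].
Qed.
End Orbit.

Section Tube.
Variable Omega : R.
Hypothesis HOmega : 0 <= Omega.

Definition solves (eps : R) (x y s : R -> R) : Prop :=
  (forall a b, a <= b -> ae_curve (broken eps) x y s a b) /\
  forall t, core g (x t * x t + y t * y t) /\ Rabs (s t) <= Omega * Rabs eps.

(** The crossings where the rotation carries the curve from one side to the side of
    sigma. *)
Definition starts (sigma : R) (x y s : R -> R) (t : R) : Prop :=
  above g (x t) (y t) (s t) = 0 /\ 0 < sigma * x t.

Lemma solves_lipschitz : exists L e1, 1 <= L /\ 0 < e1 <= 1 /\ forall eps x y s, Rabs eps <= e1 -> solves eps x y s ->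
  (forall t, in_region (x t) (y t) (s t)) /\
  forall t u, u <= t -> Rabs (x t - x u) <= L * (t - u) /\ Rabs (y t - y u) <= L * (t - u) /\
    Rabs (s t - s u) <= L * Rabs eps * (t - u) /\
    Rabs ((x t * x t + y t * y t) - (x u * x u + y u * y u)) <= L * Rabs eps * (t - u) /\
    Rabs (height g (x t * x t + y t * y t) (s t) - height g (x u * x u + y u * y u) (s u)) <= L * Rabs eps * (t - u) /\
    Rabs (above g (x t) (y t) (s t) - above g (x u) (y u) (s u)) <= L * (t - u).
Proof.
assert (A := sw_lo_pos g). assert (B := sw_hi_lo g). assert (Hm := sw_margin_pos g). assert (L1 := sw_lip_ge1 g).
set (H := sw_hi g + 1) in *. set (L0 := H + K + 4 * H * K + Rabs lam * Omega + K).
assert (Hl := Rabs_pos lam). assert (HlO : 0 <= Rabs lam * Omega) by pos.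
assert (HH : 1 <= H) by (unfold H; lra).
assert (HHK : 0 <= H * K) by pos.
assert (HL0 : 1 <= L0) by (unfold L0; lra).
assert (HL1 : 0 <= sw_lip g * (2 * L0)) by pos.
destruct (small_enough Omega 1 HOmega ltac:(lra)) as [e1 [He1 E1]].
exists (L0 + sw_lip g * (2 * L0)), (Rmin e1 1).
split; [lra |]. split; [split; [apply Rmin_glb_lt; lra | apply Rmin_r] |].
intros eps x y s Heps [Hae Hreg]. set (e := Rabs eps) in *.
assert (He : 0 <= e) by apply Rabs_pos.
assert (l1 : e <= e1) by (eapply Rle_trans; [exact Heps | apply Rmin_l]).
assert (l2 : e <= 1) by (eapply Rle_trans; [exact Heps | apply Rmin_r]).
specialize (E1 e l1).
assert (Hin : forall t, in_region (x t) (y t) (s t)).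
{ intros t. destruct (Hreg t) as [h1 h2]. unfold core in h1. split; [lra |]. lra. }
split; [exact Hin |]. intros t u Hut.
destruct (Hae u t Hut) as [b1 [b2 [b3 [N [HN Hd]]]]].
assert (Hb : forall r, Rabs (x r) <= H /\ Rabs (y r) <= H) by (intros r; apply (region_bound _ _ _ (Hin r))).
assert (Hd2 : forall r, u <= r <= t -> ~ N r -> exists vx vy vs, is_derive x r vx /\ is_derive y r vy /\ is_derive s r vs /\
  Rabs vx <= L0 /\ Rabs vy <= L0 /\ Rabs vs <= L0 * e /\ Rabs (vx * x r + x r * vx + (vy * y r + y r * vy)) <= L0 * e).
{ intros r h1 h2. destruct (Hd r h1 h2) as [vx [vy [vs [d1 [d2 [d3 [_ [_ [n1 [n2 n3]]]]]]]]]]. fold e in n1, n2, n3.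
  exists vx, vy, vs. split; [exact d1 |]. split; [exact d2 |]. split; [exact d3 |].
  destruct (Hb r) as [q1 q2]. destruct (Hreg r) as [_ q3]. fold e in q3.
  assert (Ke : K * e <= K * 1) by mono.
  split; [| split; [| split]].
  - replace vx with ((vx + y r) + - y r) by ring. eapply Rle_trans; [apply Rabs_add_le; [exact n1 |] |].
    + rewrite Rabs_Ropp. exact q2.
    + unfold L0. lra.
  - replace vy with ((vy - x r) + x r) by ring. eapply Rle_trans; [apply Rabs_add_le; [exact n2 | exact q1] |]. unfold L0. lra.
  - replace vs with ((vs + lam * s r) + - (lam * s r)) by ring.
    eapply Rle_trans; [apply Rabs_add_le; [exact n3 |] |].
    + rewrite Rabs_Ropp. apply Rabs_prod; [apply Rle_refl | exact q3].
    + replace (K * e + Rabs lam * (Omega * e)) with ((K + Rabs lam * Omega) * e) by ring.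
      apply Rmult_le_compat_r; [exact He |]. unfold L0. lra.
  - replace (vx * x r + x r * vx + (vy * y r + y r * vy)) with (2 * ((vx + y r) * x r) + 2 * ((vy - x r) * y r)) by ring.
    eapply Rle_trans; [apply Rabs_add_le; (apply Rabs_prod; [right; apply Rabs_pos_eq; lra |]; apply Rabs_prod; eassumption) |].
    replace (2 * (K * e * H) + 2 * (K * e * H)) with ((4 * H * K) * e) by ring.
    apply Rmult_le_compat_r; [exact He |]. unfold L0. lra. }
assert (c1 : Rabs (x t - x u) <= L0 * (t - u)).
{ apply (ae_increment_abs_le x N); try assumption. intros r h1 h2.
  destruct (Hd2 r h1 h2) as [vx [vy [vs [d1 [d2 [d3 [i1 [i2 [i3 i4]]]]]]]]]. now exists vx. }
assert (c2 : Rabs (y t - y u) <= L0 * (t - u)).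
{ apply (ae_increment_abs_le y N); try assumption. intros r h1 h2.
  destruct (Hd2 r h1 h2) as [vx [vy [vs [d1 [d2 [d3 [i1 [i2 [i3 i4]]]]]]]]]. now exists vy. }
assert (c3 : Rabs (s t - s u) <= L0 * e * (t - u)).
{ apply (ae_increment_abs_le s N); try assumption. intros r h1 h2.
  destruct (Hd2 r h1 h2) as [vx [vy [vs [d1 [d2 [d3 [i1 [i2 [i3 i4]]]]]]]]]. now exists vs. }
assert (c4 : Rabs ((x t * x t + y t * y t) - (x u * x u + y u * y u)) <= L0 * e * (t - u)).
{ apply (ae_increment_abs_le (fun r => x r * x r + y r * y r) N); try assumption.
  - apply bac_plus; now apply bac_mult.
  - intros r h1 h2. destruct (Hd2 r h1 h2) as [vx [vy [vs [d1 [d2 [d3 [i1 [i2 [i3 i4]]]]]]]]].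
    exists (vx * x r + x r * vx + (vy * y r + y r * vy)). split; [| exact i4].
    apply derive_plus; now apply derive_mult. }
assert (c5 : Rabs (height g (x t * x t + y t * y t) (s t) - height g (x u * x u + y u * y u) (s u)) <= sw_lip g * (2 * L0) * e * (t - u)).
{ eapply Rle_trans; [apply height_lip; apply Hin |].
  replace (sw_lip g * (2 * L0) * e * (t - u)) with (sw_lip g * (L0 * e * (t - u) + L0 * e * (t - u))) by ring.
  apply Rmult_le_compat_l; lra. }
assert (up : forall a q, 0 <= a -> 0 <= q -> a <= L0 + sw_lip g * (2 * L0) -> a * q * (t - u) <= (L0 + sw_lip g * (2 * L0)) * q * (t - u)).
{ intros a q _ hq ha. apply Rmult_le_compat_r; [lra |]. apply Rmult_le_compat_r; lra. }
assert (up1 := up L0 1 ltac:(lra) ltac:(lra) ltac:(lra)). rewrite !Rmult_1_r in up1.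
assert (upe := up L0 e ltac:(lra) He ltac:(lra)).
assert (upl := up (sw_lip g * (2 * L0)) e ltac:(lra) He ltac:(lra)).
repeat split; try (eapply Rle_trans; eassumption).
unfold above.
replace (y t - height g (x t * x t + y t * y t) (s t) - (y u - height g (x u * x u + y u * y u) (s u))) with
  ((y t - y u) + - (height g (x t * x t + y t * y t) (s t) - height g (x u * x u + y u * y u) (s u))) by ring.
eapply Rle_trans; [apply Rabs_add_le; [exact c2 | rewrite Rabs_Ropp; exact c5] |].
assert (sw_lip g * (2 * L0) * e * (t - u) <= sw_lip g * (2 * L0) * 1 * (t - u)).
{ apply Rmult_le_compat_r; [lra |]. apply Rmult_le_compat_l; lra. }
lra.
Qed.

Lemma start_coords : exists e1, 0 < e1 <= 1 /\ forall eps x y s sigma t, Rabs eps <= e1 -> sigma * sigma = 1 -> solves eps x y s ->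
  above g (x t) (y t) (s t) = 0 ->
  sw_gap g / 2 <= Rabs (x t) <= sw_hi g + 2 /\ Rabs (y t) <= sw_hi g + 2 /\
  (0 < sigma * x t -> x t = sigma * abscissa g (x t * x t + y t * y t) (s t) /\ y t = height g (x t * x t + y t * y t) (s t)).
Proof.
assert (P := sw_gap_pos g). assert (L0 := sw_lo_pos g). assert (Hl := sw_hi_lo g). assert (Hm := sw_margin_pos g).
assert (n1 : 0 <= (2 * sw_hi g + 3) * Omega) by pos.
destruct (small_enough _ (sw_gap g / 2) n1 ltac:(lra)) as [e2 [he2 E2]].
destruct (small_enough Omega 1 HOmega ltac:(lra)) as [e3 [he3 E3]].
exists (Rmin 1 (Rmin e2 e3)). split; [split; [repeat apply Rmin_glb_lt; lra | apply Rmin_l] |].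
intros eps x y s sigma t He Hsig [Hae Hreg] Ha.
assert (l2 : Rabs eps <= e2) by (eapply Rle_trans; [exact He | Rmin_le]).
assert (l3 : Rabs eps <= e3) by (eapply Rle_trans; [exact He | eapply Rle_trans; [apply Rmin_r | apply Rmin_r]]).
specialize (E2 _ l2). specialize (E3 _ l3). destruct (Hreg t) as [h1 h2]. unfold core in h1.
set (r := x t * x t + y t * y t) in *.
destruct (abscissa_bounds g r (s t)) as [A1 [A2 [A3 A4]]].
{ lra. }
{ apply Rle_trans with ((2 * sw_hi g + 3) * (Omega * Rabs eps)); [apply Rmult_le_compat_l; lra |]. lra. }
{ lra. }
assert (Hy : y t = height g r (s t)) by (unfold above in Ha; fold r in Ha; lra).
assert (Hx : abscissa g r (s t) = Rabs (x t)).
{ unfold abscissa. rewrite <- Hy. replace (r - y t * y t) with (Rsqr (x t)) by (unfold r, Rsqr; ring). apply sqrt_Rsqr_abs. }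
rewrite <- Hy in A3. rewrite Hx in A2. split; [exact A2 |]. split; [exact A3 |].
intros Hs. split; [| exact Hy]. rewrite Hx.
assert (S : sigma = 1 \/ sigma = -1).
{ assert (E : (sigma - 1) * (sigma + 1) = 0) by lra. apply Rmult_integral in E. lra. }
destruct S as [-> | ->]; [rewrite Rabs_pos_eq | rewrite Rabs_left1]; lra.
Qed.

(** Where sigma x > 0, the rotation moves y at a definite speed while the height of the
    surface over the invariants changes only by O(eps). This holds for both fields and
    for their convex combinations: the surface is crossed without sliding. *)
Lemma enters : exists delta e1, 0 < delta <= 1 /\ 0 < e1 <= 1 /\ forall eps x y s sigma t, Rabs eps <= e1 -> sigma * sigma = 1 ->
  solves eps x y s -> starts sigma x y s t -> forall u, 0 < u <= delta -> 0 < sigma * above g (x (t + u)) (y (t + u)) (s (t + u)).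
Proof.
assert (P := sw_gap_pos g). assert (L0 := sw_lo_pos g). assert (Hl := sw_hi_lo g). assert (Hm := sw_margin_pos g).
destruct solves_lipschitz as [L [e1 [HL [He1 SL]]]]. destruct start_coords as [e2 [He2 SC]].
assert (HD := drift_const_ge4 lam). set (D := drift_const lam) in *.
set (M := sw_hi g + 2). assert (HM : 2 <= M) by (unfold M; lra).
destruct (small_enough (D * K + L) (sw_gap g / 16)) as [e3 [He3 E3]]; [assert (0 <= D * K) by pos; lra | lra |].
set (delta := sw_gap g / (16 * M)).
assert (Hdel : 0 < delta) by (apply Rdiv_lt_0_compat; lra).
assert (HdM : M * delta = sw_gap g / 16) by (unfold delta; field; lra).
assert (Hdel1 : delta <= 1) by nra.
exists delta, (Rmin e1 (Rmin e2 e3)). split; [lra |].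
split; [split; [repeat apply Rmin_glb_lt; lra | eapply Rle_trans; [apply Rmin_l | lra]] |].
intros eps x y s sigma t He Hsig Hs [Ha Hx] u Hu.
assert (l1 : Rabs eps <= e1) by (eapply Rle_trans; [exact He | Rmin_le]).
assert (l2 : Rabs eps <= e2) by (eapply Rle_trans; [exact He | Rmin_le]).
assert (l3 : Rabs eps <= e3) by (eapply Rle_trans; [exact He | eapply Rle_trans; [apply Rmin_r | apply Rmin_r]]).
specialize (E3 _ l3). assert (He0 := Rabs_pos eps).
destruct (SC eps x y s sigma t l2 Hsig Hs Ha) as [c1 [c2 _]]. fold M in c1, c2.
destruct (SL eps x y s l1 Hs) as [_ SL']. destruct (SL' (t + u) t ltac:(lra)) as [_ [_ [_ [_ [k1 _]]]]].
replace (t + u - t) with u in k1 by ring.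
assert (HKe : 0 <= K * Rabs eps) by pos.
destruct (drift lam (K * Rabs eps) x y s t (t + u) ltac:(lra) HKe) as [_ [dy _]].
{ apply (ae_curve_weaken (broken eps)); [| apply (proj1 Hs); lra]. intros ? ? ? ? ? ? h. apply h. }
replace (t + u - t) with u in dy by ring. fold D in dy.
assert (S0 : 0 <= sin u) by (apply sin_ge_0; assert (A := PI2_3_2); lra).
assert (S1 := sin_expand u 0 ltac:(rewrite Rabs_pos_eq; lra) ltac:(rewrite Rabs_R0; lra)).
rewrite sin_0, !Rminus_0_r, !Rabs_pos_eq in S1 by lra.
assert (S2 := cos_small_1lip u 0 u ltac:(rewrite Rabs_pos_eq; lra) ltac:(rewrite Rabs_R0; lra)).
rewrite cos_0, Rminus_0_r, (Rabs_pos_eq u) in S2 by lra.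
assert (Ss : Rabs sigma = 1).
{ assert (E : (sigma - 1) * (sigma + 1) = 0) by lra. apply Rmult_integral in E.
  destruct E as [E | E]; [replace sigma with 1 by lra | replace sigma with (-1) by lra]; unfold Rabs; destruct Rcase_abs; lra. }
assert (Hax : sigma * x t = Rabs (x t)) by (rewrite <- (Rabs_pos_eq (sigma * x t)), Rabs_mult, Ss by lra; ring).
set (A0 := above g (x t) (y t) (s t)) in *.
assert (Eq : sigma * above g (x (t + u)) (y (t + u)) (s (t + u)) =
  (sigma * x t) * sin u + sigma * (y t * (cos u - 1)) + sigma * (y (t + u) - (x t * sin u + y t * cos u)) +
  - (sigma * (height g (x (t + u) * x (t + u) + y (t + u) * y (t + u)) (s (t + u)) - height g (x t * x t + y t * y t) (s t)))).
{ transitivity (sigma * (above g (x (t + u)) (y (t + u)) (s (t + u)) - A0)); [rewrite Ha; ring |]. unfold A0, above. ring. }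
rewrite Eq, Hax.
assert (t1 : sw_gap g / 2 * (u / 2) <= Rabs (x t) * sin u) by (apply Rmult_le_compat; lra).
assert (t2 : Rabs (sigma * (y t * (cos u - 1))) <= 1 * (M * (u * u))).
{ apply Rabs_prod; [lra |]. now apply Rabs_prod. }
assert (t3 : Rabs (sigma * (y (t + u) - (x t * sin u + y t * cos u))) <= 1 * (D * (K * Rabs eps) * u)) by (apply Rabs_prod; lra).
assert (t4 : Rabs (sigma * (height g (x (t + u) * x (t + u) + y (t + u) * y (t + u)) (s (t + u)) - height g (x t * x t + y t * y t) (s t))) <= 1 * (L * Rabs eps * u)) by (apply Rabs_prod; lra).
apply Rabs_le_between in t2. apply Rabs_le_between in t3. apply Rabs_le_between in t4.
assert (t5 : M * (u * u) <= sw_gap g / 16 * u) by (rewrite <- HdM; nra).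
assert (t6 : (D * K + L) * Rabs eps * u <= sw_gap g / 16 * u) by mono.
assert (t7 : 0 < sw_gap g * u) by (apply Rmult_lt_0_compat; lra).
lra.
Qed.

(** [enters] puts the solution on the right side for a short time. As long as it stays
    there it obeys the smooth field and coincides with the smooth trajectory, by
    [gronwall]; and as long as the two coincide the solution stays on that side, until
    the exit. Real induction combines the two statements. *)
Lemma follow : exists e1, 0 < e1 <= 1 /\ forall eps G1 G2 G3 sigma x y s t0 X Y S T, Rabs eps <= e1 ->
  tame K G1 -> tame K G2 -> tame K G3 -> sigma * sigma = 1 ->
  (forall x y s vx vy vs, broken eps x y s vx vy vs -> 0 < sigma * above g x y s -> velocity lam G1 G2 G3 eps x y s vx vy vs) ->
  solves eps x y s -> starts sigma x y s t0 -> is_flow lam G1 G2 G3 eps X Y S ->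
  X 0 = x t0 -> Y 0 = y t0 -> S 0 = s t0 -> exits g sigma X Y S T -> T <= 10 ->
  forall u, 0 <= u <= T -> x (t0 + u) = X u /\ y (t0 + u) = Y u /\ s (t0 + u) = S u.
Proof.
destruct enters as [delta [e1 [Hdel [He1 EN]]]].
destruct solves_lipschitz as [L [e2 [HL [He2 SL]]]].
exists (Rmin e1 e2). split; [split; [apply Rmin_glb_lt; lra | eapply Rle_trans; [apply Rmin_l | lra]] |].
intros eps G1 G2 G3 sigma x y s t0 X Y S T Heps HG1 HG2 HG3 Hsig HG Hs Hst Hf hX hY hS Hex HT.
assert (l1 : Rabs eps <= e1) by (eapply Rle_trans; [exact Heps | apply Rmin_l]).
assert (l2 : Rabs eps <= e2) by (eapply Rle_trans; [exact Heps | apply Rmin_r]).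
destruct (SL eps x y s l2 Hs) as [Hin SL'].
set (dist := fun u => Rabs (x (t0 + u) - X u) + Rabs (y (t0 + u) - Y u) + Rabs (s (t0 + u) - S u)).
assert (dist_eq : forall u, dist u <= 0 -> x (t0 + u) = X u /\ y (t0 + u) = Y u /\ s (t0 + u) = S u).
{ intros u Hu. unfold dist in Hu.
  assert (A1 := Rabs_pos (x (t0 + u) - X u)). assert (A2 := Rabs_pos (y (t0 + u) - Y u)). assert (A3 := Rabs_pos (s (t0 + u) - S u)).
  assert (z : forall v, Rabs v <= 0 -> v = 0). { intros v Hv. apply Rabs_eq_0. assert (B := Rabs_pos v). lra. }
  assert (z1 := z _ (ltac:(lra) : Rabs (x (t0 + u) - X u) <= 0)). assert (z2 := z _ (ltac:(lra) : Rabs (y (t0 + u) - Y u) <= 0)).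
  assert (z3 := z _ (ltac:(lra) : Rabs (s (t0 + u) - S u) <= 0)). repeat split; lra. }
assert (dist_pos : forall u, 0 <= dist u) by (intros u; unfold dist; repeat apply Rplus_le_le_0_compat; apply Rabs_pos).
assert (eq_dist : forall u, x (t0 + u) = X u /\ y (t0 + u) = Y u /\ s (t0 + u) = S u -> dist u = 0).
{ intros u [h1 [h2 h3]]. unfold dist. rewrite h1, h2, h3, !Rminus_diag, !Rabs_R0. ring. }
(* on the right side of the surface the solution obeys the smooth field, for which
   trajectories are unique *)
assert (stay : forall a b, 0 <= a <= b -> b <= 10 -> dist a = 0 ->
  (forall u, a < u <= b -> 0 < sigma * above g (x (t0 + u)) (y (t0 + u)) (s (t0 + u))) -> dist b = 0).
{ intros a b Hab Hb Ha Hpos.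
  destruct (proj1 Hs (t0 + a) (t0 + b) ltac:(lra)) as [b1 [b2 [b3 [N [HN Hd]]]]].
  assert (GR := gronwall lam K G1 G2 G3 HK HG1 HG2 HG3 eps x y s (fun t => X (t + - t0)) (fun t => Y (t + - t0)) (fun t => S (t + - t0)) (t0 + a) (t0 + b) ltac:(lra) ltac:(lra)).
  cbv beta in GR. replace (t0 + a + - t0) with a in GR by ring. replace (t0 + b + - t0) with b in GR by ring.
  fold (dist a) (dist b) in GR. rewrite Ha, Rmult_0_r in GR. apply Rle_antisym; [| apply dist_pos]. apply GR.
  - split; [exact b1 |]. split; [exact b2 |]. split; [exact b3 |].
    exists (fun t => N t \/ t = t0 + a). split; [now apply null_set_add |].
    intros t Ht Hn. destruct (Hd t Ht ltac:(tauto)) as [vx [vy [vs [d1 [d2 [d3 V]]]]]].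
    exists vx, vy, vs. split; [exact d1 |]. split; [exact d2 |]. split; [exact d3 |]. apply HG; [exact V |].
    assert (Hne : t <> t0 + a) by tauto. replace t with (t0 + (t - t0)) by ring. apply Hpos.
    assert (t0 + a < t) by (destruct Ht as [[h | h] _]; [lra | now elim Hne]). lra.
  - exact (is_flow_shift lam G1 G2 G3 eps X Y S (- t0) Hf). }
assert (dist_cont : forall v, 0 < dist v -> exists d, 0 < d /\ forall u, Rabs (u - v) < d -> 0 < dist u).
{ intros v Hv.
  assert (cL : forall z : R -> R, (forall t u, u <= t -> Rabs (z t - z u) <= L * (t - u)) -> continuous (fun u => z (t0 + u)) v).
  { intros z Hz. apply filterlim_locally. intros et. assert (het : 0 < et / (L + 1)) by (apply Rdiv_lt_0_compat; [apply cond_pos | lra]).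
    exists (mkposreal _ het). intros u Hu. change (Rabs (u - v) < et / (L + 1)) in Hu. change (Rabs (z (t0 + u) - z (t0 + v)) < et).
    apply Rle_lt_trans with (L * Rabs (u - v)).
    - destruct (Rle_lt_dec v u) as [h | h].
      + rewrite (Rabs_pos_eq (u - v)) by lra. replace (u - v) with (t0 + u - (t0 + v)) by ring. apply Hz. lra.
      + rewrite Rabs_minus_sym, (Rabs_minus_sym u v), (Rabs_pos_eq (v - u)) by lra. replace (v - u) with (t0 + v - (t0 + u)) by ring. apply Hz. lra.
    - apply Rle_lt_trans with (L * (et / (L + 1))); [apply Rmult_le_compat_l; lra |].
      apply Rmult_lt_reg_r with (L + 1); [lra |]. replace (L * (et / (L + 1)) * (L + 1)) with (L * et) by (field; lra).
      assert (A := cond_pos et). nra. }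
  destruct (is_flow_continuous lam G1 G2 G3 eps X Y S v Hf) as [c1 [c2 c3]].
  assert (cd : continuous dist v).
  { unfold dist. apply @continuous_plus; [apply @continuous_plus |];
    (apply continuous_comp; [| apply continuous_Rabs]; apply @continuous_minus; [apply cL | assumption]).
    - intros t u h. apply (SL' t u h).
    - intros t u h. apply (SL' t u h).
    - intros t u h. destruct (SL' t u h) as [_ [_ [q _]]]. eapply Rle_trans; [exact q |].
      apply Rmult_le_compat_r; [lra |]. rewrite <- (Rmult_1_r L) at 2. apply Rmult_le_compat_l; lra. }
  destruct (proj1 (filterlim_locally dist (dist v)) cd (mkposreal _ Hv)) as [d Hd].
  exists d. split; [apply cond_pos |]. intros u Hu. specialize (Hd u Hu). change (Rabs (dist u - dist v) < dist v) in Hd.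
  apply Rabs_lt_between in Hd. lra. }
destruct Hex as [HT0 [_ Hpos]].
enough (H : forall v, 0 <= v <= T -> dist v = 0) by (intros u Hu; apply dist_eq; rewrite (H u Hu); apply Rle_refl).
apply (real_induction (fun t => forall v, 0 <= v <= t -> dist v = 0) 0 T); [lra | |].
- intros v Hv. apply eq_dist. replace v with 0 by lra. rewrite Rplus_0_r. auto.
- intros c Hc. destruct (classic (forall v, 0 <= v <= c -> dist v = 0)) as [Hyes | Hno].
  + destruct (Req_dec c T) as [-> | HcT].
    { exists 1. split; [lra |]. intros s0 t Hs0 Ht _ _ _ v Hv. apply Hyes. lra. }
    destruct (Req_dec c 0) as [-> | Hc0].
    { exists delta. split; [lra |]. intros s0 t Hs0 Ht _ Htd _ v Hv.
      apply (stay 0 v); try lra.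
      - apply Hyes. lra.
      - intros u Hu. apply (EN eps x y s sigma t0 l1 Hsig Hs Hst). lra. }
    assert (Ha := Hpos c ltac:(lra)). destruct (dist_eq c ltac:(rewrite (Hyes c); lra)) as [h1 [h2 h3]].
    rewrite <- h1, <- h2, <- h3 in Ha. set (a := sigma * above g (x (t0 + c)) (y (t0 + c)) (s (t0 + c))) in *.
    exists (a / (2 * L)). assert (Hd : 0 < a / (2 * L)) by (apply Rdiv_lt_0_compat; lra). split; [exact Hd |].
    intros s0 t Hs0 Ht Hs0d Htd HP v Hv.
    assert (near : forall u, Rabs (u - c) <= a / (2 * L) -> 0 < sigma * above g (x (t0 + u)) (y (t0 + u)) (s (t0 + u))).
    { intros u Hu.
      assert (q : Rabs (above g (x (t0 + u)) (y (t0 + u)) (s (t0 + u)) - above g (x (t0 + c)) (y (t0 + c)) (s (t0 + c))) <= L * (a / (2 * L))).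
      { apply Rle_trans with (L * Rabs (u - c)); [| apply Rmult_le_compat_l; lra].
        destruct (Rle_lt_dec c u) as [h | h].
        - rewrite (Rabs_pos_eq (u - c)) by lra. replace (u - c) with (t0 + u - (t0 + c)) by ring. apply SL'. lra.
        - rewrite Rabs_minus_sym, (Rabs_minus_sym u c), (Rabs_pos_eq (c - u)) by lra. replace (c - u) with (t0 + c - (t0 + u)) by ring. apply SL'. lra. }
      replace (L * (a / (2 * L))) with (a / 2) in q by (field; lra). apply Rabs_le_between in q.
      unfold a in q, Ha. destruct (sign_cases sigma Hsig) as [-> | ->]; lra. }
    destruct (Rle_lt_dec v s0) as [h | h]; [apply HP; lra |].
    apply (stay s0 v); try lra.
    * apply HP. lra.
    * intros u Hu. apply near. apply Rabs_le. lra.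
  + apply not_all_ex_not in Hno. destruct Hno as [v Hv]. apply imply_to_and in Hv. destruct Hv as [Hv Hd].
    assert (Hvp : 0 < dist v) by (assert (A := dist_pos v); lra).
    destruct (dist_cont v Hvp) as [d [Hd0 Hd1]]. exists d. split; [exact Hd0 |].
    intros s0 t Hs0 Ht Hs0d _ HP. exfalso. destruct (Rle_lt_dec v s0) as [h | h].
    * apply Hd. apply HP. lra.
    * assert (A := Hd1 s0 ltac:(rewrite Rabs_left; lra)). rewrite (HP s0) in A; lra.
Qed.

(** The rotation carries the solution from the lowest point of its circle to the highest
    one in half a turn, through x > 0. *)
Lemma start_exists : exists e1, 0 < e1 <= 1 /\ forall eps x y s, Rabs eps <= e1 -> solves eps x y s -> exists t, starts 1 x y s t.
Proof.
assert (P := sw_gap_pos g). assert (L0 := sw_lo_pos g). assert (Hl := sw_hi_lo g). assert (Hm := sw_margin_pos g).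
destruct solves_lipschitz as [L [e1 [HL [He1 SL]]]].
destruct start_coords as [e2 [He2 SC]].
assert (n1 : 0 <= (2 * sw_hi g + 3) * Omega) by pos.
destruct (small_enough _ (sw_gap g / 2) n1 ltac:(lra)) as [e3 [he3 E3]].
destruct (small_enough Omega 1 HOmega ltac:(lra)) as [e4 [he4 E4]].
assert (HD := drift_const_ge4 lam). set (D := drift_const lam) in *.
destruct (small_enough (8 * (D * K)) (sw_gap g / 16)) as [e5 [he5 E5]]; [assert (0 <= D * K) by pos; lra | lra |].
set (e0 := Rmin e1 (Rmin e2 (Rmin e3 (Rmin e4 e5)))).
assert (Hle : e0 <= e1 /\ e0 <= e2 /\ e0 <= e3 /\ e0 <= e4 /\ e0 <= e5) by (unfold e0; repeat split; Rmin_le).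
exists e0. split; [split; [unfold e0; repeat apply Rmin_glb_lt; lra | lra] |].
intros eps x y s He Hs. destruct Hle as [l1 [l2 [l3 [l4 l5]]]].
specialize (E3 (Rabs eps) ltac:(lra)). specialize (E4 (Rabs eps) ltac:(lra)). specialize (E5 (Rabs eps) ltac:(lra)).
destruct (SL eps x y s ltac:(lra) Hs) as [Hin SL']. assert (Hpi := PI_4).
set (q := 8 * (D * K) * Rabs eps) in *.
assert (HKe : 0 <= K * Rabs eps) by pos.
assert (dr : forall a b, a <= b <= a + 8 ->
  Rabs (x b - (x a * cos (b - a) - y a * sin (b - a))) <= q /\ Rabs (y b - (x a * sin (b - a) + y a * cos (b - a))) <= q).
{ intros a b Hab. destruct (drift lam (K * Rabs eps) x y s a b ltac:(lra) HKe) as [d1 [d2 _]].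
  { apply (ae_curve_weaken (broken eps)); [| apply (proj1 Hs); lra]. intros ? ? ? ? ? ? h. apply h. }
  fold D in d1, d2. assert (D * (K * Rabs eps) * (b - a) <= D * (K * Rabs eps) * 8) by mono.
  unfold q. split; lra. }
assert (room : forall t, sw_gap g / 2 <= x t * x t + y t * y t - height g (x t * x t + y t * y t) (s t) * height g (x t * x t + y t * y t) (s t)).
{ intros t. destruct (proj2 Hs t) as [h1 h2]. unfold core in h1.
  apply abscissa_bounds; [lra | | lra].
  apply Rle_trans with ((2 * sw_hi g + 3) * (Omega * Rabs eps)); [apply Rmult_le_compat_l; lra |]. lra. }
assert (side : forall t, Rabs (x t) <= 3 * q -> (y t < 0 -> above g (x t) (y t) (s t) < 0) /\ (0 < y t -> 0 < above g (x t) (y t) (s t))).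
{ intros t Ht. assert (R := room t). unfold above. set (h := height g (x t * x t + y t * y t) (s t)) in *.
  assert (x t * x t <= sw_gap g / 4).
  { apply Rabs_le_between in Ht. nra. }
  split; intros Hy; nra. }
set (rr := x 0 * x 0 + y 0 * y 0).
assert (Hrr : sw_gap g <= rr).
{ assert (H := sw_transversal g rr). destruct (proj2 Hs 0) as [h1 _]. fold rr in h1. unfold core in h1.
  specialize (H ltac:(lra)). assert (A := Rle_0_sqr (sw_y g rr)). unfold Rsqr in A. lra. }
set (R := sqrt rr). assert (HR2 : R * R = rr) by (apply sqrt_sqrt; lra).
assert (HR : sw_gap g <= R). { assert (0 <= R) by apply sqrt_pos. nra. }
destruct (rotation_angle (x 0) (y 0) 0 (- R)) as [ta [Hta [t1 t2]]]; [fold rr; lra | fold rr; lra |].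
destruct (dr 0 ta ltac:(lra)) as [d1 d2]. rewrite Rminus_0_r, t1 in d1. rewrite Rminus_0_r, t2 in d2.
apply Rabs_le_between in d1. apply Rabs_le_between in d2.
destruct (dr ta (ta + PI) ltac:(lra)) as [d3 d4]. replace (ta + PI - ta) with PI in d3, d4 by ring.
rewrite cos_PI, sin_PI in d3, d4. apply Rabs_le_between in d3. apply Rabs_le_between in d4.
assert (s1 : above g (x ta) (y ta) (s ta) < 0) by (apply side; [apply Rabs_le |]; lra).
assert (s2 : 0 < above g (x (ta + PI)) (y (ta + PI)) (s (ta + PI))) by (apply side; [apply Rabs_le |]; lra).
destruct (ivt_lipschitz (fun t => above g (x t) (y t) (s t)) L ta (ta + PI)) as [c [Hc Hz]]; [lra | lra | | nra |].
{ intros t r _ _. destruct (Rle_lt_dec r t) as [h | h].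
  - rewrite (Rabs_pos_eq (t - r)) by lra. apply SL'. exact h.
  - rewrite Rabs_minus_sym, (Rabs_minus_sym t r), (Rabs_pos_eq (r - t)) by lra. apply SL'. lra. }
exists c. split; [exact Hz |]. rewrite Rmult_1_l.
destruct (SC eps x y s 1 c ltac:(lra) ltac:(ring) Hs Hz) as [[k1 _] _].
destruct (dr ta c ltac:(lra)) as [d5 _]. apply Rabs_le_between in d5.
assert (S0 : 0 <= sin (c - ta)) by (apply sin_ge_0; lra).
assert (S1 : Rabs (x ta * cos (c - ta)) <= q * 1) by (apply Rabs_prod; [apply Rabs_le; lra | apply Rabs_cos_le1]).
apply Rabs_le_between in S1.
assert (S2 : 0 <= - y ta * sin (c - ta)) by pos.
unfold Rabs in k1. destruct (Rcase_abs (x c)); lra.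
Qed.

(** The end of the first leg is the start of the second one. On the first leg the
    solution is above the surface and on the second one below, so that there is no other
    start of the same kind. *)
Lemma round_follow : exists e1, 0 < e1 <= 1 /\ forall eps x y s t o, Rabs eps <= e1 -> solves eps x y s -> starts 1 x y s t ->
  is_round eps (x t * x t + y t * y t) (s t) o -> Tp o <= 10 -> Tm o <= 10 ->
  (forall u, 0 <= u <= period o -> lift (x (t + u)) (y (t + u)) (s (t + u)) = loop o u) /\
  starts 1 x y s (t + period o) /\
  x (t + period o) * x (t + period o) + y (t + period o) * y (t + period o) = rm o /\ s (t + period o) = wm o /\
  forall u, 0 < u < period o -> ~ starts 1 x y s (t + u).
Proof.
destruct follow as [e1 [He1 FO]].
destruct start_coords as [e2 [He2 SC]].
exists (Rmin e1 e2). split; [split; [apply Rmin_glb_lt; lra | eapply Rle_trans; [apply Rmin_l | lra]] |].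
intros eps x y s t o Heps Hs Hst Ho hTp hTm.
assert (l1 : Rabs eps <= e1) by (eapply Rle_trans; [exact Heps | apply Rmin_l]).
assert (l2 : Rabs eps <= e2) by (eapply Rle_trans; [exact Heps | apply Rmin_r]).
assert (P := sw_gap_pos g).
assert (Ho' := Ho). destruct Ho' as [[[f1 [a1 [a2 a3]]] [x1 [b1 [b2 [b3 b4]]]]] [[f2 [c1 [c2 c3]]] [x2 [d1 [d2 [d3 d4]]]]]].
destruct Hst as [z1 z2]. destruct (SC eps x y s 1 t l2 ltac:(ring) Hs z1) as [_ [_ sc]]. destruct (sc z2) as [y1 y2].
assert (F1 := FO eps P1 P2 P3 1 x y s t _ _ _ _ l1 TP1 TP2 TP3 ltac:(ring)
  ltac:(intros ? ? ? ? ? ? hb ha; apply hb; lra) Hs (conj z1 z2) f1 ltac:(congruence) ltac:(congruence) a3 x1 hTp).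
assert (hT1 : 0 < Tp o) by apply x1. assert (hT2 : 0 < Tm o) by apply x2.
destruct (F1 (Tp o) ltac:(lra)) as [g1 [g2 g3]].
assert (z3 : above g (x (t + Tp o)) (y (t + Tp o)) (s (t + Tp o)) = 0) by (rewrite g1, g2, g3; apply x1).
assert (z4 : 0 < -1 * x (t + Tp o)).
{ destruct (SC eps x y s 1 _ l2 ltac:(ring) Hs z3) as [[q _] _]. rewrite g1, b3 in *.
  assert (A := sqrt_pos (rp o - height g (rp o) (wp o) * height g (rp o) (wp o))). fold (abscissa g (rp o) (wp o)) in A.
  set (ab := abscissa g (rp o) (wp o)) in *. rewrite Rabs_left1 in q by lra. lra. }
assert (F2 := FO eps M1 M2 M3 (-1) x y s (t + Tp o) (xm o) (ym o) (sm o) (Tm o) l1 TM1 TM2 TM3 ltac:(ring)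
  ltac:(intros ? ? ? ? ? ? hb ha; apply hb; lra) Hs (conj z3 z4) f2).
destruct (round_seam _ _ _ _ Ho) as [k1 [k2 k3]].
specialize (F2 ltac:(congruence) ltac:(congruence) ltac:(congruence) x2 hTm).
destruct (F2 (Tm o) ltac:(lra)) as [h1 [h2 h3]].
assert (Hend : t + period o = t + Tp o + Tm o) by (unfold period; ring).
assert (z5 : above g (x (t + period o)) (y (t + period o)) (s (t + period o)) = 0) by (rewrite Hend, h1, h2, h3; apply x2).
split; [| split; [| split; [| split]]].
- intros u Hu. destruct (Rle_lt_dec u (Tp o)) as [h | h].
  + rewrite loop_left by exact h. destruct (F1 u ltac:(lra)) as [-> [-> ->]]. reflexivity.
  + rewrite (loop_right _ _ _ _ _ Ho) by lra. unfold period in Hu. destruct (F2 (u - Tp o) ltac:(lra)) as [<- [<- <-]].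
    replace (t + Tp o + (u - Tp o)) with (t + u) by ring. reflexivity.
- split; [exact z5 |]. destruct (SC eps x y s 1 _ l2 ltac:(ring) Hs z5) as [[q _] _]. rewrite Hend, h1, d3 in *.
  assert (A := sqrt_pos (rm o - height g (rm o) (wm o) * height g (rm o) (wm o))). fold (abscissa g (rm o) (wm o)) in A.
  set (ab := abscissa g (rm o) (wm o)) in *. rewrite Rabs_pos_eq in q by lra. lra.
- rewrite Hend, h1, h2. symmetry. exact d1.
- rewrite Hend, h3. symmetry. exact d2.
- intros u Hu [j1 j2]. destruct (Rtotal_order u (Tp o)) as [h | [-> | h]].
  + destruct (F1 u ltac:(lra)) as [E1 [E2 E3]]. rewrite E1, E2, E3 in j1. assert (B := proj2 (proj2 x1) u ltac:(lra)). lra.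
  + lra.
  + unfold period in Hu. destruct (F2 (u - Tp o) ltac:(lra)) as [E1 [E2 E3]].
    replace (t + Tp o + (u - Tp o)) with (t + u) in * by ring. rewrite E1, E2, E3 in j1.
    assert (B := proj2 (proj2 x2) (u - Tp o) ltac:(lra)). lra.
Qed.

(** The successive starts of the solution form a sequence of rounds, and no start is
    missed. So the start reached after a period is one of them, the sequence of its
    coordinates is periodic, and [fixed_unique] identifies it with the fixed point. *)
Lemma periodic_solution_is_loop : exists e1, 0 < e1 <= 1 /\ forall eps x y s T rb wb ob, 0 < Rabs eps <= e1 ->
  solves eps x y s -> (forall t, Rabs (x t * x t + y t * y t - rs) <= kap) -> 0 < T ->
  (forall t, x (t + T) = x t /\ y (t + T) = y t /\ s (t + T) = s t) ->
  Rabs (rb - rs) <= kap -> Rabs wb <= Omega * Rabs eps -> is_round eps rb wb ob -> rm ob = rb -> wm ob = wb ->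
  exists t0, forall n u, 0 <= u <= period ob -> lift (x (t0 + INR n * period ob + u)) (y (t0 + INR n * period ob + u)) (s (t0 + INR n * period ob + u)) = loop ob u.
Proof.
destruct round_follow as [e1 [He1 RF]].
destruct (round_exists Omega HOmega) as [e2 [He2 RX]].
destruct (round_bounds Omega HOmega) as [C2 [e3 [HC2 [He3 RB]]]].
destruct start_exists as [e4 [He4 SX]].
destruct (fixed_unique Omega HOmega) as [e5 [He5 FU]].
set (e0 := Rmin e1 (Rmin e2 (Rmin e3 (Rmin e4 e5)))).
assert (Hle : e0 <= e1 /\ e0 <= e2 /\ e0 <= e3 /\ e0 <= e4 /\ e0 <= e5) by (unfold e0; repeat split; Rmin_le).
exists e0. split; [split; [unfold e0; repeat apply Rmin_glb_lt; lra | lra] |].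
intros eps x y s T rb wb ob Heps Hs Hkp HT Hper Hrb Hwb Hob Frb Fwb.
destruct Hle as [l1 [l2 [l3 [l4 l5]]]].
destruct (SX eps x y s ltac:(lra) Hs) as [t0 Ht0].
set (rho := fun t => x t * x t + y t * y t) in *.
set (pick := fun t => epsilon round_inh (fun o => is_round eps (rho t) (s t) o)).
assert (Hpick : forall t, is_round eps (rho t) (s t) (pick t)).
{ intros t. unfold pick. apply epsilon_spec.
  destruct (RX eps (rho t) (s t) ltac:(lra) (near_deep _ (Hkp t)) (proj2 (proj2 Hs t))) as [o h]. now exists o. }
assert (Hpb : forall t, / C2 <= Tp (pick t) <= 10 /\ / C2 <= Tm (pick t) <= 10).
{ intros t. destruct (RB eps (rho t) (s t) (pick t) ltac:(lra) (near_deep _ (Hkp t)) (proj2 (proj2 Hs t)) (Hpick t)) as [h1 [h2 _]]. auto. }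
assert (HC2' : 0 < / C2) by (apply Rinv_0_lt_compat; lra).
set (tn := fix tn n := match n with O => t0 | S m => tn m + period (pick (tn m)) end).
assert (Hst : forall n, starts 1 x y s (tn n)).
{ induction n as [| n IH]; [exact Ht0 |].
  destruct (RF eps x y s (tn n) (pick (tn n)) ltac:(lra) Hs IH (Hpick _) ltac:(apply Hpb) ltac:(apply Hpb)) as [_ [h _]]. exact h. }
assert (Hstep : forall n, tn n + / C2 <= tn (S n)).
{ intros n. simpl. unfold period. destruct (Hpb (tn n)). lra. }
assert (Hgrow : forall n, t0 + INR n * / C2 <= tn n).
{ induction n as [| n IH]; [simpl; lra |]. rewrite S_INR. assert (A := Hstep n). lra. }
(* a turn takes at least a fixed time, so that the starts go beyond t0 + T *)
assert (Hbr : exists N, tn N <= t0 + T < tn (S N)).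
{ apply NNPP. intros Hno.
  assert (Hall : forall n, tn n <= t0 + T).
  { induction n as [| n IH]; [simpl; lra |]. apply Rnot_lt_le. intros h. apply Hno. now exists n. }
  destruct (euclid_nat (/ C2) T HC2' ltac:(lra)) as [n Hn]. assert (A := Hgrow (S (S n))). assert (B := Hall (S (S n))).
  rewrite !S_INR in A. lra. }
destruct Hbr as [N HN].
assert (HNT : t0 + T = tn N).
{ destruct (Req_dec (tn N) (t0 + T)) as [h | h]; [lra | exfalso].
  destruct (RF eps x y s (tn N) (pick (tn N)) ltac:(lra) Hs (Hst N) (Hpick _) ltac:(apply Hpb) ltac:(apply Hpb)) as [_ [_ [_ [_ hn]]]].
  apply (hn (t0 + T - tn N)).
  - simpl in HN. lra.
  - replace (tn N + (t0 + T - tn N)) with (t0 + T) by ring. destruct (Hper t0) as [p1 [p2 p3]].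
    destruct Ht0 as [q1 q2]. split; rewrite ?p1, ?p2, ?p3; assumption. }
destruct N as [| M]; [simpl in HNT; lra |].
destruct (FU eps rb wb ob ltac:(lra) Hrb Hwb Hob Frb Fwb (fun n => rho (tn n)) (fun n => s (tn n)) (fun n => pick (tn n)) M) as [u1 u2].
- intros n. split; [apply Hkp |]. split; [apply (proj2 Hs) |]. split; [apply Hpick |].
  destruct (RF eps x y s (tn n) (pick (tn n)) ltac:(lra) Hs (Hst n) (Hpick _) ltac:(apply Hpb) ltac:(apply Hpb)) as [_ [_ [h1 [h2 _]]]].
  split; [exact h1 | exact h2].
- rewrite <- HNT. destruct (Hper t0) as [p1 [p2 p3]]. unfold rho. rewrite p1, p2. reflexivity.
- rewrite <- HNT. apply Hper.
- simpl in u1, u2.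
  destruct (RB eps rb wb ob ltac:(lra) (near_deep _ Hrb) Hwb Hob) as [b1 [b2 _]].
  assert (HH : forall n, let t := t0 + INR n * period ob in starts 1 x y s t /\ rho t = rb /\ s t = wb).
  { induction n as [| n IH].
    - simpl. rewrite Rmult_0_l, Rplus_0_r. auto.
    - cbv zeta in *. destruct IH as [i1 [i2 i3]].
      destruct (RF eps x y s (t0 + INR n * period ob) ob ltac:(lra) Hs i1) as [_ [h1 [h2 [h3 _]]]]; [| apply b1 | apply b2 |].
      + fold (rho (t0 + INR n * period ob)). rewrite i2, i3. exact Hob.
      + rewrite S_INR. replace (t0 + (INR n + 1) * period ob) with (t0 + INR n * period ob + period ob) by ring.
        split; [exact h1 |]. split; [rewrite <- Frb; exact h2 | rewrite <- Fwb; exact h3]. }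
  exists t0. intros n u Hu. destruct (HH n) as [i1 [i2 i3]].
  destruct (RF eps x y s (t0 + INR n * period ob) ob ltac:(lra) Hs i1) as [h0 _]; [| apply b1 | apply b2 |].
  + fold (rho (t0 + INR n * period ob)). rewrite i2, i3. exact Hob.
  + now apply h0.
Qed.
End Tube.

(** * From a fixed point to a limit cycle *)

Variables (f : R3 -> R) (Xp Xm : R -> vector_field).
Hypothesis Hsep : separates f.
Hypothesis HXp : forall eps, represents (Xp eps) P1 P2 P3 eps.
Hypothesis HXm : forall eps, represents (Xm eps) M1 M2 M3 eps.

Lemma deep_region r s : deep g r -> forall x y, x * x + y * y = r -> Rabs s <= 1 -> in_region x y s.
Proof. intros Hd x y E Hs. assert (Hm := sw_margin_pos g). unfold deep in Hd. split; [rewrite E; lra | exact Hs]. Qed.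

Lemma tube p q d H : 0 <= d <= 1 -> Rabs (px p) <= H -> Rabs (py p) <= H -> norm (minus q p) < d ->
  Rabs ((px q * px q + py q * py q) - (px p * px p + py p * py p)) <= (4 * H + 2) * d /\
  Rabs (ps q - ps p) <= (4 * H + 3) * d.
Proof.
intros Hd Hx Hy Hn. destruct (R3_norm_ge q p) as [n1 [n2 n3]].
assert (sq : forall a b, Rabs b <= H -> Rabs (a - b) <= d -> Rabs (a * a - b * b) <= (2 * H + 1) * d).
{ intros a b hb hab. replace (a * a - b * b) with ((a - b) * ((a - b) + 2 * b)) by ring. rewrite Rmult_comm, Rabs_mult.
  apply Rmult_le_compat; try apply Rabs_pos; [| exact hab]. replace (2 * H + 1) with (1 + 2 * H) by ring.
  apply Rabs_add_le; [lra |]. apply Rabs_prod; [right; apply Rabs_pos_eq; lra | exact hb]. }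
assert (s1 := sq (px q) (px p) Hx ltac:(lra)). assert (s2 := sq (py q) (py p) Hy ltac:(lra)).
assert (E : Rabs ((px q * px q + py q * py q) - (px p * px p + py p * py p)) <= (4 * H + 2) * d).
{ replace (px q * px q + py q * py q - (px p * px p + py p * py p)) with ((px q * px q - px p * px p) + (py q * py q - py p * py p)) by ring.
  eapply Rle_trans; [apply Rabs_add_le; eassumption |]. lra. }
split; [exact E |]. unfold ps.
replace (pz q - (px q * px q + py q * py q) - (pz p - (px p * px p + py p * py p))) with
  ((pz q - pz p) + - ((px q * px q + py q * py q) - (px p * px p + py p * py p))) by ring.
eapply Rle_trans; [apply Rabs_add_le; [apply Rlt_le, (Rle_lt_trans _ _ _ n3 Hn) | rewrite Rabs_Ropp; exact E] |]. lra.
Qed.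

(** The fixed point of the return map yields the cycle. Its neighbourhood is chosen so
    small that a periodic orbit inside remains in the tube where
    [periodic_solution_is_loop] applies. Both invariants vary by O(eps) along the cycle,
    hence the distance from the circle. *)
Theorem cycle_near : exists C e1, 0 <= C /\ 0 < e1 <= 1 /\ forall eps, 0 < Rabs eps <= e1 ->
  exists G, limit_cycle f (Xp eps) (Xm eps) G /\
    (forall p, G p -> near_set (circle rs) (C * Rabs eps) p) /\
    (forall q, circle rs q -> near_set G (C * Rabs eps) q).
Proof.
assert (P := sw_gap_pos g). assert (L0 := sw_lo_pos g). assert (Hl := sw_hi_lo g). assert (Hm := sw_margin_pos g).
destruct (fixed_exists)
  as [Om0 [C0 [e1 [HO0 [HC0 [He1 FX]]]]]].
destruct (round_bounds Om0 HO0) as [C1 [e2 [HC1 [He2 RB]]]].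
(* the tube is wider than the one of the fixed point: it has to contain its neighbours
   *)
set (Om := C1 + 1). assert (HO : 0 <= Om) by (unfold Om; lra).
destruct (periodic_solution_is_loop Om HO) as [e3 [He3 PU]].
set (H := sw_hi g + 1). assert (HH : 1 <= H) by (unfold H; lra).
assert (HD := drift_const_ge4 lam). set (D := drift_const lam) in *.
destruct (small_enough (C0 + C1 + 1) kap ltac:(lra) kap_pos) as [e4 [he4 E4]].
destruct (small_enough Om 1 HO ltac:(lra)) as [e5 [he5 E5]].
destruct (small_enough ((2 * sw_hi g + 3) * Om) (sw_gap g / 2)) as [e6 [he6 E6]]; [apply Rmult_le_pos; lra | lra |].
set (e0 := Rmin e1 (Rmin e2 (Rmin e3 (Rmin e4 (Rmin e5 e6))))).
assert (Hle : e0 <= e1 /\ e0 <= e2 /\ e0 <= e3 /\ e0 <= e4 /\ e0 <= e5 /\ e0 <= e6) by (unfold e0; repeat split; Rmin_le).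
assert (HiL : 0 < / sw_lo g) by (apply Rinv_0_lt_compat; lra).
set (A := / sw_lo g * (C0 + C1) * H). assert (HA : 0 <= A).
{ unfold A. apply Rmult_le_pos; [apply Rmult_le_pos |]; lra. }
set (A2 := D * K * 8). assert (HA2 : 0 <= A2) by (unfold A2; apply Rmult_le_pos; [apply Rmult_le_pos; lra | lra]).
exists (8 * (A + A2 + C0 + 2 * C1 + 1)), e0.
split; [lra |]. split; [split; [unfold e0; repeat apply Rmin_glb_lt; lra | lra] |].
intros eps Heps. destruct Hle as [l1 [l2 [l3 [l4 [l5 l6]]]]].
set (e := Rabs eps) in *. specialize (E4 e ltac:(lra)). specialize (E5 e ltac:(lra)). specialize (E6 e ltac:(lra)).
destruct (FX eps ltac:(fold e; lra)) as [r [w [o [hr [hr2 [hw [Ho [Fr Fw]]]]]]]]. fold e in hr, hw.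
assert (Hrk : Rabs (r - rs) <= kap) by lra. assert (Hdr := near_deep r Hrk).
destruct (RB eps r w o ltac:(fold e; lra) Hdr hw Ho) as [bT1 [bT2 [B1 B2]]]. fold e in B1, B2.
assert (iC : 0 < / C1) by (apply Rinv_0_lt_compat; lra).
assert (HC1e : 0 <= C1 * e) by pos. assert (HC0e : 0 <= C0 * e) by pos.
assert (HT : 0 < period o) by (unfold period; lra).
assert (dk : forall q, Rabs (q - r) <= C1 * e -> Rabs (q - rs) <= kap /\ Rabs (q - rs) <= (C0 + C1) * e).
{ intros q Hq. assert (Rabs (q - rs) <= (C0 + C1) * e).
  { replace (q - rs) with ((q - r) + (r - rs)) by ring. eapply Rle_trans; [apply Rabs_add_le; [exact Hq | exact hr] |]. lra. }
  split; lra. }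
assert (Rp : forall t, 0 <= t <= Tp o -> in_region (xp o t) (yp o t) (sp o t)).
{ intros t Ht. destruct (B1 t Ht) as [k1 k2]. eapply deep_region; [| reflexivity | unfold Om in E5; lra].
  apply near_deep. apply (dk _ k1). }
assert (Rm : forall t, 0 <= t <= Tm o -> in_region (xm o t) (ym o t) (sm o t)).
{ intros t Ht. destruct (B2 t Ht) as [k1 k2]. eapply deep_region; [| reflexivity | unfold Om in E5; lra].
  apply near_deep. apply (dk _ k1). }
assert (Ho' := Ho). destruct Ho' as [[[_ [a1 [a2 a3]]] [x1 [b1 [b2 [b3 b4]]]]] _].
assert (hw1 : Rabs w <= C1 * e) by (rewrite <- a3; apply (B1 0); lra).
assert (ab0 : 0 < abscissa g r w /\ sw_gap g / 2 <= r /\ r = xp o 0 * xp o 0 + yp o 0 * yp o 0).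
{ assert (q : sw_lo g <= r <= sw_hi g) by (unfold deep in Hdr; lra).
  destruct (abscissa_bounds g r w q) as [_ [q2 [_ q3]]].
  - apply Rle_trans with ((2 * sw_hi g + 3) * (Om * e)); [| lra]. apply Rmult_le_compat_l; [lra |]. unfold Om. lra.
  - unfold Om in E5. lra.
  - split; [lra |]. assert (T := sw_transversal g r q). assert (S := Rle_0_sqr (sw_y g r)). unfold Rsqr in S.
    split; [lra |]. rewrite a1, a2, Rmult_1_l. symmetry. exact q3. }
destruct ab0 as [ab0 [rpos Er]].
assert (ab1 : 0 < abscissa g (rp o) (wp o)).
{ destruct (B1 (Tp o) ltac:(lra)) as [k1 k2]. rewrite <- b1 in k1. rewrite <- b2 in k2.
  assert (q0 := near_deep _ (proj1 (dk _ k1))).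
  assert (q : sw_lo g <= rp o <= sw_hi g) by (unfold deep in q0; lra).
  destruct (abscissa_bounds g (rp o) (wp o) q) as [_ [q2 _]].
  - apply Rle_trans with ((2 * sw_hi g + 3) * (Om * e)); [| lra]. apply Rmult_le_compat_l; [lra |]. unfold Om. lra.
  - unfold Om in E5. lra.
  - lra. }
destruct (loop_periodic_orbit f (Xp eps) (Xm eps) Hsep eps r w o ltac:(fold e; lra)
  (HXp eps) (HXm eps) Ho Fr Fw ltac:(lra) ltac:(lra) ab0 ab1 Rp Rm) as [Sol [Per [Non [Cu Call]]]].
set (cc := periodic_ext (period o) (loop o)) in *.
set (G := fun p => exists u, 0 <= u <= period o /\ loop o u = p).
assert (HGrange : forall p, G p <-> exists t, cc t = p).
{ intros p. split.
  - intros [u [Hu E]]. exists u. now rewrite Cu.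
  - intros [t E]. destruct (Call t) as [u [Hu Eu]]. exists u. split; [exact Hu |]. now rewrite <- Eu. }
assert (HG : forall p, G p -> Rabs (px p * px p + py p * py p - r) <= C1 * e /\ Rabs (ps p) <= C1 * e).
{ intros p [u [Hu <-]]. destruct (Rle_lt_dec u (Tp o)) as [h | h].
  - rewrite loop_left, ps_lift by exact h. apply (B1 u). lra.
  - rewrite (loop_right eps r w o u Ho), ps_lift by lra. apply (B2 (u - Tp o)). unfold period in Hu. lra. }
assert (HGreg : forall p, G p -> in_region (px p) (py p) (ps p)).
{ intros p Hp. destruct (HG p Hp) as [k1 k2]. eapply deep_region; [apply near_deep; apply (dk _ k1) | reflexivity |]. unfold Om in E5. lra. }
exists G. split; [split | split].
- exists cc, (period o). split; [exact Sol |]. split; [exact HT |]. split; [exact Per |]. split; [| exact HGrange].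
  exists (Tp o). exact Non.
- set (d := e / (4 * H + 4)). assert (Hd : 0 < d) by (apply Rdiv_lt_0_compat; lra).
  assert (Hde : (4 * H + 4) * d = e) by (unfold d; field; lra).
  assert (Hd1 : d <= 1) by nra.
  exists d. split; [exact Hd |]. intros G' [c' [T' [Sol' [HT' [Per' [_ HG']]]]]] Hnear.
  assert (Hpt : forall t, Rabs (px (c' t) * px (c' t) + py (c' t) * py (c' t) - rs) <= kap /\ Rabs (ps (c' t)) <= Om * e).
  { intros t. destruct (Hnear (c' t)) as [q [Hq Hn]]; [apply HG'; now exists t |].
    destruct (HG q Hq) as [k1 k2]. destruct (region_bound _ _ _ (HGreg q Hq)) as [k3 k4]. fold H in k3, k4.
    destruct (tube q (c' t) d H ltac:(lra) k3 k4 Hn) as [t1 t2]. split.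
    - replace (px (c' t) * px (c' t) + py (c' t) * py (c' t) - rs) with
        ((px (c' t) * px (c' t) + py (c' t) * py (c' t) - (px q * px q + py q * py q)) + (px q * px q + py q * py q - rs)) by ring.
      eapply Rle_trans; [apply Rabs_add_le; [exact t1 | exact (proj2 (dk _ k1))] |]. lra.
    - replace (ps (c' t)) with ((ps (c' t) - ps q) + ps q) by ring.
      eapply Rle_trans; [apply Rabs_add_le; [exact t2 | exact k2] |]. unfold Om. lra. }
  assert (Hs' : solves Om eps (fun t => px (c' t)) (fun t => py (c' t)) (fun t => ps (c' t))).
  { split.
    - apply (filippov_chart f (Xp eps) (Xm eps) eps c' Hsep (HXp eps) (HXm eps) Sol').
      intros t. destruct (Hpt t) as [k1 k2]. eapply deep_region; [apply near_deep; exact k1 | reflexivity |]. lra.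
    - intros t. destruct (Hpt t) as [k1 k2]. split; [| exact k2]. assert (q := near_deep _ k1). unfold deep in q. unfold core. lra. }
  destruct (PU eps _ _ _ T' r w o ltac:(fold e; lra) Hs' (fun t => proj1 (Hpt t)) HT') as [t0 Ht0]; try assumption.
  { intros t. rewrite Per'. auto. }
  { fold e. unfold Om. lra. }
  intros p. rewrite HG'. split.
  + intros [t Et].
    assert (Hs : exists t1, t0 <= t1 /\ c' t1 = c' t).
    { assert (Hk : forall k, c' (t + INR k * T') = c' t).
      { induction k as [| k IH]; [simpl; now rewrite Rmult_0_l, Rplus_0_r |].
        rewrite S_INR. replace (t + (INR k + 1) * T') with (t + INR k * T' + T') by ring. now rewrite Per'. }
      destruct (euclid_nat T' (Rabs (t0 - t)) HT' (Rabs_pos _)) as [k Hkk].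
      exists (t + INR (S k) * T'). split; [| apply Hk]. rewrite S_INR. assert (Q := Rle_abs (t0 - t)). lra. }
    destruct Hs as [t1 [Ht1 Ec]]. rewrite <- Et, <- Ec.
    destruct (euclid_nat (period o) (t1 - t0) HT ltac:(lra)) as [n Hn].
    exists (t1 - t0 - INR n * period o). split; [lra |].
    assert (Q := Ht0 n (t1 - t0 - INR n * period o) ltac:(lra)). cbv beta in Q. rewrite lift_ps in Q.
    rewrite <- Q. f_equal. ring.
  + intros [u [Hu <-]]. exists (t0 + INR 0 * period o + u). assert (Q := Ht0 0%nat u Hu). cbv beta in Q. now rewrite lift_ps in Q.
- intros p Hp. destruct (HG p Hp) as [k1 k2]. destruct (dk _ k1) as [_ k3].
  assert (q0 := near_deep _ (proj1 (dk _ k1))). assert (q1 : deep g rs) by (apply near_deep; rewrite Rminus_diag, Rabs_R0; lra).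
  set (rho := px p * px p + py p * py p) in *. unfold deep in q0, q1.
  destruct (sqrt_ratio rs rho (sw_lo g) L0 ltac:(lra) ltac:(lra)) as [k [Hk0 [Hk Hk1]]].
  assert (Hk2 : Rabs (k - 1) <= / sw_lo g * ((C0 + C1) * e)).
  { eapply Rle_trans; [exact Hk1 |]. apply Rmult_le_compat_l; [lra |]. rewrite Rabs_minus_sym. exact k3. }
  exists ((k * px p, k * py p, rs) : R3). split.
  + split; [| reflexivity]. change (k * px p * (k * px p) + k * py p * (k * py p) = rs).
    replace (k * px p * (k * px p) + k * py p * (k * py p)) with (k * k * rho) by (unfold rho; ring). rewrite Hk. field. lra.
  + eapply Rle_lt_trans; [apply R3_norm_le |]. destruct (region_bound _ _ _ (HGreg p Hp)) as [k4 k5]. fold H in k4, k5.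
    assert (bx : forall a, Rabs a <= H -> Rabs (a - k * a) <= A * e).
    { intros a Ha. replace (a - k * a) with (- ((k - 1) * a)) by ring. rewrite Rabs_Ropp.
      eapply Rle_trans; [apply Rabs_prod; eassumption |]. right. unfold A. ring. }
    assert (v1 := bx _ k4). assert (v2 := bx _ k5).
    assert (v3 : Rabs (pz p - rs) <= C1 * e + (C0 + C1) * e).
    { replace (pz p - rs) with (ps p + (rho - rs)) by (unfold ps, rho; ring). now apply Rabs_add_le. }
    change (px ((k * px p, k * py p, rs) : R3)) with (k * px p). change (py ((k * px p, k * py p, rs) : R3)) with (k * py p).
    change (pz ((k * px p, k * py p, rs) : R3)) with rs.
    assert (0 <= A2 * e) by pos. lra.
- intros q [Hq1 Hq2].
  assert (Hreg : forall t, in_region (px (cc t)) (py (cc t)) (ps (cc t))) by (intros t; apply HGreg, HGrange; now exists t).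
  assert (Hch := filippov_chart f (Xp eps) (Xm eps) eps cc Hsep (HXp eps) (HXm eps) Sol Hreg).
  assert (q1 : deep g rs) by (apply near_deep; rewrite Rminus_diag, Rabs_R0; lra). unfold deep in q1, Hdr.
  destruct (sqrt_ratio r rs (sw_lo g) L0 ltac:(lra) ltac:(lra)) as [k [Hk0 [Hk Hk1]]].
  assert (Hk2 : Rabs (k - 1) <= / sw_lo g * ((C0 + C1) * e)).
  { eapply Rle_trans; [exact Hk1 |]. apply Rmult_le_compat_l; lra. }
  assert (Ec0 : px (cc 0) = xp o 0 /\ py (cc 0) = yp o 0).
  { rewrite (Cu 0) by lra. rewrite loop_left by lra. split; reflexivity. }
  destruct Ec0 as [ec1 ec2].
  destruct (rotation_angle (px (cc 0)) (py (cc 0)) (k * px q) (k * py q)) as [t [Ht [r1 r2]]].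
  + rewrite ec1, ec2, <- Er. lra.
  + rewrite ec1, ec2, <- Er. replace (k * px q * (k * px q) + k * py q * (k * py q)) with (k * k * (px q * px q + py q * py q)) by ring.
    rewrite Hk, Hq1. field. lra.
  + assert (Hpi := PI_4). assert (HKe : 0 <= K * e) by pos.
    destruct (drift lam (K * e) (fun t => px (cc t)) (fun t => py (cc t)) (fun t => ps (cc t)) 0 t ltac:(lra) HKe) as [d1 [d2 _]].
    { apply (ae_curve_weaken (broken eps)); [| apply Hch; lra]. intros ? ? ? ? ? ? h. apply h. }
    cbv beta in d1, d2. rewrite Rminus_0_r, r1 in d1. rewrite Rminus_0_r, r2 in d2. fold D in d1, d2.
    assert (d3 : D * (K * e) * t <= A2 * e).
    { replace (A2 * e) with (D * (K * e) * 8) by (unfold A2; ring). apply Rmult_le_compat_l; [apply Rmult_le_pos; lra | lra]. }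
    assert (Gt : G (cc t)) by (apply HGrange; now exists t).
    exists (cc t). split; [exact Gt |]. destruct (HG _ Gt) as [k1 k2]. destruct (dk _ k1) as [_ k3].
    eapply Rle_lt_trans; [apply R3_norm_le |].
    assert (bx : forall a b, Rabs a <= H -> Rabs (b - k * a) <= D * (K * e) * t -> Rabs (a - b) <= A * e + A2 * e).
    { intros a b Ha Hb. replace (a - b) with (- ((k - 1) * a) + - (b - k * a)) by ring. apply Rabs_add_le; rewrite Rabs_Ropp; [| lra].
      eapply Rle_trans; [apply Rabs_prod; eassumption |]. right. unfold A. ring. }
    assert (qb : Rabs (px q) <= H /\ Rabs (py q) <= H).
    { apply (region_bound _ _ 0). split; [rewrite Hq1; lra | rewrite Rabs_R0; lra]. }
    assert (v1 := bx _ _ (proj1 qb) d1). assert (v2 := bx _ _ (proj2 qb) d2).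
    assert (v3 : Rabs (pz q - pz (cc t)) <= C1 * e + (C0 + C1) * e).
    { rewrite Hq2. replace (rs - pz (cc t)) with (- (ps (cc t)) + - (px (cc t) * px (cc t) + py (cc t) * py (cc t) - rs)) by (unfold ps; ring).
      apply Rabs_add_le; rewrite Rabs_Ropp; assumption. }
    lra.
Qed.
End Return.

(** * Zeros of rescaled functions *)

(** Order of vanishing at 0 in the C^1 sense: without the derivative, zeros could not be
    kept simple. *)
Definition vanishes (m : nat) (W : R -> R) : Prop := exists W' C, 0 <= C /\ forall a, 0 <= a <= 1 ->
  is_derive W a (W' a) /\ Rabs (W a) <= C * a ^ S m /\ Rabs (W' a) <= C * a ^ m.

Lemma vanishes_add m W V : vanishes m W -> vanishes m V -> vanishes m (fun a => W a + V a).
Proof.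
intros [W' [C [HC H]]] [V' [D [HD H']]]. exists (fun a => W' a + V' a), (C + D). split; [lra |].
intros a Ha. destruct (H a Ha) as [h1 [h2 h3]]. destruct (H' a Ha) as [k1 [k2 k3]].
split; [now apply derive_plus |]. rewrite !Rmult_plus_distr_r. split; now apply Rabs_add_le.
Qed.

Lemma vanishes_mul m k c W : vanishes m W -> vanishes (m + k) (fun a => c * a ^ k * W a).
Proof.
intros [W' [C [HC H]]].
exists (fun a => c * (INR k * 1 * a ^ pred k) * W a + c * a ^ k * W' a), (Rabs c * (INR k + 1) * C).
assert (Hk := pos_INR k). assert (Hc := Rabs_pos c).
split; [apply Rmult_le_pos; [apply Rmult_le_pos; lra | lra] |].
intros a Ha. destruct (H a Ha) as [h1 [h2 h3]]. split; [| split].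
- apply (derive_mult (fun a => c * a ^ k) W); [| exact h1]. auto_derive; [exact I | ring].
- assert (P : 0 <= a ^ k) by (apply pow_le; lra). assert (P2 : 0 <= a ^ S m) by (apply pow_le; lra).
  rewrite !Rabs_mult, (Rabs_pos_eq (a ^ k)) by exact P.
  apply Rle_trans with (Rabs c * a ^ k * (C * a ^ S m)).
  + apply Rmult_le_compat_l; [apply Rmult_le_pos; lra | exact h2].
  + replace (S (m + k)) with (k + S m)%nat by lia. rewrite pow_add.
    replace (Rabs c * a ^ k * (C * a ^ S m)) with (Rabs c * 1 * C * (a ^ k * a ^ S m)) by ring.
    apply Rmult_le_compat_r; [apply Rmult_le_pos; assumption |]. apply Rmult_le_compat_r; [exact HC |]. apply Rmult_le_compat_l; lra.
- assert (P : 0 <= a ^ k) by (apply pow_le; lra). assert (P2 : 0 <= a ^ m) by (apply pow_le; lra).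
  assert (P3 : 0 <= a ^ pred k) by (apply pow_le; lra).
  apply Rle_trans with (Rabs c * INR k * C * a ^ (m + k) + Rabs c * C * a ^ (m + k)); [| right; ring].
  apply Rabs_add_le; rewrite !Rabs_mult.
  + rewrite (Rabs_pos_eq (INR k)), Rabs_R1, (Rabs_pos_eq (a ^ pred k)) by assumption.
    apply Rle_trans with (Rabs c * (INR k * 1 * a ^ pred k) * (C * a ^ S m)).
    { apply Rmult_le_compat_l; [| exact h2]. repeat apply Rmult_le_pos; lra. }
    destruct k as [| k]; [simpl; lra |].
    replace (m + S k)%nat with (k + S m)%nat by lia. rewrite pow_add. simpl pred. right. ring.
  + rewrite (Rabs_pos_eq (a ^ k)) by exact P. apply Rle_trans with (Rabs c * a ^ k * (C * a ^ m)).
    { apply Rmult_le_compat_l; [apply Rmult_le_pos; lra | exact h3]. }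
    rewrite pow_add. right. ring.
Qed.

Lemma vanishes_weaken m k W : (k <= m)%nat -> vanishes m W -> vanishes k W.
Proof.
intros Hk [W' [C [HC H]]]. exists W', C. split; [exact HC |]. intros a Ha. destruct (H a Ha) as [h1 [h2 h3]].
assert (mono : forall i j, (i <= j)%nat -> a ^ j <= a ^ i).
{ intros i j Hij. replace j with (i + (j - i))%nat by lia. rewrite pow_add. rewrite <- (Rmult_1_r (a ^ i)) at 2.
  apply Rmult_le_compat_l; [apply pow_le; lra |]. rewrite <- (pow1 (j - i)). apply pow_incr. lra. }
split; [exact h1 |]. split; (eapply Rle_trans; [eassumption |]); apply Rmult_le_compat_l; try exact HC; apply mono; lia.
Qed.

Lemma vanishes_ext m W V : (forall a, W a = V a) -> vanishes m W -> vanishes m V.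
Proof.
intros E [W' [C [HC H]]]. exists W', C. split; [exact HC |]. intros a Ha. destruct (H a Ha) as [h1 [h2 h3]].
split; [exact (is_derive_ext _ _ _ _ E h1) |]. rewrite <- E. auto.
Qed.

Lemma vanishes_id : vanishes 0 (fun a => a).
Proof.
exists (fun _ => 1), 1. split; [lra |]. intros a Ha. split; [apply @is_derive_id |].
rewrite pow_1, pow_O, Rabs_R1, Rabs_pos_eq; lra.
Qed.

Lemma vanishes_monomial m k c : (m < k)%nat -> vanishes m (fun a => c * a ^ k).
Proof.
intros Hk. destruct k as [| k]; [lia |]. apply (vanishes_weaken k); [lia |].
apply (vanishes_ext (0 + k) (fun a => c * a ^ k * a)); [intros a; simpl; ring |]. apply vanishes_mul, vanishes_id.
Qed.

(** The expansion has to go beyond the largest exponent, 12, used for the parabolic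
    cylinder. *)
Definition atan_tail (a : R) : R := atan a - (a - a ^ 3 / 3 + a ^ 5 / 5 - a ^ 7 / 7 + a ^ 9 / 9 - a ^ 11 / 11).

Lemma atan_tail_vanishes : vanishes 12 atan_tail.
Proof.
assert (D : forall a, is_derive atan_tail a (a ^ 12 / (1 + a ^ 2))).
{ intros a. unfold atan_tail.
  evar_last.
  - apply derive_minus; [apply is_derive_atan |].
    instantiate (1 := 1 - a ^ 2 + a ^ 4 - a ^ 6 + a ^ 8 - a ^ 10). auto_derive; [exact I |]. field.
  - assert (P : 0 <= a * a) by (assert (Q := Rle_0_sqr a); exact Q).
    apply (Rmult_eq_reg_r (1 + a * a)); [| lra]. unfold Rsqr. simpl. field. lra. }
assert (B : forall a, Rabs (a ^ 12 / (1 + a ^ 2)) <= a ^ 12).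
{ intros a. assert (P : 0 <= a ^ 2) by apply pow2_ge_0.
  assert (Q : 0 <= a ^ 12) by (replace (a ^ 12) with ((a ^ 6) ^ 2) by ring; apply pow2_ge_0).
  rewrite Rabs_pos_eq by (apply Rdiv_le_0_compat; lra).
  apply Rmult_le_reg_r with (1 + a ^ 2); [lra |]. unfold Rdiv. rewrite Rmult_assoc, Rinv_l by lra. nra. }
exists (fun a => a ^ 12 / (1 + a ^ 2)), 1. split; [lra |]. intros a Ha.
split; [apply D |]. rewrite !Rmult_1_l. split; [| apply B].
assert (E := derive_bound_increment atan_tail (fun a => a ^ 12 / (1 + a ^ 2)) (a ^ 12) 0 a (fun t _ => D t)).
replace (atan_tail 0) with 0 in E by (unfold atan_tail; rewrite atan_0; field).
rewrite !Rminus_0_r, (Rabs_pos_eq a) in E by lra. replace (a ^ 13) with (a ^ 12 * a) by ring. apply E.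
intros t Ht. rewrite Rmin_left, Rmax_right in Ht by lra. eapply Rle_trans; [apply B |]. apply pow_incr. lra.
Qed.

(** The functions Z del, seen at scale del, tend to p in the C^1 sense, uniformly on an
    interval that contains 1, ..., 8. *)
Definition realizes (p p' : R -> R) (Z : R -> R -> R) : Prop := exists Z' C, 0 <= C /\
  forall del psi, 0 < del <= / 10 -> 0 <= psi <= 10 ->
    is_derive (Z del) (del * psi) (Z' del (del * psi)) /\
    Rabs (Z del (del * psi) - p psi) <= C * del /\ Rabs (del * Z' del (del * psi) - p' psi) <= C * del.

Lemma realizes_add p p' q q' Y Z : realizes p p' Y -> realizes q q' Z ->
  realizes (fun u => p u + q u) (fun u => p' u + q' u) (fun del a => Y del a + Z del a).
Proof.
intros [Y' [C [HC H]]] [Z' [D [HD H']]]. exists (fun del a => Y' del a + Z' del a), (C + D). split; [lra |].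
intros del psi h1 h2. destruct (H del psi h1 h2) as [i1 [i2 i3]]. destruct (H' del psi h1 h2) as [j1 [j2 j3]].
split; [now apply derive_plus |]. rewrite Rmult_plus_distr_r. split.
- replace (Y del (del * psi) + Z del (del * psi) - (p psi + q psi)) with ((Y del (del * psi) - p psi) + (Z del (del * psi) - q psi)) by ring.
  now apply Rabs_add_le.
- replace (del * (Y' del (del * psi) + Z' del (del * psi)) - (p' psi + q' psi)) with
    ((del * Y' del (del * psi) - p' psi) + (del * Z' del (del * psi) - q' psi)) by ring.
  now apply Rabs_add_le.
Qed.

(** Dividing the coefficient by del ^ n gives all exponents the same weight at scale
    del, and leaves a factor del for the tail. *)
Lemma realizes_monomial n c W : vanishes n W ->
  realizes (fun u => c * u ^ n) (fun u => c * (INR n * u ^ pred n)) (fun del a => c / del ^ n * (a ^ n + W a)).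
Proof.
intros [W' [C [HC H]]].
exists (fun del a => c / del ^ n * (INR n * a ^ pred n + W' a)), (Rabs c * C * 10 ^ S n).
assert (P10 : 0 <= 10 ^ S n) by (apply pow_le; lra).
split; [apply Rmult_le_pos; [apply Rmult_le_pos; [apply Rabs_pos | exact HC] | exact P10] |].
intros del psi Hd Hp. set (a := del * psi). assert (Ha : 0 <= a <= 1) by (unfold a; split; nra).
destruct (H a Ha) as [h1 [h2 h3]]. assert (Pd : 0 < del ^ n) by (apply pow_lt; lra).
assert (Ea : a ^ n = del ^ n * psi ^ n) by (unfold a; apply Rpow_mult_distr).
assert (Pp : psi ^ S n <= 10 ^ S n) by (apply pow_incr; lra).
assert (Pp2 : psi ^ n <= 10 ^ S n).
{ apply Rle_trans with (10 ^ n); [apply pow_incr; lra |]. simpl. assert (0 <= 10 ^ n) by (apply pow_le; lra). lra. }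
assert (Hc := Rabs_pos c). assert (HcC : 0 <= Rabs c * C) by pos.
split; [| split].
- evar_last.
  + apply is_derive_scal. apply derive_plus; [| exact h1]. instantiate (1 := INR n * a ^ pred n). auto_derive; [exact I | ring].
  + reflexivity.
- replace (c / del ^ n * (a ^ n + W a) - c * psi ^ n) with (c / del ^ n * W a) by (rewrite Ea; field; lra).
  rewrite Rabs_mult, Rabs_div, (Rabs_pos_eq (del ^ n)) by lra.
  apply Rle_trans with (Rabs c / del ^ n * (C * a ^ S n)).
  { apply Rmult_le_compat_l; [apply Rdiv_le_0_compat; lra | exact h2]. }
  replace (Rabs c / del ^ n * (C * a ^ S n)) with (Rabs c * C * del * psi ^ S n) by (simpl; rewrite Ea; unfold a; field; lra).
  replace (Rabs c * C * 10 ^ S n * del) with (Rabs c * C * del * 10 ^ S n) by ring.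
  apply Rmult_le_compat_l; [apply Rmult_le_pos; lra | exact Pp].
- replace (del * (c / del ^ n * (INR n * a ^ pred n + W' a)) - c * (INR n * psi ^ pred n)) with (del * c / del ^ n * W' a).
  2:{ destruct n as [| n]; [simpl; field |]. simpl pred. simpl pow in *.
      assert (Pd' : 0 < del ^ n) by (apply pow_lt; lra).
      replace (a ^ n) with (del ^ n * psi ^ n) by (unfold a; symmetry; apply Rpow_mult_distr). field. lra. }
  rewrite Rabs_mult, Rabs_div, Rabs_mult, (Rabs_pos_eq (del ^ n)), (Rabs_pos_eq del) by lra.
  apply Rle_trans with (del * Rabs c / del ^ n * (C * a ^ n)).
  { apply Rmult_le_compat_l; [apply Rdiv_le_0_compat; [apply Rmult_le_pos; lra | lra] | exact h3]. }
  replace (del * Rabs c / del ^ n * (C * a ^ n)) with (Rabs c * C * del * psi ^ n) by (rewrite Ea; field; lra).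
  replace (Rabs c * C * 10 ^ S n * del) with (Rabs c * C * del * 10 ^ S n) by ring.
  apply Rmult_le_compat_l; [apply Rmult_le_pos; lra | exact Pp2].
Qed.

(** Simplicity in quantitative form: near z the increments of N have a definite sign and
    are comparable with those of the variable. No derivative is needed, and the form
    survives changes of variable. *)
Definition simple_zero (N : R -> R) (z : R) : Prop := N z = 0 /\ exists kap c L sg, 0 < kap /\ 0 < c /\ 0 <= L /\ (sg = 1 \/ sg = -1) /\
  forall a b, Rabs (a - z) <= kap -> Rabs (b - z) <= kap -> b <= a ->
    c * (a - b) <= sg * (N a - N b) /\ Rabs (N a - N b) <= L * (a - b).

(** Near a simple zero of p the derivative keeps its sign, and so does the derivative of
    Z at scale del. *)
Lemma realizes_zero p p' Z i : realizes p p' Z -> (forall u, is_derive p u (p' u)) -> continuous p' i ->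
  1 <= i <= 8 -> p i = 0 -> p' i <> 0 ->
  exists d, 0 < d /\ forall del, 0 < del <= d -> exists psi, Rabs (psi - i) <= / 3 /\ simple_zero (Z del) (del * psi).
Proof.
intros [Z' [C [HC H]]] Dp Cp Hi pi0 pi1.
assert (Hsg : exists sg, (sg = 1 \/ sg = -1) /\ Rabs (p' i) = sg * p' i).
{ unfold Rabs. destruct (Rcase_abs (p' i)); [exists (-1) | exists 1]; split; auto; ring. }
destruct Hsg as [sg [Hsg Esg]]. set (eta := Rabs (p' i) / 2).
assert (Heta : 0 < eta) by (unfold eta; assert (A := Rabs_pos_lt _ pi1); lra).
destruct (proj1 (filterlim_locally p' (p' i)) Cp (mkposreal _ Heta)) as [d0 Hd0].
set (kap := Rmin (/ 3) (d0 / 2)). assert (Hd0p := cond_pos d0).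
assert (Hk : 0 < kap <= / 3 /\ kap <= d0 / 2).
{ unfold kap. split; [split; [apply Rmin_glb_lt; lra | apply Rmin_l] | apply Rmin_r]. }
clearbody kap. destruct Hk as [Hk1 Hk2].
assert (Hp' : forall u, Rabs (u - i) <= kap -> eta <= sg * p' u <= 3 * eta).
{ intros u Hu. assert (A := Hd0 u). change (Rabs (u - i) < d0 -> Rabs (p' u - p' i) < eta) in A. specialize (A ltac:(lra)).
  apply Rabs_lt_between in A. assert (E : sg * p' i = 2 * eta) by (unfold eta; lra). destruct Hsg as [-> | ->]; lra. }
destruct (small_enough C (eta / 2 * Rmin 1 kap) HC) as [e1 [He1 E1]].
{ apply Rmult_lt_0_compat; [lra | apply Rmin_glb_lt; lra]. }
exists (Rmin e1 (/ 10)). split; [apply Rmin_glb_lt; lra |]. intros del Hdel.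
assert (B1 := Rmin_l e1 (/ 10)). assert (B2 := Rmin_r e1 (/ 10)).
specialize (E1 del ltac:(lra)). assert (C1 := Rmin_l 1 kap). assert (C2 := Rmin_r 1 kap).
assert (s1 : C * del <= eta / 2) by nra. assert (s2 : C * del <= eta * (kap / 2)) by nra.
assert (HdZ : forall u, Rabs (u - i) <= kap -> is_derive (Z del) (del * u) (Z' del (del * u)) /\
  eta / 2 <= sg * (del * Z' del (del * u)) <= 7 / 2 * eta).
{ intros u Hu. assert (Hu' := Hu). apply Rabs_le_between in Hu'. destruct (H del u ltac:(lra) ltac:(lra)) as [h1 [h2 h3]].
  split; [exact h1 |]. apply Rabs_le_between in h3. assert (A := Hp' u Hu). destruct Hsg as [-> | ->]; lra. }
assert (inc : forall u v, Rabs (u - i) <= kap -> Rabs (v - i) <= kap -> v <= u ->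
  eta / 2 * (u - v) <= sg * (Z del (del * u) - Z del (del * v)) <= 7 / 2 * eta * (u - v)).
{ intros u v Hu Hv Hvu. apply Rabs_le_between in Hu. apply Rabs_le_between in Hv.
  assert (A := derive_bound_increment (fun w => sg * Z del (del * w) - 2 * eta * w) (fun w => sg * (del * Z' del (del * w)) - 2 * eta) (3 / 2 * eta) v u).
  rewrite Rmin_left, Rmax_right, (Rabs_pos_eq (u - v)) in A by lra.
  assert (R : Rabs (sg * Z del (del * u) - 2 * eta * u - (sg * Z del (del * v) - 2 * eta * v)) <= 3 / 2 * eta * (u - v)).
  { apply A; intros w Hw; destruct (HdZ w ltac:(apply Rabs_le; lra)) as [k1 k2].
    - apply derive_minus; [| auto_derive; [exact I | ring]]. apply is_derive_scal.
      apply (is_derive_comp (Z del) (fun w => del * w)); [exact k1 | auto_derive; [exact I | ring]].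
    - apply Rabs_le. lra. }
  apply Rabs_le_between in R. lra. }
assert (endp : forall w, Rabs (w - i) <= kap -> Rabs (Z del (del * w) - p w) <= C * del).
{ intros w Hw. apply Rabs_le_between in Hw. apply H; lra. }
assert (pinc : forall u v, Rabs (u - i) <= kap -> Rabs (v - i) <= kap -> v <= u -> eta * (u - v) <= sg * (p u - p v)).
{ intros u v Hu Hv Hvu. apply Rabs_le_between in Hu. apply Rabs_le_between in Hv.
  assert (A := derive_bound_increment (fun w => sg * p w - 2 * eta * w) (fun w => sg * p' w - 2 * eta) eta v u).
  rewrite Rmin_left, Rmax_right, (Rabs_pos_eq (u - v)) in A by lra.
  assert (R : Rabs (sg * p u - 2 * eta * u - (sg * p v - 2 * eta * v)) <= eta * (u - v)).
  { apply A; intros w Hw.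
    - apply derive_minus; [apply is_derive_scal, Dp | auto_derive; [exact I | ring]].
    - assert (B := Hp' w ltac:(apply Rabs_le; lra)). apply Rabs_le. lra. }
  apply Rabs_le_between in R. lra. }
assert (i0 : Rabs (i - i) <= kap) by (rewrite Rminus_diag, Rabs_R0; lra).
assert (ip : Rabs (i + kap / 2 - i) <= kap) by (apply Rabs_le; lra).
assert (im : Rabs (i - kap / 2 - i) <= kap) by (apply Rabs_le; lra).
assert (p1 := pinc _ _ ip i0 ltac:(lra)). assert (p2 := pinc _ _ i0 im ltac:(lra)). rewrite pi0 in p1, p2.
assert (e1' := endp _ ip). assert (e2' := endp _ im). apply Rabs_le_between in e1'. apply Rabs_le_between in e2'.
destruct (ivt_lipschitz (fun w => Z del (del * w)) (7 / 2 * eta) (i - kap / 2) (i + kap / 2)) as [psi [Hpsi Hz]].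
- lra.
- lra.
- assert (K : forall u v, i - kap / 2 <= u <= i + kap / 2 -> i - kap / 2 <= v <= i + kap / 2 -> v <= u ->
    Rabs (Z del (del * u) - Z del (del * v)) <= 7 / 2 * eta * Rabs (u - v)).
  { intros u v Hu Hv Hvu. destruct (inc u v ltac:(apply Rabs_le; lra) ltac:(apply Rabs_le; lra) Hvu) as [k1 k2].
    assert (0 <= eta / 2 * (u - v)) by pos. rewrite (Rabs_pos_eq (u - v)) by lra.
    apply Rabs_le. destruct Hsg as [-> | ->]; lra. }
  intros u v Hu Hv. destruct (Rle_lt_dec v u); [now apply K |]. rewrite Rabs_minus_sym, (Rabs_minus_sym u v). apply K; lra.
- destruct Hsg as [-> | ->].
  + assert (0 <= Z del (del * (i + kap / 2))) by lra. assert (Z del (del * (i - kap / 2)) <= 0) by lra. nra.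
  + assert (Z del (del * (i + kap / 2)) <= 0) by lra. assert (0 <= Z del (del * (i - kap / 2))) by lra. nra.
- exists psi. split; [apply Rabs_le; lra |]. split; [exact Hz |].
  assert (hd : 0 < del) by lra.
  exists (del * (kap / 2)), (eta / 2 / del), (7 / 2 * eta / del), sg.
  split; [apply Rmult_lt_0_compat; lra |]. split; [apply Rdiv_lt_0_compat; lra |]. split; [apply Rdiv_le_0_compat; lra |].
  split; [exact Hsg |]. intros a b Ha Hb Hba.
  assert (sc : forall t, Rabs (t - del * psi) <= del * (kap / 2) -> Rabs (t / del - i) <= kap).
  { intros t Ht. assert (E : t - del * psi = del * (t / del - psi)) by (field; lra).
    rewrite E, Rabs_mult, (Rabs_pos_eq del) in Ht by lra. apply Rmult_le_reg_l in Ht; [| exact hd].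
    apply Rabs_le_between in Ht. apply Rabs_le. lra. }
  assert (hab : b / del <= a / del) by (apply Rmult_le_compat_r; [left; now apply Rinv_0_lt_compat | exact Hba]).
  destruct (inc _ _ (sc a Ha) (sc b Hb) hab) as [k1 k2].
  replace (del * (a / del)) with a in * by (field; lra). replace (del * (b / del)) with b in * by (field; lra).
  replace (eta / 2 * (a / del - b / del)) with (eta / 2 / del * (a - b)) in k1 by (field; lra).
  replace (7 / 2 * eta * (a / del - b / del)) with (7 / 2 * eta / del * (a - b)) in k2 by (field; lra).
  split; [exact k1 |].
  assert (0 <= eta / 2 / del * (a - b)) by (apply Rmult_le_pos; [apply Rdiv_le_0_compat |]; lra).
  apply Rabs_le. destruct Hsg as [-> | ->]; lra.
Qed.

(** Close to z the factor h is bounded below, while its variation is multiplied by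
    values of Z that are small. *)
Lemma simple_zero_mul Z h z : simple_zero Z z -> (exists k m L, 0 < k /\ 0 < m /\ 0 <= L /\ forall a b, Rabs (a - z) <= k -> Rabs (b - z) <= k ->
    m <= h a /\ Rabs (h a) <= L /\ Rabs (h a - h b) <= L * Rabs (a - b)) ->
  simple_zero (fun a => h a * Z a) z.
Proof.
intros [Hz [kap [c [L [sg [Hk [Hc [HL [Hsg H]]]]]]]]] [k [m [M [Hk' [Hm [HM Hh]]]]]].
split; [rewrite Hz; ring |].
destruct (small_enough (L * M) (c * m / 2)) as [e [He E]]; [apply Rmult_le_pos; lra | assert (0 < c * m) by (apply Rmult_lt_0_compat; lra); lra |].
set (k0 := Rmin e (Rmin kap k)).
assert (Hl : k0 <= e /\ k0 <= kap /\ k0 <= k) by (unfold k0; split; [apply Rmin_l | split; [Rmin_le | eapply Rle_trans; [apply Rmin_r | apply Rmin_r]]]).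
assert (Hk0 : 0 < k0) by (unfold k0; repeat apply Rmin_glb_lt; lra).
assert (HLM : 0 <= L * M) by pos.
assert (Hcm : 0 < c * m) by (apply Rmult_lt_0_compat; lra).
exists k0, (c * m / 2), (M * L + L * kap * M), sg.
assert (0 <= L * kap * M) by (apply Rmult_le_pos; [apply Rmult_le_pos |]; lra).
split; [exact Hk0 |]. split; [lra |]. split; [lra |]. split; [exact Hsg |]. clearbody k0.
intros a b Ha Hb Hba. destruct (H a b ltac:(lra) ltac:(lra) Hba) as [h1 h2].
destruct (Hh a b ltac:(lra) ltac:(lra)) as [i1 [i2 i3]]. rewrite (Rabs_pos_eq (a - b)) in i3 by lra.
assert (Zb : Rabs (Z b) <= L * k0).
{ assert (z0 : Rabs (z - z) <= kap) by (rewrite Rminus_diag, Rabs_R0; lra).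
  replace (Z b) with (Z b - Z z) by (rewrite Hz; ring). destruct (Rle_lt_dec z b) as [q | q].
  - destruct (H b z ltac:(lra) z0 q) as [_ j]. eapply Rle_trans; [exact j |]. apply Rmult_le_compat_l; [exact HL |].
    apply Rabs_le_between in Hb. lra.
  - destruct (H z b z0 ltac:(lra) ltac:(lra)) as [_ j]. rewrite Rabs_minus_sym. eapply Rle_trans; [exact j |]. apply Rmult_le_compat_l; [exact HL |].
    apply Rabs_le_between in Hb. lra. }
assert (err : Rabs ((h a - h b) * Z b) <= M * (a - b) * (L * k0)) by now apply Rabs_prod.
assert (E' : L * M * k0 <= c * m / 2) by (apply E; lra).
split.
- replace (sg * (h a * Z a - h b * Z b)) with (h a * (sg * (Z a - Z b)) + sg * ((h a - h b) * Z b)) by ring.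
  assert (m * (c * (a - b)) <= h a * (sg * (Z a - Z b))).
  { apply Rle_trans with (h a * (c * (a - b))).
    - apply Rmult_le_compat_r; [apply Rmult_le_pos; lra | exact i1].
    - apply Rmult_le_compat_l; lra. }
  assert (err2 : M * (a - b) * (L * k0) <= c * m / 2 * (a - b)).
  { replace (M * (a - b) * (L * k0)) with (L * M * k0 * (a - b)) by ring. apply Rmult_le_compat_r; lra. }
  apply Rabs_le_between in err. destruct Hsg as [-> | ->]; lra.
- replace (h a * Z a - h b * Z b) with (h a * (Z a - Z b) + (h a - h b) * Z b) by ring.
  rewrite Rmult_plus_distr_r. apply Rabs_add_le.
  + rewrite Rmult_assoc. now apply Rabs_prod.
  + eapply Rle_trans; [exact err |]. replace (M * (a - b) * (L * k0)) with (L * M * (a - b) * k0) by ring.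
    replace (L * kap * M * (a - b)) with (L * M * (a - b) * kap) by ring. apply Rmult_le_compat_l; [apply Rmult_le_pos; lra | lra].
Qed.

Lemma simple_zero_transfer N G R z k0 m M : simple_zero N z -> 0 < k0 -> 0 < m -> 0 <= M ->
  (forall a b, Rabs (a - z) <= k0 -> Rabs (b - z) <= k0 -> b <= a -> m * (a - b) <= R a - R b <= M * (a - b)) ->
  (forall a, Rabs (a - z) <= k0 -> G (R a) = N a) ->
  G (R z) = 0 /\ exists kap c sg, 0 < kap /\ 0 < c /\ (sg = 1 \/ sg = -1) /\
    forall r r', Rabs (r - R z) <= kap -> Rabs (r' - R z) <= kap -> r' <= r -> c * (r - r') <= sg * (G r - G r').
Proof.
intros [Hz [kap [c [L [sg [Hk [Hc [HL [Hsg H]]]]]]]]] Hk0 Hm HM HR HG.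
assert (z0 : forall k, 0 < k -> Rabs (z - z) <= k) by (intros k h; rewrite Rminus_diag, Rabs_R0; lra).
split; [rewrite HG by (apply z0; lra); exact Hz |].
set (k1 := Rmin kap k0). assert (Hk1 : 0 < k1) by (apply Rmin_glb_lt; lra).
assert (l1 : k1 <= kap) by apply Rmin_l. assert (l2 : k1 <= k0) by apply Rmin_r. clearbody k1.
assert (onto : forall r, Rabs (r - R z) <= m * k1 -> exists a, Rabs (a - z) <= k1 /\ R a = r).
{ intros r Hr. apply Rabs_le_between in Hr.
  assert (u1 := HR (z + k1) z ltac:(apply Rabs_le; lra) (z0 k0 Hk0) ltac:(lra)).
  assert (u2 := HR z (z - k1) (z0 k0 Hk0) ltac:(apply Rabs_le; lra) ltac:(lra)).
  destruct (ivt_lipschitz (fun a => R a - r) M (z - k1) (z + k1)) as [a [Ha Ea]].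
  - lra.
  - exact HM.
  - intros u v Hu Hv. replace (R u - r - (R v - r)) with (R u - R v) by ring.
    destruct (Rle_lt_dec v u) as [q | q].
    + destruct (HR u v ltac:(apply Rabs_le; lra) ltac:(apply Rabs_le; lra) q) as [j1 j2].
      assert (0 <= m * (u - v)) by pos. rewrite !Rabs_pos_eq; lra.
    + destruct (HR v u ltac:(apply Rabs_le; lra) ltac:(apply Rabs_le; lra) ltac:(lra)) as [j1 j2].
      assert (0 <= m * (v - u)) by pos. rewrite (Rabs_left1 (u - v)), Rabs_left1; lra.
  - assert (0 <= R (z + k1) - r) by lra. assert (R (z - k1) - r <= 0) by lra. nra.
  - exists a. split; [apply Rabs_le; lra | lra]. }
assert (HM0 : 0 < M).
{ assert (u1 := HR (z + k1) z ltac:(apply Rabs_le; lra) (z0 k0 Hk0) ltac:(lra)). assert (0 < m * (z + k1 - z)) by (apply Rmult_lt_0_compat; lra). nra. }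
exists (m * k1), (c / M), sg. split; [apply Rmult_lt_0_compat; lra |]. split; [apply Rdiv_lt_0_compat; lra |]. split; [exact Hsg |].
intros r r' Hr Hr' Hle. destruct (onto r Hr) as [a [Ha <-]]. destruct (onto r' Hr') as [b [Hb <-]].
rewrite !HG by lra.
assert (Hba : b <= a).
{ destruct (Rle_lt_dec b a) as [q | q]; [exact q | exfalso].
  destruct (HR b a ltac:(lra) ltac:(lra) ltac:(lra)) as [j1 _]. assert (0 < m * (b - a)) by (apply Rmult_lt_0_compat; lra). lra. }
destruct (HR a b ltac:(lra) ltac:(lra) Hba) as [_ j]. destruct (H a b ltac:(lra) ltac:(lra) Hba) as [j2 _].
eapply Rle_trans; [| exact j2]. apply Rle_trans with (c / M * (M * (a - b))).
- apply Rmult_le_compat_l; [left; apply Rdiv_lt_0_compat; lra | exact j].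
- right. field. lra.
Qed.

Lemma uniform_threshold (n : nat) (P : nat -> R -> Prop) :
  (forall i, (i < n)%nat -> exists d, 0 < d /\ forall del, 0 < del <= d -> P i del) ->
  exists d, 0 < d /\ forall i del, (i < n)%nat -> 0 < del <= d -> P i del.
Proof.
induction n as [| n IH]; intros H.
- exists 1. split; [lra |]. intros; lia.
- destruct IH as [d1 [Hd1 H1]]; [intros i Hi; apply H; lia |]. destruct (H n ltac:(lia)) as [d2 [Hd2 H2]].
  exists (Rmin d1 d2). split; [now apply Rmin_glb_lt |]. intros i del Hi Hdel.
  assert (A := Rmin_l d1 d2). assert (B := Rmin_r d1 d2).
  destruct (Nat.eq_dec i n) as [-> | h]; [apply H2; lra | apply H1; [lia | lra]].
Qed.

(** * The gain in closed form *)

(** Along the circle x' = - y and y' = x, so that A t + B x y - C x - E x^3 / 3 is a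
    primitive. *)
Lemma melnikov_closed g Q sigma r A B C E : sigma * sigma = 1 -> deep g r ->
  (forall x y, x * x + y * y = r -> Q x y 0 = A + B * (x * x - y * y) + C * y + E * (x * x * y)) ->
  melnikov g Q sigma r = A * turn g sigma r - 2 * (sigma * B) * (abscissa g r 0 * height g r 0) +
    2 * (sigma * C) * abscissa g r 0 + 2 / 3 * (sigma * E) * abscissa g r 0 ^ 3.
Proof.
intros Hs Hd HQ. assert (Hm := sw_margin_pos g).
assert (Hg := sw_gap_pos g). destruct (base_bounds g r ltac:(unfold deep in Hd; lra)) as [hX0 [_ hXY]].
destruct (half_turn_spec sigma (abscissa g r 0) (height g r 0) 0 Hs ltac:(lra)) as [_ [_ [hX [hY _]]]].
set (X := abscissa g r 0) in *. set (Y := height g r 0) in *. set (T := turn g sigma r) in *.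
assert (dx : forall t, is_derive (circle_x g sigma r) t (- circle_y g sigma r t)).
{ intros t. unfold circle_x, circle_y. auto_derive; [exact I |]. ring. }
assert (dy : forall t, is_derive (circle_y g sigma r) t (circle_x g sigma r t)).
{ intros t. unfold circle_x, circle_y. auto_derive; [exact I |]. ring. }
assert (rr : forall t, circle_x g sigma r t * circle_x g sigma r t + circle_y g sigma r t * circle_y g sigma r t = r).
{ intros t. unfold circle_x, circle_y. fold X Y. rewrite <- hXY.
  assert (S := sin2_cos2 t). unfold Rsqr in S.
  replace ((sigma * X * cos t - Y * sin t) * (sigma * X * cos t - Y * sin t) + (sigma * X * sin t + Y * cos t) * (sigma * X * sin t + Y * cos t))
    with ((sigma * sigma * (X * X) + Y * Y) * (sin t * sin t + cos t * cos t)) by ring. rewrite S, Hs. ring. }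
set (x := circle_x g sigma r) in *. set (y := circle_y g sigma r) in *.
assert (x0 : x 0 = sigma * X) by (unfold x, circle_x; rewrite cos_0, sin_0; fold X; ring).
assert (y0 : y 0 = Y) by (unfold y, circle_y; rewrite cos_0, sin_0; fold Y; ring).
assert (xT : x T = - (sigma * X)) by exact hX. assert (yT : y T = Y) by exact hY.
set (prim := fun t => A * t + B * (x t * y t) - C * x t - E / 3 * (x t * (x t * x t))).
set (dprim := fun t => A + B * (x t * x t + -1 * (y t * y t)) + C * y t + E * (x t * x t * y t)).
assert (I0 : is_RInt dprim 0 T (minus (prim T) (prim 0))).
{ apply (is_RInt_derive prim dprim).
  - intros t _. unfold prim, dprim. evar_last.
    + apply derive_minus; [apply derive_minus; [apply derive_plus |] |].
      * apply is_derive_scal, @is_derive_id.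
      * apply is_derive_scal, derive_mult; [apply dx | apply dy].
      * apply is_derive_scal, dx.
      * apply is_derive_scal, derive_mult; [apply dx | apply derive_mult; apply dx].
    + unfold one. simpl. field.
  - intros t _. unfold dprim.
    apply (poly3_continuous (fun u v _ => A + B * (u * u + -1 * (v * v)) + C * v + E * (u * u * v)) x y (fun _ => 0) t).
    + repeat first [apply poly3_x | apply poly3_y | apply poly3_const | apply poly3_add | apply poly3_mul].
    + apply @ex_derive_continuous. eexists. apply dx.
    + apply @ex_derive_continuous. eexists. apply dy.
    + apply continuous_const. }
unfold melnikov. fold T.
rewrite (RInt_ext _ dprim).
- rewrite (is_RInt_unique _ _ _ _ I0). unfold minus, plus, opp. simpl. unfold prim. rewrite x0, y0, xT, yT.
  replace (X ^ 3) with (X * X * X) by ring.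
  replace (sigma * X * (sigma * X * (sigma * X))) with (sigma * sigma * sigma * (X * X * X)) by ring.
  replace (- (sigma * X) * (- (sigma * X) * - (sigma * X))) with (- (sigma * sigma * sigma * (X * X * X))) by ring.
  rewrite Hs. field.
- intros t _. assert (E0 : Q (x t) (y t) 0 = dprim t); [| exact E0].
  rewrite HQ by apply rr. unfold dprim. ring.
Qed.

Lemma triple_eq (a b c a' b' c' : R) : a = a' -> b = b' -> c = c' -> (a, b, c) = (a', b', c').
Proof. now intros -> -> ->. Qed.

Definition rotation_field (lam : R) (X : vector_field) : Prop :=
  forall x y z, X (x, y, z) = (- y, x, lam * (x ^ 2 + y ^ 2 - z)).

(** At eps = 0 both fields are the same rotation of the circle. *)
Lemma circle_crossing lam f X X' r : 0 < r -> rotation_field lam X -> rotation_field lam X' ->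
  (exists p, circle r p /\ f p = 0) -> (forall p, circle r p -> f p = 0 -> lie_derivative X f p <> 0) ->
  crossing_periodic_orbit f X X' (circle r).
Proof.
intros Hr HX HX' Hex Hlie.
assert (EX : forall p, X' p = X p) by (intros [[x y] z]; now rewrite HX, HX').
split; [| split; [exact Hex |]].
2:{ intros p Hp Hf. split; [exact Hf |]. assert (E : lie_derivative X' f p = lie_derivative X f p) by (unfold lie_derivative; now rewrite EX).
    rewrite E. assert (A := Hlie p Hp Hf). nra. }
set (R := sqrt r). assert (HR : R * R = r) by (apply sqrt_sqrt; lra). assert (HR0 : 0 < R) by now apply sqrt_lt_R0.
set (c := fun t => (R * cos t, R * sin t, r) : R3).
exists c, (2 * PI). assert (Hpi := PI_RGT_0).
split; [split | split; [lra | split; [| split]]].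
- apply (absolutely_continuous_lipschitz c (8 * R)); [lra |]. intros t u Hut.
  eapply Rle_trans; [apply R3_norm_le |]. unfold c, px, py, pz. simpl.
  rewrite Rminus_diag, Rabs_R0, <- !Rmult_minus_distr_l, !Rabs_mult, (Rabs_pos_eq R) by lra.
  assert (A := cos_1lip t u). assert (B := sin_1lip t u). rewrite (Rabs_pos_eq (t - u)) in A, B by lra.
  assert (R * Rabs (cos t - cos u) <= R * (t - u)) by mono.
  assert (R * Rabs (sin t - sin u) <= R * (t - u)) by mono. lra.
- apply (null_set_sub _ (fun _ => False)); [| apply null_set_empty]. intros t Ht. apply Ht. clear Ht.
  assert (Ec : X (c t) = (- (R * sin t), R * cos t, 0)).
  { unfold c. rewrite HX. f_equal. assert (S := sin2_cos2 t). unfold Rsqr in S.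
    replace ((R * cos t) ^ 2 + (R * sin t) ^ 2 - r) with (R * R * (sin t * sin t + cos t * cos t) - r) by ring. rewrite S, HR. ring. }
  exists (X (c t)). split.
  + rewrite Ec. unfold c. apply is_derive_R3.
    * auto_derive; [exact I | ring].
    * auto_derive; [exact I | ring].
    * apply @is_derive_const.
  + split; [reflexivity |]. split; [intros _; symmetry; apply EX |]. intros _. exists 1. split; [lra |].
    rewrite EX, Rminus_diag.
    assert (Z : plus (scal (one : R_AbsRing) (X (c t))) (scal (zero : R_AbsRing) (X (c t))) = X (c t)).
    { etransitivity; [apply f_equal2; [apply scal_one | exact (scal_zero_l (K := R_AbsRing) (X (c t)))] | apply plus_zero_r]. }
    symmetry. exact Z.
- intros t. unfold c.
  replace (cos (t + 2 * PI)) with (cos t) by (rewrite cos_plus, cos_2PI, sin_2PI; ring).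
  replace (sin (t + 2 * PI)) with (sin t) by (rewrite sin_plus, cos_2PI, sin_2PI; ring). reflexivity.
- exists PI. intros E. assert (E' := f_equal px E). unfold c, px in E'. simpl in E'. rewrite cos_PI, cos_0 in E'. lra.
- intros p. split.
  + intros [h1 h2]. destruct (rotation_angle R 0 (px p) (py p)) as [t [_ [t1 t2]]]; [lra | rewrite h1; lra |].
    exists t. destruct p as [[x y] z]. unfold px, py, pz, c in *. simpl in *. rewrite h2. apply triple_eq; lra.
  + intros [t <-]. unfold circle, c, px, py, pz. simpl. split; [| reflexivity].
    assert (S := sin2_cos2 t). unfold Rsqr in S.
    replace (R * cos t * (R * cos t) + R * sin t * (R * sin t)) with (R * R * (sin t * sin t + cos t * cos t)) by ring. rewrite S, HR. ring.
Qed.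

(** The data of a [switching] for all rho up to 1/2; the interval is chosen afterwards,
    according to the scale del of the zeros. *)
Record profile := {
  pr_y : R -> R;
  pr_d : R -> R;
  pr_k : R;
  pr_k_le1 : Rabs pr_k <= 1;
  pr_derive : forall r, 0 < r <= / 2 -> is_derive pr_y r (pr_d r);
  pr_d_bound : forall r, 0 < r <= / 2 -> Rabs (pr_d r) <= 2;
  pr_d_lip : forall r r', 0 < r <= / 2 -> 0 < r' <= / 2 -> Rabs (pr_d r - pr_d r') <= 2 * Rabs (r - r');
  pr_transversal : forall r, 0 < r <= / 2 -> r / 2 <= r - pr_y r * pr_y r
}.

Definition switching_of (pr : profile) (m top : R) : 0 < m -> 4 * m <= top -> top + 2 * m <= / 2 -> switching.
Proof.
intros Hm Htop Hhi.
refine {| sw_y := pr_y pr; sw_d := pr_d pr; sw_k := pr_k pr; sw_lo := 2 * m; sw_hi := top + 2 * m; sw_margin := m; sw_lip := 2; sw_gap := m;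
  sw_k_le1 := pr_k_le1 pr |}; try lra.
- intros r Hr. apply pr_derive. lra.
- intros r Hr. apply pr_d_bound. lra.
- intros r r' Hr Hr'. apply pr_d_lip; lra.
- intros r Hr. assert (A := pr_transversal pr r ltac:(lra)). lra.
Defined.

(** The coefficients that are used, named after the terms of [reduced_gain] to which
    they contribute. *)
Record coefs := { cq0 : R; cq1 : R; cq2 : R; ce : R; cd : R; ca0 : R; ca1 : R; cb0 : R; cb1 : R }.

(** The coefficient d is shared with opposite signs by x z in the first component and y
    z in the second one: it contributes (x^2 - y^2) z / 2 to x G1 + y G2. *)
Definition plus_x (k : coefs) (x y s : R) : R :=
  ca0 k * x + (ca1 k + cd k * / 2) * (x * (s + (x * x + y * y))).
Definition plus_y (k : coefs) (x y s : R) : R :=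
  cq0 k + cq1 k * (s + (x * x + y * y)) + cq2 k * ((s + (x * x + y * y)) * (s + (x * x + y * y))) + ca0 k * y +
  (ca1 k + -1 * (cd k * / 2)) * (y * (s + (x * x + y * y))) + ce k * (x * x).
Definition minus_x (k : coefs) (x y s : R) : R := cb0 k * x + cb1 k * (x * (s + (x * x + y * y))).
Definition minus_y (k : coefs) (x y s : R) : R := cb0 k * y + cb1 k * (y * (s + (x * x + y * y))).
Definition radial (F1 F2 : R -> R -> R -> R) (x y s : R) : R := x * F1 x y s + y * F2 x y s.
Definition vertical (F1 F2 : R -> R -> R -> R) (x y s : R) : R := -2 * radial F1 F2 x y s.

Definition plus_coefs (k : coefs) (l i j n : nat) : R :=
  match l, i, j, n with
  | 1%nat, 1%nat, 0%nat, 0%nat => ca0 k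
  | 1%nat, 1%nat, 0%nat, 1%nat => ca1 k + cd k * / 2
  | 2%nat, 0%nat, 0%nat, 0%nat => cq0 k
  | 2%nat, 0%nat, 0%nat, 1%nat => cq1 k
  | 2%nat, 0%nat, 0%nat, 2%nat => cq2 k
  | 2%nat, 0%nat, 1%nat, 0%nat => ca0 k
  | 2%nat, 0%nat, 1%nat, 1%nat => ca1 k + -1 * (cd k * / 2)
  | 2%nat, 2%nat, 0%nat, 0%nat => ce k
  | _, _, _, _ => 0
  end.
Definition minus_coefs (k : coefs) (l i j n : nat) : R :=
  match l, i, j, n with
  | 1%nat, 1%nat, 0%nat, 0%nat => cb0 k
  | 1%nat, 1%nat, 0%nat, 1%nat => cb1 k
  | 2%nat, 0%nat, 1%nat, 0%nat => cb0 k
  | 2%nat, 0%nat, 1%nat, 1%nat => cb1 k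
  | _, _, _, _ => 0
  end.

Lemma quadratic_expand c x y z : quadratic c x y z =
  c 0%nat 0%nat 0%nat + c 0%nat 0%nat 1%nat * z + c 0%nat 0%nat 2%nat * z ^ 2 + c 0%nat 1%nat 0%nat * y + c 0%nat 1%nat 1%nat * (y * z) +
  c 0%nat 2%nat 0%nat * y ^ 2 + c 1%nat 0%nat 0%nat * x + c 1%nat 0%nat 1%nat * (x * z) + c 1%nat 1%nat 0%nat * (x * y) + c 2%nat 0%nat 0%nat * x ^ 2.
Proof.
unfold quadratic. rewrite !sum_n_S, !sum_n_0. cbn [Nat.sub]. rewrite !sum_n_S, !sum_n_0. cbn [Nat.sub].
rewrite ?sum_n_S, ?sum_n_0. simpl. ring.
Qed.

Ltac poly3_tac := repeat first [apply poly3_const | apply poly3_x | apply poly3_y | apply poly3_z | apply poly3_add | apply poly3_mul].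

Lemma poly3_fields k : poly3 (plus_x k) /\ poly3 (plus_y k) /\ poly3 (minus_x k) /\ poly3 (minus_y k).
Proof. unfold plus_x, plus_y, minus_x, minus_y. repeat split; poly3_tac. Qed.

Lemma poly3_radial F1 F2 : poly3 F1 -> poly3 F2 -> poly3 (radial F1 F2) /\ poly3 (vertical F1 F2).
Proof. intros H1 H2. unfold vertical, radial. split; repeat first [assumption | apply poly3_const | apply poly3_x | apply poly3_y | apply poly3_add | apply poly3_mul]. Qed.

Lemma represents_clamped lam g (c : nat -> nat -> nat -> nat -> R) F1 F2 eps :
  (forall x y z, quadratic (c 1%nat) x y z = F1 x y (z - (x * x + y * y)) /\ quadratic (c 2%nat) x y z = F2 x y (z - (x * x + y * y)) /\
    quadratic (c 3%nat) x y z = 0) ->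
  represents lam g (perturbed_field lam eps c) (clamped (2 * sw_hi g + 6) F1) (clamped (2 * sw_hi g + 6) F2)
    (clamped (2 * sw_hi g + 6) (vertical F1 F2)) eps.
Proof.
intros Hc x y s Hin. destruct (region_bound g x y s Hin) as [hx hy]. destruct Hin as [_ hs].
assert (A := sw_lo_pos g). assert (B := sw_hi_lo g).
destruct (Hc x y (s + (x * x + y * y))) as [c1 [c2 c3]].
replace (s + (x * x + y * y) - (x * x + y * y)) with s in c1, c2 by ring.
assert (E : forall F, clamped (2 * sw_hi g + 6) F x y s = F x y s) by (intros F; unfold clamped; rewrite !clamp_id by lra; reflexivity).
do 3 eexists. split; [repeat split |]. rewrite !E. unfold lift, perturbed_field. rewrite c1, c2, c3. f_equal. unfold vertical, radial. ring.
Qed.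

Definition reduced_gain (pr : profile) (k : coefs) (r : R) : R :=
  let Y := pr_y pr r in let X := sqrt (r - Y * Y) in
  2 * X * (cq0 k + cq1 k * r + cq2 k * r ^ 2) + 2 / 3 * ce k * X ^ 3 - cd k * r * (X * Y) +
  r * (ca0 k + ca1 k * r) * (PI - 2 * atan (Y / X)) + r * (cb0 k + cb1 k * r) * (PI + 2 * atan (Y / X)).

Lemma gain_reduced pr k m top (h1 : 0 < m) (h2 : 4 * m <= top) (h3 : top + 2 * m <= / 2) r :
  deep (switching_of pr m top h1 h2 h3) r ->
  gain (radial (plus_x k) (plus_y k)) (radial (minus_x k) (minus_y k)) (switching_of pr m top h1 h2 h3) r = reduced_gain pr k r.
Proof.
intros Hd. set (g := switching_of pr m top h1 h2 h3) in *. unfold gain.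
rewrite (melnikov_closed g _ 1 r (r * (ca0 k + ca1 k * r)) (cd k * / 2 * r) (cq0 k + cq1 k * r + cq2 k * r ^ 2) (ce k)); [| ring | exact Hd |].
- rewrite (melnikov_closed g _ (-1) r (r * (cb0 k + cb1 k * r)) 0 0 0); [| ring | exact Hd |].
  + unfold turn, half_turn. unfold reduced_gain.
    assert (EH : height g r 0 = pr_y pr r) by apply height_0.
    assert (EA : abscissa g r 0 = sqrt (r - pr_y pr r * pr_y pr r)) by (unfold abscissa; now rewrite EH).
    rewrite EH, EA. field.
  + intros x y <-. unfold radial, minus_x, minus_y. ring.
- intros x y <-. unfold radial, plus_x, plus_y. field.
Qed.

(** * Limit cycles from the zeros of the gain *)

Definition has_cycles (lam : R) (f : R3 -> R) (lh : nat) : Prop :=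
  exists pp pm : nat -> nat -> nat -> nat -> R,
  exists eps0 : R, 0 < eps0 /\
  exists C : nat -> R -> R3 -> Prop,
    (forall eps : R, 0 < Rabs eps < eps0 ->
      (forall i : nat, (i < lh)%nat ->
        limit_cycle f (perturbed_field lam eps pp) (perturbed_field lam eps pm)
          (C i eps)) /\
      (forall i j : nat, (i < lh)%nat -> (j < lh)%nat -> i <> j ->
        ~ (forall p : R3, C i eps p <-> C j eps p))) /\
    (forall i : nat, (i < lh)%nat ->
      exists G : R3 -> Prop,
        crossing_periodic_orbit f (perturbed_field lam 0 pp)
          (perturbed_field lam 0 pm) G /\
        (forall x y z : R, G (x, y, z) -> z = x ^ 2 + y ^ 2) /\
        converges_to (C i) G).

Lemma near_set_mono G r r' p : r <= r' -> near_set G r p -> near_set G r' p.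
Proof. intros H [q [h1 h2]]. exists q. split; [exact h1 | lra]. Qed.

Lemma mu_neq_1 lam : lam <> 0 -> mu lam <> 1.
Proof.
intros H E. unfold mu in E. rewrite <- exp_0 in E. apply exp_inv in E. assert (P := PI_RGT_0).
assert (E2 : lam * PI = 0) by lra. apply Rmult_integral in E2. lra.
Qed.

(** In the applications rho is a function of a parameter a, comparable with a ^ 2,
    through which the gain is a factor h times functions Z del; at scale del these tend
    to a polynomial p with simple zeros 1, ..., n. *)
Section Scaling.
Variables (lam : R) (f : R3 -> R) (pr : profile) (n : nat) (p p' : R -> R) (Z : R -> R -> R) (rho h : R -> R) (kc : R -> coefs).
Hypothesis Hlam : lam <> 0.
Hypothesis Hn : (n <= 8)%nat.
Hypothesis Hsign : forall x y s, 0 < x * x + y * y <= / 2 -> Rabs s <= 1 ->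
  (0 < f (lift x y s) <-> 0 < y - (pr_y pr (x * x + y * y) + pr_k pr * s)) /\
  (f (lift x y s) < 0 <-> y - (pr_y pr (x * x + y * y) + pr_k pr * s) < 0).
Hypothesis Hmeet : forall r, 0 < r <= / 2 -> exists q, circle r q /\ f q = 0.
Hypothesis Hlie : forall r X q, 0 < r <= / 2 -> rotation_field lam X -> circle r q -> f q = 0 -> lie_derivative X f q <> 0.
Hypothesis HR0 : rho 0 = 0.
Hypothesis HR : forall a b, 0 <= b -> b <= a -> a <= / 2 -> (a * a - b * b) / 4 <= rho a - rho b <= 2 * (a * a - b * b).
Hypothesis Hh : exists L, 0 < L /\ forall a b, 0 < a <= / 2 -> 0 < b <= / 2 -> a <= L * h a /\ Rabs (h a) <= L /\ Rabs (h a - h b) <= L * Rabs (a - b).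
Hypothesis Hreal : realizes p p' Z.
Hypothesis Hp : forall u, is_derive p u (p' u).
Hypothesis Hp' : forall u, continuous p' u.
Hypothesis Hroot : forall i, (i < n)%nat -> p (INR (S i)) = 0 /\ p' (INR (S i)) <> 0.
Hypothesis Hgain : forall del a, 0 < del -> 0 < a <= / 2 -> reduced_gain pr (kc del) (rho a) = h a * Z del a.

(** The scale del is chosen here, once for all n zeros. They are at distances of order
    del ^ 2 from each other and from the ends of the interval of the surface. *)
Lemma scaled_zeros : exists del z, 0 < del <= / 40 /\ (forall i, (i < n)%nat -> rho (del / 2) + del * del / 32 <= z i <= rho (10 * del) - del * del / 32 /\
    reduced_gain pr (kc del) (z i) = 0 /\ exists kap c sg, 0 < kap /\ 0 < c /\ (sg = 1 \/ sg = -1) /\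
    forall r r', Rabs (r - z i) <= kap -> Rabs (r' - z i) <= kap -> r' <= r -> c * (r - r') <= sg * (reduced_gain pr (kc del) r - reduced_gain pr (kc del) r')) /\
  forall i j, (i < n)%nat -> (j < n)%nat -> i <> j -> del * del / 9 <= Rabs (z i - z j).
Proof.
destruct Hh as [L [HL Hh']].
destruct (uniform_threshold n (fun i del => exists psi, Rabs (psi - INR (S i)) <= / 3 /\ simple_zero (Z del) (del * psi))) as [d [Hd Hth]].
{ intros i Hi. destruct (Hroot i Hi) as [r1 r2]. apply (realizes_zero p p'); try assumption; [apply Hp' |].
  assert (A := lt_INR i 8 ltac:(lia)). rewrite S_INR. assert (B := pos_INR i). assert (C := le_INR (S i) 8 ltac:(lia)).
  rewrite S_INR in C. simpl in C. lra. }
set (del := Rmin d (/ 40)). assert (Hdel : 0 < del <= / 40) by (unfold del; split; [apply Rmin_glb_lt; lra | apply Rmin_r]).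
assert (Hdd : del <= d) by apply Rmin_l. clearbody del.
set (psi := fun i => epsilon (inhabits 0) (fun u => Rabs (u - INR (S i)) <= / 3 /\ simple_zero (Z del) (del * u))).
assert (Hpsi : forall i, (i < n)%nat -> Rabs (psi i - INR (S i)) <= / 3 /\ simple_zero (Z del) (del * psi i)).
{ intros i Hi. unfold psi. apply epsilon_spec. apply Hth; [exact Hi | lra]. }
assert (Hrange : forall i, (i < n)%nat -> 2 / 3 <= psi i <= 25 / 3).
{ intros i Hi. destruct (Hpsi i Hi) as [k _]. apply Rabs_le_between in k.
  assert (B := pos_INR i). assert (C := le_INR (S i) 8 ltac:(lia)). rewrite S_INR in *. simpl in C. lra. }
assert (Hdd2 : 0 < del * del) by nra.
exists del, (fun i => rho (del * psi i)). split; [exact Hdel |]. split.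
- intros i Hi. destruct (Hpsi i Hi) as [_ Hs]. assert (Hri := Hrange i Hi). set (a := del * psi i) in *.
  assert (Ha : 2 / 3 * del <= a <= 25 / 3 * del) by (unfold a; nra).
  split.
  { assert (A := HR a (del / 2) ltac:(lra) ltac:(lra) ltac:(lra)). assert (B := HR (10 * del) a ltac:(lra) ltac:(lra) ltac:(lra)).
    assert (a * a <= 25 / 3 * del * (25 / 3 * del)) by nra. assert (2 / 3 * del * (2 / 3 * del) <= a * a) by nra. split; lra. }
  apply (simple_zero_transfer (fun a => h a * Z del a) _ rho a (del / 6) (del / 4) 2).
  + apply simple_zero_mul; [exact Hs |]. exists (del / 6), (del / 2 / L), L.
    split; [lra |]. split; [apply Rdiv_lt_0_compat; lra |]. split; [lra |]. intros b c Hb Hc.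
    apply Rabs_le_between in Hb. apply Rabs_le_between in Hc.
    destruct (Hh' b c ltac:(lra) ltac:(lra)) as [j1 [j2 j3]]. split; [| auto].
    apply Rmult_le_reg_l with L; [lra |]. replace (L * (del / 2 / L)) with (del / 2) by (field; lra). lra.
  + lra.
  + lra.
  + lra.
  + intros b c Hb Hc Hcb. apply Rabs_le_between in Hb. apply Rabs_le_between in Hc.
    assert (A := HR b c ltac:(lra) Hcb ltac:(lra)).
    assert (del * (b - c) <= (b + c) * (b - c)) by mono.
    assert ((b + c) * (b - c) <= 1 * (b - c)) by mono. lra.
  + intros b Hb. apply Rabs_le_between in Hb. apply Hgain; lra.
- assert (K : forall i j, (j < i < n)%nat -> del * del / 9 <= rho (del * psi i) - rho (del * psi j)).
  { intros i j Hij. assert (r1 := Hrange i ltac:(lia)). assert (r2 := Hrange j ltac:(lia)).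
    destruct (Hpsi i ltac:(lia)) as [k1 _]. destruct (Hpsi j ltac:(lia)) as [k2 _].
    apply Rabs_le_between in k1. apply Rabs_le_between in k2. assert (B := le_INR (S j) i ltac:(lia)). rewrite !S_INR in *.
    assert (g1 : 1 / 3 <= psi i - psi j) by lra.
    assert (A := HR (del * psi i) (del * psi j) ltac:(nra) ltac:(nra) ltac:(nra)).
    replace (del * psi i * (del * psi i) - del * psi j * (del * psi j)) with (del * del * ((psi i - psi j) * (psi i + psi j))) in A by ring.
    assert (1 / 3 * (4 / 3) <= (psi i - psi j) * (psi i + psi j)) by (apply Rmult_le_compat; lra). nra. }
  intros i j Hi Hj Hij. destruct (Nat.lt_total i j) as [l | [l | l]]; [| contradiction |].
  + rewrite Rabs_minus_sym. eapply Rle_trans; [apply (K j i); lia | apply Rle_abs].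
  + eapply Rle_trans; [apply (K i j); lia | apply Rle_abs].
Qed.

Lemma plus_quadratic k x y z : quadratic (plus_coefs k 1) x y z = plus_x k x y (z - (x * x + y * y)) /\
  quadratic (plus_coefs k 2) x y z = plus_y k x y (z - (x * x + y * y)) /\ quadratic (plus_coefs k 3) x y z = 0.
Proof. rewrite !quadratic_expand. unfold plus_coefs, plus_x, plus_y. repeat split; ring. Qed.

Lemma minus_quadratic k x y z : quadratic (minus_coefs k 1) x y z = minus_x k x y (z - (x * x + y * y)) /\
  quadratic (minus_coefs k 2) x y z = minus_y k x y (z - (x * x + y * y)) /\ quadratic (minus_coefs k 3) x y z = 0.
Proof. rewrite !quadratic_expand. unfold minus_coefs, minus_x, minus_y. repeat split; ring. Qed.

(** With del fixed, [cycle_near] applies at each of the n zeros. The circles are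
    separated by del ^ 2 / 9 in height, which keeps cycles at distance less than del ^ 2
    / 20 from them distinct. *)
Theorem cycles_by_scaling : has_cycles lam f n.
Proof.
destruct scaled_zeros as [del [z [Hdel [Hz Hsepz]]]]. assert (Hdd : 0 < del * del) by nra.
set (k := kc del) in *. set (m := rho (del / 2) / 8). set (top := rho (10 * del)).
assert (r0 := HR (del / 2) 0 ltac:(lra) ltac:(lra) ltac:(lra)). assert (r1 := HR (10 * del) (del / 2) ltac:(lra) ltac:(lra) ltac:(lra)).
assert (r2 := HR (10 * del) 0 ltac:(lra) ltac:(lra) ltac:(lra)). rewrite HR0 in r0, r2.
assert (d10 : 10 * del * (10 * del) <= / 4 * / 4) by (apply Rmult_le_compat; lra).
assert (h1 : 0 < m) by (unfold m; nra).
assert (h2 : 4 * m <= top) by (unfold m, top; nra).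
assert (h3 : top + 2 * m <= / 2) by (unfold m, top in *; lra).
set (g := switching_of pr m top h1 h2 h3).
assert (lo_eq : sw_lo g = 2 * m) by reflexivity. assert (hi_eq : sw_hi g = top + 2 * m) by reflexivity. assert (ma_eq : sw_margin g = m) by reflexivity.
assert (Hdeep : forall r, 4 * m <= r <= top -> deep g r) by (intros r Hr; unfold deep; rewrite lo_eq, hi_eq, ma_eq; lra).
assert (Hzr : forall i, (i < n)%nat -> forall r, Rabs (r - z i) <= del * del / 32 -> 4 * m <= r <= top).
{ intros i Hi r Hr. destruct (Hz i Hi) as [Hb _]. apply Rabs_le_between in Hr. unfold m, top in *. lra. }
assert (Hz2 : forall i, (i < n)%nat -> 0 < z i <= / 2).
{ intros i Hi. assert (A := Hzr i Hi (z i)). rewrite Rminus_diag, Rabs_R0 in A. specialize (A ltac:(lra)). lra. }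
destruct (poly3_fields k) as [q1 [q2 [q3 q4]]].
destruct (poly3_radial _ _ q1 q2) as [q5 q6]. destruct (poly3_radial _ _ q3 q4) as [q7 q8].
set (B := 2 * sw_hi g + 6). assert (HB : 0 <= B) by (unfold B; rewrite hi_eq; lra).
destruct (clamped_tame _ B q1 HB) as [K1 [k1 t1]]. destruct (clamped_tame _ B q2 HB) as [K2 [k2 t2]].
destruct (clamped_tame _ B q6 HB) as [K3 [k3 t3]]. destruct (clamped_tame _ B q3 HB) as [K4 [k4 t4]].
destruct (clamped_tame _ B q4 HB) as [K5 [k5 t5]]. destruct (clamped_tame _ B q8 HB) as [K6 [k6 t6]].
set (K := 1 + K1 + K2 + K3 + K4 + K5 + K6). assert (HK : 1 <= K) by (unfold K; lra).
apply (fun q => tame_mono _ K1 K q) in t1; [| unfold K; lra]. apply (fun q => tame_mono _ K2 K q) in t2; [| unfold K; lra].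
apply (fun q => tame_mono _ K3 K q) in t3; [| unfold K; lra]. apply (fun q => tame_mono _ K4 K q) in t4; [| unfold K; lra].
apply (fun q => tame_mono _ K5 K q) in t5; [| unfold K; lra]. apply (fun q => tame_mono _ K6 K q) in t6; [| unfold K; lra].
assert (rad : forall F1 F2 x y s, Rabs x <= B -> Rabs y <= B -> Rabs s <= B ->
  x * clamped B F1 x y s + y * clamped B F2 x y s = radial F1 F2 x y s).
{ intros F1 F2 x y s hx hy hs. unfold clamped. now rewrite !clamp_id. }
assert (Hsep : separates g f).
{ intros x y s [Hr Hs]. rewrite lo_eq, hi_eq in Hr. apply (Hsign x y s); [lra | exact Hs]. }
set (Xp := fun eps => perturbed_field lam eps (plus_coefs k)). set (Xm := fun eps => perturbed_field lam eps (minus_coefs k)).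
assert (each : forall i, (i < n)%nat -> exists C e1, 0 <= C /\ 0 < e1 <= 1 /\ forall eps, 0 < Rabs eps <= e1 ->
  exists G, limit_cycle f (Xp eps) (Xm eps) G /\ (forall q, G q -> near_set (circle (z i)) (C * Rabs eps) q) /\
    (forall q, circle (z i) q -> near_set G (C * Rabs eps) q)).
{ intros i Hi. destruct (Hz i Hi) as [_ [z0 [kap [c [sg [Hkap [Hc [Hsg Hmon]]]]]]]].
  set (kap' := Rmin kap (del * del / 32)). assert (Hkap' : 0 < kap') by (apply Rmin_glb_lt; lra).
  assert (l1 : kap' <= kap) by apply Rmin_l. assert (l2 : kap' <= del * del / 32) by apply Rmin_r. clearbody kap'.
  assert (dp : forall r, Rabs (r - z i) <= kap' -> deep g r) by (intros r Hr; apply Hdeep, (Hzr i Hi); lra).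
  assert (zd : deep g (z i)) by (apply dp; rewrite Rminus_diag, Rabs_R0; lra).
  apply (cycle_near lam K _ _ _ _ _ _ (radial (plus_x k) (plus_y k)) (radial (minus_x k) (minus_y k)) g HK t1 t2 t3 t4 t5 t6 q5 q7
    (rad _ _) (rad _ _) (z i) kap' c sg Hkap' dp Hc Hsg).
  - unfold g. rewrite gain_reduced by exact zd. exact z0.
  - intros r r' Hr Hr' Hle. unfold g. rewrite !gain_reduced by (apply dp; assumption). apply Hmon; lra.
  - now apply mu_neq_1.
  - exact Hsep.
  - intros eps. apply represents_clamped. apply plus_quadratic.
  - intros eps. apply represents_clamped. apply minus_quadratic. }
set (Cst := fun i => epsilon (inhabits 0) (fun C => exists e1, 0 <= C /\ 0 < e1 <= 1 /\ forall eps, 0 < Rabs eps <= e1 ->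
  exists G, limit_cycle f (Xp eps) (Xm eps) G /\ (forall q, G q -> near_set (circle (z i)) (C * Rabs eps) q) /\
    (forall q, circle (z i) q -> near_set G (C * Rabs eps) q))).
assert (HC : forall i, (i < n)%nat -> exists e1, 0 <= Cst i /\ 0 < e1 <= 1 /\ forall eps, 0 < Rabs eps <= e1 ->
  exists G, limit_cycle f (Xp eps) (Xm eps) G /\ (forall q, G q -> near_set (circle (z i)) (Cst i * Rabs eps) q) /\
    (forall q, circle (z i) q -> near_set G (Cst i * Rabs eps) q)).
{ intros i Hi. unfold Cst. apply epsilon_spec. now apply each. }
set (C := fun i eps => epsilon (inhabits (fun _ : R3 => False)) (fun G => limit_cycle f (Xp eps) (Xm eps) G /\
  (forall q, G q -> near_set (circle (z i)) (Cst i * Rabs eps) q) /\ (forall q, circle (z i) q -> near_set G (Cst i * Rabs eps) q))).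
destruct (uniform_threshold n (fun i e => Cst i * e <= del * del / 20 /\ forall eps, Rabs eps = e -> limit_cycle f (Xp eps) (Xm eps) (C i eps) /\
  (forall q, C i eps q -> near_set (circle (z i)) (Cst i * Rabs eps) q) /\ (forall q, circle (z i) q -> near_set (C i eps) (Cst i * Rabs eps) q)))
  as [eps0 [He0 Hall]].
{ intros i Hi. destruct (HC i Hi) as [e1 [c0 [He1 Hex]]].
  destruct (small_enough (Cst i) (del * del / 20) c0 ltac:(lra)) as [e2 [He2 E2]].
  exists (Rmin e1 e2). split; [apply Rmin_glb_lt; lra |]. intros e He.
  assert (A1 := Rmin_l e1 e2). assert (A2 := Rmin_r e1 e2). split; [apply E2; lra |].
  intros eps Heps. unfold C. apply epsilon_spec. apply Hex. lra. }
exists (plus_coefs k), (minus_coefs k), eps0. split; [exact He0 |]. exists C. split.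
- intros eps Heps. assert (Ha : forall i, (i < n)%nat -> Cst i * Rabs eps <= del * del / 20 /\ limit_cycle f (Xp eps) (Xm eps) (C i eps) /\
    (forall q, C i eps q -> near_set (circle (z i)) (Cst i * Rabs eps) q) /\ (forall q, circle (z i) q -> near_set (C i eps) (Cst i * Rabs eps) q)).
  { intros i Hi. destruct (Hall i (Rabs eps) Hi ltac:(lra)) as [a1 a2]. split; [exact a1 | now apply a2]. }
  split; [intros i Hi; apply (Ha i Hi) |]. intros i j Hi Hj Hij Heq.
  destruct (Ha i Hi) as [a1 [_ [_ a4]]]. destruct (Ha j Hj) as [b1 [_ [b3 _]]].
  assert (zi := Hz2 i Hi).
  set (q := (sqrt (z i), 0, z i) : R3).
  assert (Hq : circle (z i) q) by (split; [unfold q, px, py; simpl; rewrite sqrt_sqrt by lra; ring | reflexivity]).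
  destruct (a4 q Hq) as [u [Hu1 Hu2]]. destruct (b3 u (proj1 (Heq u) Hu1)) as [v [Hv1 Hv2]].
  destruct (R3_norm_ge q u) as [_ [_ n1]]. destruct (R3_norm_ge u v) as [_ [_ n2]].
  rewrite (proj2 Hv1) in n2. change (pz q) with (z i) in n1.
  assert (S := Hsepz i j Hi Hj Hij).
  assert (T : Rabs (z i - z j) <= Rabs (z i - pz u) + Rabs (pz u - z j)).
  { replace (z i - z j) with ((z i - pz u) + (pz u - z j)) by ring. apply Rabs_triang. }
  lra.
- intros i Hi. exists (circle (z i)). assert (zi := Hz2 i Hi). split; [| split].
  + assert (rf : forall c, rotation_field lam (perturbed_field lam 0 c)).
    { intros c x y w. unfold perturbed_field. rewrite !Rmult_0_l, !Rplus_0_r. reflexivity. }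
    apply (circle_crossing lam); [lra | apply rf | apply rf | now apply Hmeet |].
    intros q Hq Hf. apply (Hlie (z i)); [exact zi | apply rf | exact Hq | exact Hf].
  + intros x y w [c1 c2]. unfold px, py, pz in *. simpl in c1, c2. rewrite c2, <- c1. ring.
  + intros eta Heta. destruct (HC i Hi) as [_ [c0 _]].
    destruct (small_enough (Cst i) eta c0 Heta) as [e [He E]].
    exists (Rmin e eps0). split; [apply Rmin_glb_lt; lra |]. intros eps Heps.
    assert (A1 := Rmin_l e eps0). assert (A2 := Rmin_r e eps0).
    destruct (Hall i (Rabs eps) Hi ltac:(lra)) as [_ a2]. destruct (a2 eps eq_refl) as [_ [a3 a4]].
    assert (E' : Cst i * Rabs eps <= eta) by (apply E; lra).
    split; intros q Hq; [apply (near_set_mono _ _ _ _ E'), a3, Hq | apply (near_set_mono _ _ _ _ E'), a4, Hq].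
Qed.
End Scaling.

(** * Displacement functions as perturbed polynomials *)

(** A function a ^ degree + tail a that occurs in the displacement, with the weight of u
    ^ degree in the target polynomial. *)
Record term := { degree : nat; weight : R; tail : R -> R }.

Fixpoint target (l : list term) (u : R) : R :=
  match l with nil => 0 | t :: l => weight t * u ^ degree t + target l u end.
Fixpoint target_slope (l : list term) (u : R) : R :=
  match l with nil => 0 | t :: l => weight t * (INR (degree t) * u ^ Nat.pred (degree t)) + target_slope l u end.
(** The function that [target] approximates: the weights are divided by powers of del as
    in [realizes_monomial]. *)
Fixpoint rescaled (l : list term) (del a : R) : R :=
  match l with nil => 0 | t :: l => weight t / del ^ degree t * (a ^ degree t + tail t a) + rescaled l del a end.

Lemma rescaled_realizes l : List.Forall (fun t => vanishes (degree t) (tail t)) l -> realizes (target l) (target_slope l) (rescaled l).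
Proof.
induction 1 as [| t l Ht Hl IH].
- exists (fun _ _ => 0), 0. split; [lra |]. intros del psi _ _. simpl. rewrite Rmult_0_r, Rminus_diag, Rabs_R0.
  split; [apply @is_derive_const | lra].
- exact (realizes_add _ _ _ _ _ _ (realizes_monomial (degree t) (weight t) (tail t) Ht) IH).
Qed.

Lemma target_derive l u : is_derive (target l) u (target_slope l u).
Proof.
induction l as [| t l IH]; simpl; [apply @is_derive_const |].
apply derive_plus; [| exact IH]. auto_derive; [exact I | ring].
Qed.

Lemma target_slope_continuous l u : continuous (target_slope l) u.
Proof.
apply @ex_derive_continuous. induction l as [| t l IH]; simpl; [apply @ex_derive_const |].
apply @ex_derive_plus; [| exact IH]. auto_derive. exact I.
Qed.

Ltac vanish_tac := lazymatch goal with
  | |- vanishes ?m (fun a => @?W a + @?V a) => apply (vanishes_add m W V); vanish_tac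
  | |- vanishes ?m (fun a => ?c * a ^ ?k * atan_tail a) =>
      apply (vanishes_weaken (12 + k)); [lia | exact (vanishes_mul 12 k c atan_tail atan_tail_vanishes)]
  | |- vanishes ?m (fun a => ?c * a ^ ?k) => exact (vanishes_monomial m k c ltac:(lia))
  end.

Lemma vanishes_zero m : vanishes m (fun _ => 0).
Proof. apply (vanishes_ext m (fun a => 0 * a ^ S m)); [intros a; ring |]. apply vanishes_monomial. lia. Qed.

(** The sum of the contributions of the two sides is governed by A0 and A1, their
    difference, which multiplies the arctangent, by B0 and B1. *)
Definition coefs_of (q0 q1 q2 e d A0 A1 B0 B1 : R) : coefs :=
  {| cq0 := q0; cq1 := q1; cq2 := q2; ce := e; cd := d;
     ca0 := (A0 / PI - B0 / 2) / 2; ca1 := (A1 / PI - B1 / 2) / 2;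
     cb0 := (A0 / PI + B0 / 2) / 2; cb1 := (A1 / PI + B1 / 2) / 2 |}.

Lemma reduced_gain_eq pr q0 q1 q2 e d A0 A1 B0 B1 r X Y th :
  pr_y pr r = Y -> r - Y * Y = X * X -> 0 < X -> atan (Y / X) = th ->
  reduced_gain pr (coefs_of q0 q1 q2 e d A0 A1 B0 B1) r =
  2 * X * (q0 + q1 * r + q2 * r ^ 2) + 2 / 3 * e * X ^ 3 - d * r * (X * Y) + r * (A0 + A1 * r) + r * (B0 + B1 * r) * th.
Proof.
intros HY HX HX0 Hth. unfold reduced_gain. rewrite HY, HX. replace (X * X) with (Rsqr X) by reflexivity.
rewrite sqrt_Rsqr, Hth by lra. simpl. field. apply PI_neq0.
Qed.

Lemma atan_split a : atan a = a - a ^ 3 / 3 + a ^ 5 / 5 - a ^ 7 / 7 + a ^ 9 / 9 - a ^ 11 / 11 + atan_tail a.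
Proof. unfold atan_tail. ring. Qed.

Ltac nat_cases i := repeat (destruct i as [| i]; [| try lia]).

(** * The plane y = 0 *)

Definition plane_profile : profile.
Proof.
refine {| pr_y := fun _ => 0; pr_d := fun _ => 0; pr_k := 0 |}.
- rewrite Rabs_R0. lra.
- intros r _. apply @is_derive_const.
- intros r _. rewrite Rabs_R0. lra.
- intros r r' _ _. rewrite Rminus_diag, Rabs_R0. assert (A := Rabs_pos (r - r')). lra.
- intros r Hr. lra.
Defined.

Definition no_tail (n : nat) (c : R) : term := {| degree := n; weight := c; tail := fun _ => 0 |}.

(** The polynomial (u - 1) (u - 2) (u - 3) (u - 4). *)
Definition plane_terms : list term :=
  no_tail 0 24 :: no_tail 1 (-50) :: no_tail 2 35 :: no_tail 3 (-10) :: no_tail 4 1 :: nil.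

Lemma INR_IZR n : INR n = IZR (Z.of_nat n).
Proof. apply INR_IZR_INZ. Qed.

Lemma plane_cycles lam : lam <> 0 -> has_cycles lam (fun '(x, y, z) => y) 4.
Proof.
intros Hlam.
apply (cycles_by_scaling lam _ plane_profile 4 (target plane_terms) (target_slope plane_terms) (rescaled plane_terms) (fun a => a * a) (fun a => a)
  (fun del => coefs_of (12 / 1) (35 / del ^ 2 / 2) (1 / del ^ 4 / 2) 0 0 (-50 / del ^ 1) (-10 / del ^ 3) 0 0)); try assumption.
- lia.
- intros x y s _ _. simpl. split; split; intros; lra.
- intros r Hr. exists (sqrt r, 0, r). split; [| reflexivity]. split; [| reflexivity].
  unfold px, py. simpl. rewrite sqrt_sqrt by lra. ring.
- intros r X [[x y] w] Hr HX [c1 c2] Hf. unfold px, py, pz in *. simpl in c1, c2, Hf. subst y.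
  unfold lie_derivative. rewrite (is_derive_unique _ _ x).
  + nra.
  + rewrite HX. apply (is_derive_ext (fun t => 0 + t * x)); [intros t; reflexivity |]. auto_derive; [exact I | ring].
- ring.
- intros a b Hb0 Hb _. assert (0 <= (a - b) * (a + b)) by pos. lra.
- exists 1. split; [lra |]. intros a b Ha Hb. rewrite Rabs_pos_eq by lra. lra.
- apply rescaled_realizes. repeat apply List.Forall_cons; [exact (vanishes_zero 0) | exact (vanishes_zero 1) | exact (vanishes_zero 2) | exact (vanishes_zero 3) | exact (vanishes_zero 4) | apply List.Forall_nil].
- apply target_derive.
- apply target_slope_continuous.
- intros i Hi. rewrite INR_IZR. nat_cases i; simpl; split; lra.
- intros del a Hd Ha. rewrite (reduced_gain_eq _ _ _ _ _ _ _ _ _ _ _ a 0 0); try reflexivity; try lra.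
  + simpl. field. lra.
  + unfold Rdiv. rewrite Rmult_0_l. apply atan_0.
Qed.

(** * The plane y = z *)

(** The circle of radius a / sqrt (1 + a^2) meets the plane where y = z = rho and x = a
    / (1 + a^2), that is Y / X = a. *)
Definition slanted_profile : profile.
Proof.
refine {| pr_y := fun r => r; pr_d := fun _ => 1; pr_k := 1 |}.
- rewrite Rabs_R1. lra.
- intros r _. apply @is_derive_id.
- intros r _. rewrite Rabs_R1. lra.
- intros r r' _ _. rewrite Rminus_diag, Rabs_R0. assert (A := Rabs_pos (r - r')). lra.
- intros r Hr. nra.
Defined.

(** The coefficients make the expansion of the arctangent cancel below degree 6 and
    leave a ^ 6 with coefficient 1; the next function does the same for degree 8. *)
Definition slanted_6 (a : R) : R := 105 / 16 * ((1 + 3 / 7 * a ^ 2) * ((a + a ^ 3) * atan a) - a ^ 2 - 23 / 21 * a ^ 4) - a ^ 6.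
Definition slanted_8 (a : R) : R := 525 / 16 * ((1 + / 5 * a ^ 2) * ((a + a ^ 3) * atan a) - a ^ 2 - 13 / 15 * a ^ 4) - a ^ 8.

Lemma slanted_6_vanishes : vanishes 6 slanted_6.
Proof.
apply (vanishes_ext _ (fun a => 105 / 16 * (-2 / 63 + 3 / 7 * (2 / 35)) * a ^ 10 + (105 / 16 * (2 / 99 + 3 / 7 * (-2 / 63)) * a ^ 12 +
  (105 / 16 * (-1 / 11 + 3 / 7 * (2 / 99)) * a ^ 14 + (105 / 16 * (3 / 7 * (-1 / 11)) * a ^ 16 +
  (105 / 16 * a ^ 1 * atan_tail a + (105 / 16 * (1 + 3 / 7) * a ^ 3 * atan_tail a + 105 / 16 * (3 / 7) * a ^ 5 * atan_tail a))))))).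
- intros a. unfold slanted_6. rewrite atan_split. field.
- vanish_tac.
Qed.

Lemma slanted_8_vanishes : vanishes 8 slanted_8.
Proof.
apply (vanishes_ext _ (fun a => 525 / 16 * (-2 / 63 + / 5 * (2 / 35)) * a ^ 10 + (525 / 16 * (2 / 99 + / 5 * (-2 / 63)) * a ^ 12 +
  (525 / 16 * (-1 / 11 + / 5 * (2 / 99)) * a ^ 14 + (525 / 16 * (/ 5 * (-1 / 11)) * a ^ 16 +
  (525 / 16 * a ^ 1 * atan_tail a + (525 / 16 * (1 + / 5) * a ^ 3 * atan_tail a + 525 / 16 * (/ 5) * a ^ 5 * atan_tail a))))))).
- intros a. unfold slanted_8. rewrite atan_split. field.
- vanish_tac.
Qed.

(** The polynomial (u - 1) ... (u - 6) (u^2 + 21 u + 140). The quadratic factor,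
    positive for u > 0, removes the exponents 5 and 7, which do not occur among the
    available functions. *)
Definition slanted_terms : list term :=
  no_tail 0 100800 :: {| degree := 1; weight := -231840; tail := fun a => -1 * a ^ 5 |} :: no_tail 2 191036 ::
  {| degree := 3; weight := -70560; tail := fun a => 1 * a ^ 5 |} :: no_tail 4 10689 ::
  {| degree := 6; weight := -126; tail := slanted_6 |} :: {| degree := 8; weight := 1; tail := slanted_8 |} :: nil.

(** Solves for the coefficients of the field: C1, ..., C8 are the required coefficients
    of the basis functions, E0, E2, E4 what remains of the even polynomial once the
    arctangents are taken into account. *)
Definition slanted_coefs (del : R) : coefs :=
  let C1 := -231840 / del ^ 1 in let C2 := 191036 / del ^ 2 in let C3 := -70560 / del ^ 3 in let C4 := 10689 / del ^ 4 in
  let C6 := -126 / del ^ 6 * (105 / 16) in let C8 := 1 / del ^ 8 * (525 / 16) in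
  let E0 := 100800 in let E2 := C2 - C6 - C8 in let E4 := C4 - 23 / 21 * C6 - 13 / 15 * C8 in
  let q0 := E0 / 2 in let q1 := E2 / 2 - E0 in let q2 := E4 / 2 - q0 - q1 in
  let B0 := C6 + C8 in
  coefs_of q0 q1 q2 0 0 C1 (C3 - C1 - C1) B0 (3 / 7 * C6 + / 5 * C8 - B0).

Lemma slanted_cycles lam : lam <> 0 -> has_cycles lam (fun '(x, y, z) => y - z) 6.
Proof.
intros Hlam.
apply (cycles_by_scaling lam _ slanted_profile 6 (target slanted_terms) (target_slope slanted_terms) (rescaled slanted_terms)
  (fun a => a * a / (1 + a * a)) (fun a => a / (1 + a * a) ^ 3) slanted_coefs); try assumption.
- lia.
- intros x y s _ _. simpl. split; split; intros; lra.
- intros r Hr. exists (sqrt (r - r * r), r, r). split; [| simpl; ring]. split; [| reflexivity].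
  unfold px, py. simpl. rewrite sqrt_sqrt by nra. ring.
- intros r X [[x y] w] Hr HX [c1 c2] Hf. unfold px, py, pz in *. simpl in c1, c2, Hf.
  assert (y = r) by lra. subst w y.
  unfold lie_derivative. rewrite (is_derive_unique _ _ x).
  + nra.
  + rewrite HX. replace (x ^ 2 + r ^ 2 - r) with 0 by (simpl; lra).
    apply (is_derive_ext (fun t => r + t * x - (r + t * (lam * 0)))); [intros t; reflexivity |]. auto_derive; [exact I | ring].
- field.
- intros a b Hb Hba Ha.
  assert (P : 0 <= (a - b) * (a + b)) by pos.
  assert (A : 1 <= 1 + a * a <= 5 / 4) by nra. assert (B : 1 <= 1 + b * b <= 5 / 4) by nra.
  assert (D : 1 <= (1 + a * a) * (1 + b * b) <= 25 / 16) by nra.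
  replace (a * a / (1 + a * a) - b * b / (1 + b * b)) with (((a - b) * (a + b)) / ((1 + a * a) * (1 + b * b))) by (field; lra).
  replace (a * a - b * b) with ((a - b) * (a + b)) by ring. set (u := (a - b) * (a + b)) in *. set (v := (1 + a * a) * (1 + b * b)) in *.
  assert (E : u / v * v = u) by (field; lra). assert (0 <= u / v) by (apply Rdiv_le_0_compat; lra). split; nra.
- exists 7. split; [lra |].
  assert (Hp : forall t, 1 <= 1 + t * t) by (intros t; assert (Q := Rle_0_sqr t); unfold Rsqr in Q; lra).
  assert (D : forall t, is_derive (fun a => a / (1 + a * a) ^ 3) t ((1 - 5 * (t * t)) / (1 + t * t) ^ 4)).
  { intros t. assert (Q := Hp t). assert (Q3 : (1 + t * t) ^ 3 <> 0) by (apply pow_nonzero; lra).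
    auto_derive; [exact Q3 |]. field. lra. }
  intros a b Ha Hb. assert (A : 1 <= 1 + a * a <= 5 / 4) by nra.
  assert (A3 : 1 <= (1 + a * a) ^ 3 <= 2).
  { split; [apply pow_R1_Rle; lra |]. apply Rle_trans with ((5 / 4) ^ 3); [apply pow_incr; lra | lra]. }
  set (v := (1 + a * a) ^ 3) in *. assert (E : a / v * v = a) by (field; lra).
  assert (P : 0 <= a / v) by (apply Rdiv_le_0_compat; lra).
  split; [nra |]. split; [rewrite Rabs_pos_eq by exact P; nra |].
  unfold v. apply (derive_bound_increment (fun a => a / (1 + a * a) ^ 3) (fun t => (1 - 5 * (t * t)) / (1 + t * t) ^ 4)); intros t _; [apply D |].
  assert (Q := Hp t). assert (Q4 : 1 <= (1 + t * t) ^ 3) by (apply pow_R1_Rle; exact Q).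
  unfold Rdiv. rewrite Rabs_mult, Rabs_inv, (Rabs_pos_eq ((1 + t * t) ^ 4)) by (apply pow_le; lra).
  assert (Q5 : 0 < (1 + t * t) ^ 4) by (apply pow_lt; lra).
  apply Rmult_le_reg_r with ((1 + t * t) ^ 4); [exact Q5 |]. rewrite Rmult_assoc, Rinv_l, Rmult_1_r by lra.
  assert (F : Rabs (1 - 5 * (t * t)) <= 7 * (1 + t * t)) by (apply Rabs_le; split; lra).
  eapply Rle_trans; [exact F |]. simpl in *. nra.
- apply rescaled_realizes. repeat apply List.Forall_cons; [| | | | | | | apply List.Forall_nil].
  + exact (vanishes_zero 0).
  + exact (vanishes_monomial 1 5 (-1) ltac:(lia)).
  + exact (vanishes_zero 2).
  + exact (vanishes_monomial 3 5 1 ltac:(lia)).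
  + exact (vanishes_zero 4).
  + exact slanted_6_vanishes.
  + exact slanted_8_vanishes.
- apply target_derive.
- apply target_slope_continuous.
- intros i Hi. rewrite INR_IZR. nat_cases i; simpl; split; lra.
- intros del a Hd Ha. assert (P : 1 + a * a <> 0) by nra.
  unfold slanted_coefs. rewrite (reduced_gain_eq _ _ _ _ _ _ _ _ _ _ _ (a / (1 + a * a)) (a * a / (1 + a * a)) (atan a)).
  + simpl. unfold slanted_6, slanted_8. field. split; lra.
  + reflexivity.
  + field. exact P.
  + apply Rdiv_lt_0_compat; nra.
  + f_equal. field. split; lra.
Qed.

(** * The parabolic cylinder y = x^2 *)

Lemma cylinder_root r : 0 <= r -> let y := (sqrt (1 + 4 * r) - 1) / 2 in 0 <= y /\ y + y * y = r.
Proof.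
intros Hr y. assert (S := sqrt_sqrt (1 + 4 * r) ltac:(lra)). assert (P := sqrt_pos (1 + 4 * r)).
unfold y. split; nra.
Qed.

Definition cylinder_profile : profile.
Proof.
refine {| pr_y := fun r => (sqrt (1 + 4 * r) - 1) / 2; pr_d := fun r => / sqrt (1 + 4 * r); pr_k := 0 |}.
- rewrite Rabs_R0. lra.
- intros r Hr. assert (P : 0 < sqrt (1 + 4 * r)) by (apply sqrt_lt_R0; lra). auto_derive; [lra |]. field. lra.
- intros r Hr. assert (S := sqrt_sqrt (1 + 4 * r) ltac:(lra)). assert (P := sqrt_lt_R0 (1 + 4 * r) ltac:(lra)).
  assert (1 <= sqrt (1 + 4 * r)) by nra. assert (/ sqrt (1 + 4 * r) <= / 1) by (apply Rinv_le_contravar; lra).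
  assert (0 < / sqrt (1 + 4 * r)) by (apply Rinv_0_lt_compat; lra). rewrite Rabs_pos_eq; lra.
- intros r r' Hr Hr'. assert (S := sqrt_sqrt (1 + 4 * r) ltac:(lra)). assert (P := sqrt_lt_R0 (1 + 4 * r) ltac:(lra)).
  assert (S' := sqrt_sqrt (1 + 4 * r') ltac:(lra)). assert (P' := sqrt_lt_R0 (1 + 4 * r') ltac:(lra)).
  set (u := sqrt (1 + 4 * r)) in *. set (v := sqrt (1 + 4 * r')) in *.
  assert (u1 : 1 <= u) by nra. assert (v1 : 1 <= v) by nra.
  replace (/ u - / v) with ((v - u) * / (u * v)) by (field; lra).
  assert (E : 4 * (r' - r) = (v - u) * (u + v)) by lra.
  rewrite Rabs_mult, Rabs_inv, (Rabs_pos_eq (u * v)) by nra.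
  assert (iuv : / (u * v) <= 1). { rewrite <- Rinv_1. apply Rinv_le_contravar; nra. }
  assert (F : Rabs (v - u) * 2 <= 4 * Rabs (r - r')).
  { rewrite (Rabs_minus_sym r r'). replace (4 * Rabs (r' - r)) with (Rabs (4 * (r' - r))) by (rewrite Rabs_mult, (Rabs_pos_eq 4) by lra; reflexivity).
    rewrite E, Rabs_mult, (Rabs_pos_eq (u + v)) by lra. apply Rmult_le_compat_l; [apply Rabs_pos | lra]. }
  assert (G := Rabs_pos (v - u)). nra.
- intros r Hr. destruct (cylinder_root r ltac:(lra)) as [h1 h2]. set (y := (sqrt (1 + 4 * r) - 1) / 2) in *. nra.
Defined.

Definition cylinder_10 (a : R) : R :=
  693 / 20 * ((1 - 35 / 44 * (a ^ 2 + a ^ 4)) * ((a + a ^ 3) * atan a) - a ^ 2 + 17 / 132 * a ^ 4 + 321 / 220 * a ^ 6 + 424 / 1155 * a ^ 8) - a ^ 10.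
Definition cylinder_12 (a : R) : R :=
  2079 / 20 * ((1 - 5 / 12 * (a ^ 2 + a ^ 4)) * ((a + a ^ 3) * atan a) - a ^ 2 - / 4 * a ^ 4 + 149 / 180 * a ^ 6 + 52 / 315 * a ^ 8) - a ^ 12.

Lemma cylinder_10_vanishes : vanishes 10 cylinder_10.
Proof.
apply (vanishes_ext _ (fun a => 693 / 20 * (-1 / 11 - 35 / 44 * (-8 / 693)) * a ^ 14 + (693 / 20 * (-35 / 44 * (-7 / 99)) * a ^ 16 +
  (693 / 20 * (-35 / 44 * (-1 / 11)) * a ^ 18 + (693 / 20 * a ^ 1 * atan_tail a + (693 / 20 * (1 - 35 / 44) * a ^ 3 * atan_tail a +
  (693 / 20 * (2 * (-35 / 44)) * a ^ 5 * atan_tail a + 693 / 20 * (-35 / 44) * a ^ 7 * atan_tail a))))))).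
- intros a. unfold cylinder_10. rewrite atan_split. field.
- vanish_tac.
Qed.

Lemma cylinder_12_vanishes : vanishes 12 cylinder_12.
Proof.
apply (vanishes_ext _ (fun a => 2079 / 20 * (-1 / 11 - 5 / 12 * (-8 / 693)) * a ^ 14 + (2079 / 20 * (-5 / 12 * (-7 / 99)) * a ^ 16 +
  (2079 / 20 * (-5 / 12 * (-1 / 11)) * a ^ 18 + (2079 / 20 * a ^ 1 * atan_tail a + (2079 / 20 * (1 - 5 / 12) * a ^ 3 * atan_tail a +
  (2079 / 20 * (2 * (-5 / 12)) * a ^ 5 * atan_tail a + 2079 / 20 * (-5 / 12) * a ^ 7 * atan_tail a))))))).
- intros a. unfold cylinder_12. rewrite atan_split. field.
- vanish_tac.
Qed.

(** The polynomial (u - 1) ... (u - 8) (7 u^4 + 252 u^3 + 3677 u^2 + 26532 u + 83160).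
    The last factor, positive for u > 0, removes the exponents 5, 7, 9 and 11. *)
Definition cylinder_terms : list term :=
  no_tail 0 3353011200 :: {| degree := 1; weight := -8043235200; tail := fun a => -2 * a ^ 5 + -1 * a ^ 7 |} :: no_tail 2 7063965792 ::
  {| degree := 3; weight := -2854051200; tail := fun a => 2 * a ^ 5 + 1 * a ^ 7 |} :: no_tail 4 488688772 ::
  no_tail 6 (-8527519) :: no_tail 8 149721 ::
  {| degree := 10; weight := -1573; tail := cylinder_10 |} :: {| degree := 12; weight := 7; tail := cylinder_12 |} :: nil.

Definition cylinder_coefs (del : R) : coefs :=
  let C1 := -8043235200 / del ^ 1 in let C2 := 7063965792 / del ^ 2 in let C3 := -2854051200 / del ^ 3 in let C4 := 488688772 / del ^ 4 in
  let C6 := -8527519 / del ^ 6 in let C8 := 149721 / del ^ 8 in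
  let C10 := -1573 / del ^ 10 * (693 / 20) in let C12 := 7 / del ^ 12 * (2079 / 20) in
  let E2 := C2 - C10 - C12 in let E4 := C4 + 17 / 132 * C10 - / 4 * C12 in
  let E6 := C6 + 321 / 220 * C10 + 149 / 180 * C12 in let E8 := C8 + 424 / 1155 * C10 + 52 / 315 * C12 in
  let q1 := (E4 + E8 - E6) / 2 in
  coefs_of (3353011200 / 2) q1 (E8 / 2) (3 / 2 * (E2 - 2 * q1)) (2 * E8 - E6) C1 (C3 - C1) (C10 + C12) (- (35 / 44) * C10 - 5 / 12 * C12).

Lemma cylinder_cycles lam : lam <> 0 -> has_cycles lam (fun '(x, y, z) => y - x ^ 2) 8.
Proof.
intros Hlam.
apply (cycles_by_scaling lam _ cylinder_profile 8 (target cylinder_terms) (target_slope cylinder_terms) (rescaled cylinder_terms)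
  (fun a => a * a + a * a * (a * a)) (fun a => a) cylinder_coefs); try assumption.
- lia.
- intros x y s Hr _. destruct (cylinder_root (x * x + y * y) ltac:(lra)) as [h1 h2].
  change (pr_y cylinder_profile (x * x + y * y)) with ((sqrt (1 + 4 * (x * x + y * y)) - 1) / 2).
  change (pr_k cylinder_profile) with 0. set (Y := (sqrt (1 + 4 * (x * x + y * y)) - 1) / 2) in *.
  assert (E : y - x ^ 2 = (y - Y) * (y + Y + 1)) by (simpl; nra).
  assert (P : 0 < y + Y + 1) by nra.
  unfold lift. rewrite E, Rmult_0_l, Rplus_0_r. split; split; intros; nra.
- intros r Hr. destruct (cylinder_root r ltac:(lra)) as [h1 h2]. set (Y := (sqrt (1 + 4 * r) - 1) / 2) in *.
  exists (sqrt Y, Y, r). split; [split; [| reflexivity] |].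
  + unfold px, py. simpl. rewrite sqrt_sqrt by lra. exact h2.
  + simpl. rewrite Rmult_1_r, sqrt_sqrt by lra. ring.
- intros r X [[x y] w] Hr HX [c1 c2] Hf. unfold px, py, pz in *. simpl in c1, c2, Hf.
  unfold lie_derivative. rewrite (is_derive_unique _ _ (x * (1 + 2 * y))).
  + assert (hx : x <> 0) by (intros ->; nra). assert (hy : 0 <= y) by nra.
    apply Rmult_integral_contrapositive_currified; [exact hx | lra].
  + rewrite HX. apply (is_derive_ext (fun t => y + t * x - (x + t * - y) ^ 2)); [intros t; reflexivity |]. auto_derive; [exact I | ring].
- ring.
- intros a b Hb Hba Ha. assert (P : 0 <= (a - b) * (a + b)) by pos.
  replace (a * a + a * a * (a * a) - (b * b + b * b * (b * b))) with ((a - b) * (a + b) * (1 + a * a + b * b)) by ring.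
  replace (a * a - b * b) with ((a - b) * (a + b)) by ring. set (u := (a - b) * (a + b)) in *.
  assert (1 <= 1 + a * a + b * b <= 2) by nra. split; nra.
- exists 1. split; [lra |]. intros a b Ha Hb. rewrite Rabs_pos_eq by lra. lra.
- apply rescaled_realizes. repeat apply List.Forall_cons; [| | | | | | | | | apply List.Forall_nil].
  + exact (vanishes_zero 0).
  + exact (vanishes_add _ _ _ (vanishes_monomial 1 5 (-2) ltac:(lia)) (vanishes_monomial 1 7 (-1) ltac:(lia))).
  + exact (vanishes_zero 2).
  + exact (vanishes_add _ _ _ (vanishes_monomial 3 5 2 ltac:(lia)) (vanishes_monomial 3 7 1 ltac:(lia))).
  + exact (vanishes_zero 4).
  + exact (vanishes_zero 6).
  + exact (vanishes_zero 8).
  + exact cylinder_10_vanishes.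
  + exact cylinder_12_vanishes.
- apply target_derive.
- apply target_slope_continuous.
- intros i Hi. rewrite INR_IZR. nat_cases i; simpl; split; lra.
- intros del a Hd Ha. unfold cylinder_coefs.
  assert (EY : pr_y cylinder_profile (a * a + a * a * (a * a)) = a * a).
  { simpl. replace (1 + 4 * (a * a + a * a * (a * a))) with (Rsqr (1 + 2 * (a * a))) by (unfold Rsqr; ring).
    rewrite sqrt_Rsqr by nra. field. }
  rewrite (reduced_gain_eq _ _ _ _ _ _ _ _ _ _ _ a (a * a) (atan a)).
  + simpl. unfold cylinder_10, cylinder_12. field. lra.
  + exact EY.
  + ring.
  + lra.
  + f_equal. field. lra.
Qed.

Theorem theorem5 (lam : R) (f : R3 -> R) (lh : nat)
    (hlam : lam <> 0)
    (hf : (f = (fun '(x, y, z) => y) /\ lh = 4%nat) \/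
          (f = (fun '(x, y, z) => y - z) /\ lh = 6%nat) \/
          (f = (fun '(x, y, z) => y - x ^ 2) /\ lh = 8%nat)) :
  exists pp pm : nat -> nat -> nat -> nat -> R,
  exists eps0 : R, 0 < eps0 /\
  exists C : nat -> R -> R3 -> Prop,
    (forall eps : R, 0 < Rabs eps < eps0 ->
      (forall i : nat, (i < lh)%nat ->
        limit_cycle f (perturbed_field lam eps pp) (perturbed_field lam eps pm)
          (C i eps)) /\
      (forall i j : nat, (i < lh)%nat -> (j < lh)%nat -> i <> j ->
        ~ (forall p : R3, C i eps p <-> C j eps p))) /\
    (forall i : nat, (i < lh)%nat ->
      exists G : R3 -> Prop,
        crossing_periodic_orbit f (perturbed_field lam 0 pp)
          (perturbed_field lam 0 pm) G /\
        (forall x y z : R, G (x, y, z) -> z = x ^ 2 + y ^ 2) /\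
        converges_to (C i) G).
Proof.
destruct hf as [[-> ->] | [[-> ->] | [-> ->]]].
- now apply plane_cycles.
- now apply slanted_cycles.
- now apply cylinder_cycles.
Qed.
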